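(* Let $\ell$ be a square prime power and $q=\ell^2$. For every $R\in(0,1)$ and every pair of integers $m\ge s\ge 1$, there is an infinite family (with block length $N\to\infty$) of $m$-folded algebraic-geometric codes $\mathsf{F}(N,l,q,e,m)$ over the alphabet $\mathbb{F}_q^m$, of rate at least $R$ and relative distance at least $1-R-2/(\sqrt{\ell}-1)$, which can be list decoded from an error fraction \[\tau=\frac{s}{s+1}\left(1-\frac{m}{m-s+1}\Big(R+\frac{2}{\sqrt{\ell}-1}\Big)\right),\] in the following sense: for every received word $\mathbf{y}\in(\mathbb{F}_q^m)^N$ the decoder outputs an $\mathbb{F}_q$-subspace of the message space with at most $O(N^{(\sqrt{\ell}-1)s})$ elements which contains every message function whose encoding is within Hamming distance $\tau N$ of $\mathbf{y}$.
   Context: A folded algebraic-geometric code $\mathsf{F}(N,l,q,e,m)$ is defined from: a function field $F/\mathbb{F}_q$ (full constant field $\mathbb{F}_q$) of genus $g$; an automorphism $\sigma\in\mathrm{Aut}(F/\mathbb{F}_q)$; rational places $P_1,\dots,P_N$ of $F$ such that the $mN$ places $P_i^{\sigma^j}$ ($1\le i\le N$, $0\le j\le m-1$) are pairwise distinct rational places, where $P^{\sigma}=\{\sigma(x):x\in P\}$; a divisor $D$ of degree $e$ with $D^\sigma=D$ and no $P_i^{\sigma^j}$ in $\mathrm{Supp}(D)$; and a positive integer $l$. Its message space is the Riemann–Roch space $\mathcal{L}(lD)=\{f\in F^*:\mathrm{div}(f)+lD\ge 0\}\cup\{0\}$ and $f$ is encoded as $\big((f(P_i),f(P_i^{\sigma}),\dots,f(P_i^{\sigma^{m-1}}))^T\big)_{i=1}^N\in(\mathbb{F}_q^m)^N$,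 where $f(P)$ is the residue of $f$ at $P$. Rate is $\dim_{\mathbb{F}_q}(\text{code})/(mN)$; relative distance is the minimum Hamming distance (over alphabet $\mathbb{F}_q^m$) divided by $N$. *)

(* Defs.v *)
From HB Require Import structures.
From mathcomp Require Import all_boot all_order all_algebra.
From mathcomp Require Import boolp Rstruct.

Set Implicit Arguments.
Unset Strict Implicit.
Unset Printing Implicit Defensive.

Import Order.TTheory GRing.Theory Num.Theory.
Local Open Scope ring_scope.

Section FunctionField.
Variables (K F : fieldType) (emb : {rmorphism K -> F}).

Definition pev (p : {poly K}) (z : F) : F := (map_poly emb p).[z].

Definition transcendental (x : F) : Prop :=
  forall p : {poly K}, p != 0 -> pev p x != 0.

Definition algebraic (z : F) : Prop :=
  exists2 p : {poly K}, p != 0 & pev p z = 0.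

(* F/K is an algebraic function field in one variable with full constant
   field K: there is x transcendental over K with [F : K(x)] finite
   (F is spanned over K(x) by finitely many b_i), and every element of F
   algebraic over K lies in K. *)
Definition is_function_field : Prop :=
  (exists x : F, transcendental x /\
     exists (n : nat) (b : 'I_n -> F),
       forall z : F, exists (c : {poly K}) (a : 'I_n -> {poly K}),
         c != 0 /\ pev c x * z = \sum_(i < n) pev (a i) x * b i)
  /\ (forall z : F, algebraic z -> exists a : K, z = emb a).

(* A place P of F/K is represented by its normalized discrete valuation
   v_P : F -> Z \cup {oo}; we store v_P on F^* and use the junk value
   v 0 = 0 (the value at 0 is never used as a valuation). *)
Definition is_place (v : F -> int) : Prop :=
  [/\ v 0 = 0,
      (forall x y, x != 0 -> y != 0 -> v (x * y) = v x + v y),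
      (forall x y, x != 0 -> y != 0 -> x + y != 0 ->
        (v x <= v (x + y)) || (v y <= v (x + y))),
      (forall a : K, a != 0 -> v (emb a) = 0) &
      exists t : F, t != 0 /\ v t = 1].

Definition same_place (v w : F -> int) : Prop := forall x, v x = w x.

Definition residue_is (v : F -> int) (z : F) (a : K) : bool :=
  (z == emb a) || (0 < v (z - emb a)).

Definition rational_place (v : F -> int) : Prop :=
  is_place v /\ forall z, 0 <= v z -> exists a : K, residue_is v z a.

(* P^sigma = { sigma x : x in P }, so v_{P^sigma} = v_P o sigma^{-1} *)
Definition place_act (sigmainv : F -> F) (v : F -> int) : F -> int :=
  fun x => v (sigmainv x).

Definition is_automorphism (sigma sigmainv : F -> F) : Prop :=
  [/\ {morph sigma : x y / x + y}, {morph sigma : x y / x * y}, sigma 1 = 1,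
      (cancel sigma sigmainv /\ cancel sigmainv sigma) &
      forall a : K, sigma (emb a) = emb a].

(* A divisor D = sum_k Dn k * Dp k, given by pairwise distinct places
   Dp k with nonzero coefficients Dn k. *)
Definition is_divisor (nD : nat) (Dp : 'I_nD -> F -> int) (Dn : 'I_nD -> int)
  : Prop :=
  [/\ (forall k, is_place (Dp k)),
      (forall k, Dn k != 0) &
      forall k k', k != k' -> ~ same_place (Dp k) (Dp k')].

Definition divisor_invariant (sigmainv : F -> F) (nD : nat)
  (Dp : 'I_nD -> F -> int) (Dn : 'I_nD -> int) : Prop :=
  forall k, exists k', same_place (Dp k') (place_act sigmainv (Dp k))
                       /\ Dn k' = Dn k.

Definition in_RR (l : nat) (nD : nat) (Dp : 'I_nD -> F -> int)
  (Dn : 'I_nD -> int) (f : F) : Prop :=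
  f = 0 \/
  ((forall P, is_place P -> (forall k, ~ same_place P (Dp k)) -> 0 <= P f)
   /\ (forall k, - (l%:Z * Dn k) <= Dp k f)).

End FunctionField.

Section FoldedAG.
Variables (K : finFieldType) (F : fieldType) (emb : {rmorphism K -> F}).
Variables (sigma sigmainv : F -> F) (N m l nD : nat).
Variables (Pp : 'I_N -> F -> int) (Dp : 'I_nD -> F -> int) (Dn : 'I_nD -> int).

Definition fplace (i : 'I_N) (j : 'I_m) : F -> int :=
  fun x => Pp i (iter j sigmainv x).

(* f(P) : the residue of f at P (for rational P with v_P(f) >= 0) *)
Definition fval (v : F -> int) (f : F) : K :=
  odflt 0 [pick a | residue_is emb v f a].

(* the encoding of f: row i is the i-th symbol
   (f(P_i), f(P_i^sigma), ..., f(P_i^{sigma^{m-1}})) in K^m *)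
Definition fenc (f : F) : 'M[K]_(N, m) :=
  \matrix_(i < N, j < m) fval (fplace i j) f.

(* all the data of F(N,l,q,e,m) (e = deg D, q = #|K|) *)
Definition folded_AG_data : Prop :=
  [/\ (is_function_field emb /\ is_automorphism emb sigma sigmainv),
      ((0 < l)%N /\ (0 < N)%N /\ (0 < m)%N),
      (forall i j, rational_place emb (fplace i j)) /\
      (forall i j i' j', (i, j) != (i', j') ->
        ~ same_place (fplace i j) (fplace i' j')),
      (is_divisor emb Dp Dn /\ divisor_invariant sigmainv Dp Dn) &
      (forall i j k, ~ same_place (fplace i j) (Dp k))].

Definition message (f : F) : Prop := in_RR emb l Dp Dn f.

Definition fcode : {set 'M[K]_(N, m)} :=
  [set c | `[< exists f, message f /\ fenc f = c >]].

(* K-dimension of the (K-linear) code: #|code| = #|K| ^ dim *)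
Definition fcode_dim : nat := trunc_log #|K| #|fcode|.

Definition hamming (c c' : 'M[K]_(N, m)) : nat :=
  #|[set i : 'I_N | row i c != row i c']|.

End FoldedAG.

(* Main.v *)
(* Neither the genus of [F] nor the degree of [D] enters the claim, so a folded code may be realised in any function
   field whose places and Riemann-Roch space produce it. A tower of wildly ramified Artin-Schreier steps in which the
   pole orders are prescribed has, for one place [D], a Riemann-Roch space with a prescribed basis [x, y_0, y_1, ...],
   and the values of the [y_l] at the rational places, as well as the action of [sigma] on them (unipotent, or
   diagonal with eigenvalues of order [n]), can be chosen freely. It remains to exhibit good linear codes.

   If [R + 2 / (r - 1) >= 1] nothing is asked of distance and radius. If [r <= 8 m], a random code has distance and
   list decoding radius within [1 / (4 m)] of [1 - R], which suffices. If [r > 8 m], take the functions on the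
   Garcia-Stichtenoth tower [x_(j+1)^l + x_(j+1) = x_j^l / (x_j^(l-1) + 1)], [l = r^2], with the automorphism
   [s : x_j |-> gamma x_j] of order [l - 1], evaluated at windows of length [m] in the [s]-orbits of the
   completely split places.

   Messages [b_0, ..., b_u] that agree with the received word at a block make the determinant [W] with rows
   [1, b, s b, ..., s^(u-1) b] vanish there, while its number of zeros is at most [u T]. For [u] equal to the
   decoding parameter this bounds the rank of the list over the fixed field [E] of [s]. A list of rank [u] below it is
   bounded by averaging over its [(u+1)]-tuples: all their determinants agree up to factors in [E], and a zero of such
   a factor is a zero on a whole orbit, which is much longer than the windows used in it. *)
Require Import Defs.
From HB Require Import structures.
From mathcomp Require Import all_boot all_order all_algebra.
From mathcomp Require Import boolp Rstruct.
From mathcomp Require Import fraction qpoly qfpoly closed_field finfield cyclic perm.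
From mathcomp Require Import ring lra zify.
Set Implicit Arguments.
Unset Strict Implicit.
Unset Printing Implicit Defensive.
Import Order.TTheory GRing.Theory Num.Theory.
Local Open Scope ring_scope.

(** Places are not constructed as objects: a place of interest is a homomorphism into Laurent
    series, so values are residues and orders are pulled back, and what has to exist follows from
    universal properties of Artin-Schreier steps and from lifting simple residues. In the
    prescribing tower a step reads [y_(j+1) ^ q - y_(j+1) = (x ^ q - x) x ^ b_j y_j]; above [x = 0]
    the right side vanishes, every element of [K] solves the residue equation, and this is why
    values at rational places are free. The slack [1 / (4 m)] comes from [q = r ^ 4]: the sets of
    agreeing blocks number [2 ^ N <= q ^ (N / 4)] for each message, against [m] symbols per block.
    It is available when [2 / (r - 1) > 1 / (4 m)], that is [r <= 8 m]. For larger [r] only a little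
    more than [r] of the [r ^ 2 - 1] points of an orbit are used: enough to keep the loss due to the
    poles of the tower below [2 / (r - 1)], and few enough for the windows to be a small part of the
    orbit, which limits the loss of the averaging to [1 / (2 (m + 1))]. *)

Ltac vlia :=
  repeat match goal with H : ?P |- _ =>
    match type of P with Prop => idtac end;
    match P with context[?v ?x] => is_var v;
      match type of (v x) with int => revert H end end end;
  repeat match goal with |- context[?v ?x] => is_var v;
      match type of (v x) with int => generalize (v x); intro end end;
  intros; lia.

Ltac glia := clear; intros; lia.
Ltac gnia := clear; intros; nia.

(** * Power series *)

(** Course-of-values recursion as an existence statement: [G] sees only values below [n], the others
    being replaced by the default [d]. It produces series whose coefficients depend on earlier ones:
    inverses and solutions of [y ^ Q + e y = u]. *)
Lemma strong_rec (A : Type) (d : A) (G : nat -> (nat -> A) -> A) :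
  exists g : nat -> A, forall n, g n = G n (fun i => if (i < n)%N then g i else d).
Proof.
pose fix tab n : nat -> A := if n is n'.+1 then
  (fun i => if i == n' then G n' (tab n') else tab n' i) else (fun=> d).
have tabE n i : (i < n)%N -> tab n i = tab i.+1 i.
  elim: n => // n IH; rewrite ltnS leq_eqVlt /=; case: (eqVneq i n) => [->|ne] /=.
    by rewrite /= eqxx.
  by move=> /IH ->.
have tab0 n i : (n <= i)%N -> tab n i = d.
  elim: n => // n IH ni /=; rewrite gtn_eqF // IH //; exact: ltnW.
exists (fun n => tab n.+1 n) => n /=; rewrite eqxx; congr G.
apply: funext => i; case: ltnP => ni; first by rewrite tabE.
exact: tab0.
Qed.

Section PowerSeries.
Variable R : fieldType.

Record pseries := PSeries { pcoef : nat -> R }.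
Implicit Types f g h : pseries.

Lemma pseriesP (f g : pseries) : (forall n, pcoef f n = pcoef g n) -> f = g.
Proof. by case: f g => [f] [g] /= fg; congr PSeries; apply: funext. Qed.

HB.instance Definition _ := gen_eqMixin pseries.
HB.instance Definition _ := gen_choiceMixin pseries.

Definition ps0 := PSeries (fun=> 0).
Definition psopp f := PSeries (fun n => - pcoef f n).
Definition psadd f g := PSeries (fun n => pcoef f n + pcoef g n).
Definition pscst a := PSeries (fun n => if n is 0 then a else 0).
Definition psmul f g :=
  PSeries (fun n => \sum_(i < n.+1) pcoef f i * pcoef g (n - i)).

Fact psaddA : associative psadd.
Proof. by move=> f g h; apply: pseriesP => n /=; rewrite addrA. Qed.
Fact psaddC : commutative psadd.
Proof. by move=> f g; apply: pseriesP => n /=; rewrite addrC. Qed.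
Fact psadd0 : left_id ps0 psadd.
Proof. by move=> f; apply: pseriesP => n /=; rewrite add0r. Qed.
Fact psaddN : left_inverse ps0 psopp psadd.
Proof. by move=> f; apply: pseriesP => n /=; rewrite addNr. Qed.

HB.instance Definition _ := GRing.isZmodule.Build pseries psaddA psaddC psadd0 psaddN.

Definition trunc n f : {poly R} := \poly_(i < n.+1) pcoef f i.

(** A coefficient of a product only sees truncations, so the ring laws of series are inherited from
    polynomials. *)
Lemma psmul_trunc N n f g : (n <= N)%N ->
  pcoef (psmul f g) n = (trunc N f * trunc N g)`_n.
Proof.
move=> nN; rewrite coefM /=; apply: eq_bigr => i _.
have iN : (i <= n)%N by rewrite -ltnS.
by rewrite !coef_poly !ltnS (leq_trans iN nN) (leq_trans (leq_subr _ _) nN).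
Qed.

Fact psmulC : commutative psmul.
Proof. by move=> f g; apply: pseriesP => n; rewrite !(psmul_trunc _ _ (leqnn n)) mulrC. Qed.

Lemma psmul_truncr f g h n :
  pcoef (psmul f (psmul g h)) n = (trunc n f * (trunc n g * trunc n h))`_n.
Proof.
rewrite (psmul_trunc _ _ (leqnn n)) !(coefM (trunc n f)); apply: eq_bigr => i _.
by rewrite [X in _ * X = _]coef_poly ltnS leq_subr (psmul_trunc _ _ (leq_subr i n)).
Qed.

Fact psmulA : associative psmul.
Proof.
move=> f g h; apply: pseriesP => n; rewrite psmul_truncr.
by rewrite psmulC psmul_truncr mulrA mulrC.
Qed.
Fact psmul1 : left_id (pscst 1) psmul.
Proof.
move=> f; apply: pseriesP => n /=; rewrite big_ord_recl /= subn0 mul1r.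
by rewrite big1 ?addr0 // => i _; rewrite mul0r.
Qed.
Fact psmulD : left_distributive psmul psadd.
Proof.
move=> f g h; apply: pseriesP => n /=; rewrite -big_split /=.
by apply: eq_bigr => i _; rewrite mulrDl.
Qed.
Fact ps1_neq0 : pscst 1 != 0.
Proof. by apply/eqP => /(congr1 (fun f => pcoef f 0)) /= /eqP; rewrite oner_eq0. Qed.

HB.instance Definition _ :=
  GRing.Zmodule_isComNzRing.Build pseries psmulA psmulC psmul1 psmulD ps1_neq0.

Definition psunit : pred pseries := fun f => `[< exists g, g * f = 1 >].
Definition psinv (f : pseries) : pseries :=
  if pselect (exists g, g * f = 1) is left h then sval (cid h) else f.
Fact psmulV : {in psunit, left_inverse 1 psinv *%R}.
Proof.
by move=> f /asboolP h; rewrite /psinv; case: pselect => // h'; case: cid.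
Qed.
Fact psunitP (x y : pseries) : y * x = 1 -> psunit x.
Proof. by move=> h; apply/asboolP; exists y. Qed.
Fact psinv_out : {in [predC psunit], psinv =1 id}.
Proof.
by move=> f /negP h; rewrite /psinv; case: pselect => // h'; case: h; apply/asboolP.
Qed.
HB.instance Definition _ :=
  GRing.ComNzRing_hasMulInverse.Build pseries psmulV psunitP psinv_out.

Lemma pcoefD f g n : pcoef (f + g) n = pcoef f n + pcoef g n. Proof. by []. Qed.
Lemma pcoefM f g n : pcoef (f * g) n = \sum_(i < n.+1) pcoef f i * pcoef g (n - i).
Proof. by []. Qed.
Lemma ps_neq0 f : f != 0 -> exists n, pcoef f n != 0.
Proof.
move=> f0; apply: contrapT => /forallNP h; case/eqP: f0; apply: pseriesP => n.
by apply/eqP; apply: contrapT => /negP; exact: h.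
Qed.

Definition psord f : nat :=
  if pselect (exists n, pcoef f n != 0) is left h then ex_minn h else 0.

Lemma psordP f : f != 0 ->
  pcoef f (psord f) != 0 /\ forall n, (n < psord f)%N -> pcoef f n = 0.
Proof.
move=> /ps_neq0 h; rewrite /psord; case: pselect => // h'; case: ex_minnP => n n0 nmin.
split=> // i; apply: contraPeq => i0; apply/negP; rewrite -leqNgt; exact: nmin.
Qed.

Lemma psord_eq f n : pcoef f n != 0 -> (forall i, (i < n)%N -> pcoef f i = 0) ->
  psord f = n.
Proof.
move=> fn0 fi; have f0 : f != 0 by apply: contraNneq fn0 => ->.
have [h1 h2] := psordP f0.
case: (ltngtP (psord f) n) => // [/fi h|/h2 h]; first by rewrite h eqxx in h1.
by rewrite h eqxx in fn0.
Qed.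

Lemma psordM_aux f g : f != 0 -> g != 0 ->
  let n := (psord f + psord g)%N in
  pcoef (f * g) n = pcoef f (psord f) * pcoef g (psord g) /\
  forall i, (i < n)%N -> pcoef (f * g) i = 0.
Proof.
move=> /psordP [_ f2] /psordP [_ g2] n; split.
  rewrite pcoefM (bigD1 (inord (psord f) : 'I_n.+1)) //= inordK ?ltnS ?leq_addr //.
  rewrite big1 ?addr0 ?addKn // => i ine.
  case: (ltngtP i (psord f)) => [/f2 ->|lt|e]; rewrite ?mul0r //.
    by rewrite [pcoef g _]g2 ?mulr0 //; move: (ltn_ord i) lt; rewrite /n; lia.
  by case/eqP: ine; apply: val_inj; rewrite /= inordK ?ltnS ?leq_addr.
move=> i lin; rewrite pcoefM big1 // => j _.
case: (ltnP j (psord f)) => [/f2 ->|le]; rewrite ?mul0r //.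
by rewrite [pcoef g _]g2 ?mulr0 //; move: (ltn_ord j) lin le; rewrite /n; lia.
Qed.

Fact ps_integral (f g : pseries) : f * g = 0 -> (f == 0) || (g == 0).
Proof.
move=> fg; apply/orP; apply: contrapT => /not_orP [/negP f0 /negP g0].
have [] := psordM_aux f0 g0; rewrite fg => /esym/eqP; rewrite mulf_eq0.
by case/orP => h; [have [] := psordP f0|have [] := psordP g0]; rewrite h.
Qed.
HB.instance Definition _ := GRing.ComUnitRing_isIntegral.Build pseries ps_integral.

Lemma psordM f g : f != 0 -> g != 0 -> psord (f * g) = (psord f + psord g)%N.
Proof.
move=> f0 g0; have [h1 h2] := psordM_aux f0 g0; apply: psord_eq => //.
by rewrite h1 mulf_neq0 //; [have [] := psordP f0|have [] := psordP g0].
Qed.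

Lemma psordD f g : f != 0 -> g != 0 -> f + g != 0 ->
  (psord f <= psord (f + g)%R)%N || (psord g <= psord (f + g)%R)%N.
Proof.
move=> f0 g0 fg0; have [_ f2] := psordP f0; have [_ g2] := psordP g0.
have [h1 h2] := psordP fg0; apply: contraNT h1; rewrite negb_or -!ltnNge.
by case/andP => /f2 h /g2 h'; rewrite pcoefD h h' addr0.
Qed.

Fact pscst_zmod : zmod_morphism pscst.
Proof. by move=> a b; apply: pseriesP => -[|n] //=; rewrite subr0. Qed.
Fact pscst_monoid : monoid_morphism pscst.
Proof.
split=> // a b; apply: pseriesP => -[|n] /=; first by rewrite big_ord1.
rewrite big1 // => -[[|i] ilt] _ /=; first by rewrite mulr0.
by rewrite mul0r.
Qed.
HB.instance Definition _ := GRing.isZmodMorphism.Build R pseries pscst pscst_zmod.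
HB.instance Definition _ := GRing.isMonoidMorphism.Build R pseries pscst pscst_monoid.

Definition psX := PSeries (fun n => (n == 1%N)%:R).

Lemma pcoefCM a f n : pcoef (pscst a * f) n = a * pcoef f n.
Proof.
rewrite pcoefM big_ord_recl /= subn0 big1 ?addr0 // => i _.
by rewrite mul0r.
Qed.

Lemma psunitE (f : pseries) : pcoef f 0 != 0 -> exists g, g * f = 1.
Proof.
move=> f0.
have [g gE] := strong_rec (0 : R) (fun n (g : nat -> R) => (pcoef f 0)^-1 *
  ((n == 0)%:R - \sum_(i < n) g (i : nat) * pcoef f (n - i))).
exists (PSeries g); apply: pseriesP => n; rewrite pcoefM big_ord_recr /= subnn.
rewrite [g n]gE mulrAC mulVf // mul1r.
have -> : \sum_(i < n) (if (i < n)%N then g i else 0) * pcoef f (n - i) =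
          \sum_(i < n) g i * pcoef f (n - i).
  by apply: eq_bigr => i _; rewrite ltn_ord.
by rewrite addrC subrK; case: n.
Qed.

(** Divide both by the power [psord d] of the variable; what is left of [d] has a nonzero constant
    term and is invertible. *)
Lemma ps_div (n d : pseries) : n != 0 -> d != 0 -> (psord d <= psord n)%N ->
  exists g, n = g * d.
Proof.
move=> n0 d0 le; pose sh k f := PSeries (fun i => pcoef f (i + k)).
have [d1 d2] := psordP d0; have [_ n2] := psordP n0.
have shE f k : (forall i, (i < k)%N -> pcoef f i = 0) -> f = psX ^+ k * sh k f.
  elim: k f => [|k IH] f fk.
    by rewrite expr0 mul1r; apply: pseriesP => i /=; rewrite addn0.
  rewrite {1}(IH f) => [|i ik]; last by apply: fk; exact: ltnW.
  rewrite exprSr -mulrA; congr (_ * _); apply: pseriesP => -[|i].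
    by rewrite pcoefM big_ord1 /= mul0r; apply: fk; rewrite add0n.
  rewrite pcoefM big_ord_recl /= mul0r add0r big_ord_recl /= mul1r /bump /=.
  rewrite big1 ?addr0 => [|j _]; last by rewrite mul0r.
  by rewrite subSS subn0 addnS addSn.
have [g gE] : exists g, g * sh (psord d) d = 1 by apply: psunitE.
exists (g * sh (psord d) n).
have AC (x1 x2 x3 x4 : pseries) : x1 * x2 * (x3 * x4) = x1 * x4 * (x3 * x2).
  by rewrite mulrACA [RHS]mulrACA [x2 * x4]mulrC.
transitivity (g * sh (psord d) n * (psX ^+ psord d * sh (psord d) d)); last first.
  by rewrite -shE.
rewrite -AC gE mul1r; apply: shE => i ik; apply: n2; exact: leq_trans ik le.
Qed.

(** For [Q] a power of the characteristic, raising to the power [Q] is additive, hence acts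
    termwise; this is checked on truncations. Coefficient [n] then involves only the index
    [n / Q]. *)
Lemma pcoef_pow p Q f n : p \in [pchar R] -> [pchar R].-nat Q -> (0 < Q)%N ->
  pcoef (f ^+ Q) n = if (Q %| n)%N then pcoef f (n %/ Q) ^+ Q else 0.
Proof.
move=> cp cQ Q0.
have powE k : (0 < k)%N -> forall N i, (i <= N)%N -> pcoef (f ^+ k) i = (trunc N f ^+ k)`_i.
  case: k => // k _; elim: k => [|k IH] N i iN.
    by rewrite !expr1 coef_poly ltnS iN.
  rewrite exprS [trunc N f ^+ _]exprS pcoefM coefM; apply: eq_bigr => j _.
  have jN : (j <= N)%N by apply: leq_trans iN; rewrite -ltnS.
  by rewrite (IH N) ?coef_poly ?ltnS ?jN // (leq_trans (leq_subr _ _) iN).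
rewrite (powE _ Q0 n n) // /trunc poly_def.
have cP : [pchar {poly R}].-nat Q.
  apply: sub_in_pnat cQ => x _; rewrite !inE => /andP[-> /eqP h] /=.
  by rewrite -polyC_natr h.
have -> : (\sum_(i < n.+1) pcoef f i *: 'X^i) ^+ Q =
          \sum_(i < n.+1) (pcoef f i ^+ Q) *: 'X^(i * Q)%N :> {poly R}.
  elim/big_rec2: _ => [|i x y _ <-]; first by rewrite expr0n gtn_eqF.
  by rewrite exprDn_pchar // exprZn exprM.
rewrite coef_sum; under eq_bigr do rewrite coefZ coefXn.
case: (boolP (Q %| n)%N) => [dv|ndv].
  have lt : (n %/ Q < n.+1)%N by rewrite ltnS leq_div.
  rewrite (bigD1 (Ordinal lt)) //= divnK // eqxx mulr1 big1 ?addr0 // => i ne.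
  case: eqP => [e|_]; rewrite ?mulr0 //; case/eqP: ne; apply: val_inj => /=.
  by apply/eqP; rewrite -(eqn_pmul2r Q0) -e divnK.
rewrite big1 // => i _; case: eqP => [e|_]; rewrite ?mulr0 //.
by case/negP: ndv; apply/dvdnP; exists i.
Qed.

End PowerSeries.

(** * Valuations and Laurent series *)

Section Valuations.
Variable F : fieldType.
Implicit Types (v : F -> int) (x y : F).

(** Weaker than [is_place]: neither normalised nor trivial on constants, so that multiples and
    pullbacks are covered. *)
Definition valn v : Prop :=
  [/\ v 0 = 0,
      (forall x y, x != 0 -> y != 0 -> v (x * y) = v x + v y) &
      (forall x y, x != 0 -> y != 0 -> x + y != 0 ->
        (v x <= v (x + y)) || (v y <= v (x + y)))].

(** The order of 0 is read as infinite here, which hides the default [v 0 = 0]. *)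
Definition vge v (e : int) x : bool := (x == 0) || (e <= v x).

Variable v : F -> int.
Hypothesis vP : valn v.

Lemma valnM x y : x != 0 -> y != 0 -> v (x * y) = v x + v y.
Proof. by case: vP => _ h _; apply: h. Qed.
Lemma valn0 : v 0 = 0. Proof. by case: vP. Qed.
Lemma valn1 : v 1 = 0.
Proof. have h := valnM (oner_neq0 F) (oner_neq0 F); rewrite mulr1 in h; move: (v 1) h => a h; vlia. Qed.
Lemma valnV x : v x^-1 = - v x.
Proof.
have [->|x0] := eqVneq x 0; first by rewrite invr0 valn0.
by have := valnM x0 (invr_neq0 x0); rewrite mulfV // valn1; vlia.
Qed.
Lemma valnX x n : v (x ^+ n) = v x *+ n.
Proof.
have [->|x0] := eqVneq x 0.
  by case: n => [|n]; rewrite ?expr0 ?expr0n ?valn1 ?valn0 // mul0rn.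
by elim: n => [|n IH]; rewrite ?expr0 ?valn1 // exprS valnM ?expf_neq0 // IH mulrS.
Qed.
Lemma valnN x : v (- x) = v x.
Proof.
have [->|x0] := eqVneq x 0; first by rewrite oppr0.
have n1 : (-1 : F) != 0 by rewrite oppr_eq0 oner_eq0.
have : v ((-1) * (-1)) = v (-1) + v (-1) by rewrite valnM.
by rewrite mulrNN mulr1 valn1 -[- x]mulN1r valnM //; vlia.
Qed.

Lemma vge0 e : vge v e 0. Proof. by rewrite /vge eqxx. Qed.
Lemma vgeE e x : x != 0 -> vge v e x = (e <= v x).
Proof. by move=> /negPf x0; rewrite /vge x0. Qed.
Lemma vge_le e e' x : e' <= e -> vge v e x -> vge v e' x.
Proof. by move=> le /orP[/eqP ->|h]; rewrite /vge ?eqxx // (le_trans le h) orbT. Qed.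
Lemma vgeM e e' x y : vge v e x -> vge v e' y -> vge v (e + e') (x * y).
Proof.
have [->|x0] := eqVneq x 0; first by move=> _ _; rewrite mul0r vge0.
have [->|y0] := eqVneq y 0; first by move=> _ _; rewrite mulr0 vge0.
by rewrite !vgeE ?mulf_neq0 // valnM // => *; apply: lerD.
Qed.
Lemma vgeD e x y : vge v e x -> vge v e y -> vge v e (x + y).
Proof.
have [->|x0] := eqVneq x 0; first by move=> _; rewrite add0r.
have [->|y0] := eqVneq y 0; first by move=> h _; rewrite addr0.
have [->|s0] := eqVneq (x + y) 0; first by move=> _ _; rewrite vge0.
rewrite !vgeE //; case: vP => _ _ /(_ _ _ x0 y0 s0) /orP[] h h1 h2; vlia.
Qed.
Lemma vgeN e x : vge v e (- x) = vge v e x.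
Proof. by rewrite /vge oppr_eq0 valnN. Qed.
Lemma vgeB e x y : vge v e x -> vge v e y -> vge v e (x - y).
Proof. by move=> hx hy; apply: vgeD; rewrite ?vgeN. Qed.
Lemma vge_sum e (I : Type) (r : seq I) (P : pred I) (f : I -> F) :
  (forall i, P i -> vge v e (f i)) -> vge v e (\sum_(i <- r | P i) f i).
Proof. by move=> h; elim/big_rec: _ => [|i x /h]; [exact: vge0|exact: vgeD]. Qed.
Lemma vge1 : vge v 0 1.
Proof. by rewrite vgeE ?oner_neq0 // valn1. Qed.
Lemma vgeX e x n : vge v e x -> vge v (e *+ n) (x ^+ n).
Proof.
by move=> h; elim: n => [|n IH]; rewrite ?mulr0n ?vge1 // mulrS exprS vgeM.
Qed.
Lemma vge0M x y : vge v 0 x -> vge v 0 y -> vge v 0 (x * y).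
Proof. by move=> hx hy; have := vgeM hx hy; rewrite addr0. Qed.
Lemma vge0X x n : vge v 0 x -> vge v 0 (x ^+ n).
Proof. by move=> h; have := vgeX n h; rewrite mul0rn. Qed.

Lemma valnD_lt x y : x != 0 -> vge v (v x + 1) y -> x + y != 0 /\ v (x + y) = v x.
Proof.
move=> x0 hy; have s0 : x + y != 0.
  apply: contraTneq hy => /eqP; rewrite addr_eq0 => /eqP e; rewrite -vgeN -e vgeE //; vlia.
split=> //; apply/eqP; rewrite eq_le; apply/andP; split; last first.
  rewrite -vgeE //; apply: vgeD; first by rewrite vgeE.
  by apply: vge_le hy; vlia.
rewrite leNgt; apply/negP => lt.
have : vge v (v x + 1) (x + y - y).
  by apply: vgeB => //; rewrite vgeE //; vlia.
by rewrite addrK vgeE //; vlia.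
Qed.

Lemma valn_sum_min (I : finType) (f : I -> F) i0 : f i0 != 0 ->
  (forall i, i != i0 -> vge v (v (f i0) + 1) (f i)) ->
  \sum_i f i != 0 /\ v (\sum_i f i) = v (f i0).
Proof.
move=> f0 h; rewrite (bigD1 i0) //=; apply: valnD_lt => //.
exact: vge_sum.
Qed.

End Valuations.

Lemma subf_div (F : fieldType) (a b c d : F) : b != 0 -> d != 0 ->
  a / b - c / d = (a * d - c * b) / (b * d).
Proof. by move=> b0 d0; rewrite -(mulNr c) addf_div // mulNr. Qed.

(** * Fields of fractions *)

Section Fractions.
Variable R : idomainType.
Local Notation tofrac := (@FracField.tofrac R).

Lemma fracP (f : {fraction R}) :
  exists (n d : R), d != 0 /\ f = tofrac n / tofrac d.
Proof.
elim/quotW: f => x; exists \n_x, \d_x; split; first exact: denom_ratioP.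
apply: (canRL (mulfK _)); first by rewrite tofrac_eq0 denom_ratioP.
unlock FracField.tofrac; rewrite -[LHS]FracField.pi_mul.
apply/eqmodP; rewrite /= /FracField.equivf /FracField.mulf.
by rewrite !numden_Ratio ?mulr1 ?oner_eq0 ?denom_ratioP // mulrC.
Qed.

Lemma frac_hom (L : fieldType) (h : {rmorphism R -> L}) :
  (forall x, x != 0 -> h x != 0) ->
  exists H : {rmorphism {fraction R} -> L}, forall x, H (tofrac x) = h x.
Proof.
move=> inj.
have /choice [H HP] : forall f, exists z, forall n d, d != 0 ->
    f = tofrac n / tofrac d -> z = h n / h d.
  move=> f; have [n [d [d0 fE]]] := fracP f; exists (h n / h d) => n' d' d'0.
  rewrite fE => /eqP; rewrite eqr_div ?tofrac_eq0 // -!rmorphM tofrac_eq => /eqP e.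
  by apply/eqP; rewrite eqr_div ?inj // -!rmorphM e.
have Hf x : H (tofrac x) = h x.
  by rewrite (HP _ x 1) ?oner_eq0 // ?rmorph1 ?divr1.
have HB : zmod_morphism H.
  move=> x y; have [n [d [d0 ->]]] := fracP x; have [n' [d' [d'0 ->]]] := fracP y.
  rewrite (HP (tofrac n / _) n d) // (HP (tofrac n' / _) n' d') //.
  rewrite (HP _ (n * d' - n' * d) (d * d')) ?mulf_neq0 //; last first.
    by rewrite rmorphB !rmorphM /= subf_div ?tofrac_eq0.
  by rewrite rmorphB !rmorphM /= subf_div ?inj.
have HM : monoid_morphism H.
  split=> [|x y]; first by rewrite -(rmorph1 tofrac) Hf rmorph1.
  have [n [d [d0 ->]]] := fracP x; have [n' [d' [d'0 ->]]] := fracP y.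
  rewrite (HP (tofrac n / _) n d) // (HP (tofrac n' / _) n' d') //.
  rewrite (HP _ (n * n') (d * d')) ?mulf_neq0 //; last by rewrite !rmorphM mulf_div.
  by rewrite !rmorphM mulf_div.
pose HZ := GRing.isZmodMorphism.Build _ _ H HB.
pose HMM := GRing.isMonoidMorphism.Build _ _ H HM.
pose HH : {rmorphism {fraction R} -> L} := HB.pack H HZ HMM.
by exists HH.
Qed.

Lemma frac_valn (o : R -> int) :
  (forall x y, x != 0 -> y != 0 -> o (x * y) = o x + o y) ->
  (forall x y, x != 0 -> y != 0 -> x + y != 0 -> (o x <= o (x + y)) || (o y <= o (x + y))) ->
  exists v : {fraction R} -> int, valn v /\
    forall n d, n != 0 -> d != 0 -> v (tofrac n / tofrac d) = o n - o d.
Proof.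
move=> oM oD.
have /choice [v vP] : forall f, exists z : int, (f = 0 -> z = 0) /\
    forall n d, n != 0 -> d != 0 -> f = tofrac n / tofrac d -> z = o n - o d.
  move=> f; have [n [d [d0 fE]]] := fracP f.
  have [n0|n0] := eqVneq n 0.
    exists 0; split=> // n' d' n'0 d'0; rewrite fE n0 rmorph0 mul0r => /esym/eqP.
    by rewrite mulf_eq0 invr_eq0 !tofrac_eq0 (negPf n'0) (negPf d'0).
  exists (o n - o d); split.
    by move/eqP; rewrite fE mulf_eq0 invr_eq0 !tofrac_eq0 (negPf n0) (negPf d0).
  move=> n' d' n'0 d'0; rewrite fE => /eqP.
  rewrite eqr_div ?tofrac_eq0 // -!rmorphM tofrac_eq => /eqP e.
  have := oM _ _ n0 d'0; rewrite e oM // => e'.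
  by move: e'; vlia.
exists v; have vE n d : n != 0 -> d != 0 -> v (tofrac n / tofrac d) = o n - o d.
  by move=> n0 d0; case: (vP (tofrac n / tofrac d)) => _; apply.
have nz n d : d != 0 -> tofrac n / tofrac d != 0 -> n != 0.
  by move=> d0; apply: contraNneq => ->; rewrite rmorph0 mul0r.
split=> //; split; first by case: (vP 0) => ->.
  move=> x y; have [n [d [d0 ->]]] := fracP x; have [n' [d' [d'0 ->]]] := fracP y.
  move=> /(nz _ _ d0) n0 /(nz _ _ d'0) n'0.
  by rewrite mulf_div -!rmorphM !vE ?mulf_neq0 // !oM //; vlia.
move=> x y; have [n [d [d0 ->]]] := fracP x; have [n' [d' [d'0 ->]]] := fracP y.
move=> /(nz _ _ d0) n0 /(nz _ _ d'0) n'0.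
rewrite addf_div ?tofrac_eq0 // -!rmorphM -rmorphD => /nz; rewrite mulf_neq0 // => /(_ isT) s0.
rewrite !vE ?mulf_neq0 //; have := oD _ _ (mulf_neq0 n0 d'0) (mulf_neq0 n'0 d0) s0.
by move: s0; set s := _ + _; rewrite !oM //; vlia.
Qed.

End Fractions.

(* Laurent series over [kk], axiomatised by what is used of them: a discretely valued field with
   residue field [kk] in which separable additive equations are solvable above a simple residue. *)
Record laurent (kk : fieldType) := Laurent {
  lfield :> fieldType;
  lcst : {rmorphism kk -> lfield};
  lvar : lfield;
  lval : lfield -> int;
  lvalP : valn lval;
  lval_cst : forall a, a != 0 -> lval (lcst a) = 0;
  lval_var : lval lvar = 1;
  lres_ex : forall z, vge lval 0 z -> exists a, vge lval 1 (z - lcst a);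
  lhensel : forall p Q (e u : lfield) (e0 c : kk), p \in [pchar kk] -> [pchar kk].-nat Q ->
    (1 < Q)%N -> e0 != 0 -> e = lcst e0 ->
    vge lval 1 (u - lcst (c ^+ Q + e0 * c)) ->
    exists y, y ^+ Q + e * y = u /\ vge lval 1 (y - lcst c)
}.

Local Notation tf := (@FracField.tofrac (pseries _)).

(** The fractions of power series serve. The equation [y ^ Q + e y = u] is solved coefficient by
    coefficient: for [n > 0] the coefficient [n] of [y ^ Q] is 0 or a power of [y_(n / Q)], so
    [e0 y_n] is determined by earlier coefficients, and [y_0] is the prescribed [c]. *)
Lemma laurent_exists (kk : fieldType) : inhabited (laurent kk).
Proof.
have oD (f g : pseries kk) : f != 0 -> g != 0 -> f + g != 0 ->
    ((psord f)%:Z <= (psord (f + g))%:Z) || ((psord g)%:Z <= (psord (f + g))%:Z).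
  by move=> *; rewrite !lez_nat; apply: psordD.
have oM (f g : pseries kk) : f != 0 -> g != 0 -> (psord (f * g))%:Z = (psord f)%:Z + (psord g)%:Z.
  by move=> *; rewrite psordM // PoszD.
have [v [vP vE]] := frac_valn oM oD.
have tf0 f : (tf f == 0) = (f == 0) by rewrite tofrac_eq0.
have vf f : f != 0 -> v (tf f) = (psord f)%:Z.
  move=> f0; rewrite -[tf f]divr1 -(rmorph1 tf) vE ?oner_eq0 //.
  by rewrite (@psord_eq _ 1 0) ?subr0 ?oner_eq0.
have int_ps z : vge v 0 z -> exists g, z = tf g.
  have [n [d [d0 ->]]] := fracP z; have [->|n0] := eqVneq n 0.
    by exists 0; rewrite !rmorph0 mul0r.
  rewrite vgeE ?mulf_neq0 ?invr_eq0 ?tofrac_eq0 // vE // subr_ge0 lez_nat => le.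
  have [g ->] := ps_div n0 d0 le; exists g.
  by rewrite rmorphM mulfK ?tofrac_eq0.
have vge1 f : vge v 1 (tf f) = (pcoef f 0 == 0).
  have [->|f0] := eqVneq f 0; first by rewrite rmorph0 vge0 eqxx.
  rewrite vgeE ?tf0 // vf // lez_nat.
  have [h1 h2] := psordP f0; apply/idP/idP => [lt|/eqP e]; first by rewrite h2.
  by rewrite lt0n; apply: contraNneq h1 => ->; apply/eqP.
have X0 : psX kk != 0.
  by apply/eqP => /(congr1 (fun f => pcoef f 1)) /= /eqP; rewrite oner_eq0.
pose C : {rmorphism kk -> {fraction pseries kk}} := [the {rmorphism _ -> _} of tf \o @pscst kk].
constructor; refine (@Laurent kk {fraction pseries kk} C (tf (psX kk)) v vP _ _ _ _).
- move=> a a0; rewrite /= vf; last first.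
    by apply: contraNneq a0 => /(congr1 (fun f => pcoef f 0)) /= ->.
  by rewrite (@psord_eq _ _ 0).
- by rewrite vf // (@psord_eq _ _ 1) ?oner_eq0 // => -[].
- move=> z /int_ps [g ->]; exists (pcoef g 0); rewrite /= -rmorphB vge1 /=.
  by rewrite subrr.
move=> p Q e u e0 c cp cQ Q1 e00 -> hu.
have [g uE] : exists g, u = tf g.
  apply: int_ps; rewrite -[u](subrK (C (c ^+ Q + e0 * c))); apply: vgeD => //.
    exact: vge_le hu.
  have [->|n0] := eqVneq (c ^+ Q + e0 * c) 0; first by rewrite rmorph0 vge0.
  rewrite vgeE ?fmorph_eq0 // vf // -?tf0 ?fmorph_eq0 //.
  by rewrite -[tf _]/(C _) fmorph_eq0.
have g0 : pcoef g 0 = c ^+ Q + e0 * c.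
  by move: hu; rewrite uE -rmorphB vge1 subr_eq0 => /eqP.
have Q0 : (0 < Q)%N by apply: ltnW.
have [y yE] := strong_rec (0 : kk) (fun n y => if n == 0 then c else
  e0^-1 * (pcoef g n - if (Q %| n)%N then y (n %/ Q)%N ^+ Q else 0)).
exists (tf (PSeries y)); split; last first.
  by rewrite /= -rmorphB vge1 /= yE /= subrr.
rewrite uE /= -rmorphM -rmorphXn -rmorphD; congr tf; apply: pseriesP => n.
rewrite pcoefD (pcoef_pow _ _ cp cQ Q0) pcoefCM /=.
case: n => [|n]; first by rewrite dvdn0 div0n yE /= g0.
rewrite [y n.+1]yE /= mulrA mulfV // mul1r ltn_Pdiv //.
by case: ifP => _; rewrite ?subr0 ?add0r // addrC subrK.
Qed.

(** * Artin-Schreier extensions *)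

Lemma simple_ext (F : fieldType) (p : {poly F}) : p \is monic -> irreducible_poly p ->
  exists (F' : fieldType) (pi : {rmorphism {poly F} -> F'}),
    (forall f : {poly F}, (pi f == 0) = (p %| f)) /\
    (forall z : F', exists f : {poly F}, (size f < size p)%N /\ z = pi f).
Proof.
move=> pm pi; have hI : monic_irreducible_poly p by split.
have pE : mk_monic p = p by exact: (mk_monicE hI).
pose G : {rmorphism {poly F} -> {poly %/ p with hI}} := [the {rmorphism {poly F} -> {poly %/ p}} of @in_qpoly F p].
have gv f : val (G f) = Pdiv.Ring.rmodp f p :> {poly F} by rewrite /G /= pE.
exists {poly %/ p with hI}, G; split=> [f|z].
  by rewrite -val_eqE -[val _]/(val (G f)) gv dvdpE.
have sz : (size (val (z : {poly %/ p})) < size p)%N.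
  by apply: leq_trans (size_mk_monic (z : {poly %/ p})) _; rewrite pE.
exists (val (z : {poly %/ p})); split=> //.
by apply: val_inj; rewrite gv Pdiv.Ring.rmodp_small.
Qed.

Section ArtinSchreier.
Variables (F : fieldType) (Q : nat) (e u : F).
Hypothesis Q1 : (1 < Q)%N.

Let Q0 : (0 < Q)%N. Proof. exact: ltnW. Qed.

Definition as_poly : {poly F} := 'X^Q + (e *: 'X - u%:P).

Lemma size_as_tail : (size (e *: 'X - u%:P : {poly F})%R <= Q)%N.
Proof.
apply: leq_trans (size_polyD _ _) _; rewrite size_polyN geq_max.
rewrite (leq_trans (size_scale_leq _ _)) ?size_polyX //=.
by rewrite (leq_trans (size_polyC_leq1 _)).
Qed.

Lemma size_as_poly : size as_poly = Q.+1.
Proof. by rewrite size_polyDl size_polyXn // ltnS size_as_tail. Qed.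

Lemma as_poly_monic : as_poly \is monic.
Proof.
by rewrite monicE lead_coefDl ?lead_coefXn // size_polyXn ltnS size_as_tail.
Qed.

(** The product has degree at most [2 Q - 2], so substituting [u - e X] for [X ^ Q] once reduces it
    completely. *)
Lemma as_modp (f g : {poly F}) : (size f <= Q)%N -> (size g <= Q)%N ->
  (f * g) %% as_poly =
  take_poly Q (f * g) + (u%:P - e *: 'X) * drop_poly Q (f * g).
Proof.
move=> sf sg; set A := f * g; set C := _ + _.
have sA : (size A - Q <= Q.-1)%N.
  by have := size_polyMleq f g; rewrite -/A; move: (size A) sf sg Q1 => a; lia.
have sC : (size C < size as_poly)%N.
  rewrite size_as_poly ltnS; apply: leq_trans (size_polyD _ _) _.
  rewrite geq_max size_take_poly /=; apply: leq_trans (size_polyMleq _ _) _.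
  rewrite size_drop_poly; have : (size (u%:P - e *: 'X : {poly F})%R <= 2)%N.
    apply: leq_trans (size_polyD _ _) _; rewrite size_polyN geq_max.
    rewrite (leq_trans (size_polyC_leq1 _)) //=.
    by rewrite (leq_trans (size_scale_leq _ _)) ?size_polyX.
  by move: (size _) sA Q1 => a; move: (size A) => b; lia.
have -> : A = drop_poly Q A * as_poly + C.
  rewrite /C -{1}(poly_take_drop Q A) /as_poly; move: (take_poly _ _) (drop_poly _ _) => a b; rewrite -!mul_polyC; ring.
by rewrite modpD modp_mull add0r modp_small.
Qed.

Section Dominant.
Variables (v : F -> int) (m : nat).
Hypotheses (vP : valn v) (ve : e != 0 -> v e = 0) (vu : v u = - m%:Z) (m0 : (0 < m)%N)
  (mQ : coprime m Q).

Let u0 : u != 0.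
Proof. by apply/eqP => h; move: vu; rewrite h (valn0 vP); lia. Qed.

Let V : F -> int := fun x => Q%:Z * v x.
Let VP : valn V.
Proof.
split; rewrite /V; first by rewrite (valn0 vP) mulr0.
  by move=> x y x0 y0; rewrite (valnM vP) // mulrDr.
move=> x y x0 y0 s0; case: vP => _ _ /(_ x y x0 y0 s0).
by rewrite !ler_pM2l // ltz_nat.
Qed.

Implicit Types f g h : {poly F}.

(** The order of the monomial [f_i y ^ i] when [F] carries [Q v] and [y] is given order [-m]. As [m]
    is prime to [Q], nonzero terms of index below [Q] have pairwise different orders; [dom f i] says
    that the term [i] has the strictly smallest one. *)
Definition wt (f : {poly F}) i : int := V f`_i - (i * m)%:Z.

Definition dom (f : {poly F}) i :=
  f`_i != 0 /\ forall j, j != i -> vge V (wt f i + (j * m)%:Z + 1) f`_j.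

Lemma dom_ge f i : dom f i -> forall j, vge V (wt f i + (j * m)%:Z) f`_j.
Proof.
case=> fi h j; have [->|ji] := eqVneq j i; last by apply: vge_le (h _ ji); lia.
by rewrite vgeE // /wt; lia.
Qed.

Lemma dom_uniq f i j : dom f i -> dom f j -> i = j.
Proof.
case=> fi hi [fj hj]; apply/eqP; apply: contraT => ij.
have := hi j; rewrite eq_sym ij => /(_ isT); rewrite vgeE // => h1.
have := hj i ij; rewrite vgeE // => h2; move: h1 h2; rewrite /wt; vlia.
Qed.

Lemma dom_ex f : f != 0 -> (size f <= Q)%N -> exists i, (i < Q)%N /\ dom f i.
Proof.
move=> f0 sf; have hl : f`_((size f).-1) != 0 by rewrite -lead_coefE lead_coef_eq0.
have lt : ((size f).-1 < Q)%N by rewrite -size_poly_gt0 in f0; move: f0 sf; case: size.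
pose i0 := Ordinal lt.
case: (@arg_minP _ _ _ i0 (fun i : 'I_Q => f`_i != 0) (fun i : 'I_Q => wt f i) hl) => i fi imin.
exists i; split; first exact: ltn_ord.
split=> // j ji; case: (ltnP j Q) => jQ; last by rewrite nth_default ?vge0 // (leq_trans sf).
have [->|fj] := eqVneq f`_j 0; first exact: vge0.
have := imin (Ordinal jQ) fj; rewrite vgeE //= => le.
have ne : wt f j != wt f i.
  apply: contraNneq ji; rewrite /wt /V => eqw.
  have : (Q%:Z %| (j%:Z - i%:Z) * m%:Z)%Z.
    by apply/dvdzP; exists (v f`_j - v f`_i); move: eqw; rewrite !PoszM; vlia.
  rewrite dvdzE abszM !absz_nat Gauss_dvdl 1?coprime_sym // => dv.
  have lti := ltn_ord i; apply/eqP.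
  case/dvdnP: dv => -[|k]; lia.
by move: le ne; rewrite /wt; move: (V _) (V _) => a b; lia.
Qed.

(** As in Gauss's lemma, the product of the two strictly lowest terms cannot be cancelled by any
    other pair of terms. *)
Lemma dom_mul f g i j : dom f i -> dom g j ->
  dom (f * g) (i + j) /\ wt (f * g) (i + j) = wt f i + wt g j.
Proof.
move=> [fi hf] [gj hg]; have hf' := dom_ge (conj fi hf); have hg' := dom_ge (conj gj hg).
have ilt : (i < (i + j).+1)%N by rewrite ltnS leq_addr.
have [nz Ve] : (f * g)`_(i + j) != 0 /\ V (f * g)`_(i + j) = V (f`_i * g`_j).
  rewrite coefM.
  have := @valn_sum_min _ _ VP _ (fun l : 'I_(i + j).+1 => f`_l * g`_(i + j - l)) (Ordinal ilt).
  rewrite /= addKn => h; apply: h; first by rewrite mulf_neq0.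
  move=> l li; have {}li : (l : nat) != i by apply: contraNneq li => h; apply/eqP/val_inj.
  have := vgeM VP (hf _ li) (hg' (i + j - l)%N); apply: vge_le.
  rewrite (valnM VP) // /wt; have := ltn_ord l; move: (V f`_i) (V g`_j) => a b; nia.
have wE : wt (f * g) (i + j) = wt f i + wt g j.
  by rewrite /wt Ve (valnM VP) //; move: (V f`_i) (V g`_j) => a b; lia.
split=> //; split=> // k kij; rewrite wE coefM; apply: (vge_sum VP) => l _.
have [li|li] := eqVneq (l : nat) i.
  have kl : (k - l)%N != j.
    by apply: contraNneq kij => <-; rewrite -li subnKC // -ltnS.
  have := vgeM VP (hf' l) (hg _ kl); apply: vge_le.
  by have := ltn_ord l; move: (wt f i) (wt g j) => a b; nia.
have := vgeM VP (hf _ li) (hg' (k - l)%N); apply: vge_le.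
by have := ltn_ord l; move: (wt f i) (wt g j) => a b; nia.
Qed.

(** Reduction replaces [X ^ Q], of order [-Q m], by [u], of the same order, and by [-e X], of larger
    order. The lowest term of the product survives, at its own index or moved down by [Q]. *)
Lemma dom_mod f g i j : (size f <= Q)%N -> (size g <= Q)%N -> dom f i -> dom g j ->
  let h := (f * g) %% as_poly in
  exists k, dom h k /\ wt h k = wt f i + wt g j.
Proof.
move=> sf sg df dg; have [[nz hA] wA] := dom_mul df dg.
have hA' := dom_ge (conj nz hA).
rewrite as_modp //; set A := f * g in nz hA wA hA' *; set C := _ + _ => /=.
have Vu : V u = - (Q * m)%:Z by rewrite /V vu; lia.
have Ve : e != 0 -> V e = 0 by move=> e0; rewrite /V ve // mulr0.
have vgee : vge V 0 e by rewrite /vge; case: eqVneq => //= /Ve ->.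
have CE l : C`_l = (if (l < Q)%N then A`_l else 0) + u * A`_(l + Q) -
    (if l is l'.+1 then e * A`_(l' + Q) else 0).
  rewrite /C coefD coef_take_poly mulrBl coefB coefCM coef_drop_poly -scalerAl coefZ.
  rewrite coefXM; case: l => [|l] /=; rewrite ?mulr0 //; last by rewrite coef_drop_poly addrA.
  by rewrite addrA.
set w := wt A (i + j) in hA hA' wA.
have tE l : vge V (w + (l * m)%:Z + 1) (if l is l'.+1 then e * A`_(l' + Q) else 0).
  case: l => [|l]; first exact: vge0.
  have := vgeM VP vgee (hA' (l + Q)%N); apply: vge_le; nia.
have tU l : (l + Q)%N != (i + j)%N -> vge V (w + (l * m)%:Z + 1) (u * A`_(l + Q)).
  move=> ne; have hu : vge V (- (Q * m)%:Z) u by rewrite vgeE // Vu.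
  by have := vgeM VP hu (hA _ ne); apply: vge_le; nia.
have tA l : l != (i + j)%N -> vge V (w + (l * m)%:Z + 1) (if (l < Q)%N then A`_l else 0).
  by move=> ne; case: ifP => _; [exact: hA|exact: vge0].
case: (ltnP (i + j) Q) => ijQ.
  exists (i + j)%N; have [C0 VC] : C`_(i + j) != 0 /\ V C`_(i + j) = V A`_(i + j).
    rewrite CE ijQ -addrA; apply: (valnD_lt VP nz).
    have -> : V A`_(i + j) = w + ((i + j) * m)%:Z by rewrite /w /wt; lia.
    by apply: (vgeB VP) => //; apply: tU; lia.
  have wC : wt C (i + j) = w by rewrite /wt VC.
  split; last by rewrite wC.
  split=> // l ne; rewrite wC CE; apply: (vgeB VP) => //; apply: (vgeD VP); first exact: tA.
  case: (eqVneq (l + Q)%N (i + j)%N) => [h|]; last exact: tU.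
  by lia.
have lt2 : (i + j < Q + Q)%N.
  case: (ltnP i Q) => iQ; last by case: df; rewrite nth_default ?eqxx // (leq_trans sf).
  by case: (ltnP j Q) => jQ; [lia|case: dg; rewrite nth_default ?eqxx // (leq_trans sg)].
have kE : (i + j - Q + Q)%N = (i + j)%N by rewrite subnK.
exists (i + j - Q)%N.
have [C0 VC] : C`_(i + j - Q) != 0 /\ V C`_(i + j - Q) = V (u * A`_(i + j)).
  rewrite CE kE [X in X - _]addrC -addrA; apply: (valnD_lt VP); first by rewrite mulf_neq0.
  have -> : V (u * A`_(i + j)) = w + ((i + j - Q) * m)%:Z.
    by rewrite (valnM VP) // Vu /w /wt; move: (V _) => a; nia.
  by apply: (vgeB VP) => //; apply: tA; lia.
have wC : wt C (i + j - Q) = w.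
  by rewrite /wt VC (valnM VP) // Vu /w /wt; move: (V _) => a; nia.
split; last by rewrite wC.
split=> // l ne; rewrite wC CE; apply: (vgeB VP) => //; apply: (vgeD VP).
  case: (eqVneq l (i + j)%N) => [h|]; last exact: tA.
  by rewrite ltnNge h ijQ /= vge0.
by apply: tU; apply: contraNneq ne => h; rewrite -h addnK.
Qed.

(** A proper factorisation would be a product of two reduced polynomials with remainder 0, whereas
    [dom_mod] exhibits a nonzero coefficient of the remainder. *)
Lemma as_irreducible : irreducible_poly as_poly.
Proof.
split=> [|g sg dg]; first by rewrite size_as_poly ltnS.
have p0 : as_poly != 0 by rewrite -size_poly_gt0 size_as_poly.
rewrite -dvdp_size_eqp //; apply: contraT => ne.
have le := dvdp_leq p0 dg; have g0 : g != 0 by apply: contraTneq dg => ->; rewrite dvd0p.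
have [h hE] := dvdpP _ _ dg.
have h0 : h != 0 by apply: contraNneq p0 => h0; rewrite hE h0 mul0r.
have := size_mul h0 g0; rewrite -hE size_as_poly => sE.
have sg' : (size g <= Q)%N by rewrite size_as_poly in ne le; move: ne le; case: ltngtP.
have sg0 : (1 < size g)%N by move: sg; rewrite -size_poly_gt0 in g0; move: g0; case: size => [|[]].
have sh' : (size h <= Q)%N by move: sE sg0; clear; move: (size h) (size g) => a b; lia.
have [i [_ di]] := dom_ex h0 sh'; have [j [_ dj]] := dom_ex g0 sg'.
have [k [[nz _] _]] := dom_mod sh' sg' di dj.
by rewrite -hE modpp coef0 eqxx in nz.
Qed.

End Dominant.
End ArtinSchreier.

(* One Artin-Schreier step: [F'] is [F(y)] with [y ^ Q + e y = u], totally ramified above a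
   valuation at which [u] has a pole of order prime to [Q]. *)
Lemma as_step (F : fieldType) (Q : nat) (e u : F) (v : F -> int) (m : nat) :
  (1 < Q)%N -> valn v -> v e = 0 -> v u = - m%:Z -> (0 < m)%N -> coprime m Q ->
  exists (F' : fieldType) (i : {rmorphism F -> F'}) (y : F'),
  [/\ y ^+ Q + i e * y = i u,
      forall z, exists c : nat -> F, z = \sum_(j < Q) i (c j) * y ^+ j,
      forall c : nat -> F, \sum_(j < Q) i (c j) * y ^+ j = 0 -> forall j, (j < Q)%N -> c j = 0,
      forall (B : fieldType) (h : {rmorphism F -> B}) (b : B), b ^+ Q + h e * b = h u ->
        exists h' : {rmorphism F' -> B}, (forall a, h' (i a) = h a) /\ h' y = b &
      exists v' : F' -> int, [/\ valn v', forall a, v' (i a) = Q%:Z * v a &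
        forall c : nat -> F, \sum_(j < Q) i (c j) * y ^+ j != 0 ->
        exists j, [/\ (j < Q)%N, c j != 0,
          v' (\sum_(j < Q) i (c j) * y ^+ j) = Q%:Z * v (c j) - (j * m)%:Z &
          forall l, (l < Q)%N -> c l != 0 ->
            v' (\sum_(j < Q) i (c j) * y ^+ j) <= Q%:Z * v (c l) - (l * m)%:Z]]].
Proof.
move=> Q1 vP ve vu m0 mQ; have Q0 : (0 < Q)%N by apply: ltnW.
have ve' : e != 0 -> v e = 0 by [].
have [F' [pi [piE piS]]] := simple_ext (as_poly_monic e u Q1) (as_irreducible Q1 vP ve' vu m0 mQ).
pose p := as_poly Q e u.
have sp : size p = Q.+1 by rewrite size_as_poly.
pose i : {rmorphism F -> F'} := [the {rmorphism _ -> _} of pi \o polyC].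
have iX (f : {poly F}) : (size f <= Q)%N -> pi f = \sum_(j < Q) i f`_j * pi 'X ^+ j.
  move=> sf; rewrite -{1}(take_poly_id sf) /take_poly poly_def rmorph_sum; apply: eq_bigr => j _.
  by rewrite -mul_polyC rmorphM rmorphXn.
have Xi (c : nat -> F) : \sum_(j < Q) i (c j) * pi 'X ^+ j = pi (\poly_(j < Q) c j).
  rewrite poly_def rmorph_sum; apply: eq_bigr => j _.
  by rewrite -mul_polyC rmorphM rmorphXn.
have pi_inj (f : {poly F}) : (size f <= Q)%N -> pi f = 0 -> f = 0.
  move=> sf /eqP; rewrite piE => dv; apply: contraTeq sf => f0; rewrite -ltnNge.
  by have := dvdp_leq f0 dv; rewrite sp.
exists F', i, (pi 'X); split.
- have /eqP : pi p == 0 by rewrite piE dvdpp.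
  rewrite /p /as_poly rmorphD rmorphB -mul_polyC rmorphM rmorphXn addrA => /eqP.
  by rewrite subr_eq0 => /eqP.
- move=> z; have [f [sf ->]] := piS z; exists (fun j => f`_j); apply: iX.
  by rewrite -ltnS -sp.
- move=> c; rewrite Xi => /(pi_inj _ (size_poly _ _)) /polyP h j jQ.
  by have := h j; rewrite coef_poly jQ coef0.
- move=> B h b hb.
  pose ev : {rmorphism {poly F} -> B} := [the {rmorphism _ -> _} of horner_eval b \o map_poly h].
  have evE f : ev f = (map_poly h f).[b] by [].
  have evp : ev p = 0.
    rewrite evE /p /as_poly rmorphD rmorphB /= map_polyXn map_polyZ map_polyX map_polyC /=.
    by rewrite hornerD hornerXn hornerD hornerN hornerZ hornerX hornerC addrA hb subrr.
  have /choice [g gP] : forall z, exists w, forall f, z = pi f -> w = ev f.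
    move=> z; have [f [_ zE]] := piS z; exists (ev f) => f' zE'.
    apply/eqP; rewrite -subr_eq0 -rmorphB.
    have : pi (f - f') == 0 by rewrite rmorphB -zE -zE' subrr.
    rewrite piE => /dvdpP [k ->]; by rewrite rmorphM evp mulr0.
  have gE f : g (pi f) = ev f by apply: gP.
  have gB : zmod_morphism g.
    move=> x y; have [f [_ ->]] := piS x; have [f' [_ ->]] := piS y.
    by rewrite -rmorphB !gE rmorphB.
  have gM : monoid_morphism g.
    split=> [|x y]; first by rewrite -(rmorph1 pi) gE rmorph1.
    have [f [_ ->]] := piS x; have [f' [_ ->]] := piS y.
    by rewrite -rmorphM !gE rmorphM.
  pose gZ := GRing.isZmodMorphism.Build _ _ g gB.
  pose gMM := GRing.isMonoidMorphism.Build _ _ g gM.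
  pose G : {rmorphism F' -> B} := HB.pack g gZ gMM.
  exists G; split=> [a|]; rewrite -[G _]/(g _) gE evE ?map_polyC ?map_polyX ?hornerC ?hornerX //.
(* The order of an element is the weight of the dominant term of its reduced representative;
   representative and dominant index are both unique. *)
have /choice [v' v'P] : forall z, exists w : int, (z = 0 -> w = 0) /\
    forall (f : {poly F}) j, (size f <= Q)%N -> z = pi f -> dom Q v m f j -> w = wt Q v m f j.
  move=> z; have [f [sf zE]] := piS z; rewrite sp ltnS in sf.
  have [f0|f0] := eqVneq f 0.
    exists 0; split=> // f' j sf' e' [nz _]; move: nz; have -> : f' = 0.
      by apply: pi_inj => //; rewrite -e' zE f0 rmorph0.
    by rewrite coef0 eqxx.
  have [j [_ dj]] := dom_ex Q1 vP ve' vu m0 mQ f0 sf; exists (wt Q v m f j); split.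
    by move=> z0; case/eqP: f0; apply: pi_inj => //; rewrite -zE.
  move=> f' j' sf' e' dj'; have ff : f' = f.
    apply/eqP; rewrite -subr_eq0; apply/eqP; apply: pi_inj; last by rewrite rmorphB -e' -zE subrr.
    by apply: leq_trans (size_polyD _ _) _; rewrite size_polyN geq_max sf sf'.
  by rewrite ff in dj' *; rewrite (dom_uniq Q1 vP ve' vu m0 mQ dj dj').
have v'E (f : {poly F}) j : (size f <= Q)%N -> dom Q v m f j -> v' (pi f) = wt Q v m f j.
  by move=> sf dj; case: (v'P (pi f)) => _; apply.
have rep z : z != 0 -> exists (f : {poly F}) j, [/\ (size f <= Q)%N, (j < Q)%N, z = pi f & dom Q v m f j].
  move=> z0; have [f [sf zE]] := piS z; rewrite sp ltnS in sf.
  have f0 : f != 0 by apply: contraNneq z0 => f0; rewrite zE f0 rmorph0.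
  by have [j [jQ dj]] := dom_ex Q1 vP ve' vu m0 mQ f0 sf; exists f, j.
have pi_mod f : pi (f %% p) = pi f.
  by rewrite {2}(divp_eq f p) rmorphD rmorphM (eqP (_ : pi p == 0)) ?mulr0 ?add0r // piE dvdpp.
exists v'; split.
- split; first by case: (v'P 0) => ->.
  + move=> x y /rep [f [j [sf _ -> dj]]] /rep [f' [j' [sf' _ -> dj']]].
    have [k [dk wk]] := dom_mod Q1 vP ve' vu m0 mQ sf sf' dj dj'.
    rewrite -rmorphM -pi_mod (v'E _ k) // ?(v'E f j) ?(v'E f' j') //.
    by rewrite -ltnS -sp ltn_modp -size_poly_gt0 sp.
  + move=> x y /rep [f [j [sf _ -> dj]]] /rep [f' [j' [sf' _ -> dj']]]; rewrite -rmorphD => s0.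
    have ss : (size (f + f')%R <= Q)%N.
      by apply: leq_trans (size_polyD _ _) _; rewrite geq_max sf sf'.
    have ff0 : f + f' != 0 by apply: contraNneq s0 => ->; rewrite rmorph0.
    have [k [_ dk]] := dom_ex Q1 vP ve' vu m0 mQ ff0 ss.
    rewrite (v'E f j) ?(v'E f' j') ?(v'E _ k) //.
    have h1 := dom_ge Q1 vP ve' vu m0 mQ dj k; have h2 := dom_ge Q1 vP ve' vu m0 mQ dj' k.
    set w := wt Q v m f j in h1 *; set w' := wt Q v m f' j' in h2 *.
    have [nz _] := dk; move: nz; rewrite /wt coefD => nz.
    have sc : forall t, vge (fun x => Q%:Z * v x) t f`_k -> vge (fun x => Q%:Z * v x) t f'`_k ->
        t <= Q%:Z * v (f`_k + f'`_k).
      move=> t; rewrite /vge; have [a0|a0] := eqVneq f`_k 0.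
        have [b0|b0] := eqVneq f'`_k 0; first by move: nz; rewrite a0 b0 addr0 eqxx.
        by rewrite a0 add0r.
      have [b0|b0] := eqVneq f'`_k 0; first by rewrite b0 addr0.
      case: vP => _ _ /(_ _ _ a0 b0 nz) /=; case/orP => le h1' h2'.
        by apply: le_trans h1' _; rewrite ler_pM2l ?ltz_nat.
      by apply: le_trans h2' _; rewrite ler_pM2l ?ltz_nat.
    case: (leP w w') => le.
      have := sc _ h1 (vge_le (_ : w + _ <= w' + _) h2); rewrite lerD2r => /(_ le); move: (Q%:Z * _) => a.
      by rewrite lerBrDr; move=> h; apply/orP; left; lia.
    have := sc _ (vge_le (_ : w' + _ <= w + _) h1) h2; rewrite lerD2r => /(_ (ltW le)); move: (Q%:Z * _) => a.
    by move=> h; apply/orP; right; lia.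
- move=> a; have [->|a0] := eqVneq a 0.
    by rewrite rmorph0 (valn0 vP) mulr0; case: (v'P 0) => ->.
  rewrite /= (v'E _ 0%N) ?(leq_trans (size_polyC_leq1 _)) //; first by rewrite /wt coefC /= mul0n subr0.
  by split=> [|j j0]; rewrite coefC ?eqxx // (negPf j0) vge0.
move=> c; rewrite Xi => /rep [f [j [sf jQ fE dj]]].
have cE l : (l < Q)%N -> c l = f`_l.
  move=> lQ; have : (\poly_(j < Q) c j) - f = 0.
    apply: pi_inj; last by rewrite rmorphB fE subrr.
    by apply: leq_trans (size_polyD _ _) _; rewrite size_polyN geq_max sf size_poly.
  by move/polyP/(_ l)/eqP; rewrite coefB coef0 coef_poly lQ subr_eq0 => /eqP.
exists j; rewrite fE (v'E f j) // cE //; split=> //; first by case: dj.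
move=> l lQ; rewrite cE // => fl; have := dom_ge Q1 vP ve' vu m0 mQ dj l; rewrite vgeE //.
by rewrite /wt; lia.
Qed.

Lemma pchar_pnat (F : fieldType) p n : p \in [pchar F] -> [pchar F].-nat (p ^ n)%N.
Proof.
move=> pF; rewrite (eq_pnat _ (pcharf_eq pF)) pnatX pnat_id ?orTb //.
by case/andP: pF.
Qed.

(** Newton interpolation: the divided differences at a node are integral because differences of
    nodes are units, and induction applies to the quotient. It recovers integrality of coefficients
    from integrality at all conjugates of a generator. *)
Lemma vge_interp (F : fieldType) (v : F -> int) (zs : seq F) (p : {poly F}) :
  valn v -> (size p <= size zs)%N ->
  pairwise (fun z z' => (z - z' != 0) && (v (z - z') == 0)) zs ->
  all (vge v 0) zs -> (forall z, z \in zs -> vge v 0 p.[z]) -> forall i, vge v 0 p`_i.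
Proof.
move=> vP; elim: zs p => [|z zs IH] p /=.
  by rewrite leqn0 size_poly_eq0 => /eqP -> *; rewrite coef0 vge0.
move=> sp /andP[pz pw] /andP[vz vzs] pv i.
have : root (p - p.[z]%:P) z by rewrite rootE hornerD hornerN hornerC subrr.
case/factor_theorem => g gE.
have pE : p = p.[z]%:P + g * ('X - z%:P) by rewrite -gE addrC subrK.
have sg : (size g <= size zs)%N.
  have [->|g0] := eqVneq g 0; first by rewrite size_poly0.
  have : (size (p - p.[z]%:P)%R <= (size zs).+1)%N.
    apply: leq_trans (size_polyD _ _) _; rewrite size_polyN geq_max sp.
    by apply: leq_trans (size_polyC_leq1 _) _.
  by rewrite gE size_Mmonic ?monicXsubC // size_XsubC addnC.
have gi : forall i, vge v 0 g`_i.
  apply: IH => // z' z'in; have /andP[d0 /eqP dv] := allP pz _ z'in.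
  have d1 : z' - z != 0 by rewrite -opprB oppr_eq0.
  have -> : g.[z'] = (p.[z'] - p.[z]) / (z' - z).
    by rewrite [in p.[z']]pE hornerD hornerC addrC addKr hornerM hornerXsubC mulfK.
  apply: (vge0M vP); first by apply: (vgeB vP); apply: pv; rewrite inE ?eqxx ?z'in ?orbT.
  by rewrite vgeE ?invr_neq0 // (valnV vP) -opprB (valnN vP) dv.
rewrite pE coefD; apply: (vgeD vP).
  by rewrite coefC; case: eqP => _; [apply: pv; rewrite inE eqxx|exact: vge0].
rewrite mulrBr coefB coefMX coefMC; apply: (vgeB vP); last exact: (vge0M vP).
by case: eqP => _; [exact: vge0|exact: gi].
Qed.

(** The value group is a nonzero subgroup of the integers and [d] is its least positive element.
    This turns pullbacks of valuations into places in the sense of [is_place]. *)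
Lemma valn_normalize (F : fieldType) (v : F -> int) z : valn v -> v z != 0 ->
  exists d (w : F -> int), [/\ 0 < d, valn w, exists t, t != 0 /\ w t = 1 &
    forall x, v x = d * w x].
Proof.
move=> vP vz.
pose P d := (0 < d)%N && `[< exists x, x != 0 /\ v x = d%:Z >].
have nz x : v x != 0 -> x != 0 by apply: contraNneq => ->; rewrite (valn0 vP).
have exP : exists d, P d.
  exists `|v z|%N; rewrite /P absz_gt0 vz; apply/asboolP.
  case: (leP 0 (v z)) => h; first by exists z; rewrite (nz _ vz) gez0_abs.
  by exists z^-1; rewrite invr_eq0 (nz _ vz) (valnV vP) ltz0_abs.
case: (ex_minnP exP) => d /andP[d0 /asboolP [t [t0 vt]]] dmin.
have dvE x : v x = d%:Z * (v x %/ d%:Z)%Z.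
  have [->|x0] := eqVneq x 0; first by rewrite (valn0 vP) div0z mulr0.
  have {1}-> := divz_eq (v x) d; rewrite mulrC; apply/eqP; rewrite eq_sym -subr_eq0 opprD addNKr oppr_eq0.
  apply: contraT => m0; have mge : 0 <= (v x %% d%:Z)%Z by rewrite modz_ge0 // eqz_nat -lt0n.
  have mlt : (v x %% d%:Z)%Z < d%:Z by rewrite ltz_pmod.
  have tX e : exists y, y != 0 /\ v y = e * d%:Z.
    case: (leP 0 e) => he.
      by exists (t ^+ `|e|%N); rewrite expf_neq0 // (valnX vP) vt -mulr_natl natz gez0_abs.
    by exists (t ^- `|e|%N); rewrite invr_eq0 expf_neq0 // (valnV vP) (valnX vP) vt -mulr_natl natz ltz0_abs // mulNr opprK.
  have [y [y0 vy]] := tX (- (v x %/ d%:Z)%Z).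
  have := dmin `|(v x %% d%:Z)%Z|%N; rewrite /P absz_gt0 m0 /= => h.
  have : (d <= `|(v x %% d%:Z)%Z|)%N.
    apply: h; apply/asboolP; exists (x * y); rewrite mulf_neq0 // (valnM vP) // vy gez0_abs //.
    by split=> //; have := divz_eq (v x) d; lia.
  by move: mge mlt; clear; lia.
exists d%:Z, (fun x => (v x %/ d%:Z)%Z); split=> //.
- split; first by rewrite (valn0 vP) div0z.
    move=> x y x0 y0; apply: (mulfI (_ : d%:Z != 0)); first by rewrite eqz_nat -lt0n.
    by rewrite mulrDr -!dvE (valnM vP).
  move=> x y x0 y0 s0; case: vP => _ _ /(_ x y x0 y0 s0).
  by rewrite (dvE x) (dvE y) (dvE (x + y)) !ler_pM2l // !mulKz // eqz_nat -lt0n.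
- by exists t; rewrite vt divzz eqz_nat -lt0n d0.
Qed.

(** * Orders of solutions of Artin-Schreier equations *)

Section ArtinSchreierValuation.
Variables (F : fieldType) (v : F -> int) (Q : nat) (e y : F).
Hypotheses (vP : valn v) (Q1 : (1 < Q)%N) (e0 : e != 0) (ve : v e = 0).

Lemma as_neg : y != 0 -> v y < 0 ->
  y ^+ Q + e * y != 0 /\ v (y ^+ Q + e * y) = Q%:Z * v y.
Proof.
move=> y0 vy; have E : v (y ^+ Q) = Q%:Z * v y by rewrite (valnX vP) -mulr_natl natz.
rewrite -E; apply: (valnD_lt vP); first by rewrite expf_neq0.
by rewrite vgeE ?mulf_neq0 // (valnM vP) // ve E; move: (v y) vy => a; nia.
Qed.

Lemma as_integral : vge v 0 (y ^+ Q + e * y) -> vge v 0 y.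
Proof.
move=> h; have [->|y0] := eqVneq y 0; first exact: vge0.
rewrite vgeE //; case: (leP 0 (v y)) => // vy.
have [n0 E] := as_neg y0 vy; move: h; rewrite vgeE // E; move: (v y) vy => a; nia.
Qed.

Lemma as_pole : v (y ^+ Q + e * y) < 0 -> y != 0 /\ Q%:Z * v y = v (y ^+ Q + e * y).
Proof.
move=> lt; have y0 : y != 0.
  by apply: contraTneq lt => ->; rewrite mulr0 addr0 expr0n gtn_eqF ?(valn0 vP) // ltnW.
split=> //; case: (ltP (v y) 0) => vy; first by have [] := as_neg y0 vy.
have : vge v 0 (y ^+ Q + e * y).
  have hy : vge v 0 y by rewrite vgeE.
  by apply: (vgeD vP); rewrite ?(vge0X vP) // (vge0M vP) // vgeE // ve.
by rewrite /vge => /orP[/eqP h|]; [move: lt; rewrite h (valn0 vP)|move=> h; lia].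
Qed.

End ArtinSchreierValuation.

(** * Expansions at a finite point of the line *)

Section LaurentPoint.
Variables (kk : fieldType) (L : laurent kk) (be : kk).
Local Notation z := (lcst L be + lvar L).
Local Notation pe p := (map_poly (lcst L) p).[z].

Lemma lcst_vge a : vge (@lval _ L) 0 (lcst L a).
Proof.
have [->|a0] := eqVneq a 0; first by rewrite rmorph0 vge0.
by rewrite vgeE ?fmorph_eq0 // lval_cst.
Qed.

Lemma lvar_neq0 : lvar L != 0.
Proof. by apply/eqP => h; have := lval_var L; rewrite h (valn0 (lvalP L)). Qed.

Lemma lpoint_poly_vge p : vge (@lval _ L) 0 (pe p).
Proof.
have zv : vge (@lval _ L) 0 z.
  apply: (vgeD (lvalP L)); first exact: lcst_vge.
  by rewrite vgeE ?lvar_neq0 // lval_var.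
rewrite horner_coef; apply: (vge_sum (lvalP L)) => i _; apply: (vge0M (lvalP L)).
  by rewrite coef_map; exact: lcst_vge.
exact: (vge0X (lvalP L)).
Qed.

Lemma lpoint_residue p : vge (@lval _ L) 1 (pe p - lcst L p.[be]).
Proof.
have : root (p - p.[be]%:P) be by rewrite rootE hornerD hornerN hornerC subrr.
case/factor_theorem => g gE.
have -> : pe p - lcst L p.[be] = pe g * lvar L.
  have := congr1 (fun f : {poly kk} => pe f) gE.
  rewrite rmorphB rmorphM /= map_polyXsubC map_polyC hornerM hornerXsubC hornerD hornerN hornerC => ->.
  by rewrite (addrC (lcst L be)) addrK.
have := vgeM (lvalP L) (lpoint_poly_vge g) (_ : vge (@lval _ L) 1 (lvar L)).
by rewrite add0r; apply; rewrite vgeE ?lvar_neq0 // lval_var.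
Qed.

Lemma lpoint_unit p : p.[be] != 0 -> pe p != 0 /\ lval (pe p) = 0.
Proof.
move=> p0; have c0 : lcst L p.[be] != 0 by rewrite fmorph_eq0.
have := @valnD_lt _ _ (lvalP L) (lcst L p.[be]) (pe p - lcst L p.[be]) c0.
rewrite lval_cst // add0r (addrC (lcst L p.[be])) subrK; apply; exact: lpoint_residue.
Qed.

Lemma lpoint_val (p q : {poly kk}) e : p = q * ('X - be%:P) ^+ e -> q.[be] != 0 ->
  pe p != 0 /\ lval (pe p) = e%:Z.
Proof.
move=> -> q0; have [n0 qv] := lpoint_unit q0.
have E : pe (q * ('X - be%:P) ^+ e) = pe q * lvar L ^+ e.
  by rewrite rmorphM rmorphXn /= map_polyXsubC hornerM horner_exp hornerXsubC (addrC (lcst L be)) addrK.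
rewrite E mulf_neq0 ?expf_neq0 ?lvar_neq0 // (valnM (lvalP L)) ?expf_neq0 ?lvar_neq0 //.
by rewrite qv (valnX (lvalP L)) lval_var add0r natz.
Qed.

Lemma lpoint_neq0 p : p != 0 -> pe p != 0.
Proof.
move=> p0; have [e [q]] := multiplicity_XsubC p be; rewrite p0 /= => rq pE.
by have [] := lpoint_val pE rq.
Qed.

End LaurentPoint.

Lemma pev_sum (K F : fieldType) (em : {rmorphism K -> F}) (p : {poly K}) x :
  pev em p x = \sum_(i < size p) em p`_i * x ^+ i.
Proof.
by rewrite /pev horner_coef size_map_poly; apply: eq_bigr => i _; rewrite coef_map.
Qed.

Lemma rmorph_pev (K F B : fieldType) (em : {rmorphism K -> F}) (h0 : {rmorphism K -> B})
    (h : {rmorphism F -> B}) p x :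
  (forall a, h (em a) = h0 a) -> h (pev em p x) = pev h0 p (h x).
Proof.
move=> hc; rewrite !pev_sum rmorph_sum; apply: eq_bigr => i _.
by rewrite rmorphM rmorphXn hc.
Qed.

Lemma pevM (K F : fieldType) (em : {rmorphism K -> F}) (p q : {poly K}) x :
  pev em (p * q) x = pev em p x * pev em q x.
Proof. by rewrite /pev rmorphM hornerM. Qed.

Lemma ratfun_exists (K : fieldType) : exists (F : fieldType) (em : {rmorphism K -> F}) (x : F),
  [/\ transcendental em x,
      forall z, exists n d : {poly K}, [/\ d != 0, coprimep n d & z = pev em n x / pev em d x],
      forall (L : fieldType) (h : {rmorphism K -> L}) (b : L), transcendental h b ->
        exists H : {rmorphism F -> L}, (forall a, H (em a) = h a) /\ H x = b &
      exists v : F -> int, valn v /\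
        forall p : {poly K}, p != 0 -> v (pev em p x) = - (size p).-1%:Z].
Proof.
pose em : {rmorphism K -> {fraction {poly K}}} :=
  [the {rmorphism K -> {fraction {poly K}}} of (@tofrac {poly K}) \o polyC].
have E p : pev em p (tofrac 'X) = tofrac p.
  rewrite -[in RHS](coefK p) poly_def rmorph_sum pev_sum.
  by apply: eq_bigr => i _; rewrite -mul_polyC rmorphM rmorphXn.
exists {fraction {poly K}}, em, (tofrac 'X); split.
- by move=> p p0; rewrite E tofrac_eq0.
- move=> z; have [n [d [d0 zE]]] := fracP z.
  have g0 : gcdp n d != 0 by rewrite gcdp_eq0 negb_and d0 orbT.
  have nE : n = n %/ gcdp n d * gcdp n d by rewrite divpK ?dvdp_gcdl.
  have dE : d = d %/ gcdp n d * gcdp n d by rewrite divpK ?dvdp_gcdr.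
  exists (n %/ gcdp n d), (d %/ gcdp n d); split.
  + by apply: contraNneq d0 => h; rewrite dE h mul0r.
  + by rewrite coprimep_div_gcd // d0 orbT.
  have tn : tofrac n = tofrac (n %/ gcdp n d) * tofrac (gcdp n d) by rewrite -rmorphM -nE.
  have td : tofrac d = tofrac (d %/ gcdp n d) * tofrac (gcdp n d) by rewrite -rmorphM -dE.
  by rewrite !E zE tn td -mulf_div mulfV ?mulr1 // tofrac_eq0.
- move=> L h b tr.
  pose ev : {rmorphism {poly K} -> L} := [the {rmorphism _ -> _} of horner_eval b \o map_poly h].
  have [H HE] := frac_hom (h := ev) tr.
  by exists H; split=> [a|]; rewrite HE /= /horner_eval ?map_polyC ?map_polyX ?hornerC ?hornerX.
have sM (x y : {poly K}) : x != 0 -> y != 0 -> - (size (x * y)).-1%:Z = - (size x).-1%:Z - (size y).-1%:Z.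
  move=> x0 y0; rewrite size_mul //; rewrite -size_poly_gt0 in x0; rewrite -size_poly_gt0 in y0.
  by move: (size x) (size y) x0 y0 => a b; lia.
have sD (x y : {poly K}) : x != 0 -> y != 0 -> x + y != 0 ->
   (- (size x).-1%:Z <= - (size (x + y)%R).-1%:Z) || (- (size y).-1%:Z <= - (size (x + y)%R).-1%:Z).
  move=> *; have := size_polyD x y; move: (size x) (size y) (size _) => a b c; lia.
have [v [vP vE]] := frac_valn sM sD; exists v; split=> // p p0.
have -> : pev em p (tofrac 'X) = tofrac p / tofrac (1 : {poly K}) by rewrite E rmorph1 divr1.
by rewrite vE ?oner_neq0 // size_poly1; lia.
Qed.

(** * Function fields with prescribed values *)

Section WagTower.
Variables (K : finFieldType) (KK : closedFieldType) (io : {rmorphism K -> KK}).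
Variables (p e : nat) (bb : nat -> nat).
Hypotheses (pp : prime p) (Kp : #|K| = (p ^ e)%N) (e0 : (0 < e)%N) (pb : ~~ (p %| bb 0)%N).

Local Notation q := #|K|.

Let q1 : (1 < q)%N. Proof. by rewrite Kp -(exp1n e) ltn_exp2r // prime_gt1. Qed.
Let q0 : (0 < q)%N. Proof. exact: ltnW. Qed.
Let pK : p \in [pchar K]. Proof. exact: card_finPcharP Kp pp. Qed.
Let pKK : p \in [pchar KK]. Proof. by rewrite (fmorph_pchar io). Qed.
Let qKK : [pchar KK].-nat q. Proof. by rewrite Kp pchar_pnat. Qed.

(** The pole order of [y_j] in the field generated by [x, y_1, ..., y_j]. With [x] of pole order
    [q ^ j], the right side of the equation of [y_(j+1)] has pole order [q ^ j (q + b_j) + mm j]; as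
    the step is totally ramified of degree [q], this is the pole order of [y_(j+1)] one level up. *)
Fixpoint mm j : nat := if j is i.+1 then (q ^ i * (q + bb i) + mm i)%N else 0%N.

(** All increments after the first are multiples of [q], so [mm] stays congruent to [b_0] modulo
    [p]; the condition on [b_0] alone makes every step totally ramified. *)
Lemma mm_coprime k : coprime (mm k.+1) q.
Proof.
rewrite Kp coprimeXr // coprime_sym prime_coprime //.
have pq : (p %| q)%N by rewrite Kp dvdn_exp.
elim: k => [|k IH] /=; first by rewrite mul1n addn0 dvdn_addr.
by rewrite dvdn_addr // expnS -!mulnA dvdn_mulr.
Qed.

Lemma mm_gt k : (q ^ k.+1 <= mm k.+1)%N.
Proof. by rewrite /= expnSr (leq_trans _ (leq_addr _ _)) // leq_mul2l leq_addr orbT. Qed.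

(** Integrality at all places above finite values of [x]. They are tested over the algebraically
    closed [KK], with [x - be] itself as uniformiser: the equations [y ^ q - y = u] are separable,
    so nothing ramifies above finite [x]. *)
Definition regular (F : fieldType) (em : {rmorphism K -> F}) (x f : F) :=
  forall (L : laurent KK) (h : {rmorphism F -> L}) (be : KK),
    (forall a, h (em a) = lcst L (io a)) -> h x = lcst L be + lvar L -> vge (@lval _ L) 0 (h f).

(** Level [k] of the tower, by its properties. [wuniq]: a valuation with a pole at [x] is
    proportional to [wv], so a single place lies above infinity. [wreg]: below pole order [2 q ^ k],
    that of [x ^ 2], regular functions are combinations of [x] and of the [y_j] of admissible pole
    order; this is the Riemann-Roch space with prescribed basis. *)
Record wag (k : nat) := Wag {
  wF :> fieldType;
  we : {rmorphism K -> wF};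
  wx : wF;
  wy : nat -> wF;
  wv : wF -> int;
  wy0 : wy 0 = 1;
  weq : forall j, (j < k)%N -> wy j.+1 ^+ q - wy j.+1 = (wx ^+ q - wx) * wx ^+ bb j * wy j;
  wvP : valn wv;
  wv_e : forall a, a != 0 -> wv (we a) = 0;
  wv_x : wv wx = - (q ^ k)%:Z;
  wv_y : forall j, (j <= k)%N -> wv (wy j) = - (q ^ (k - j) * mm j)%:Z;
  wspan : exists (I : finType) (b : I -> wF), forall z, exists (c : {poly K}) (a : I -> {poly K}),
    c != 0 /\ pev we c wx * z = \sum_i pev we (a i) wx * b i;
  wuniq : forall P, valn P -> (forall a, a != 0 -> P (we a) = 0) -> P wx < 0 ->
    forall f, P f * wv wx = P wx * wv f;
  whom : forall (B : fieldType) (h0 : {rmorphism K -> B}) (bx : B) (by_ : nat -> B),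
    transcendental h0 bx -> by_ 0 = 1 ->
    (forall j, (j < k)%N -> by_ j.+1 ^+ q - by_ j.+1 = (bx ^+ q - bx) * bx ^+ bb j * by_ j) ->
    exists h : {rmorphism wF -> B}, [/\ forall a, h (we a) = h0 a, h wx = bx &
      forall j, (j <= k)%N -> h (wy j) = by_ j];
  wext : forall (B : fieldType) (h1 h2 : {rmorphism wF -> B}), (forall a, h1 (we a) = h2 (we a)) ->
    h1 wx = h2 wx -> (forall j, (j <= k)%N -> h1 (wy j) = h2 (wy j)) -> h1 =1 h2;
  wreg : forall D f, (D < 2 * q ^ k)%N -> regular we wx f -> vge wv (- D%:Z) f ->
    exists (a : K) (c : nat -> K), [/\ f = we a * wx + \sum_(j < k.+1) we (c j) * wy j,
      a != 0 -> (q ^ k <= D)%N &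
      forall j, (j <= k)%N -> c j != 0 -> (q ^ (k - j) * mm j <= D)%N]
}.

Arguments wv {k} w _ : rename.

Lemma wag0 : inhabited (wag 0).
Proof.
have [F [em [x [tr fr hom [v [vP vp]]]]]] := ratfun_exists K.
have vc a : a != 0 -> v (em a) = 0.
  move=> a0; have := vp a%:P; rewrite /pev map_polyC hornerC polyC_eq0 size_polyC a0; exact.
have vx : v x = -1 by have := vp 'X; rewrite /pev map_polyX hornerX polyX_eq0 size_polyX; exact.
have x0 : x != 0 by apply/eqP => h; move: vx; rewrite h (valn0 vP).
have vf (n d : {poly K}) : n != 0 -> d != 0 ->
    v (pev em n x / pev em d x) = (size d).-1%:Z - (size n).-1%:Z.
  move=> n0 d0; rewrite (valnM vP) ?invr_eq0 ?tr // (valnV vP) !vp // opprK addrC //.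
constructor; apply: (@Wag 0 F em x (fun=> 1) v) => //.
- by move=> j; rewrite leqn0 => /eqP ->; rewrite (valn1 vP) muln0.
- exists unit, (fun=> 1) => z; have [n [d [d0 _ ->]]] := fr z.
  exists d, (fun=> n); split=> //; rewrite (big_pred1 tt); last by case.
  by rewrite mulr1 mulrCA mulfV ?mulr1 // tr.
- move=> P PP Pe Px f; rewrite vx.
  have Pp (g : {poly K}) : g != 0 -> P (pev em g x) = P x * (size g).-1%:Z.
    move=> g0; have sg : (0 < size g)%N by rewrite size_poly_gt0.
    have lt : ((size g).-1 < size g)%N by rewrite prednK.
    have lc : g`_(size g).-1 != 0 by rewrite -lead_coefE lead_coef_eq0.
    have vt i : g`_i != 0 -> P (em g`_i * x ^+ i) = P x * i%:Z.
      move=> gi; rewrite (valnM PP) ?expf_neq0 ?fmorph_eq0 // Pe // add0r (valnX PP).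
      by rewrite -mulr_natr natz.
    rewrite pev_sum.
    pose G (i : 'I_(size g)) := em g`_i * x ^+ i.
    have G0 : G (Ordinal lt) != 0 by rewrite /G mulf_neq0 ?expf_neq0 ?fmorph_eq0.
    have PG : P (G (Ordinal lt)) = P x * (size g).-1%:Z := vt _ lc.
    have Gm i : i != Ordinal lt -> vge P (P (G (Ordinal lt)) + 1) (G i).
      move=> ii; have {}ii : (i < (size g).-1)%N.
        rewrite ltn_neqAle; apply/andP; split; last by rewrite -ltnS prednK.
        by apply: contraNneq ii => h; apply/eqP/val_inj.
      rewrite PG /G; have [->|gi] := eqVneq g`_i 0; first by rewrite rmorph0 mul0r vge0.
      rewrite vgeE ?mulf_neq0 ?expf_neq0 ?fmorph_eq0 // vt //.
      by move: (P x) (nat_of_ord i) (_.-1) Px ii; gnia.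
    by have [_ ->] := valn_sum_min PP G0 Gm.
  have [n [d [d0 _ ->]]] := fr f; have [->|n0] := eqVneq n 0.
    by rewrite /pev rmorph0 horner0 mul0r (valn0 PP) (valn0 vP) mul0r mulr0.
  rewrite vf // (valnM PP) ?invr_eq0 ?tr // (valnV PP) !Pp //.
  by move: (P _) => a; ring.
- move=> B h0 bx by_ htr b0 _; have [H [Hc Hx]] := hom _ _ _ htr.
  by exists H; split=> // j; rewrite leqn0 => /eqP ->; rewrite rmorph1.
- move=> B h1 h2 hc hx _ f; have [n [d [d0 _ ->]]] := fr f.
  have hp (g : {poly K}) : h1 (pev em g x) = h2 (pev em g x).
    by rewrite !pev_sum !rmorph_sum; apply: eq_bigr => i _; rewrite !rmorphM !rmorphXn hc hx.
  by rewrite !fmorph_div !hp.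
move=> D f; rewrite expn0 muln1 => D2 rf vfD.
have [f0|f0] := eqVneq f 0.
  exists 0, (fun=> 0); split; [|by rewrite eqxx|by move=> j _; rewrite eqxx].
  by rewrite f0 rmorph0 mul0r big1 ?addr0 // => i _; rewrite mul0r.
have [n [d [d0 cop fE]]] := fr f.
have n0 : n != 0 by apply: contraNneq f0 => n0; rewrite fE n0 /pev rmorph0 horner0 mul0r.
(* A nonconstant denominator has a root in [KK] at which the coprime numerator does not vanish; the
   Laurent point at this root contradicts regularity. *)
have sd : size d = 1%N.
  apply/eqP; apply: contraT => sd1.
  have /closed_rootP [be rb] : size (map_poly io d) != 1%N by rewrite size_map_poly.
  have nb : (map_poly io n).[be] != 0.
    apply/negP => /eqP h; have : coprimep (map_poly io n) (map_poly io d) by rewrite coprimep_map.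
    by move/coprimep_root => /(_ be); rewrite rootE h eqxx => /(_ isT); rewrite -rootE rb.
  have [L] := laurent_exists KK.
  pose h0 : {rmorphism K -> L} := [the {rmorphism K -> L} of lcst L \o io].
  have me (g : {poly K}) : map_poly h0 g = map_poly (lcst L) (map_poly io g) by rewrite -map_poly_comp.
  have tr' : transcendental h0 (lcst L be + lvar L).
    by move=> g g0; rewrite /pev me lpoint_neq0 // map_poly_eq0.
  have [H [Hc Hx]] := hom _ h0 _ tr'.
  have Hp (g : {poly K}) : H (pev em g x) = (map_poly (lcst L) (map_poly io g)).[lcst L be + lvar L].
    by rewrite (rmorph_pev _ _ Hc) Hx /pev me.
  have := rf L H be Hc Hx; rewrite fE fmorph_div !Hp.
  have [z0 v0] := lpoint_unit L nb.
  have dn := tr' _ d0; rewrite /pev me in dn.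
  have := lpoint_residue L be (map_poly io d); rewrite (eqP rb) rmorph0 subr0 vgeE // => d1.
  rewrite vgeE ?mulf_neq0 ?invr_eq0 // (valnM (lvalP L)) ?invr_eq0 // (valnV (lvalP L)) v0.
  by move: (lval _) d1; glia.
move: vfD; rewrite vgeE // fE vf // sd => sn.
have d00 : d`_0 != 0 by have := lead_coef_eq0 d; rewrite (negPf d0) lead_coefE sd /= => /negbT.
have dC : d = (d`_0)%:P by apply: size1_polyC; rewrite sd.
have sn2 : (size n <= 2)%N by clear -sn D2; move: (size n) sn D2; lia.
exists (n`_1 / d`_0), (fun=> n`_0 / d`_0); split.
- have nE : n = (n`_1)%:P * 'X + (n`_0)%:P.
    apply/polyP => i; rewrite coefD coefMX coefC coefC.
    by case: i => [|[|i]] //=; rewrite ?add0r ?addr0 // nth_default // (leq_trans sn2).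
  rewrite big_ord1 mulr1 {1}dC {1}nE /pev rmorphD rmorphM /= map_polyX !map_polyC.
  by rewrite hornerD hornerM !hornerC hornerX !fmorph_div mulrDl mulrAC.
- move=> a0; have n1 : n`_1 != 0 by apply: contraNneq a0 => ->; rewrite mul0r.
  have : (1 < size n)%N by rewrite ltnNge; apply: contra n1 => h; rewrite nth_default.
  by clear -sn; move: (size n) sn; lia.
by move=> j; rewrite leqn0 => /eqP ->; rewrite muln0.
Qed.

(** [x] and all [y_j] with [j > 0] have pole order at least [q ^ k], so only [y_0 = 1] remains in
    the expansion given by [wreg]. *)
Lemma regular_const k (W : wag k) f : regular (we W) (wx W) f -> vge (wv W) (1 - (q ^ k)%:Z) f ->
  exists a, f = we W a.
Proof.
have Q0 : (0 < q ^ k)%N by rewrite expn_gt0 q0.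
move=> rf vf; have [||a [c [-> a0 c0]]] := @wreg k W (q ^ k).-1 f _ rf.
- by lia.
- by apply: vge_le vf; lia.
exists (c 0%N); have -> : a = 0.
  by apply/eqP; apply: contraT => /a0; move: (q ^ k)%N Q0; glia.
rewrite rmorph0 mul0r add0r big_ord_recl /= wy0 mulr1 big1 ?addr0 // => j _.
suff -> : c (bump 0 j) = 0 by rewrite rmorph0 mul0r.
rewrite /bump /= add1n; apply/eqP; apply: contraT => cj.
have := c0 j.+1 (ltn_ord j) cj; have := mm_gt j.
rewrite -(leq_pmul2l (_ : 0 < q ^ (k - j.+1))%N) ?expn_gt0 ?q0 // -expnD subnK // => h1 h2.
by have := leq_trans h1 h2; move: (q ^ k)%N Q0; glia.
Qed.

Lemma regular_le0 k (W : wag k) f : regular (we W) (wx W) f -> f != 0 -> wv W f <= 0.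
Proof.
move=> rf f0; case: (leP (wv W f) 0) => // h.
have Q0 : (0 < q ^ k)%N by rewrite expn_gt0 q0.
have [|a fE] := regular_const rf; first by rewrite vgeE //; move: (q ^ k)%N (wv W f) Q0 h; glia.
have a0 : a != 0 by apply: contraNneq f0 => a0; rewrite fE a0 rmorph0.
by rewrite fE wv_e in h.
Qed.

(** At a finite point the equation of [y] has the [q] solutions [eta + b] with [b] in [K], and each
    of them extends the point to the next level. The function is integral at all these extensions
    and the solutions differ by units, so [vge_interp] applies. *)
Lemma regular_coef k (W : wag k) (F' : fieldType) (i : {rmorphism wF W -> F'}) (y : F') (c : nat -> wF W) :
  let u := (wx W ^+ q - wx W) * wx W ^+ bb k * wy W k in
  (forall (B : fieldType) (h : {rmorphism wF W -> B}) (b : B), b ^+ q + h (-1) * b = h u ->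
        exists h' : {rmorphism F' -> B}, (forall a, h' (i a) = h a) /\ h' y = b) ->
  regular [the {rmorphism K -> F'} of i \o we W] (i (wx W)) (\sum_(j < q) i (c j) * y ^+ j) ->
  forall j, (j < q)%N -> regular (we W) (wx W) (c j).
Proof.
move=> u univ rf j0 j0q L h be he hx; have vP := lvalP L.
have hxv : vge (@lval _ L) 0 (h (wx W)).
  rewrite hx; apply: (vgeD vP); first exact: lcst_vge.
  by rewrite vgeE ?lvar_neq0 // lval_var.
have hyv j : (j <= k)%N -> vge (@lval _ L) 0 (h (wy W j)).
  elim: j => [|j IH] jk; first by rewrite wy0 rmorph1 vge1.
  apply: (as_integral vP q1 (e := -1)); rewrite ?oppr_eq0 ?oner_neq0 // ?(valnN vP) ?(valn1 vP) //.
  rewrite mulN1r -rmorphXn -rmorphB weq // !rmorphM rmorphB !rmorphXn.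
  by apply: (vge0M vP); [apply: (vge0M vP); [apply: (vgeB vP)|]|]; rewrite ?(vge0X vP) ?IH // ltnW.
have huv : vge (@lval _ L) 0 (h u).
  rewrite /u !rmorphM rmorphB !rmorphXn.
  by apply: (vge0M vP); [apply: (vge0M vP); [apply: (vgeB vP)|]|]; rewrite ?(vge0X vP) ?hyv.
have [r0 hr] := lres_ex huv.
have [c0 rc] : exists c0 : KK, c0 ^+ q + (-1) * c0 = r0.
  have sz : size ('X^q - ('X + r0%:P) : {poly KK}) = q.+1.
    by rewrite size_polyDl size_polyXn // size_polyN size_XaddC.
  have /closed_rootP [c0] : size ('X^q - ('X + r0%:P) : {poly KK}) != 1%N by rewrite sz; move: q1; case: (#|K|).
  rewrite rootE hornerD hornerN hornerD hornerXn hornerX hornerC subr_eq0 => /eqP h0.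
  by exists c0; rewrite h0 mulN1r addrC addKr.
have [|||eta [etaE etac]] := @lhensel _ L p q (-1) (h u) (-1) c0 pKK qKK q1.
- by rewrite oppr_eq0 oner_neq0.
- by rewrite rmorphN rmorph1.
- by rewrite rc.
have qL : [pchar lfield L].-nat q by rewrite (eq_pnat _ (fmorph_pchar (lcst L))).
pose zs := [seq eta + lcst L (io b) | b <- enum K].
have etav : vge (@lval _ L) 0 eta.
  rewrite -(subrK (lcst L c0) eta); apply: (vgeD vP); last exact: lcst_vge.
  exact: vge_le etac.
pose P := \poly_(j < q) h (c j).
have -> : h (c j0) = P`_j0 by rewrite coef_poly j0q.
apply: (@vge_interp _ _ zs) => //.
- by rewrite size_map -cardE size_poly.
- rewrite pairwise_map; have : uniq (enum K) by exact: enum_uniq.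
  rewrite uniq_pairwise; apply: sub_pairwise => b b' /= bb'.
  have -> : eta + lcst L (io b) - (eta + lcst L (io b')) = lcst L (io (b - b')).
    by rewrite opprD addrACA subrr add0r !rmorphB.
  have n0 : io (b - b') != 0 by rewrite fmorph_eq0 subr_eq0.
  by rewrite fmorph_eq0 n0 lval_cst.
- by apply/allP => z /mapP [b _ ->]; apply: (vgeD vP) => //; exact: lcst_vge.
move=> z /mapP [b _ ->].
have [|h' [h'i h'y]] := univ L h (eta + lcst L (io b)).
  rewrite exprDn_pchar // rmorphN rmorph1 !mulN1r -!rmorphXn expf_card -etaE mulN1r opprD.
  by rewrite addrACA subrr addr0.
have := rf L h' be; rewrite h'i => /(_ _ hx) hv.
have -> : P.[eta + lcst L (io b)] = h' (\sum_(j < q) i (c j) * y ^+ j).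
  rewrite horner_poly rmorph_sum; apply: eq_bigr => j _.
  by rewrite rmorphM rmorphXn h'i h'y.
by apply: hv => a; rewrite /= h'i he.
Qed.

Lemma wagS k : wag k -> inhabited (wag k.+1).
Proof.
move=> W; have vP := wvP W.
pose u := (wx W ^+ q - wx W) * wx W ^+ bb k * wy W k.
have Q0 : (0 < q ^ k)%N by rewrite expn_gt0 q0.
have x0 : wx W != 0 by apply/eqP => h; have := wv_x W; rewrite h (valn0 vP); lia.
have y0 j : (j <= k)%N -> wy W j != 0.
  case: j => [_|j jk]; first by rewrite wy0 oner_neq0.
  apply/eqP => h; have := wv_y W jk; rewrite h (valn0 vP) => /esym/eqP.
  rewrite oppr_eq0 eqz_nat muln_eq0 expn_eq0 -[#|K| == 0%N]negbK -lt0n q0 /= => /eqP m0.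
  by have := mm_gt j; rewrite [mm _]m0 leqn0 expn_eq0 -[#|K| == 0%N]negbK -lt0n q0.
have vx1 : wx W ^+ q - wx W != 0 /\ wv W (wx W ^+ q - wx W) = - (q * q ^ k)%:Z.
  have := @valnD_lt _ _ vP (wx W ^+ q) (- wx W); rewrite (valnX vP) wv_x expf_neq0 //.
  have -> : (- (q ^ k)%:Z) *+ q = - (q * q ^ k)%:Z by rewrite -mulr_natl natz; lia.
  apply=> //; rewrite (vgeN vP) vgeE // wv_x.
  by move: (q ^ k)%N Q0 q1 => a; move: q; gnia.
have u0 : u != 0 by rewrite !mulf_neq0 ?expf_neq0 ?y0 //; case: vx1.
have vu : wv W u = - (mm k.+1)%:Z.
  rewrite /u !(valnM vP) ?mulf_neq0 ?expf_neq0 ?y0 //; try by case: vx1.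
  rewrite (valnX vP) (wv_y W (leqnn k)) wv_x (proj2 vx1) subnn expn0 mul1n -mulr_natl natz /=.
  by move: (mm k) (q ^ k)%N (bb k) (#|K|); gnia.
have m0 : (0 < mm k.+1)%N by apply: leq_trans (mm_gt k); rewrite expn_gt0 q0.
have n1 : wv W (-1) = 0 by rewrite (valnN vP) (valn1 vP).
have [F' [i [y [yE span uni univ [v' [v'P v'i v'min]]]]]] := as_step q1 vP n1 vu m0 (mm_coprime k).
have yE' : y ^+ q - y = i u by rewrite -yE rmorphN rmorph1 mulN1r.
have pole (P : F' -> int) : valn P -> P (i u) < 0 -> y != 0 /\ q%:Z * P y = P (i u).
  move=> PP; rewrite -yE => lt; apply: (as_pole PP q1 _ _ lt).
    by rewrite fmorph_eq0 oppr_eq0 oner_neq0.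
  by rewrite rmorphN rmorph1 (valnN PP) (valn1 PP).
have [yn0 v'y] : y != 0 /\ v' y = - (mm k.+1)%:Z.
  have [|-> h] := pole _ v'P; first by rewrite v'i vu; move: (#|K|) (mm k.+1) q0 m0; gnia.
  split=> //; move: h; rewrite v'i vu => /(mulfI _); apply.
  by rewrite eqz_nat -lt0n.
pose y' j := if j == k.+1 then y else i (wy W j).
have y'E j : (j <= k)%N -> y' j = i (wy W j) by rewrite /y'; case: eqP => // ->; rewrite ltnn.
have y'k : y' k.+1 = y by rewrite /y' eqxx.
pose e' := [the {rmorphism K -> F'} of i \o we W].
constructor; apply: (@Wag k.+1 F' e' (i (wx W)) y' v') => //.
- by rewrite y'E // wy0 rmorph1.
- move=> j; rewrite ltnS leq_eqVlt => /orP[/eqP ->|jk].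
    by rewrite y'k yE' y'E // /u !rmorphM rmorphB !rmorphXn.
  rewrite (y'E j.+1) // y'E; last exact: ltnW.
  by rewrite -!rmorphXn -!rmorphB -!rmorphM weq.
- by move=> a a0; rewrite /= v'i wv_e // mulr0.
- by rewrite v'i wv_x expnS PoszM mulrN.
- move=> j; rewrite leq_eqVlt => /orP[/eqP ->|jk]; first by rewrite y'k v'y subnn mul1n.
  by rewrite y'E // v'i wv_y // subSn // expnS -mulnA PoszM mulrN.
- have [I [b bP]] := wspan W.
  exists (I * 'I_q)%type, (fun ij : I * 'I_q => i (b ij.1) * y ^+ ij.2) => z.
  have [c ->] := span z.
  have /choice [d dP] : forall j : 'I_q, exists da : {poly K} * (I -> {poly K}), da.1 != 0 /\
     pev (we W) da.1 (wx W) * c j = \sum_l pev (we W) (da.2 l) (wx W) * b l.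
    by move=> j; have [d [a [d0 h]]] := bP (c j); exists (d, a).
  exists (\prod_j (d j).1), (fun ij : I * 'I_q => (\prod_(j | j != ij.2) (d j).1) * (d ij.2).2 ij.1).
  split; first by apply/prodf_neq0 => j _; case: (dP j).
  have pi (g : {poly K}) : pev e' g (i (wx W)) = i (pev (we W) g (wx W)).
    by rewrite (rmorph_pev (h0 := e')).
  under [RHS]eq_bigr => ij _ do rewrite pi mulrA -rmorphM.
  rewrite -(pair_bigA _ (fun l (j : 'I_q) => i (pev (we W) ((\prod_(j' | j' != j) (d j').1) * (d j).2 l) (wx W) * b l) * y ^+ j)) /=.
  rewrite exchange_big /= mulr_sumr; apply: eq_bigr => j _.
  rewrite -mulr_suml -rmorph_sum mulrA pi -rmorphM; congr (i _ * _).
  rewrite (bigD1 j) //= pevM mulrAC (proj2 (dP j)) mulr_suml; apply: eq_bigr => l _.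
  by rewrite pevM; ring.
(* Proportionality of [P] and [v'] holds on the lower field by induction and at [y] by its equation.
   It passes to sums because the nonzero terms [c_l y ^ l] have pairwise different orders. *)
- move=> P PP Pe Px f.
  pose P0 a := P (i a).
  have P0P : valn P0.
    split; rewrite /P0; first by rewrite rmorph0 (valn0 PP).
      by move=> a b a0 b0; rewrite rmorphM (valnM PP) ?fmorph_eq0.
    move=> a b a0 b0 s0; case: PP => _ _ /(_ (i a) (i b)); rewrite -rmorphD !fmorph_eq0; exact.
  have IH := wuniq P0P Pe Px.
  have Pu : P (i u) < 0.
    have := IH u; rewrite -[P0 u]/(P (i u)) -[P0 _]/(P (i (wx W))) vu wv_x.
    by move: (P (i u)) (P (i (wx W))) (mm k.+1) (q ^ k)%N Px m0 Q0; gnia.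
  have [_ Py] := pole _ PP Pu.
  have IHy : P y * v' (i (wx W)) = P (i (wx W)) * v' y.
    have := IH u; rewrite -[P0 u]/(P (i u)) -Py -[P0 _]/(P (i (wx W))) v'y vu v'i.
    by move=> <-; ring.
  have IHi a : P (i a) * v' (i (wx W)) = P (i (wx W)) * v' (i a).
    by rewrite !v'i mulrCA [RHS]mulrCA -[P (i a)]/(P0 a) IH.
  have IHc a j : a != 0 -> P (i a * y ^+ j) * v' (i (wx W)) = P (i (wx W)) * v' (i a * y ^+ j).
    move=> a0; rewrite !(valnM PP) ?(valnM v'P) ?expf_neq0 ?fmorph_eq0 // (valnX PP) (valnX v'P).
    by rewrite mulrDl mulrDr IHi !mulrnAl !mulrnAr IHy.
  have vX : v' (i (wx W)) < 0 by rewrite v'i wv_x; move: (#|K|) (q ^ k)%N q0 Q0; gnia.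
  have [c ->] := span f; set S := \sum_(j < q) _.
  have [->|S0] := eqVneq S 0; first by rewrite (valn0 PP) (valn0 v'P) mul0r mulr0.
  have [j [jq cj Sj Smin]] := v'min c S0.
  have tv l : c l != 0 -> v' (i (c l) * y ^+ l) = q%:Z * wv W (c l) - (l * mm k.+1)%:Z.
    move=> cl; rewrite (valnM v'P) ?expf_neq0 ?fmorph_eq0 // v'i (valnX v'P) v'y -mulr_natl natz.
    by rewrite mulrN -PoszM.
  have ne l : (l < q)%N -> c l != 0 -> l != j -> v' (i (c l) * y ^+ l) != v' (i (c j) * y ^+ j).
    move=> lq cl lj; apply: contraNneq lj; rewrite !tv // => E.
    have : (q%:Z %| (l%:Z - j%:Z) * (mm k.+1)%:Z)%Z.
      by apply/dvdzP; exists (wv W (c l) - wv W (c j)); move: E; rewrite !PoszM; move: (wv W _) (wv W _) (mm k.+1) (#|K|); glia.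
    rewrite dvdzE abszM !absz_nat Gauss_dvdl 1?coprime_sym ?mm_coprime // => dv; apply/eqP.
    by move: dv lq jq; move: (#|K|); clear => a /dvdnP[[|r]]; lia.
  pose G (l : 'I_q) := i (c l) * y ^+ l.
  have Gj : G (Ordinal jq) != 0 by rewrite mulf_neq0 ?expf_neq0 ?fmorph_eq0.
  have SG : v' S = v' (G (Ordinal jq)) by rewrite Sj -tv.
  have Gm l : l != Ordinal jq -> vge P (P (G (Ordinal jq)) + 1) (G l).
    move=> lj; have {}lj : (l : nat) != j by apply: contraNneq lj => h; apply/eqP/val_inj.
    rewrite /G; have [->|cl] := eqVneq (c l) 0; first by rewrite rmorph0 mul0r vge0.
    rewrite vgeE ?mulf_neq0 ?expf_neq0 ?fmorph_eq0 //=.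
    have := ne l (ltn_ord l) cl lj; have := Smin l (ltn_ord l) cl.
    rewrite -tv // SG /G /=; have := IHc _ l cl; have := IHc _ j cj.
    by move: (P _) (P _) (v' _) (v' _) (v' _) (P _) Px vX; gnia.
  have [_ ->] := valn_sum_min PP Gj Gm.
  by rewrite SG /G /= IHc.
- move=> B h0 bx by_ tr b0 beq.
  have [|h [hc hx hy]] := @whom k W B h0 bx by_ tr b0; first by move=> j jk; apply: beq; apply: ltnW.
  have [|h' [h'i h'y]] := univ B h (by_ k.+1).
    rewrite rmorphN rmorph1 mulN1r beq // /u !rmorphM rmorphB !rmorphXn hx hy //.
  exists h'; split=> [a||j]; rewrite /= ?h'i //.
  rewrite leq_eqVlt => /orP[/eqP ->|jk]; first by rewrite y'k.
  by rewrite y'E // h'i hy.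
- move=> B h1 h2 hc hx hy f.
  pose g1 := [the {rmorphism wF W -> B} of h1 \o i]; pose g2 := [the {rmorphism wF W -> B} of h2 \o i].
  have gg : g1 =1 g2.
    apply: wext => //= j jk; have := hy j (leqW jk); rewrite y'E //.
  have [c ->] := span f; rewrite !rmorph_sum; apply: eq_bigr => j _.
  have := hy k.+1 (leqnn _); rewrite y'k => hyy.
  by rewrite !rmorphM !rmorphXn hyy; have := gg (c j) => /= ->.
(* In [f = sum_l c_l y ^ l] the coefficients are regular, hence of order at most 0, while [y] has
   pole order [mm k.+1 >= q ^ k.+1 > D / 2]. This kills [c_l] for [l >= 2], makes [c_1] constant,
   and leaves for [c_0] the statement one level down with [D / q]. *)
move=> D f D2 rf vf.
have [f0|f0] := eqVneq f 0.
  exists 0, (fun=> 0); split; [|by rewrite eqxx|by move=> j _; rewrite eqxx].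
  by rewrite f0 /= !rmorph0 mul0r big1 ?addr0 // => j _; rewrite mul0r.
have [c fE] := span f.
have rc j : (j < q)%N -> regular (we W) (wx W) (c j).
  by apply: (regular_coef (y := y) univ); rewrite -fE.
have cmin l : (l < q)%N -> c l != 0 -> - D%:Z <= q%:Z * wv W (c l) - (l * mm k.+1)%:Z.
  move=> lq cl; move: f0 vf; rewrite fE => S0; rewrite vgeE // => h.
  by have [j [_ _ _ mn]] := v'min c S0; apply: le_trans h (mn l lq cl).
have mgt := mm_gt k; rewrite expnS in mgt; rewrite expnS in D2.
have cle l : (l < q)%N -> c l != 0 -> wv W (c l) <= 0 by move=> lq; apply: regular_le0; apply: rc.
have c2 l : (1 < l)%N -> (l < q)%N -> c l = 0.
  move=> l1 lq; apply/eqP; apply: contraT => cl; have := cmin l lq cl; have := cle l lq cl.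
  by move: (wv W (c l)) (mm k.+1) (q * q ^ k)%N (#|K|) D2 mgt l1; gnia.
have [a1 c1] : exists a, c 1%N = we W a.
  apply: regular_const; first exact: rc.
  have [->|cl] := eqVneq (c 1%N) 0; first exact: vge0.
  rewrite vgeE //; have := cmin 1%N q1 cl; move: (wv W (c 1%N)) => a.
  by move: (mm k.+1) (q ^ k)%N (#|K|) mgt D2 q0; gnia.
have [||a [cc [c0E aD cD]]] := @wreg k W (D %/ q) (c 0%N) _ (rc _ q0).
- by rewrite ltn_divLR //; move: D2; move: (q ^ k)%N (#|K|); glia.
- have [->|cl] := eqVneq (c 0%N) 0; first exact: vge0.
  rewrite vgeE //; have := cmin 0%N q0 cl; move: (wv W (c 0%N)) => a; rewrite mul0n subr0.
  have := divn_eq D q; have := ltn_pmod D q0; move: (D %/ q)%N (D %% q)%N (#|K|); gnia.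
exists a, (fun j => if j == k.+1 then a1 else cc j); split.
- have -> : f = i (c 0%N) + i (c 1%N) * y.
    rewrite fE (bigD1 (Ordinal q0)) //= (bigD1 (Ordinal q1)) //= big1 ?addr0 ?expr0 ?expr1 ?mulr1 //.
    case=> l lq /= /andP[l0 l1]; rewrite c2 ?rmorph0 ?mul0r //.
    by move: l0 l1; rewrite -!val_eqE /=; case: l lq => [|[]].
  rewrite c0E c1 rmorphD rmorphM rmorph_sum [in RHS]big_ord_recr /= eqxx y'k addrA; congr (_ + _ + _).
  apply: eq_bigr => j _; rewrite rmorphM y'E; last by rewrite -ltnS.
  by case: eqP => // h; have := ltn_ord j; rewrite h ltnn.
- move/aD => h; rewrite expnS; apply: leq_trans (_ : q * (D %/ q) <= D)%N; first by rewrite leq_mul2l h orbT.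
  by rewrite mulnC leq_trunc_div.
move=> j; rewrite leq_eqVlt => /orP[/eqP ->|jk].
  rewrite eqxx subnn mul1n => a10; have cl : c 1%N != 0 by rewrite c1 fmorph_eq0.
  by have := cmin 1%N q1 cl; rewrite c1 wv_e // mulr0 mul1n; move: (mm k.+1); glia.
have -> : (j == k.+1) = false by apply/eqP => h; move: jk; rewrite h ltnn.
move=> cj; have := cD j jk cj => h; rewrite subSn // expnS -mulnA.
apply: leq_trans (_ : q * (D %/ q) <= D)%N; first by rewrite leq_mul2l h orbT.
by rewrite mulnC leq_trunc_div.
Qed.

Lemma wag_exists k : inhabited (wag k).
Proof. by elim: k => [|k [W]]; [exact: wag0|exact: wagS]. Qed.

End WagTower.

Arguments wv {K KK io bb k} w _ : rename.
(** The nonzero terms of a polynomial in [z] have pairwise different orders, so they cannot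
    cancel. *)
Lemma val_transcendental (K F : fieldType) (em : {rmorphism K -> F}) (v : F -> int) z :
  valn v -> (forall a, a != 0 -> v (em a) = 0) -> v z != 0 -> transcendental em z.
Proof.
move=> vP ve vz g g0; rewrite pev_sum.
have z0 : z != 0 by apply: contraNneq vz => ->; rewrite (valn0 vP).
have sg : (0 < size g)%N by rewrite size_poly_gt0.
have lt : ((size g).-1 < size g)%N by rewrite prednK.
have lc : g`_(Ordinal lt) != 0 by rewrite -lead_coefE lead_coef_eq0.
case: (@arg_minP _ _ _ (Ordinal lt) (fun i : 'I_(size g) => g`_i != 0) (fun i : 'I_(size g) => v z * i%:Z) lc).
move=> i0 gi0 imin.
pose G (i : 'I_(size g)) := em g`_i * z ^+ i.
have vG i : g`_(nat_of_ord i) != 0 -> G i != 0 /\ v (G i) = v z * i%:Z.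
  move=> gi; rewrite /G mulf_neq0 ?expf_neq0 ?fmorph_eq0 //; split=> //.
  by rewrite (valnM vP) ?expf_neq0 ?fmorph_eq0 // ve // add0r (valnX vP) -mulr_natr natz.
have [G0 vG0] := vG i0 gi0.
have Gm i : i != i0 -> vge v (v (G i0) + 1) (G i).
  move=> ii; have [gi|gi] := eqVneq g`_i 0; first by rewrite /G gi rmorph0 mul0r vge0.
  have [Gi vGi] := vG i gi; rewrite vgeE // vG0 vGi; have := imin i gi.
  have {}ii : (i : nat) != i0 by apply: contraNneq ii => h; apply/eqP/val_inj.
  by move: (v z) (nat_of_ord i) (nat_of_ord i0) vz ii; gnia.
by have [] := valn_sum_min vP G0 Gm.
Qed.

Lemma valn_comp (F B : fieldType) (h : {rmorphism F -> B}) (v : B -> int) :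
  valn v -> valn (fun x => v (h x)).
Proof.
move=> vP; split; first by rewrite rmorph0 (valn0 vP).
  by move=> a b a0 b0; rewrite rmorphM (valnM vP) ?fmorph_eq0.
by move=> a b a0 b0 s0; case: vP => _ _ /(_ (h a) (h b)); rewrite -rmorphD !fmorph_eq0; exact.
Qed.

(** * Rational places from Laurent points *)

Section RationalPoint.
Variables (K : finFieldType) (F : fieldType) (em : {rmorphism K -> F}) (L : laurent K)
  (H : {rmorphism F -> L}).
Hypothesis HE : forall a, H (em a) = lcst L a.

Lemma hom_residue z a : vge (@lval _ L) 1 (H z - lcst L a) = residue_is em (fun x => lval (H x)) z a.
Proof.
rewrite /residue_is -HE -rmorphB /vge fmorph_eq0 subr_eq0; case: eqP => //= _.
Qed.

Lemma hom_residue_uniq z a b : vge (@lval _ L) 1 (H z - lcst L a) ->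
  vge (@lval _ L) 1 (H z - lcst L b) -> a = b.
Proof.
move=> ha hb; apply/eqP; rewrite -subr_eq0; apply: contraT => ab.
have := vgeB (lvalP L) hb ha; rewrite opprB addrC addrA subrK -rmorphB.
by rewrite vgeE ?fmorph_eq0 // lval_cst.
Qed.

Lemma hom_fval z a : vge (@lval _ L) 1 (H z - lcst L a) -> fval em (fun x => lval (H x)) z = a.
Proof.
move=> ha; rewrite /fval; case: pickP => [b /=|/(_ a)]; rewrite -hom_residue //.
  by move=> hb; exact: hom_residue_uniq hb ha.
by rewrite ha.
Qed.

Lemma hom_rational t : t != 0 -> lval (H t) = 1 -> rational_place em (fun x => lval (H x)).
Proof.
move=> t0 Ht; split.
  have [v0 vM vD] := valn_comp H (lvalP L); split=> // [a a0|]; last by exists t.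
  by rewrite HE lval_cst.
move=> z hz; have : vge (@lval _ L) 0 (H z) by rewrite /vge hz orbT.
by move/lres_ex => [a ha]; exists a; rewrite -hom_residue.
Qed.

(** A rational place leaves no room for further constants: an algebraic [z] has order 0, hence a
    residue [a], and [z - em a] is algebraic of positive order, thus 0. *)
Lemma hom_full_constants z : algebraic em z -> exists a, z = em a.
Proof.
have vP := valn_comp H (lvalP L).
have ve a : a != 0 -> lval (H (em a)) = 0 by move=> a0; rewrite HE lval_cst.
case=> g g0 gz; have v0 : lval (H z) = 0.
  apply/eqP; apply: contraT => vz; have := val_transcendental vP ve vz g0.
  by rewrite gz eqxx.
have : vge (@lval _ L) 0 (H z) by rewrite /vge v0 orbT.
move/lres_ex => [a ha]; exists a; apply/eqP; rewrite -subr_eq0; apply: contraT => za.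
have vz : lval (H (z - em a)) != 0.
  by move: ha; rewrite -HE -rmorphB vgeE ?fmorph_eq0 // => h; rewrite gt_eqF // (lt_le_trans _ h).
have g1 : g \Po ('X + a%:P) != 0.
  by rewrite -size_poly_gt0 size_comp_poly2 ?size_XaddC // size_poly_gt0.
have := val_transcendental vP ve vz g1.
rewrite /pev map_comp_poly horner_comp rmorphD /= map_polyX map_polyC hornerD hornerX hornerC subrK.
by rewrite -[X in X != 0]/(pev em g z) gz eqxx.
Qed.

End RationalPoint.

(** * The folded code of a tower with prescribed values *)

Section WagCode.
Variables (K : finFieldType) (p e : nat) (bb : nat -> nat).
Hypotheses (pp : prime p) (Kp : #|K| = (p ^ e)%N) (e0 : (0 < e)%N) (pb : ~~ (p %| bb 0)%N).
Local Notation q := #|K|.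

Let q1 : (1 < q)%N. Proof. by rewrite Kp -(exp1n e) ltn_exp2r // prime_gt1. Qed.
Let pK : p \in [pchar K]. Proof. exact: card_finPcharP Kp pp. Qed.

(** On the branch [x = t] the right sides have positive order, so the residue equation is
    [c ^ q = c], which every [c] in [K] satisfies; any residues [val j] can be lifted one after the
    other. *)
Lemma hensel_seq (L : laurent K) (val : nat -> K) : val 0 = 1 ->
  exists Y : nat -> L, [/\ Y 0 = 1,
    forall j, Y j.+1 ^+ q - Y j.+1 = (lvar L ^+ q - lvar L) * lvar L ^+ bb j * Y j &
    forall j, vge (@lval _ L) 1 (Y j - lcst L (val j))].
Proof.
move=> val0; have vP := lvalP L.
have tv : vge (@lval _ L) 1 (lvar L) by rewrite vgeE ?lvar_neq0 // lval_var.
have tv0 : vge (@lval _ L) 0 (lvar L) by apply: vge_le tv.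
have /choice [G GP] : forall jz : nat * L, exists y : L, vge (@lval _ L) 0 jz.2 ->
    y ^+ q + (-1) * y = (lvar L ^+ q - lvar L) * lvar L ^+ bb jz.1 * jz.2 /\
    vge (@lval _ L) 1 (y - lcst L (val jz.1.+1)).
  case=> j z /=; case: (boolP (vge (@lval _ L) 0 z)) => hz; last by exists 0.
  have [|||||y yP] := @lhensel _ L p q (-1) ((lvar L ^+ q - lvar L) * lvar L ^+ bb j * z) (-1) (val j.+1) pK.
  - by rewrite Kp pchar_pnat.
  - exact: q1.
  - by rewrite oppr_eq0 oner_neq0.
  - by rewrite rmorphN rmorph1.
  - rewrite expf_card mulN1r subrr rmorph0 subr0 -mulrA.
    have := vgeM vP (_ : vge (@lval _ L) 1 (lvar L ^+ q - lvar L)) (_ : vge (@lval _ L) 0 (lvar L ^+ bb j * z)).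
    rewrite addr0; apply; last by rewrite (vge0M vP) ?(vge0X vP).
    apply: (vgeB vP) => //; have := vgeX vP q tv; apply: vge_le; rewrite -mulr_natl natz.
    by move: (#|K|) q1; glia.
  by exists y.
pose Y := nat_rect (fun=> lfield L) 1 (fun j z => G (j, z)).
have Yv j : vge (@lval _ L) 0 (Y j) /\ vge (@lval _ L) 1 (Y j - lcst L (val j)).
  elim: j => [|j [IH _]]; first by rewrite /= val0 rmorph1 subrr vge0 vge1.
  have [_ h] := GP (j, Y j) IH; split=> //.
  by rewrite -(subrK (lcst L (val j.+1)) (Y j.+1)); apply: (vgeD vP); [apply: vge_le h|exact: lcst_vge].
exists Y; split=> // [j|j]; last by case: (Yv j).
by have [h _] := GP (j, Y j) (Yv j).1; rewrite -[RHS]h mulN1r.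
Qed.

Variables (k : nat) (ga eps : K) (lam : nat -> K).
Hypotheses (ga0 : ga != 0) (lam0 : lam 0 = 1)
  (lamS : forall j, lam j.+1 = ga ^+ (bb j).+1 * lam j)
  (epsP : eps = 0 \/ [/\ ga = 1 & forall j, bb j.+1 = bb j]).

Let lam_neq0 j : lam j != 0.
Proof. by elim: j => [|j IH]; rewrite ?lam0 ?oner_neq0 // lamS mulf_neq0 // expf_neq0. Qed.

(** The substitution respects the equations because [lam] absorbs the factors [ga ^ (b_j + 1)], and
    because a nonzero [eps] comes with [ga = 1] and equal exponents [b_j]. Elements of [K] are fixed
    by the power [q], so the equations are linear over [K]. *)
Lemma wag_auto (KK : closedFieldType) (io : {rmorphism K -> KK}) (W : wag io bb k) :
  exists g h : {rmorphism wF W -> wF W},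
  [/\ forall a, g (we W a) = we W a,
      g (wx W) = we W ga * wx W,
      forall j, (j <= k)%N -> g (wy W j) = we W (lam j) * wy W j +
         (if j is j'.+1 then we W eps * wy W j' else 0),
      cancel g h & cancel h g].
Proof.
have vP := wvP W; set x := wx W; set y := wy W; set em := we W.
have Q0 : (0 < q ^ k)%N by rewrite expn_gt0 (ltnW q1).
have tr a : a != 0 -> transcendental em (em a * x).
  move=> a0; apply: (val_transcendental vP (@wv_e _ _ _ _ _ W)).
  have x0 : x != 0 by apply/eqP => h; have := wv_x W; rewrite -/x h (valn0 vP); move: (q ^ k)%N Q0; glia.
  by rewrite (valnM vP) ?fmorph_eq0 // wv_e // add0r wv_x; move: (q ^ k)%N Q0; glia.
have qW : [pchar wF W].-nat q by rewrite (eq_pnat _ (fmorph_pchar em)) Kp pchar_pnat.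
have emq a : em a ^+ q = em a by rewrite -rmorphXn expf_card.
have frob (a b z w : wF W) : a ^+ q = a -> b ^+ q = b ->
    (a * z + b * w) ^+ q - (a * z + b * w) = a * (z ^+ q - z) + b * (w ^+ q - w).
  by move=> ha hb; rewrite exprDn_pchar // !exprMn ha hb; ring.
have [|||g [gc gx gy]] := @whom _ _ _ _ _ W (wF W) em (em ga * x)
   (fun j => em (lam j) * y j + (if j is j'.+1 then em eps * y j' else 0)).
- exact: tr.
- by rewrite lam0 rmorph1 mul1r addr0 /y wy0.
- move=> j jk; rewrite frob // weq // -/x exprMn emq -mulrBr exprMn.
  have -> : em eps * (y j ^+ q - y j) =
     em ga * em ga ^+ bb j * (x ^+ q - x) * x ^+ bb j * (if j is j'.+1 then em eps * y j' else 0).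
    case: j jk => [|j] jk; first by rewrite /y wy0 expr1n subrr !mulr0.
    case: epsP => [->|[-> bE]]; first by rewrite rmorph0 !mul0r mulr0.
    by rewrite /y weq ?(ltnW jk) // rmorph1 expr1n bE -/x -/y; ring.
  rewrite lamS rmorphM exprS rmorphM rmorphXn -/y.
  by move: (if j is j'.+1 then em eps * y j' else 0) (em (lam j)) (em ga) (em ga ^+ _) (x ^+ _) (x ^+ q) => *; ring.
(* The images of the [y_j] under the inverse, obtained by solving
   [lam_j z_j = y_j - eps z_(j-1)]. *)
pose z := nat_rect (fun=> wF W) 1 (fun j w => em (lam j.+1)^-1 * (y j.+1 - em eps * w)).
have zS j : z j.+1 = em (lam j.+1)^-1 * (y j.+1 - em eps * z j) by [].
have lamz j : em (lam j) * z j = y j - em eps * (if j is j'.+1 then z j' else 0).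
  case: j => [|j]; first by rewrite lam0 rmorph1 mul1r mulr0 subr0 /y wy0.
  by rewrite zS mulrA -rmorphM mulfV ?lam_neq0 // rmorph1 mul1r.
have zeq j : (j < k)%N -> z j.+1 ^+ q - z j.+1 =
    ((em ga^-1 * x) ^+ q - em ga^-1 * x) * (em ga^-1 * x) ^+ bb j * z j.
  elim: j => [|j IH] jk.
    rewrite zS; have -> : em (lam 1)^-1 * (y 1%N - em eps * z 0%N) = em (lam 1)^-1 * y 1%N + em (- ((lam 1)^-1 * eps)) * 1.
      by rewrite rmorphN rmorphM mulr1 /=; ring.
    rewrite frob // expr1n subrr mulr0 addr0 /y weq // wy0 -/x lamS lam0 mulr1 !exprMn emq -mulrBr mulr1.
    by rewrite exprS invfM rmorphM -exprVn rmorphXn mulr1; ring.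
  rewrite zS; have -> : em (lam j.+2)^-1 * (y j.+2 - em eps * z j.+1) =
     em (lam j.+2)^-1 * y j.+2 + em (- ((lam j.+2)^-1 * eps)) * z j.+1.
    by rewrite rmorphN rmorphM; ring.
  rewrite frob // IH ?(ltnW jk) // /y weq // -/x -/y.
  have -> : em (- ((lam j.+2)^-1 * eps)) * (((em ga^-1 * x) ^+ q - em ga^-1 * x) * (em ga^-1 * x) ^+ bb j * z j) =
     em (lam j.+2)^-1 * ((x ^+ q - x) * x ^+ bb j.+1 * (- (em eps * z j))).
    case: epsP => [->|[-> bE]]; first by rewrite mulr0 oppr0 !rmorph0 !mul0r oppr0 !mulr0.
    by rewrite rmorphN rmorphM invr1 rmorph1 mul1r bE; ring.
  rewrite -mulrDr -mulrDr -(lamz j.+1) lamS invfM exprS invfM -exprVn !rmorphM rmorphXn !exprMn emq -mulrBr.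
  have : em (lam j.+1)^-1 * em (lam j.+1) = 1 by rewrite -rmorphM mulVf ?lam_neq0 // rmorph1.
  move: (em (lam j.+1)^-1) (em (lam j.+1)) => a b ab.
  by rewrite -[RHS]mulr1 -ab; ring.
have [|||h [hc hx hy]] := @whom _ _ _ _ _ W (wF W) em (em ga^-1 * x) z.
- by apply: tr; rewrite invr_eq0.
- by [].
- exact: zeq.
have gz j : (j <= k)%N -> g (z j) = y j.
  elim: j => [|j IH] jk; first by rewrite rmorph1 /y wy0.
  rewrite zS rmorphM rmorphB rmorphM !gc gy // IH ?(ltnW jk) // addrK mulrA -rmorphM.
  by rewrite mulVf ?lam_neq0 // rmorph1 mul1r.
pose gh := [the {rmorphism wF W -> wF W} of g \o h]; pose hg := [the {rmorphism wF W -> wF W} of h \o g].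
pose idW := [the {rmorphism wF W -> wF W} of @idfun (wF W)].
exists g, h; split=> //.
- apply: (wext (h1 := hg) (h2 := idW)) => [a||j jk] /=.
  + by rewrite gc hc.
  + by rewrite gx rmorphM hc hx mulrA -rmorphM mulfV // rmorph1 mul1r.
  rewrite gy // rmorphD rmorphM hc hy // lamz; case: j jk => [|j] jk.
    by rewrite rmorph0 mulr0 subr0 addr0.
  by rewrite rmorphM hc hy ?(ltnW jk) // subrK.
apply: (wext (h1 := gh) (h2 := idW)) => [a||j jk] /=.
+ by rewrite hc gc.
+ by rewrite hx rmorphM gc gx mulrA -rmorphM mulVf // rmorph1 mul1r.
by rewrite hy // gz.
Qed.

Variables (N m k0 D : nat) (val : 'I_N -> nat -> K).

(** The value of [y_l] at the [j]-th translate of the [i]-th place: one more translation substitutes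
    [lam_l y_l + eps y_(l-1)] for [y_l]. *)
Fixpoint wpt (i : 'I_N) (j l : nat) : K :=
  if j is j'.+1 then lam l * wpt i j' l + (if l is l'.+1 then eps * wpt i j' l' else 0)
  else val i l.

Hypotheses (m0 : (0 < m)%N) (N0 : (0 < N)%N) (k0k : (k0 <= k)%N) (val0 : forall i, val i 0 = 1)
  (Dge : (q ^ k <= D)%N) (Dlt : (D < 2 * q ^ k)%N)
  (Dle : forall j, (j <= k0)%N -> (q ^ (k - j) * mm K bb j <= D)%N)
  (Dgt : forall j, (k0 < j <= k)%N -> (D < q ^ (k - j) * mm K bb j)%N)
  (distinct : forall i j i' j', (j < m)%N -> (j' < m)%N -> (i, j) != (i', j') ->
     exists2 l, (l <= k)%N & wpt i j l != wpt i' j' l).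

(** All evaluation places lie above [x = 0], so the coefficient of [x] in a message is invisible in
    the codeword. [D] separates the pole orders of [x, y_0, ..., y_k0], at most [D], from those of
    the later [y_l], which stay out of the messages and help to tell the places apart. *)
Theorem wag_code :
  exists (F : fieldType) (emb : {rmorphism K -> F}) (sigma sigmainv : F -> F)
    (Pp : 'I_N -> F -> int) (Dp : 'I_1 -> F -> int) (Dn : 'I_1 -> int) (x : F) (y : nat -> F),
  [/\ folded_AG_data emb sigma sigmainv m 1 Pp Dp Dn,
      forall f, message emb 1 Dp Dn f <->
        exists a (c : nat -> K), f = emb a * x + \sum_(l < k0.+1) emb (c l) * y l &
      forall a (c : nat -> K) i j,
        fenc emb sigmainv m Pp (emb a * x + \sum_(l < k0.+1) emb (c l) * y l) i j =
        \sum_(l < k0.+1) c l * wpt i j l].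
Proof.
have [KK [io _]] := countable_algebraic_closure K.
have [W] := wag_exists (io : {rmorphism K -> (KK : closedFieldType)}) pp Kp e0 pb k.
have [g [h [gc gx gy gh hg]]] := wag_auto W.
set em := we W in gc gx gy *; set x := wx W in gx *; set y := wy W in gy *.
have vP := wvP W.
have Q0 : (0 < q ^ k)%N by rewrite expn_gt0 (ltnW q1).
have vx : wv W x = - (q ^ k)%:Z := wv_x W.
have x0 : x != 0 by apply/eqP => hx; move: vx; rewrite hx (valn0 vP); move: (q ^ k)%N Q0; glia.
have [L] := laurent_exists K.
have LP := lvalP L.
have trL : transcendental (lcst L) (lvar L).
  by apply: (val_transcendental LP (@lval_cst _ L)); rewrite lval_var.
have /choice [H HP] : forall i, exists H : {rmorphism wF W -> L}, [/\ forall a, H (em a) = lcst L a,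
    H x = lvar L & forall l, (l <= k)%N -> vge (@lval _ L) 1 (H (y l) - lcst L (val i l))].
  move=> i; have [Y [Y0 YS Yr]] := hensel_seq L (val0 i).
  have [|H [Hc Hx Hy]] := @whom _ _ _ _ _ W L (lcst L) (lvar L) Y trL Y0; first by move=> j _; apply: YS.
  by exists H; split=> // l lk; rewrite /y Hy.
have /choice [Hj HjP] : forall ij : 'I_N * nat, exists H' : {rmorphism wF W -> L},
    [/\ forall z, H' z = H ij.1 (iter ij.2 g z), forall a, H' (em a) = lcst L a,
      lval (H' x) = 1, vge (@lval _ L) 1 (H' x) &
      forall l, (l <= k)%N -> vge (@lval _ L) 1 (H' (y l) - lcst L (wpt ij.1 ij.2 l))].
  case=> i; elim=> [|j [H' [H'E H'c H'x H'x1 H'y]]] /=.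
    have [Hc Hx Hy] := HP i; exists (H i); split=> //; rewrite ?Hx ?lval_var //.
    by rewrite vgeE ?lvar_neq0 // lval_var.
  exists [the {rmorphism wF W -> L} of H' \o g]; split=> [z|a|||l lk] /=.
  - by rewrite H'E /= -iterSr.
  - by rewrite gc H'c.
  - rewrite gx rmorphM H'c (valnM LP) ?fmorph_eq0 // lval_cst // H'x //.
  - rewrite gx rmorphM H'c; have := vgeM LP (lcst_vge L ga) H'x1; by rewrite add0r.
  rewrite gy // rmorphD rmorphM H'c rmorphD opprD addrACA rmorphM -mulrBr; apply: (vgeD LP).
    by have := vgeM LP (lcst_vge L (lam l)) (H'y l lk); rewrite add0r.
  case: l lk => [|l] lk; first by rewrite !rmorph0 subrr vge0.
  rewrite !rmorphM H'c -mulrBr.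
  by have := vgeM LP (lcst_vge L eps) (H'y l (ltnW lk)); rewrite add0r.
pose Pp i z := lval (H i z).
have fpE i (j : 'I_m) : fplace g Pp i j = fun z => lval (Hj (i, (j : nat)) z).
  by apply/funext => z; have [E _ _ _ _] := HjP (i, (j : nat)); rewrite E.
have [|d [w [d0 wP [t [t0 wt]] vw]]] := @valn_normalize _ _ x vP; first by rewrite vx; move: (q ^ k)%N Q0; glia.
have wx0 : w x < 0 by move: (vw x); rewrite vx; move: (w x) (q ^ k)%N Q0 d0; gnia.
have we_ a : a != 0 -> w (em a) = 0.
  move=> a0; have := vw (em a); rewrite wv_e //; move: (w _) d0; gnia.
have wuq P : valn P -> (forall a, a != 0 -> P (em a) = 0) -> P x < 0 -> forall f, P f * w x = P x * w f.
  move=> PP Pe Px f; have := wuniq PP Pe Px f; rewrite !vw -/x.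
  by move: (P f) (P x) (w x) (w f) d0; gnia.
(* The place at infinity is the only one, so its image is proportional to it; [x] and [ga x] have
   the same order, so the two are equal. Hence the divisor is invariant. *)
have wg z : w (g z) = w z.
  have := wuq _ (valn_comp g wP); rewrite /= gx => hu.
  have wgx : w (em ga * x) = w x by rewrite (valnM wP) ?fmorph_eq0 // we_ // add0r.
  rewrite wgx in hu.
  have : w (g z) * w x = w x * w z by apply: hu => // a a0; rewrite gc we_.
  by rewrite mulrC => /(mulfI _); apply; rewrite lt_eqF.
have xk : d <= (q ^ k)%:Z by move: (vw x); rewrite vx; move: (w x) (q ^ k)%N wx0 d0; gnia.
(* [wv] is [d] times the normalised [w], so order at least [-D] for [wv] becomes order at least
   [- (D %/ d)] for [w]. *)
pose Dp (_ : 'I_1) := w; pose Dn (_ : 'I_1) := (D%:Z %/ d)%Z.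
have DnE f : (- (1%:Z * (D%:Z %/ d)%Z) <= w f) = (- D%:Z <= wv W f).
  rewrite vw mul1r; have := divz_eq D%:Z d; have := modz_ge0 D%:Z (lt0r_neq0 d0).
  have := ltz_pmod D%:Z d0; move: (_ %/ _)%Z (_ %% _)%Z (w f) => a b c h1 h2 h3.
  apply/idP/idP; move: d0 h1 h2 h3; gnia.
have wpl : is_place em w.
  by have [w0 wM wD] := wP; split=> //; exists t.
have same P : is_place em P -> P x < 0 -> same_place P w.
  case=> P1 P2 P3 P4 [t' [t'0 Pt']] Px; have PP : valn P by [].
  have E := wuq P PP P4 Px.
  have Pt : 0 < P t by have := E t; rewrite wt; move: (P t) (P x) (w x) Px wx0; gnia.
  have E2 f : P f = P t * w f.
    have := E f; have := E t; rewrite wt mulr1 => <-; rewrite mulrAC => /(mulIf _); apply.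
    by rewrite lt_eqF.
  have : P t = 1 by have := E2 t'; rewrite Pt'; move: (P t) (w t') Pt; clear => a b a0 ab; have b0 : 0 < b; nia.
  by move=> P1' f; rewrite E2 P1' mul1r.
have yint P : is_place em P -> 0 <= P x -> forall j, (j <= k)%N -> vge P 0 (y j).
  case=> P1 P2 P3 P4 _ Px; have PP : valn P by [].
  have xv : vge P 0 x by rewrite vgeE.
  elim=> [|j IH] jk; first by rewrite /y wy0 (vge1 PP).
  apply: (as_integral PP q1 (e := -1)); rewrite ?oppr_eq0 ?oner_neq0 // ?(valnN PP) ?(valn1 PP) //.
  rewrite mulN1r /y weq //.
  by apply: (vge0M PP); [apply: (vge0M PP); [apply: (vgeB PP)|]|]; rewrite ?(vge0X PP) ?IH // ltnW.
have msg f : message em 1 Dp Dn f <->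
    exists a (c : nat -> K), f = em a * x + \sum_(l < k0.+1) em (c l) * y l.
  split.
    case=> [->|[reg inf]].
      exists 0, (fun=> 0); rewrite rmorph0 mul0r big1 ?addr0 // => l _.
      by rewrite mul0r.
    (* A Laurent point over [KK] restricts, if [f] has a pole there, to a multiple of a place over
       [K]. It is not the place at infinity since [x] is finite there, so [f] is integral at it. *)
    have rf : regular io em x f.
      move=> L' h' be hc' hx'; rewrite /vge; case: eqP => //= f0; rewrite leNgt; apply/negP => lt.
      have v'P := valn_comp h' (lvalP L').
      have [|d' [w' [d'0 w'P w't vw']]] := @valn_normalize _ _ f v'P; first by rewrite lt_eqF.
      have pl : is_place em w'.
        have [a1 a2 a3] := w'P; split=> // a a0; have := vw' (em a).
        by rewrite hc' lval_cst ?fmorph_eq0 //; move: (w' _) d'0; gnia.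
      have x'0 : 0 <= w' x.
        have : vge (@lval _ L') 0 (h' x).
          by rewrite hx' (vgeD (lvalP L')) ?lcst_vge // vgeE ?lvar_neq0 // lval_var.
        by rewrite vgeE ?fmorph_eq0 // vw'; move: (w' x) d'0; gnia.
      have : 0 <= w' f.
        by apply: reg => // i' sp; have := sp x; rewrite /Dp; move: (w x) (w' x) wx0 x'0; glia.
      by move: (vw' f) lt => -> ; move: (w' f) d'0; gnia.
    have vf : vge (wv W) (- D%:Z) f by rewrite /vge -DnE (inf ord0) orbT.
    have [a [c [fE _ cD]]] := wreg Dlt rf vf.
    exists a, c; rewrite fE; congr (_ + _); rewrite -/em -/y.
    rewrite [RHS](big_ord_widen _ (fun l => em (c l) * y l) (_ : k0.+1 <= k.+1)%N) ?ltnS //.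
    rewrite [RHS]big_mkcond /=; apply: eq_bigr => l _; case: ifP => // lk.
    suff -> : c l = 0 by rewrite rmorph0 mul0r.
    apply/eqP; apply: contraT => cl; have := cD l (ltn_ord l) cl.
    have l1 : (k0 < l)%N by rewrite ltnNge -ltnS lk.
    by rewrite leqNgt Dgt // l1 -ltnS /=.
  case=> a [c fE]; have [f0|f0] := eqVneq f 0; [by left|right; split].
    move=> P pl nP; have Px : 0 <= P x.
      by rewrite leNgt; apply/negP => /(same P pl); apply: nP ord0.
    have yi := yint P pl Px; have [P1 P2 P3 P4 _] := pl; have PP : valn P by [].
    have cv b : vge P 0 (em b).
      have [->|b0] := eqVneq b 0; first by rewrite rmorph0 vge0.
      by rewrite vgeE ?fmorph_eq0 // P4.
    have : vge P 0 f.
      rewrite fE; apply: (vgeD PP); first by rewrite (vge0M PP) ?cv // vgeE.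
      apply: (vge_sum PP) => l _; rewrite (vge0M PP) ?cv ?yi //.
      by apply: leq_trans k0k; rewrite -ltnS.
    by rewrite vgeE.
  move=> i'; rewrite /Dp /Dn DnE -vgeE //.
  have cv b : vge (wv W) 0 (em b).
    have [->|b0] := eqVneq b 0; first by rewrite rmorph0 vge0.
    by rewrite vgeE ?fmorph_eq0 // wv_e.
  have tm (b : K) z : vge (wv W) (- D%:Z) z -> vge (wv W) (- D%:Z) (em b * z).
    by move=> hz; have := vgeM vP (cv b) hz; rewrite add0r.
  rewrite fE; apply: (vgeD vP); first by apply: tm; rewrite vgeE // vx lerN2 lez_nat.
  apply: (vge_sum vP) => l _; apply: tm; rewrite /vge /y wv_y; last by apply: leq_trans k0k; rewrite -ltnS.
  by rewrite lerN2 lez_nat Dle ?orbT // -ltnS.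
(* Translating a place means composing with [sigmainv]; therefore [g], which acts on the [y_l] as
   prescribed, is taken for [sigmainv], and its inverse [h] for [sigma]. *)
exists (wF W), em, h, g, Pp, Dp, Dn, x, y; split=> //; last first.
  move=> a c i j; rewrite mxE fpE; have [_ Hc _ Hx Hy] := HjP (i, (j : nat)).
  apply: hom_fval => //.
  rewrite rmorphD rmorphM Hc rmorph_sum rmorph_sum -addrA -sumrB; apply: (vgeD LP).
    by have := vgeM LP (lcst_vge L a) Hx; rewrite add0r.
  apply: (vge_sum LP) => l _; rewrite !rmorphM Hc -mulrBr.
  have lk : (l <= k)%N by apply: leq_trans k0k; rewrite -ltnS.
  by have := vgeM LP (lcst_vge L (c l)) (Hy l lk); rewrite add0r.
split.
- split; last first.
    split=> //; [exact: rmorphD|exact: rmorphM|exact: rmorph1|].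
    by move=> a; rewrite -{1}(gc a) gh.
  split.
    exists x; split; first by apply: (val_transcendental vP (@wv_e _ _ _ _ _ W)); rewrite vx; move: (q ^ k)%N Q0; glia.
    have [I [b bP]] := wspan W; exists #|I|, (fun i => b (enum_val i)) => z.
    have [c [a [c0 E]]] := bP z; exists c, (fun i => a (enum_val i)); split=> //.
    by rewrite E (reindex _ (onW_bij _ (@enum_val_bij I))).
  have [Hc _ _] := HP (Ordinal N0).
  exact: hom_full_constants Hc.
- by [].
- split=> [i j|i j i' j' ne].
    rewrite fpE; have [_ Hc Hx _ _] := HjP (i, (j : nat)).
    exact: (hom_rational Hc x0 Hx).
  have ne' : (i, (j : nat)) != (i', (j' : nat)).
    by apply: contraNneq ne => -[-> /val_inj ->].
  have [l lk] := distinct (ltn_ord j) (ltn_ord j') ne'.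
  rewrite !fpE => wl sp; move: wl; have [_ Hc _ _ Hy] := HjP (i, (j : nat)).
  have [_ Hc' _ _ Hy'] := HjP (i', (j' : nat)).
  case/eqP; apply: (hom_residue_uniq (Hy l lk)).
  have := Hy' l lk; rewrite (hom_residue Hc') (hom_residue Hc) /residue_is.
  by rewrite (sp (y l - em _)).
- split; last by move=> i; exists ord0; split=> // z; rewrite /place_act /Dp wg.
  split=> [//|i|i i']; last by rewrite !ord1 eqxx.
  rewrite /Dn gt_eqF // -(@ltr_pM2l _ d) // mulr0.
  have := divz_eq D%:Z d; have := ltz_pmod D%:Z d0; have : d <= D%:Z by apply: le_trans xk _; rewrite lez_nat.
  by move: (_ %/ _)%Z (_ %% _)%Z; glia.
move=> i j i'; rewrite fpE => /(_ x); have [_ _ -> _ _] := HjP (i, (j : nat)).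
by rewrite /Dp; move: (w x) wx0; glia.
Qed.

End WagCode.

(** * Linear codes as folded codes *)

Section Reduction.
Variables (K : finFieldType) (N m k0 : nat) (w : 'I_N -> nat -> nat -> K).

Definition encw (c : 'rV[K]_k0.+1) : 'M[K]_(N, m) :=
  \matrix_(i, j) \sum_l c 0 l * w i j l.

Definition agree (M M' : 'M[K]_(N, m)) : nat := #|[set i | row i M == row i M']|.

Lemma encwB c c' : encw (c - c') = encw c - encw c'.
Proof.
by apply/matrixP => i j; rewrite !mxE -sumrB; apply: eq_bigr => l _; rewrite !mxE mulrBl.
Qed.

Lemma hamming_agree (M M' : 'M[K]_(N, m)) : (hamming M M' + agree M M' = N)%N.
Proof.
rewrite /hamming /agree -[RHS]card_ord -(cardsC [set i | row i M != row i M']).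
by congr (_ + _)%N; apply: eq_card => i; rewrite !inE negbK.
Qed.

Lemma agreeB M M' : agree M M' = agree (M - M') 0.
Proof. by apply: eq_card => i; rewrite !inE raddfB /= row0 subr_eq0. Qed.

Variables (R0 : realFieldType) (R rho tau : R0) (L0 : nat).

(** Stated through agreements instead of distances: [rho] encodes relative distance [1 - rho], and
    [L0] is the list size at error fraction [tau]. *)
Record good_code : Prop := GoodCode {
  gc_rate : R * (m * N)%:R <= k0.+1%:R;
  gc_inj : forall c, encw c = 0 -> c = 0;
  gc_dist : forall c, c != 0 -> (agree (encw c) 0)%:R <= rho * N%:R;
  gc_list : forall y : 'M[K]_(N, m),
    (#|[set c | ((1 - tau) * N%:R <= (agree (encw c) y)%:R)%R]| <= L0)%N
}.

Hypotheses (m0 : (0 < m)%N) (N0 : (0 < N)%N) (G : good_code).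

Variables (F : fieldType) (emb : {rmorphism K -> F}) (sigma sigmainv : F -> F)
  (Pp : 'I_N -> F -> int) (Dp : 'I_1 -> F -> int) (Dn : 'I_1 -> int) (x : F) (y : nat -> F).
Hypotheses (msg : forall f, message emb 1 Dp Dn f <->
        exists a (c : nat -> K), f = emb a * x + \sum_(l < k0.+1) emb (c l) * y l)
  (enc : forall a (c : nat -> K) i j,
        fenc emb sigmainv m Pp (emb a * x + \sum_(l < k0.+1) emb (c l) * y l) i j =
        \sum_(l < k0.+1) c l * w i j l).

Let el a (c : 'rV[K]_k0.+1) : F := emb a * x + \sum_(l < k0.+1) emb (c 0 l) * y l.

Let elD a b c d : el (a + b) (c + d) = el a c + el b d.
Proof.
rewrite /el rmorphD mulrDl addrACA -big_split; congr (_ + _); apply: eq_bigr => l _.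
by rewrite mxE rmorphD mulrDl.
Qed.

Let elZ b a c : el (b * a) (b *: c) = emb b * el a c.
Proof.
rewrite /el rmorphM mulrDr mulrA mulr_sumr; congr (_ + _); apply: eq_bigr => l _.
by rewrite mxE rmorphM mulrA.
Qed.

Let elE a (c : nat -> K) : emb a * x + \sum_(l < k0.+1) emb (c l) * y l = el a (\row_l c l).
Proof. by congr (_ + _); apply: eq_bigr => l _; rewrite mxE. Qed.

Let elI a (c : 'rV[K]_k0.+1) : el a c = emb a * x + \sum_(l < k0.+1) emb (c 0 (inord l)) * y l.
Proof. by congr (_ + _); apply: eq_bigr => l _; rewrite inord_val. Qed.

Let el_msg a c : message emb 1 Dp Dn (el a c).
Proof. by apply/msg; exists a, (fun l => c 0 (inord l)); rewrite elI. Qed.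

Let el_enc a c : fenc emb sigmainv m Pp (el a c) = encw c.
Proof.
apply/matrixP => i j; rewrite elI (enc a (fun l => c 0 (inord l))) mxE; apply: eq_bigr => l _.
by rewrite inord_val.
Qed.

Let msg_el f : message emb 1 Dp Dn f -> exists a c, f = el a c.
Proof. by move/msg => [a [c ->]]; exists a, (\row_l c l); rewrite elE. Qed.

Let codeE : fcode emb sigmainv m 1 Pp Dp Dn = encw @: setT.
Proof.
apply/setP => M; rewrite inE; apply/asboolP/imsetP.
  by case=> f [/msg_el [a [c ->]] <-]; exists c; rewrite ?inE ?el_enc.
by case=> c _ ->; exists (el 0 c); rewrite el_enc.
Qed.

Let dimE : fcode_dim emb sigmainv m 1 Pp Dp Dn = k0.+1.
Proof.
rewrite /fcode_dim codeE card_imset.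
  by rewrite cardsT card_mx mul1n trunc_expnK // finRing_gt1.
move=> c c' E; apply/eqP; rewrite -subr_eq0; apply/eqP; apply: (gc_inj G).
by rewrite encwB E subrr.
Qed.

Lemma reduction_rate :
  R <= (fcode_dim emb sigmainv m 1 Pp Dp Dn)%:R / (m * N)%:R.
Proof. by rewrite dimE ler_pdivlMr ?ltr0n ?muln_gt0 ?m0 //; exact: gc_rate G. Qed.

Lemma reduction_dist (M M' : 'M[K]_(N, m)) : M \in fcode emb sigmainv m 1 Pp Dp Dn ->
  M' \in fcode emb sigmainv m 1 Pp Dp Dn -> M != M' ->
  1 - rho <= (hamming M M')%:R / N%:R.
Proof.
rewrite codeE => /imsetP [c _ ->] /imsetP [c' _ ->] ne.
have cc : c - c' != 0 by rewrite subr_eq0; apply: contraNneq ne => ->.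
have := gc_dist G cc; rewrite encwB -agreeB => h.
rewrite ler_pdivlMr ?ltr0n // mulrBl mul1r lerBlDr.
by rewrite -{1}(hamming_agree (encw c) (encw c')) natrD lerD2l.
Qed.

Lemma reduction_list (M : 'M[K]_(N, m)) : exists S : seq F,
  [/\ uniq S, (size S <= #|K| ^ L0.+1)%N,
      (forall f, f \in S -> message emb 1 Dp Dn f),
      (0 \in S) /\
      (forall f g, f \in S -> g \in S -> f + g \in S) /\
      (forall (a : K) f, f \in S -> emb a * f \in S) &
      (forall f, message emb 1 Dp Dn f ->
         (hamming (fenc emb sigmainv m Pp f) M)%:R <= tau * N%:R -> f \in S)].
Proof.
set A := [set c | ((1 - tau) * N%:R <= (agree (encw c) M)%:R)%R].
pose B : 'M[K]_(#|A|, k0.+1) := \matrix_i enum_val i.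
pose s := [seq el at_.1 (at_.2 *m B) | at_ : K * 'rV[K]_#|A|].
have sP f : reflect (exists a t, f = el a (t *m B)) (f \in undup s).
  rewrite mem_undup; apply: (iffP mapP) => [[[a t] _ ->]|[a [t ->]]]; first by exists a, t.
  by exists (a, t); rewrite ?mem_enum.
exists (undup s); split.
- exact: undup_uniq.
- apply: leq_trans (size_undup _) _; rewrite size_map -cardE card_prod card_mx mul1n -expnS.
  by rewrite leq_exp2l ?finRing_gt1 // ltnS; exact: (gc_list G).
- by move=> f /sP [a [t ->]]; apply: el_msg.
- split; first by apply/sP; exists 0, 0; rewrite mul0mx /el rmorph0 mul0r add0r big1 // => l _; rewrite mxE rmorph0 mul0r.
  split=> [f g /sP [a [t ->]] /sP [b [u ->]]|b f /sP [a [t ->]]]; apply/sP.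
    by exists (a + b), (t + u); rewrite mulmxDl elD.
  by exists (b * a), (b *: t); rewrite -scalemxAl elZ.
move=> f /msg_el [a [c ->]]; rewrite el_enc => h; apply/sP.
have cA : c \in A.
  rewrite inE mulrBl mul1r lerBlDr -{1}(hamming_agree (encw c) M) natrD addrC lerD2l //.
exists a, (delta_mx 0 (enum_rank_in cA c)); congr (el a _).
by rewrite -rowE; apply/rowP => l; rewrite !mxE enum_rankK_in.
Qed.

End Reduction.

(** The linear code with table of values [w] is a folded code, up to the additional message
    coordinate along [x]. *)
Definition realised (K : finFieldType) (N m k0 : nat) (w : 'I_N -> nat -> nat -> K) : Prop :=
  exists (F : fieldType) (emb : {rmorphism K -> F}) (sigma sigmainv : F -> F)
    (Pp : 'I_N -> F -> int) (Dp : 'I_1 -> F -> int) (Dn : 'I_1 -> int) (x : F) (y : nat -> F),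
  [/\ folded_AG_data emb sigma sigmainv m 1 Pp Dp Dn,
      forall f, message emb 1 Dp Dn f <->
        exists a (c : nat -> K), f = emb a * x + \sum_(l < k0.+1) emb (c l) * y l &
      forall a (c : nat -> K) i j,
        fenc emb sigmainv m Pp (emb a * x + \sum_(l < k0.+1) emb (c l) * y l) i j =
        \sum_(l < k0.+1) c l * w i j l].

Lemma realised_eq (K : finFieldType) (N m k0 : nat) (w w' : 'I_N -> nat -> nat -> K) :
  (forall i j l, (l <= k0)%N -> w i j l = w' i j l) -> realised m k0 w -> realised m k0 w'.
Proof.
move=> E [F [emb [s [si [Pp [Dp [Dn [x [y [h1 h2 h3]]]]]]]]]].
exists F, emb, s, si, Pp, Dp, Dn, x, y; split=> // a c i j.
by rewrite h3; apply: eq_bigr => l _; rewrite E // -ltnS.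
Qed.

(** * Prescribed unipotent and diagonal actions *)

Section Realisation.
Variables (K : finFieldType) (p e : nat).
Hypotheses (pp : prime p) (Kp : #|K| = (p ^ e)%N) (e0 : (0 < e)%N) (q4 : (4 <= #|K|)%N).
Local Notation q := #|K|.

Lemma mm_bound bb B j : (forall i, (i < j)%N -> (bb i <= B)%N) ->
  (q.-1 * mm K bb j < q ^ j * (q + B))%N.
Proof.
elim: j => [|j IH] h /=; first by rewrite muln0 expn0 mul1n; move: (#|K|) q4; glia.
have := IH (fun i ij => h i (ltnW ij)); have := h j (ltnSn j).
have : (0 < q ^ j)%N by rewrite expn_gt0; move: (#|K|) q4; glia.
rewrite expnS; move: (mm K bb j) (q ^ j)%N (bb j) q4; case: (#|K|) => // c M Q b _ Q0 bB /= IH'.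
by move: bB Q0 IH'; gnia.
Qed.

(** A geometric sum gives [mm j < q ^ j (q + B) / (q - 1)], and [q + B <= 2 (q - 1)]. *)
Lemma mm_level bb B k j : (forall i, (i < j)%N -> (bb i <= B)%N) -> (B <= q - 2)%N ->
  (j <= k)%N -> (q ^ (k - j) * mm K bb j < 2 * q ^ k)%N.
Proof.
move=> h Bq jk; have := mm_bound h.
have Q0 : (0 < q ^ (k - j))%N by rewrite expn_gt0; move: (#|K|) q4; glia.
have Q1 : (0 < q ^ j)%N by rewrite expn_gt0; move: (#|K|) q4; glia.
have -> : (q ^ k = q ^ (k - j) * q ^ j)%N by rewrite -expnD subnK.
move: (q ^ (k - j))%N (q ^ j)%N (mm K bb j) q4 Bq Q0 Q1; case: (#|K|) => // c Q P M c3 Bq Q0 Q1 /= lt.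
have {}lt : (M < 2 * P)%N.
  rewrite -(ltn_pmul2l (_ : 0 < c)%N); last by move: c3; glia.
  by apply: leq_trans lt _; move: c3 Bq; clear; nia.
by rewrite mulnCA ltn_pmul2l.
Qed.

(** The [j]-th power of [1 + shift], expanded by the binomial theorem. *)
Definition unip_pt N (val : 'I_N -> nat -> K) (i : 'I_N) (j l : nat) : K :=
  \sum_(a < l.+1) 'C(j, a)%:R * val i (l - a)%N.

Lemma wpt_unip N (val : 'I_N -> nat -> K) i j l :
  wpt 1 (fun=> 1) val i j l = unip_pt val i j l.
Proof.
rewrite /unip_pt; elim: j l => [|j IH] l /=.
  rewrite big_ord_recl bin0 mul1r subn0 big1 ?addr0 // => a _.
  by rewrite bin0n mul0r.
rewrite mul1r IH; case: l => [|l]; first by rewrite addr0 !big_ord1 !bin0.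
rewrite mul1r IH [in RHS]big_ord_recl [X in X + _]big_ord_recl !bin0 -addrA; congr (_ + _).
rewrite -big_split; apply: eq_bigr => a _.
by rewrite /bump /= ?add1n subSS binS natrD mulrDl.
Qed.

(** With [ga = eps = 1] and all [b_j = 1] the pole orders increase with [j] in a common scale, so
    [D] can be placed between those of [y_k0] and [y_(k0+1)]. The [m N] coordinates beyond [k0]
    serve to make the places distinct. *)
Lemma unip_realised N m k0 (val : 'I_N -> nat -> K) : (0 < m)%N -> (0 < N)%N ->
  (forall i, val i 0 = 1) -> realised m k0 (unip_pt val).
Proof.
move=> m0 N0 val0; pose k := (k0 + m * N)%N.
(* Beyond [k0], place [i] has value 1 in coordinate [k0 + m (i + 1)] and 0 elsewhere. Translates mix
   it with fewer than [m] lower coordinates, so the marks of different places do not interfere. *)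
pose val' i l := if (l <= k0)%N then val i l else (l == k0 + m * i.+1)%N%:R.
have val'0 i : val' i 0 = 1 by rewrite /val' val0.
pose D := maxn (q ^ k) (q ^ (k - k0) * mm K (fun=> 1%N) k0).
have q0 : (0 < q)%N by apply: leq_trans q4.
have mono j : (j < k)%N -> (q ^ (k - j) * mm K (fun=> 1%N) j < q ^ (k - j.+1) * mm K (fun=> 1%N) j.+1)%N.
  move=> jk; have := @mm_bound (fun=> 1%N) 1%N j (fun _ _ => isT).
  have -> : (k - j = (k - j.+1).+1)%N by rewrite -subSn.
  have Q0 : (0 < q ^ (k - j.+1))%N by rewrite expn_gt0 q0.
  rewrite expnSr -mulnA ltn_pmul2l // [mm _ _ j.+1]/=.
  by move: (mm K _ j) (q ^ j * (q + 1))%N (#|K|) q4; case=> [|a] b; case=> [|c] //=; glia.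
have mono2 j j' : (j < j')%N -> (j' <= k)%N ->
    (q ^ (k - j) * mm K (fun=> 1%N) j < q ^ (k - j') * mm K (fun=> 1%N) j')%N.
  elim: j' => // j' IH; rewrite ltnS leq_eqVlt => /orP[/eqP -> h|jj h]; first exact: mono.
  by apply: ltn_trans (mono _ h); apply: IH => //; apply: ltnW.
have D1 : (q ^ k < q ^ (k - 1) * mm K (fun=> 1%N) 1)%N.
  have k1 : (0 < k)%N by rewrite addn_gt0 muln_gt0 m0 N0 orbT.
  rewrite -{1}(subnK k1) expnD expn1 ltn_pmul2l ?expn_gt0 ?q0 //= mul1n addn0.
  by rewrite addn1.
apply: (realised_eq (w := wpt 1 (fun=> 1) val')) => [i j l lk|].
  rewrite wpt_unip; apply: eq_bigr => a _; rewrite /val' ifT //.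
  by apply: leq_trans lk; apply: leq_subr.
apply: (@wag_code K p e (fun=> 1%N) pp Kp e0 _ k 1 1 (fun=> 1) _ _ _ _ N m k0 D val') => //.
- by rewrite gtnNdvd // prime_gt1.
- by rewrite oner_neq0.
- by move=> _; rewrite mulr1 expr1n.
- by right.
- by rewrite leq_addr.
- by rewrite leq_maxl.
- rewrite gtn_max; apply/andP; split; first by rewrite ltn_Pmull // expn_gt0 q0.
  by apply: (@mm_level _ 1%N) => //; [rewrite leq_subRL; move: q4; lia|rewrite leq_addr].
- move=> j; rewrite leq_eqVlt => /orP[/eqP ->|jk]; first by rewrite leq_maxr.
  by apply: leq_trans (leq_maxr _ _); apply: ltnW; apply: mono2 => //; rewrite leq_addr.
- move=> j /andP[kj jk]; rewrite gtn_max (mono2 _ _ kj jk) andbT.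
  case: j kj jk => // -[|j] kj jk //; apply: ltn_trans D1 _.
  exact: mono2.
move=> i j i' j' jm jm' ne.
have [ii|ii] := eqVneq i i'; last first.
  have lk : (k0 + m * i.+1 <= k)%N by rewrite leq_add2l leq_mul2l ltn_ord orbT.
  exists (k0 + m * i.+1)%N => //; rewrite !wpt_unip.
  have key (i2 : 'I_N) j2 : (j2 < m)%N -> unip_pt val' i2 j2 (k0 + m * i.+1) = (i2 == i)%:R.
    move=> j2m; rewrite /unip_pt big_ord_recl bin0 mul1r subn0 big1 ?addr0 => [|a _].
      rewrite /val' leqNgt -[X in (X < _)%N]addn0 ltn_add2l muln_gt0 m0 /=.
      by rewrite eqn_add2l eqn_pmul2l // eqSS eq_sym.
    rewrite /bump /= ?add1n; move: (nat_of_ord a) => {}a; case: (ltnP j2 a.+1) => aj; first by rewrite bin_small ?mul0r.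
    suff -> : val' i2 (k0 + m * i.+1 - a.+1)%N = 0 by rewrite mulr0.
    have am : (a.+1 < m)%N by apply: leq_ltn_trans j2m.
    rewrite /val' ifF; last by rewrite mulnS; move: (m * i)%N am; clear; lia.
    case: eqP => // E; exfalso; move: E; rewrite mulnS.
    have : (i2 <= i \/ i < i2)%N by case: (leqP i2 i); [left|right].
    case=> h; [have : (m * i2 <= m * i)%N by rewrite leq_mul2l h orbT|have : (m * i.+1 <= m * i2)%N by rewrite leq_mul2l h orbT].
      case: (ltnP i2 i) => h2.
        have : (m * i2.+1 <= m * i)%N by rewrite leq_mul2l h2 orbT.
        by move: (m * i)%N (m * i2.+1)%N am; clear; lia.
      have -> : i2 = i by apply/val_inj/eqP; rewrite eqn_leq h h2.
      by rewrite mulnS; move: (m * i)%N am; clear; lia.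
    by rewrite !mulnS; move: (m * i)%N (m * i2)%N am; clear; lia.
  by rewrite !key // eqxx [_ == i]eq_sym (negPf ii) oner_eq0.
subst i'; have jj : j != j' by apply: contraNneq ne => ->.
wlog lt : j j' jm jm' ne jj / (j' < j)%N.
  move=> H; case: (ltngtP j' j) => h; first exact: H.
    have ne' : (i, j') != (i, j) by rewrite eq_sym.
    have jj' : j' != j by rewrite eq_sym.
    by have [l lk wl] := H j' j jm' jm ne' jj' h; exists l; rewrite // eq_sym.
  by rewrite h eqxx in jj.
(* Two translates of one place are told apart by the first coordinate [a] at which the binomials of
   [j] and [j'] differ in [K]: there only the term with the factor [val' i 0 = 1] survives. *)
have ex : exists a, ('C(j, a)%:R : K) != 'C(j', a)%:R.
  by exists j; rewrite binn bin_small ?oner_neq0.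
case: (ex_minnP ex) => a aP amin; exists a.
  have : (a <= j)%N by apply: amin; rewrite binn bin_small ?oner_neq0.
  move=> aj; apply: leq_trans aj _; apply: leq_trans (ltnW jm) _.
  by rewrite /k -{1}(muln1 m); apply: leq_trans (leq_addl _ _); rewrite leq_mul2l N0 orbT.
rewrite !wpt_unip /unip_pt -subr_eq0 -sumrB big_ord_recr /= big1 => [|b _].
  by rewrite add0r subnn -mulrBl val'0 mulr1 subr_eq0.
rewrite -mulrBl; case: (eqVneq ('C(j, b)%:R : K) 'C(j', b)%:R) => [->|h]; first by rewrite subrr mul0r.
by have := amin b h; rewrite leqNgt ltn_ord.
Qed.

Lemma wpt_tame N (val : 'I_N -> nat -> K) lam i j l :
  wpt 0 lam val i j l = lam l ^+ j * val i l.
Proof.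
elim: j l => [|j IH] l /=; first by rewrite mul1r.
by rewrite IH exprS mulrA; case: l => [|l]; rewrite ?mul0r addr0.
Qed.

(** The eigenvalue of [y_(l+1)] is that of [y_l] times [ga ^ (b_l + 1)], so any exponents are
    reached by choosing [b_l] in the class of [A (l + 1) - A l - 1] modulo [n]. *)
Lemma tame_realised N m k0 n (ga : K) (ax : nat -> nat) (val : 'I_N -> nat -> K) :
  n.-primitive_root ga -> (p %| n.+1)%N -> (2 * n <= q.-1)%N -> (0 < m <= n)%N -> (0 < N)%N ->
  ax 0%N = 0%N -> (forall i, val i 0 = 1) ->
  realised m k0 (fun i j l => ga ^+ (ax l * j) * val i l).
Proof.
move=> prim pn nq /andP[m0 mn] N0 ax0 val0; pose k := (k0 + N.+1)%N.
have n0 : (0 < n)%N by apply: prim_order_gt0 prim.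
have q0 : (0 < q)%N by apply: leq_trans q4.
have p1 := prime_gt1 pp.
(* Beyond [k0] there is one coordinate with eigenvalue [ga] and value 1, which separates translates,
   followed by invariant coordinates that separate the places. *)
pose A l := if (l <= k0)%N then ax l else (l == k0.+1 : nat).
pose bm l := ((A l.+1 + (n - A l %% n) + n.-1) %% n)%N.
(* From [k0] on, adding [n q] keeps the class modulo [n] and pushes the pole orders of the auxiliary
   coordinates above [D]. *)
pose bl l := (bm l + (if (l < k0)%N then 0 else n * q))%N.
(* [b_0] must be prime to [p]; otherwise [n] is added, which is prime to [p] because [p] divides
   [n + 1]. Below [k0] one still has [b_l <= 2 n - 1 <= q - 2], as [mm_level] demands. *)
pose bb l := (bl l + (if (l == 0) && (p %| bl l) then n else 0))%N.
pose lam l := ga ^+ A l.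
pose val' i l := if (l <= k0)%N then val i l else if l == k0.+1 then 1 else (l == k0.+2 + i)%N%:R.
pose D := (2 * q ^ k).-1.
have Q0 : (0 < q ^ k)%N by rewrite expn_gt0 q0.
have bml l : (bm l < n)%N by rewrite ltn_pmod.
have bbE l : (bb l).+1 + A l = A l.+1 %[mod n].
  rewrite /bb /bl; have -> : ((bm l + (if l < k0 then 0 else n * q) + (if (l == 0) && (p %| bm l + (if l < k0 then 0 else n * q)) then n else 0)).+1 + A l =
     (bm l).+1 + A l + n * ((if l < k0 then 0 else q) + (if (l == 0) && (p %| bm l + (if l < k0 then 0 else n * q)) then 1 else 0)))%N.
    by case: ifP; case: ifP => _ _; rewrite ?muln0 ?addn0 ?muln1 ?mulnDr ?muln1; move: (bm l) (A l) (n * q)%N; glia.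
  rewrite -modnDmr modnMr addn0.
  rewrite -(modnMDl ((A l.+1 + (n - A l %% n) + n.-1) %/ n)) -(modnMDl (2 + A l %/ n) (A l.+1)); congr (_ %% _)%N.
  have := divn_eq (A l.+1 + (n - A l %% n) + n.-1) n; have := divn_eq (A l) n; rewrite -/(bm l).
  have := ltn_pmod (A l) n0; move: (A l.+1) (A l) (bm l) (A l %% n)%N (A l %/ n)%N ((A l.+1 + (n - A l %% n) + n.-1) %/ n)%N n0; gnia.
apply: (realised_eq (w := wpt 0 lam val')) => [i j l lk|].
  by rewrite wpt_tame /lam /A /val' lk -exprM.
apply: (@wag_code K p e bb pp Kp e0 _ k ga 0 lam _ _ _ _ N m k0 D val') => //.
- rewrite /bb /= ; case: (boolP (p %| bl 0)%N) => pb; last by rewrite addn0.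
  rewrite dvdn_addr //; apply/negP => pn'; have := dvdn_sub pn pn'.
  by rewrite subSnn dvdn1 => /eqP E; rewrite E in p1.
- by apply: contraTneq n0 => g0; have := prim_expr_order prim; rewrite g0 expr0n; case: (n) => // n' /eqP; rewrite eq_sym oner_eq0.
- by rewrite /lam /A ax0.
- by move=> j; rewrite /lam -exprD; apply/eqP; rewrite (eq_prim_root_expr prim) bbE.
- by left.
- by rewrite leq_addr.
- by rewrite /D; move: (q ^ k)%N Q0; glia.
- by rewrite /D; move: (q ^ k)%N Q0; glia.
- move=> j jk; rewrite -ltnS prednK ?muln_gt0 ?Q0 //; apply: (@mm_level _ (2 * n).-1).
  + move=> i ij; rewrite /bb /bl ifT; last exact: leq_trans jk.
    by have := bml i; case: ifP => _; move: (bm i) n0; glia.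
  + by move: (#|K|) nq n0; glia.
  by apply: leq_trans jk _; rewrite leq_addr.
- case=> // j /andP[kj jk]; rewrite /D prednK ?muln_gt0 ?Q0 //=.
  have -> : (q ^ k = q ^ (k - j.+1) * (q ^ j * q))%N by rewrite -expnSr -expnD subnK.
  have : (q <= bb j)%N.
    rewrite /bb /bl ifF; last by rewrite ltnNge -ltnS kj.
    apply: leq_trans (leq_addr _ _); apply: leq_trans (leq_addl _ _); exact: leq_pmull.
  move=> qb; rewrite mulnCA leq_mul2l; apply/orP; right; rewrite mulnDr.
  have : (q ^ j * q <= q ^ j * bb j)%N by rewrite leq_mul2l qb orbT.
  by move: (q ^ j * q)%N (q ^ j * bb j)%N (mm K bb j); glia.
move=> i j i' j' jm jm' ne; have [ii|ii] := eqVneq i i'; last first.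
  exists (k0.+2 + i)%N; first by rewrite /k; move: (ltn_ord i); lia.
  rewrite !wpt_tame /lam /A /val' ifF; last by lia.
  have -> : (k0.+2 + i == k0.+1)%N = false by lia.
  have -> : (k0.+2 + i <= k0)%N = false by lia.
  rewrite !expr0 !expr1n !mul1r eqxx eqn_add2l.
  by rewrite -[_ == _ :> nat]/(i == i') (negPf ii) oner_neq0.
subst i'; have jj : j != j' by apply: contraNneq ne => ->.
exists k0.+1; first by rewrite /k -addn1 leq_add2l.
rewrite !wpt_tame /lam /A /val' ltnn eqxx !expr1 !mulr1 (eq_prim_root_expr prim).
by rewrite !modn_small // (leq_trans _ mn).
Qed.

End Realisation.

(** * Random codes *)

Section CountSolutions.
Variables (K : finFieldType) (k : nat).

(** Independent conditions form a matrix with a right inverse [B]; translating the solutions by the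
    image of [B] gives [q ^ #|X|] disjoint copies. *)
Lemma count_solutions (J : finType) (X : {set J}) (A : J -> 'cV[K]_k) (b : J -> K) :
  (forall be : J -> K, \sum_(j in X) be j *: A j = 0 -> forall j, j \in X -> be j = 0) ->
  (#|[set v : 'cV[K]_k | ([forall j in X, ((A j)^T *m v) 0 0 == b j])%R]| * #|K| ^ #|X| <= #|K| ^ k)%N.
Proof.
move=> ind; pose M : 'M[K]_(#|X|, k) := \matrix_j (A (enum_val j))^T.
have fM : row_free M.
  rewrite -kermx_eq0; apply/rowV0P => u /sub_kermxP uM.
  pose be j := if [pick i : 'I_#|X| | enum_val i == j] is Some i then u 0 i else 0.
  have beE i : be (enum_val i) = u 0 i.
    by rewrite /be; case: pickP => [i' /eqP /enum_val_inj ->|/(_ i)] //; rewrite eqxx.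
  apply/rowP => i; rewrite mxE -beE; apply: ind; last exact: enum_valP.
  rewrite big_enum_val /= -[RHS]trmx0 -uM mulmx_sum_row raddf_sum /=; apply: eq_bigr => j _.
  by rewrite beE linearZ /= rowK trmxK.
have [B MB] : exists B, M *m B = 1%:M by exists (pinvmx M); apply: mulmxVp.
set S := [set v | _].
have MS v : v \in S -> M *m v = \col_j b (enum_val j).
  rewrite inE => /forall_inP h; apply/colP => j; rewrite !mxE -(eqP (h _ (enum_valP j))) !mxE.
  by apply: eq_bigr => l _; rewrite !mxE.
pose f (vt : 'cV[K]_k * 'cV[K]_#|X|) := vt.1 + B *m vt.2.
have finj : {in setX S setT &, injective f}.
  case=> v t [v' t']; rewrite !inE !andbT /= => vS vS' E.
  have tt : t = t'.
    have : M *m (v + B *m t) = M *m (v' + B *m t') := congr1 (mulmx M) E.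
    by rewrite !mulmxDr !mulmxA !MB !mul1mx !MS ?inE // => /addrI.
  by move: E; rewrite /f /= tt => /addIr ->.
have := card_in_imset finj; rewrite cardsX cardsT !card_mx !muln1 => E.
rewrite -E; apply: leq_trans (max_card _) _; by rewrite card_mx muln1.
Qed.

End CountSolutions.

Section RandomPoints.
Variables (K : finFieldType) (m k N : nat).
Hypothesis m0 : (0 < m)%N.
Local Notation q := #|K|.
Implicit Types (c : 'rV[K]_k.+1) (v : {ffun 'I_N -> 'cV[K]_k}).

Definition cf c (l : nat) : K := if insub l is Some o then c 0 o else 0.
(** The random data: [v i] holds the values of [y_1, ..., y_k] at the [i]-th place, while [y_0 = 1]
    is fixed. For this reason the constant coordinate is treated apart below. *)
Definition rpt v (i : 'I_N) (l : nat) : K :=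
  if l is l'.+1 then (if insub l' is Some o then v i o 0 else 0) else 1.
Definition rw v := wpt 1 (fun=> 1) (rpt v).
(** Evaluation at translate [j] of the message shifted down by [a]. The unipotent action on the
    [y_l] is transposed into [1 + shift] on messages, which is [EwS]. *)
Definition Ew v c i j a : K := \sum_(l < k.+1) cf c (l + a) * rw v i j l.
Definition ccol c a : 'cV[K]_k := \col_l cf c (l.+1 + a).

Lemma cf_big c l : (k < l)%N -> cf c l = 0.
Proof. by move=> kl; rewrite /cf insubF // ltnS leqNgt kl. Qed.

Lemma cfE c (l : 'I_k.+1) : cf c l = c 0 l.
Proof. by rewrite /cf valK. Qed.

Lemma Ew0 v c i a : Ew v c i 0 a = cf c a + ((ccol c a)^T *m v i) 0 0.
Proof.
rewrite /Ew big_ord_recl /rw /= mulr1 add0n mxE; congr (_ + _); apply: eq_bigr => l _.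
by rewrite !mxE /bump /= ?add1n ?addSn valK.
Qed.

Lemma EwS v c i j a : Ew v c i j.+1 a = Ew v c i j a + Ew v c i j a.+1.
Proof.
rewrite /Ew; under eq_bigr => l _ do rewrite /rw /= mul1r mulrDr.
rewrite big_split; congr (_ + _); rewrite [LHS]big_ord_recl /= mulr0 add0r.
rewrite [RHS]big_ord_recr /= [cf c (k + _)]cf_big ?mul0r ?addr0; last by rewrite addnS ltnS leq_addr.
by apply: eq_bigr => l _; rewrite /= mul1r /bump /= ?add1n addnS addSn.
Qed.

(** Iterated forward differences: they convert the [m] symbols of a block into the values, at the
    first place of the block, of the [m] shifts of the message, hence into [m] affine conditions on
    [v i]. *)
Fixpoint zz (y : nat -> K) a j : K := if a is a'.+1 then zz y a' j.+1 - zz y a' j else y j.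

Definition yrow (y : 'M[K]_(N, m)) i (j : nat) : K := if insub j is Some o then y i o else 0.

Lemma row_agree v c (y : 'M[K]_(N, m)) i : row i (encw m (rw v) c) = row i y ->
  forall a, (a < m)%N -> Ew v c i 0 a = zz (yrow y i) a 0.
Proof.
move=> E; have E0 j : (j < m)%N -> Ew v c i j 0 = yrow y i j.
  move=> jm; have := congr1 (fun M : 'rV_m => M 0 (Ordinal jm)) E; rewrite !mxE /= => h.
  rewrite /yrow (insubT (fun l => l < m)%N jm) -h; apply: eq_bigr => l _.
  by rewrite addn0 cfE.
suff H a j : (a + j < m)%N -> Ew v c i j a = zz (yrow y i) a j by move=> a am; apply: H; rewrite addn0.
elim: a j => [|a IH] j am; first exact: E0.
by rewrite /= -!IH ?EwS ?addnS //; [rewrite addrC addKr|apply: ltnW].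
Qed.

(* The shifts [S^a c_t], [a < m], [t < L], are independent modulo the constant coordinate. *)
Definition indep L (c : nat -> 'rV[K]_k.+1) := forall be : nat -> nat -> K,
  (forall l, (l < k)%N -> \sum_(t < L) \sum_(a < m) be t a * cf (c t) (l.+1 + a) = 0) ->
  forall t a, (t < L)%N -> (a < m)%N -> be t a = 0.

(** The coordinates [v i] are independent of each other, and at block [i] the messages in [X i]
    impose [m #|X i|] independent affine conditions; their constant parts [cf (c t) a] come from
    [y_0]. *)
Lemma count_pattern L (c : nat -> 'rV[K]_k.+1) (y : 'M[K]_(N, m)) (X : {ffun 'I_N -> {set 'I_L}}) :
  indep L c ->
  (#|[set v : {ffun 'I_N -> 'cV[K]_k} |
      [forall i, forall t in X i, row i (encw m (rw v) (c t)) == row i y]]|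
    * q ^ (m * \sum_i #|X i|) <= q ^ (k * N))%N.
Proof.
move=> ind.
pose T i : {set 'I_L * 'I_m} := setX (X i) setT.
pose S i : {set 'cV[K]_k} := [set x | ([forall ta in T i,
   ((ccol (c ta.1) ta.2)^T *m x) 0 0 == zz (yrow y i) ta.2 0 - cf (c ta.1) ta.2])%R].
have Tc i : #|T i| = (m * #|X i|)%N by rewrite cardsX cardsT card_ord mulnC.
have Sc i : (#|S i| * q ^ (m * #|X i|) <= q ^ k)%N.
  rewrite -Tc; apply: (@count_solutions _ _ _ _ (fun ta : 'I_L * 'I_m => ccol (c ta.1) ta.2)
     (fun ta : 'I_L * 'I_m => zz (yrow y i) ta.2 0 - cf (c ta.1) ta.2)).
  move=> be hbe [t a] tX.
  pose b' (t a : nat) := if insub t is Some t' then if insub a is Some a' then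
     (if (t', a') \in T i then be (t', a') else 0) else 0 else 0.
  have b'E (t2 : 'I_L) (a2 : 'I_m) : b' t2 a2 = if (t2, a2) \in T i then be (t2, a2) else 0.
    by rewrite /b' !valK.
  have -> : be (t, a) = b' t a by rewrite b'E tX.
  apply: ind => // l lk; have := congr1 (fun M : 'cV_k => M (Ordinal lk) 0) hbe.
  rewrite summxE mxE => h0; rewrite -[RHS]h0 (pair_bigA _ (fun (t : 'I_L) (a : 'I_m) => b' t a * cf (c t) (l.+1 + a))) /= [RHS]big_mkcond; apply: eq_bigr => -[t2 a2] _ /=.
  by rewrite b'E; case: ifP => _; rewrite ?mul0r // !mxE.
have sub : [set v : {ffun 'I_N -> 'cV[K]_k} |
      [forall i, forall t in X i, row i (encw m (rw v) (c t)) == row i y]] \subset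
   [set v | v \in family (fun i => mem (S i))].
  apply/subsetP => v; rewrite !inE => /forallP h; apply/familyP => i; rewrite inE.
  apply/forall_inP => -[t a]; rewrite inE /= => /andP[tX _].
  have := row_agree (eqP (forall_inP (h i) t tX)) (ltn_ord a).
  by rewrite Ew0 => <-; rewrite addrC addKr.
apply: leq_trans (leq_mul (subset_leq_card sub) (leqnn _)) _.
rewrite cardsE card_family foldrE big_map big_enum /= big_distrr /= expn_sum -big_split /=.
have -> : (q ^ (k * N) = \prod_(i < N) q ^ k)%N by rewrite prod_nat_const card_ord expnM.
by apply: leq_prod => i _; apply: Sc.
Qed.

Lemma cf_eq0 c : (forall l, cf c l = 0) -> c = 0.
Proof. by move=> h; apply/rowP => l; rewrite -cfE h mxE. Qed.

Lemma cfB c c' l : cf (c - c') l = cf c l - cf c' l.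
Proof. by rewrite /cf; case: insubP => [o _ _|_]; rewrite ?mxE ?subr0. Qed.

Lemma cf_top c : c != 0 -> exists l0, cf c l0 != 0 /\ forall l, (l0 < l)%N -> cf c l = 0.
Proof.
move=> c0; have ex : exists l, cf c l != 0.
  apply: contrapT => h; case/eqP: c0; apply: cf_eq0 => l; apply/eqP; apply: contraT => cl.
  by case: h; exists l.
have ub l : cf c l != 0 -> (l <= k)%N by apply: contraNT; rewrite -ltnNge => /(cf_big c) ->.
case: (ex_maxnP ex ub) => l0 h hm; exists l0; split=> // l lt.
by apply/eqP; apply: contraLR lt => /hm; rewrite -leqNgt.
Qed.

(** In a vanishing combination of shifts take the least shift [a0] that occurs. At position
    [l0 - a0] it shows the top coefficient, while larger shifts look above [l0]; [m <= l0] keeps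
    this position away from the constant coordinate. *)
Lemma shift_zero c (al : nat -> K) l0 : (exists2 a, (a < m)%N & al a != 0) ->
  (forall l, (l < k)%N -> \sum_(a < m) al a * cf c (l.+1 + a) = 0) ->
  (m <= l0)%N -> (forall l, (l0 < l)%N -> cf c l = 0) -> cf c l0 = 0.
Proof.
move=> [a1 a1m al1] h ml top; case: (ltnP k l0) => kl; first exact: cf_big.
have ex : exists a, al a != 0 by exists a1.
case: (ex_minnP ex) => a0 al0 amin.
have a0m : (a0 < m)%N by apply: leq_ltn_trans a1m; apply: amin.
have E : ((l0 - a0).-1.+1 + a0 = l0)%N.
  by rewrite prednK ?subn_gt0 ?subnK //; [apply: ltnW|]; apply: leq_trans ml.
have lk : ((l0 - a0).-1 < k)%N.
  apply: leq_trans kl; rewrite -{2}E addSn ltnS leq_addr //.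
have := h _ lk; rewrite (bigD1 (Ordinal a0m)) //= E big1 ?addr0 => [/eqP|a na].
  by rewrite mulf_eq0 (negPf al0) => /eqP.
have {}na : (a : nat) != a0 by apply: contraNneq na => h'; apply/eqP/val_inj.
case: (ltngtP a a0) na => // aa _; last by rewrite top ?mulr0 // -{1}E ltn_add2l.
suff -> : al a = 0 by rewrite mul0r.
by apply/eqP; apply: contraLR aa => /amin; rewrite -leqNgt.
Qed.

Lemma indep1 c l0 : cf c l0 != 0 -> (forall l, (l0 < l)%N -> cf c l = 0) -> (m <= l0)%N ->
  indep 1 (fun=> c).
Proof.
move=> c0 top ml be h t a; rewrite ltnS leqn0 => /eqP -> am.
apply/eqP; apply: contraT => b0; case/eqP: c0.
apply: (@shift_zero c (be 0%N)) => //; first by exists a.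
by move=> l lk; have := h l lk; rewrite big_ord1.
Qed.

(** If the top index [l0] is below [m], the shift by [l0] is a nonzero constant, which evaluates to
    0 nowhere. Such messages, not covered by [indep1], are thus harmless for the distance. *)
Lemma low_never v c l0 i : cf c l0 != 0 -> (forall l, (l0 < l)%N -> cf c l = 0) -> (l0 < m)%N ->
  row i (encw m (rw v) c) != 0.
Proof.
move=> c0 top lm; apply: contra_neqN c0 => /eqP E.
have := @row_agree v c 0 i; rewrite row0 => /(_ E _ lm); rewrite Ew0.
have -> : ccol c l0 = 0 by apply/colP => l; rewrite !mxE top // addSn ltnS leq_addl.
rewrite trmx0 mul0mx mxE addr0 => ->.
have : forall a j, zz (yrow 0 i) a j = 0 => [|-> //].
elim=> [|a IH] j /=; last by rewrite !IH subrr.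
by rewrite /yrow; case: insubP => // o _ _; rewrite mxE.
Qed.

Definition upd (c : nat -> 'rV[K]_k.+1) t x s := if s == t then x else c s.

(** A message [x] that destroys independence satisfies a relation with [m + t m] coefficients. The
    relation and the first [m] coefficients of [x] determine [x]: by [shift_zero] a nonzero
    difference would have its top index below [m]. *)
Lemma indep_extend t (c : nat -> 'rV[K]_k.+1) : indep t c ->
  (#|[set x | ~~ `[< indep t.+1 (upd c t x) >]]| <= q ^ (m + t * m + m))%N.
Proof.
move=> ind; set A := [set x | _].
have /choice [f fP] : forall x, exists g : {ffun 'I_m -> K} * {ffun 'I_t * 'I_m -> K}, x \in A ->
   (exists2 a, (a < m)%N & (if insub a is Some o then g.1 o else 0) != 0) /\ forall l, (l < k)%N ->
   \sum_a g.1 a * cf x (l.+1 + a) = - \sum_(sa : 'I_t * 'I_m) g.2 sa * cf (c sa.1) (l.+1 + sa.2).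
  move=> x; case: (boolP (x \in A)) => xA; last by exists ([ffun=> 0], [ffun=> 0]).
  move: xA; rewrite inE => /asboolPn /existsNP [be] /not_implyP [h nz].
  have E l : (l < k)%N -> \sum_(a < m) be t a * cf x (l.+1 + a) =
      - \sum_(sa : 'I_t * 'I_m) be sa.1 sa.2 * cf (c sa.1) (l.+1 + sa.2).
    move=> lk; have := h l lk; rewrite big_ord_recr /= /upd eqxx addrC => /eqP; rewrite addr_eq0 => /eqP ->.
    congr (- _); rewrite -(pair_bigA _ (fun (s : 'I_t) (a : 'I_m) => be s a * cf (c s) (l.+1 + a))) /=.
    apply: eq_bigr => s _; apply: eq_bigr => a _; rewrite ifF //.
    by apply/negbTE; rewrite neq_ltn ltn_ord.
  exists ([ffun a : 'I_m => be t a], [ffun sa : 'I_t * 'I_m => be sa.1 sa.2]) => _; split; last first.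
    move=> l lk; under eq_bigr => a _ do rewrite ffunE.
    rewrite E //; congr (- _); apply: eq_bigr => sa _; by rewrite ffunE.
  apply: contrapT => na; have al0 a : (a < m)%N -> be t a = 0.
    move=> am; apply/eqP; apply: contraT => b0; case: na; exists a => //.
    by rewrite (insubT (fun l => l < m)%N am) ffunE.
  apply: nz => s a; rewrite ltnS leq_eqVlt => /orP[/eqP ->|st] am; first exact: al0.
  apply: ind => // l lk.
  have := E l lk; rewrite big1 => [/eqP|b _]; last by rewrite al0 ?mul0r.
  rewrite eq_sym oppr_eq0 -(pair_bigA _ (fun (s : 'I_t) (a : 'I_m) => be s a * cf (c s) (l.+1 + a))) /=.
  by move/eqP.
pose F x := (f x, [ffun l : 'I_m => cf x l]).
have Finj : {in A &, injective F}.
  move=> x x' xA xA' [fE gE].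
  have [nz e1] := fP x xA; have [_ e2] := fP x' xA'; rewrite -fE in e2.
  apply/eqP; rewrite -subr_eq0; apply: contraT => d0.
  have [l0 [dl top]] := cf_top d0; case: (ltnP l0 m) => lm.
    move: dl; rewrite cfB; have := congr1 (fun g : {ffun 'I_m -> K} => g (Ordinal lm)) gE.
    by rewrite !ffunE /= => ->; rewrite subrr eqxx.
  move: dl; rewrite (@shift_zero (x - x') _ l0 nz) ?eqxx // => l lk.
  under eq_bigr => a _ do rewrite valK cfB mulrBr.
  by rewrite sumrB e1 // e2 // subrr.
rewrite -(card_in_imset Finj); apply: leq_trans (max_card _) _.
by rewrite !card_prod !card_ffun !card_prod !card_ord -!expnD.
Qed.

(** Greedy choice by [indep_extend]. Long lists can therefore be excluded by excluding independent
    tuples, to which [count_pattern] applies. *)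
Lemma indep_in (A : {set 'rV[K]_k.+1}) L : (q ^ (m + L * m + m) < #|A|)%N ->
  exists c : nat -> 'rV[K]_k.+1, indep L c /\ forall t, (t < L)%N -> c t \in A.
Proof.
move=> cA; have H t : (t <= L)%N -> exists c : nat -> 'rV[K]_k.+1, indep t c /\ forall s, (s < t)%N -> c s \in A; last exact: H.
elim: t => [|t IH] tL; first by exists (fun=> 0); split.
have [c [ind cin]] := IH (ltnW tL).
have : ~~ (A \subset [set x | ~~ `[< indep t.+1 (upd c t x) >]]).
  apply/negP => /subset_leq_card; rewrite leqNgt; case/negP; apply: leq_ltn_trans cA.
  apply: leq_trans (indep_extend ind) _; rewrite leq_exp2l ?finRing_gt1 // leq_add2r leq_add2l.
  by rewrite leq_mul2r (ltnW tL) orbT.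
case/subsetPn => x xA; rewrite inE negbK => /asboolP indx; exists (upd c t x); split=> // s.
by rewrite ltnS leq_eqVlt /upd => /orP[/eqP ->|st]; rewrite ?eqxx // ifF ?cin //; apply/negbTE; rewrite neq_ltn st.
Qed.

Lemma card_exists (T U : finType) (B : T -> {set U}) :
  (#|[set v | [exists t, v \in B t]]| <= \sum_t #|B t|)%N.
Proof.
have -> : [set v | [exists t, v \in B t]] = \bigcup_t B t.
  by apply/setP => v; rewrite inE; apply/existsP/bigcupP => [[t h]|[t _ h]]; exists t.
elim/big_rec2: _ => [|t n X _ IH]; first by rewrite cards0.
by apply: leq_trans (leq_card_setU _ _) _; rewrite leq_add2l.
Qed.

Definition badset L S0 (y : 'M[K]_(N, m)) (cX : {ffun 'I_L -> 'rV[K]_k.+1} * {ffun 'I_N -> {set 'I_L}}) :=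
  [set v | `[< indep L (fun t => if insub t is Some o then cX.1 o else 0) >] && (S0 <= \sum_i #|cX.2 i|)%N &&
     [forall i, forall t in cX.2 i, row i (encw m (rw v) (cX.1 t)) == row i y]].

Lemma badset_count L S0 y cX : (#|@badset L S0 y cX| * q ^ (m * S0) <= q ^ (k * N))%N.
Proof.
case: (boolP (`[< indep L (fun t => if insub t is Some o then cX.1 o else 0) >] && (S0 <= \sum_i #|cX.2 i|)%N)) => h; last first.
  have -> : badset S0 y cX = set0 by apply/setP => v; rewrite !inE (negPf h).
  by rewrite cards0 mul0n.
have /andP[/asboolP ind le] := h.
apply: leq_trans (count_pattern y cX.2 ind).
apply: leq_mul; last by rewrite leq_exp2l ?finRing_gt1 // leq_mul2l le orbT.
apply: subset_leq_card; apply/subsetP => v; rewrite !inE => /andP[_ /forallP hv].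
apply/forallP => i; apply/forall_inP => t tX; rewrite valK; exact: (forall_inP (hv i)).
Qed.

(** Union bound over received words, [L]-tuples of messages and patterns of agreeing blocks, the
    latter [2 ^ (L N)] in number. *)
Lemma badset_union L S0 (Y : finType) (f : Y -> 'M[K]_(N, m)) :
  (#|[set v | [exists y : Y, exists cX, v \in @badset L S0 (f y) cX]]| * q ^ (m * S0) <=
     #|Y| * (q ^ (k.+1 * L) * 2 ^ (L * N)) * q ^ (k * N))%N.
Proof.
pose B (t : Y * ({ffun 'I_L -> 'rV[K]_k.+1} * {ffun 'I_N -> {set 'I_L}})) := @badset L S0 (f t.1) t.2.
set A := [set v | _].
have sub : A \subset [set v | [exists t, v \in B t]].
  apply/subsetP => v; rewrite !inE => /existsP [y /existsP [cX h]].
  by apply/existsP; exists (y, cX).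
apply: leq_trans (leq_mul (leq_trans (subset_leq_card sub) (card_exists B)) (leqnn _)) _.
rewrite big_distrl /=; apply: leq_trans (leq_sum _ (fun t _ => badset_count S0 (f t.1) t.2)) _.
have cs : #|{: {set 'I_L}}| = (2 ^ L)%N by rewrite -cardsT -powersetT card_powerset cardsT card_ord.
by rewrite sum_nat_const !card_prod !card_ffun cs card_mx !card_ord mul1n -!expnM.
Qed.

Lemma badset_tuple L S1 v (y : 'M[K]_(N, m)) (c : nat -> 'rV[K]_k.+1) : indep L c ->
  (forall t, (t < L)%N -> (S1 <= agree (encw m (rw v) (c t)) y)%N) ->
  exists cX, v \in @badset L (L * S1) y cX.
Proof.
move=> ind h; exists ([ffun t : 'I_L => c t],
  [ffun i => [set t : 'I_L | row i (encw m (rw v) (c t)) == row i y]]).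
rewrite inE /=; apply/andP; split; [apply/andP; split|].
- apply/asboolP => be hbe; apply: ind => l lk; rewrite -[RHS](hbe l lk); apply: eq_bigr => t _.
  by apply: eq_bigr => a _; rewrite valK ffunE.
- under eq_bigr => i _ do rewrite ffunE -sum1_card big_mkcond /=.
  rewrite exchange_big /= -[X in (X * _)%N](card_ord L) -sum_nat_const; apply: leq_sum => t _.
  apply: leq_trans (h t (ltn_ord t)) _; rewrite /agree -sum1_card big_mkcond /=.
  by apply: leq_sum => i _; rewrite !inE.
by apply/forallP => i; apply/forall_inP => t; rewrite !ffunE inE.
Qed.

(** The two assumptions say that at most half of all points spoil the distance and fewer than half
    spoil the list size, so some point does neither. *)
Lemma random_good L S1 S2 : (2 * (q ^ k.+1 * 2 ^ N) <= q ^ (m * S1))%N ->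
  (2 * (q ^ (m * N) * (q ^ (k.+1 * L) * 2 ^ (L * N))) < q ^ (m * (L * S2)))%N ->
  exists v, (forall c : 'rV[K]_k.+1, c != 0 -> (agree (encw m (rw v) c) 0 < S1)%N) /\
    forall y, (#|[set c : 'rV[K]_k.+1 | (S2 <= agree (encw m (rw v) c) y)%N]| <= q ^ (m + L * m + m))%N.
Proof.
move=> h1 h2.
pose A1 := [set v | [exists y : unit, exists cX, v \in @badset 1 (1 * S1) 0 cX]].
pose A2 := [set v | [exists y : 'M[K]_(N, m), exists cX, v \in @badset L (L * S2) y cX]].
have q0 : (0 < q)%N by apply: ltnW; apply: finRing_gt1.
have c1 := @badset_union 1 (1 * S1) unit (fun=> 0).
have c2 := @badset_union L (L * S2) _ (@id 'M[K]_(N, m)).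
have lt : (#|A1 :|: A2| < #|{: {ffun 'I_N -> 'cV[K]_k}}|)%N.
  apply: leq_ltn_trans (leq_card_setU _ _) _; rewrite card_ffun card_mx card_ord muln1 -expnM.
  move: c1 c2; rewrite -/A1 -/A2 card_unit !mul1n muln1 card_mx [(N * m)%N]mulnC => c1 c2.
  have P : (0 < q ^ (k * N))%N by rewrite expn_gt0 q0.
  have d1 : (2 * #|A1| <= q ^ (k * N))%N.
    have Q : (0 < q ^ (m * S1))%N by rewrite expn_gt0 q0.
    rewrite -(leq_pmul2r Q) -mulnA; apply: leq_trans (leq_mul (leqnn 2) c1) _.
    by rewrite mulnA mulnC leq_mul2l h1 orbT.
  have d2 : (2 * #|A2| < q ^ (k * N))%N.
    have Q : (0 < q ^ (m * (L * S2)))%N by rewrite expn_gt0 q0.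
    rewrite -(ltn_pmul2r Q) -mulnA; apply: leq_ltn_trans (leq_mul (leqnn 2) c2) _.
    by rewrite mulnA mulnC ltn_mul2l P h2.
  by move: (#|A1|) (#|A2|) (q ^ (k * N))%N d1 d2; glia.
have [v vn] : exists v, v \notin A1 :|: A2.
  apply/existsP; rewrite -negb_forall; apply/negP => /forallP h.
  have E : A1 :|: A2 = setT by apply/setP => v; rewrite h inE.
  by move: lt; rewrite E cardsT ltnn.
move: vn; rewrite inE negb_or => /andP[n1 n2]; exists v; split=> [c c0|y]; [rewrite ltnNge|rewrite leqNgt]; apply/negP => le.
  have [l0 [cl top]] := cf_top c0; case: (ltnP l0 m) => lm.
    have ag0 : agree (encw m (rw v) c) 0 = 0%N.
      apply/eqP; rewrite cards_eq0; apply/eqP/setP => i; rewrite !inE row0.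
      by rewrite (negPf (low_never v i cl top lm)).
    move: le; rewrite ag0 leqn0 => /eqP S10; move: h1; rewrite S10 muln0 expn0.
    have : (0 < q ^ k.+1 * 2 ^ N)%N by rewrite muln_gt0 !expn_gt0 q0.
    by move: (_ * _)%N; glia.
  move: n1; rewrite inE => /negP; apply; apply/existsP; exists tt; apply/existsP.
  by apply: (badset_tuple (indep1 cl top lm)) => t _.
have [c [ind cin]] := indep_in le.
move: n2; rewrite inE => /negP; apply; apply/existsP; exists y; apply/existsP.
by apply: (badset_tuple ind) => t tL; have := cin t tL; rewrite inE.
Qed.

(** Injectivity alone needs only a union bound over the [q ^ (k + 1) < q ^ (m N)] messages, with
    full agreement as the single pattern. *)
Lemma random_inj : (k.+1 < m * N)%N -> exists v, forall c : 'rV[K]_k.+1, encw m (rw v) c = 0 -> c = 0.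
Proof.
move=> kmN; have q0 : (0 < q)%N by apply: ltnW; apply: finRing_gt1.
pose B c := [set v | `[< indep 1 (fun=> c) >] && (encw m (rw v) c == 0)].
have Bc c : (#|B c| * q ^ (m * N) <= q ^ (k * N))%N.
  case: (boolP `[< indep 1 (fun=> c) >]) => h; last first.
    have -> : B c = set0 by apply/setP => v; rewrite !inE (negPf h).
    by rewrite cards0 mul0n.
  have := count_pattern 0 [ffun=> [set: 'I_1]] (asboolP _ h).
  under eq_bigr => i _ do rewrite ffunE cardsT card_ord.
  rewrite sum1_card card_ord; apply: leq_trans; rewrite leq_mul2r; apply/orP; right.
  apply: subset_leq_card; apply/subsetP => v; rewrite !inE => /andP[_ /eqP E].
  by apply/forallP => i; apply/forall_inP => t _; rewrite E.
pose A := [set v | [exists c, v \in B c]].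
have lt : (#|A| < #|{: {ffun 'I_N -> 'cV[K]_k}}|)%N.
  rewrite card_ffun card_mx card_ord muln1 -expnM.
  have Q : (0 < q ^ (m * N))%N by rewrite expn_gt0 q0.
  rewrite -(ltn_pmul2r Q); apply: leq_ltn_trans (leq_mul (card_exists B) (leqnn _)) _.
  rewrite big_distrl /=; apply: leq_ltn_trans (leq_sum _ (fun t _ => Bc t)) _.
  rewrite sum_nat_const card_mx mul1n mulnC ltn_mul2l expn_gt0 q0 /=.
  by rewrite ltn_exp2l ?finRing_gt1.
have [v vn] : exists v, v \notin A.
  apply/existsP; rewrite -negb_forall; apply/negP => /forallP h.
  have E : A = setT by apply/setP => v; rewrite h inE.
  by move: lt; rewrite E cardsT ltnn.
have N0 : (0 < N)%N by move: kmN; case: (N) => //; rewrite muln0.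
exists v => c E; apply/eqP; apply: contraT => c0.
have [l0 [cl top]] := cf_top c0; case: (ltnP l0 m) => lm.
  by have := low_never v (Ordinal N0) cl top lm; rewrite E row0 eqxx.
move: vn; rewrite inE => /negP; case; apply/existsP; exists c; rewrite inE E eqxx andbT.
by apply/asboolP; apply: indep1 cl top lm.
Qed.

End RandomPoints.

(** The list size is fixed before the length. *)
Definition good_family (K : finFieldType) (m : nat) (R0 : realFieldType) (R rho tau : R0) : Prop :=
  exists L0, forall N0, exists N k0 (w : 'I_N -> nat -> nat -> K),
    [/\ (N0 <= N)%N, (0 < N)%N, realised m k0 w & good_code m k0 w R rho tau L0].

(** * Parameters of random codes *)

Section CaseB.
Variables (K : finFieldType) (p e r m : nat) (R0 : archiRealFieldType) (R rho tau : R0).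
Hypotheses (pp : prime p) (Kp : #|K| = (p ^ e)%N) (e0 : (0 < e)%N) (r2 : (2 <= r)%N)
  (Kr : #|K| = (r ^ 4)%N) (m0 : (0 < m)%N) (R_gt0 : 0 < R) (R_lt1 : R < 1).

Lemma nat_ceil (x : R0) : 0 <= x -> exists n : nat, x <= n.+1%:R <= x + 1.
Proof.
move=> x0; exists (Num.truncn x); have /andP[h1 h2] := Num.Theory.truncn_itv x0.
by rewrite (ltW h2) -natr1 lerD2r h1.
Qed.

Let q4 : (4 <= #|K|)%N.
Proof. by rewrite Kr; apply: leq_trans (_ : 2 ^ 4 <= _)%N => //; rewrite leq_exp2r. Qed.

Let mgt0 : (0 : R0) < m%:R. Proof. by rewrite ltr0n. Qed.
Lemma rw_realised N k (v : {ffun 'I_N -> 'cV[K]_k}) : (0 < N)%N -> realised m k (rw v).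
Proof.
move=> N0; apply: (realised_eq (w := unip_pt (rpt v))); last exact: (unip_realised pp Kp e0 q4).
by move=> i j l _; rewrite /rw wpt_unip.
Qed.

Lemma agree_full N (M M' : 'M[K]_(N, m)) : (N <= agree M M')%N -> M = M'.
Proof.
move=> le; have E : [set i | row i M == row i M'] = setT.
  by apply/eqP; rewrite eqEcard subsetT cardsT card_ord.
by apply/row_matrixP => i; have := in_setT i; rewrite -E inE => /eqP.
Qed.

(** For [tau <= 0] only full agreement counts, so injectivity bounds the list by 1. The constant
    [n1] makes [(1 - R) m N] exceed the rounding of the dimension. *)
Lemma caseB_trivial : 1 <= rho -> tau <= 0 -> good_family K m R rho tau.
Proof.
move=> rho1 tau0; exists 1%N => N0.
have [n1 n1P] : exists n1 : nat, 2 <= (1 - R) * n1%:R.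
  have R1 : 0 < 1 - R by rewrite subr_gt0.
  have [n /andP[h _]] := nat_ceil (divr_ge0 (ler0n R0 2) (ltW R1)).
  by exists n.+1; rewrite [_ * n.+1%:R]mulrC -ler_pdivrMr.
pose N := (N0 + n1).+1.
have [k /andP[k1 k2]] : exists k : nat, R * (m * N)%:R <= k.+1%:R <= R * (m * N)%:R + 1.
  by apply: nat_ceil; rewrite mulr_ge0 // ltW.
have kmN : (k.+1 < m * N)%N.
  rewrite -(ltr_nat R0); apply: le_lt_trans k2 _; rewrite -ltrBrDl.
  have : n1%:R < (m * N)%:R :> R0.
    by rewrite ltr_nat; apply: leq_trans (_ : 1 * N <= _)%N; rewrite ?leq_mul2r ?m0 ?orbT // mul1n ltnS leq_addl.
  move: ((m * N)%:R : R0) => x hx; have := mulr_gt0 (_ : 0 < 1 - R) (_ : 0 < x - n1%:R).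
  by rewrite !subr_gt0 => /(_ R_lt1 hx); lra.
have [v vP] := random_inj K kmN.
exists N, k, (rw v); split=> //; first by rewrite leqW // leq_addr.
  exact: rw_realised.
split=> // [c _|y].
  apply: le_trans (_ : N%:R <= _); last by rewrite ler_peMl.
  by rewrite ler_nat /agree -[X in (_ <= X)%N]card_ord max_card.
apply/card_le1_eqP => c c'; rewrite !inE => hc hc'.
have full (c2 : 'rV[K]_k.+1) : (1 - tau) * N%:R <= (agree (encw m (rw v) c2) y)%:R -> encw m (rw v) c2 = y.
  move=> h; apply: agree_full; rewrite -(ler_nat R0); apply: le_trans h.
  by rewrite ler_peMl // lerBrDr gerDl.
apply/eqP; rewrite -subr_eq0; apply/eqP; apply: vP; by rewrite encwB (full _ hc) (full _ hc') subrr.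
Qed.

(** Exponents to base [r] are compared, with [q = r ^ 4] and [2 <= r]: messages cost [4 R m N],
    patterns [N], and agreements gain [4 m] per block. The excesses [e1] and [e2] are what remains
    per block; [L] is chosen so that [L e2] also pays for the [4 m N] of the received word, and [n1]
    so that rounding is absorbed. *)
Lemma caseB_random : 1 < 4 * m%:R * (rho - R) -> 1 < 4 * m%:R * (1 - tau - R) -> rho < 1 -> tau <= 1 ->
  good_family K m R rho tau.
Proof.
move=> h1 h2 rho1 tau1.
have r0 : (0 < r)%N by apply: leq_trans r2.
set e1 := 4 * m%:R * (rho - R) - 1; set e2 := 4 * m%:R * (1 - tau - R) - 1.
have e1p : 0 < e1 by rewrite /e1 subr_gt0.
have e2p : 0 < e2 by rewrite /e2 subr_gt0.
have [L1 LP] : exists L1 : nat, 4 * m%:R + 1 <= e2 * L1.+1%:R.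
  have ge : 0 <= (4 * m%:R + 1) / e2 by apply: divr_ge0; [by rewrite addr_ge0 ?mulr_ge0|exact: ltW].
  have [n /andP[h _]] := nat_ceil ge.
  by exists n; rewrite [e2 * _]mulrC -ler_pdivrMr.
set L := L1.+1 in LP.
have [n1 n1P] : exists n1 : nat, 5 <= e1 * n1%:R.
  have [n /andP[h _]] := nat_ceil (divr_ge0 (ler0n R0 5) (ltW e1p)).
  by exists n.+1; rewrite [_ * n.+1%:R]mulrC -ler_pdivrMr.
have rho0 : 0 < rho.
  have : 0 < 4 * m%:R * (rho - R) by apply: lt_trans h1.
  by rewrite pmulr_rgt0 ?mulr_gt0 // subr_gt0; apply: lt_trans.
exists (#|K| ^ (m + L * m + m))%N => N0.
pose N := (N0 + n1 + (4 * m * L + 4 * L + 1)).+1.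
have [k /andP[k1 k2]] : exists k : nat, R * (m * N)%:R <= k.+1%:R <= R * (m * N)%:R + 1.
  by apply: nat_ceil; rewrite mulr_ge0 // ltW.
have rN : 0 <= rho * N%:R by rewrite mulr_ge0 // ltW.
have tN : 0 <= (1 - tau) * N%:R by rewrite mulr_ge0 // subr_ge0.
pose S1 := (Num.truncn (rho * N%:R)).+1.
pose S2 := Num.truncn ((1 - tau) * N%:R).
have /andP[s1 s1'] := Num.Theory.truncn_itv rN; have /andP[s2 s2'] := Num.Theory.truncn_itv tN.
have pow a b : (a <= b)%N -> (r ^ a <= r ^ b)%N by move=> h; rewrite leq_exp2l.
have two n : (2 ^ n <= r ^ n)%N.
  by case: n => // n; rewrite leq_exp2r.
have N1 : n1%:R <= N%:R :> R0 by rewrite ler_nat leqW // -addnA addnCA leq_addr.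
have N2 : (4 * m%:R * L%:R + 4 * L%:R + 1) < N%:R :> R0.
  have : ((4 * m * L + 4 * L + 1)%:R : R0) < N%:R by rewrite ltr_nat ltnS leq_addl.
  by rewrite !natrD !natrM.
have L0 : (0 : R0) < L%:R by rewrite ltr0n.
rewrite natrM in k2.
have [v [v1 v2]] : exists v : {ffun 'I_N -> 'cV[K]_k}, (forall c : 'rV[K]_k.+1, c != 0 -> (agree (encw m (rw v) c) 0 < S1)%N) /\
    forall y, (#|[set c : 'rV[K]_k.+1 | (S2 <= agree (encw m (rw v) c) y)%N]| <= #|K| ^ (m + L * m + m))%N.
  apply: random_good => //; rewrite Kr -!expnM.
    apply: leq_trans (_ : r ^ (1 + (4 * k.+1 + N)) <= _)%N.
      by rewrite !expnD expn1 leq_mul // leq_mul // two.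
    apply: pow; rewrite -(ler_nat R0) !natrD !natrM.
    move: s1'; rewrite -/S1 => s1'.
    have : e1 * n1%:R <= e1 * N%:R by rewrite ler_pM2l.
    have : m%:R * (rho * N%:R) <= m%:R * S1%:R by rewrite ler_pM2l // ltW.
    by move: (N%:R : R0) (S1%:R : R0) (k.+1%:R : R0) (n1%:R : R0) n1P k2; rewrite /e1 => *; lra.
  apply: leq_ltn_trans (_ : r ^ (1 + (4 * (m * N) + (4 * (k.+1 * L) + L * N))) < _)%N.
    by rewrite !expnD expn1 leq_mul // leq_mul // leq_mul // two.
  rewrite ltn_exp2l // -(ltr_nat R0) !natrD !natrM.
  have : (1 - tau) * N%:R - 1 <= S2%:R by move: s2'; rewrite -/S2 -natr1; lra.
  have : (4 * m%:R + 1) * N%:R <= e2 * L%:R * N%:R by rewrite ler_pM2r ?ltr0n.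
  rewrite /e2.
  move: (N%:R : R0) (S2%:R : R0) (k.+1%:R : R0) (L%:R : R0) (m%:R : R0) mgt0 L0 N2 k2 => n s k' l mm mm0 l0 N2' k2' h3 h4.
  have : mm * l * ((1 - tau) * n - 1) <= mm * l * s by rewrite ler_pM2l // mulr_gt0.
  have : l * k' <= l * (R * (mm * n) + 1) by rewrite ler_pM2l.
  by move=> *; lra.
exists N, k, (rw v); split=> //.
- by rewrite /N -addnS -addnA leq_addr.
- exact: rw_realised.
split=> //.
- move=> c E; apply/eqP; apply: contraT => /v1; rewrite E ltnNge; case/negP.
  have -> : agree (0 : 'M[K]_(N, m)) 0 = N.
    by rewrite /agree -[RHS]card_ord -cardsT; congr #|pred_of_set _|; apply/setP => i; rewrite !inE eqxx.
  rewrite /S1 -(ltr_nat R0); apply: le_lt_trans s1 _; by rewrite gtr_pMl // ltr0n.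
- move=> c /v1; rewrite /S1 ltnS => h; apply: le_trans s1; by rewrite ler_nat.
move=> y; apply: leq_trans (v2 y); apply: subset_leq_card; apply/subsetP => c; rewrite !inE => h.
by rewrite -(ler_nat R0); apply: le_trans s2 h.
Qed.

End CaseB.

(** * Filtrations and dimensions along an Artin-Schreier step *)

Section Filtrations.
Variables (K F : fieldType) (em : {rmorphism K -> F}).

(* [G e] plays the role of the elements of order at least [e] at a set of places. *)
Record filt (G : int -> F -> Prop) : Prop := Filt {
  filtD : forall e x y, G e x -> G e y -> G e (x + y);
  filtK : forall e a x, G e x -> G e (em a * x);
  filtW : forall e e' x, e' <= e -> G e x -> G e' x;
  filtM : forall e e' x y, G e x -> G e' y -> G (e + e') (x * y);
  filt1 : G 0 1;
  filt0 : forall e, G e 0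
}.

Variable G : int -> F -> Prop.
Hypothesis GP : filt G.

Lemma filtN e x : G e x -> G e (- x).
Proof. by move=> h; rewrite -mulN1r -(rmorph1 em) -rmorphN; exact: filtK. Qed.

Lemma filtB e x y : G e x -> G e y -> G e (x - y).
Proof. by move=> hx hy; apply: filtD => //; exact: filtN. Qed.

Lemma filtC a : G 0 (em a).
Proof. by rewrite -[em a]mulr1; apply: filtK => //; exact: filt1. Qed.

Lemma filtX e x n : G e x -> G (e *+ n) (x ^+ n).
Proof.
by move=> h; elim: n => [|n IH]; rewrite ?mulrS ?exprS; [exact: filt1|exact: filtM].
Qed.

Lemma filt_sum e (I : Type) (r : seq I) (P : pred I) (f : I -> F) :
  (forall i, P i -> G e (f i)) -> G e (\sum_(i <- r | P i) f i).
Proof. by move=> h; elim/big_rec: _ => [|i x /h]; [exact: filt0|exact: filtD]. Qed.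

End Filtrations.

Lemma hom_filt (K F : fieldType) (em : {rmorphism K -> F}) (L : laurent K) (H : {rmorphism F -> L}) :
  (forall a, H (em a) = lcst L a) -> filt em (fun e x => vge (@lval _ L) e (H x)).
Proof.
move=> HE; have vP := lvalP L; split.
- by move=> e x y hx hy; rewrite rmorphD (vgeD vP).
- by move=> e a x hx; rewrite rmorphM HE; have := vgeM vP (lcst_vge L a) hx; rewrite add0r.
- by move=> e e' x le; apply: vge_le.
- by move=> e e' x y hx hy; rewrite rmorphM (vgeM vP).
- by rewrite rmorph1 (vge1 vP).
by move=> e; rewrite rmorph0 vge0.
Qed.

Section Step.
Variables (K F F' : fieldType) (em : {rmorphism K -> F}) (i : {rmorphism F -> F'}) (Q : nat) (u : F) (y : F').
Hypotheses (Q1 : (1 < Q)%N) (QF : [pchar F].-nat Q) (yE : y ^+ Q + y = i u)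
  (span : forall z, exists c : nat -> F, z = \sum_(j < Q) i (c j) * y ^+ j)
  (uniq : forall c : nat -> F, \sum_(j < Q) i (c j) * y ^+ j = 0 -> forall j, (j < Q)%N -> c j = 0).

Local Notation em' := ([the {rmorphism K -> F'} of i \o em]).
Let Q0 : (0 < Q)%N. Proof. exact: ltnW. Qed.

Section Shift.
Variable b : F.
Local Notation rr := (y + i b).

Lemma shift_eq : rr ^+ Q + rr = i (u + b ^+ Q + b).
Proof.
rewrite exprDn_pchar ?(eq_pnat _ (fmorph_pchar i)) // !rmorphD rmorphXn -yE; ring.
Qed.

Lemma horner_shift (f : {poly F}) : (map_poly i (f \Po ('X - b%:P))).[rr] = (map_poly i f).[y].
Proof.
rewrite map_comp_poly horner_comp rmorphB /= map_polyX map_polyC hornerD hornerN hornerX hornerC addrK //.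
Qed.

Lemma horner_sum (f : {poly F}) z : (size f <= Q)%N ->
  (map_poly i f).[z] = \sum_(j < Q) i f`_j * z ^+ j.
Proof.
move=> sf; rewrite (horner_coef_wide _ (_ : size (map_poly i f) <= Q)%N) ?size_map_poly //.
by apply: eq_bigr => j _; rewrite coef_map.
Qed.

Lemma size_comp_shift (f : {poly F}) a : size (f \Po ('X - a%:P)) = size f.
Proof. by rewrite size_comp_poly2 // size_XsubC. Qed.

Lemma span_shift z : exists c : nat -> F, z = \sum_(j < Q) i (c j) * rr ^+ j.
Proof.
have [c ->] := span z; pose f := \poly_(j < Q) c j.
have sf : (size f <= Q)%N by exact: size_poly.
exists (fun j => (f \Po ('X - b%:P))`_j).
rewrite -horner_sum ?size_comp_shift // horner_shift horner_sum //.
by apply: eq_bigr => j _; rewrite coef_poly ltn_ord.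
Qed.

Lemma uniq_shift (c : nat -> F) : \sum_(j < Q) i (c j) * rr ^+ j = 0 -> forall j, (j < Q)%N -> c j = 0.
Proof.
move=> h j jQ; pose f := \poly_(j < Q) c j.
have sf : (size f <= Q)%N by exact: size_poly.
pose g := f \Po ('X + b%:P).
have sg : (size g <= Q)%N by rewrite /g size_comp_poly2 ?size_XaddC.
have g0 : g = 0.
  apply/polyP => l; rewrite coef0; case: (ltnP l Q) => lQ; last by rewrite nth_default // (leq_trans sg).
  apply: (uniq (c := fun l => g`_l)) lQ; rewrite -horner_sum //.
  rewrite /g map_comp_poly horner_comp rmorphD /= map_polyX map_polyC hornerD hornerX hornerC horner_sum //.
  by rewrite -[RHS]h; apply: eq_bigr => l' _; rewrite coef_poly ltn_ord.
have f0 : f = 0.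
  apply/eqP; rewrite -size_poly_eq0; have := size_comp_poly2 f (size_XaddC b).
  by rewrite -/g g0 size_poly0 => <-.
by have := congr1 (fun f : {poly F} => f`_j) f0; rewrite coef_poly jQ coef0.
Qed.

Lemma coef_shift_uniq (c d : nat -> F) : \sum_(j < Q) i (c j) * rr ^+ j = \sum_(j < Q) i (d j) * rr ^+ j ->
  forall j, (j < Q)%N -> c j = d j.
Proof.
move=> h j jQ; apply/eqP; rewrite -subr_eq0; apply/eqP.
apply: (uniq_shift (c := fun j => c j - d j)) jQ; under eq_bigr => l _ do rewrite rmorphB mulrBl.
by rewrite sumrB h subrr.
Qed.

Variables (mu : int) (G : int -> F -> Prop).
Hypotheses (mu0 : 0 <= mu) (GP : filt em G) (bmu : G (- mu) (u + b ^+ Q + b)).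

(** Extension of [G] to the next field, where [F] is measured in the scale [Q] and [rr] is given
    order [-mu]. The ramified step has [b = 0] and [mu > 0]; the unramified one has [mu = 0], after
    a shift that makes [u + b ^ Q + b] integral, and keeps the scale [Q]. *)
Definition stepG e z := exists (c : nat -> F) (d : nat -> int),
  z = \sum_(l < Q) i (c l) * rr ^+ l /\
  forall l, (l < Q)%N -> G (d l) (c l) /\ e <= Q%:Z * d l - l%:Z * mu.

Lemma stepG0 e : stepG e 0.
Proof.
exists (fun=> 0), (fun l => `|e| + l%:Z * mu); split.
  by rewrite big1 // => l _; rewrite rmorph0 mul0r.
move=> l lQ; split; first exact: (filt0 GP).
have : e <= `|e| by exact: ler_norm.
by have : 0 <= `|e| by []; move: (`|e|) => x; nia.
Qed.

Lemma stepG_mono e d c l : (l < Q)%N -> G d c -> e <= Q%:Z * d - l%:Z * mu -> stepG e (i c * rr ^+ l).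
Proof.
move=> lQ Gc le; have [c0 [d0 [_ h0]]] := stepG0 e.
exists (fun j => if j == l then c else 0), (fun j => if j == l then d else `|e| + j%:Z * mu); split.
  rewrite (bigD1 (Ordinal lQ)) //= eqxx big1 ?addr0 // => j jl.
  by rewrite ifF ?rmorph0 ?mul0r //; apply: contraNF jl => /eqP h; apply/eqP/val_inj.
move=> j jQ; case: eqP => [->|_] //; split; first exact: (filt0 GP).
have : e <= `|e| by exact: ler_norm.
by have : 0 <= `|e| by []; move: (`|e|) => x; nia.
Qed.

Lemma stepG_add e x z : stepG e x -> stepG e z -> stepG e (x + z).
Proof.
case=> c [d [-> h]] [c' [d' [-> h']]].
exists (fun l => c l + c' l), (fun l => Num.min (d l) (d' l)); split.
  by rewrite -big_split; apply: eq_bigr => l _; rewrite rmorphD mulrDl.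
move=> l lQ; have [g1 e1] := h l lQ; have [g2 e2] := h' l lQ; split.
  by apply: (filtD GP); [apply: (filtW GP _ g1)|apply: (filtW GP _ g2)]; rewrite ge_min lexx ?orbT.
by case: (leP (d l) (d' l)) => _.
Qed.

Lemma stepG_sum e (I : Type) (r : seq I) (P : pred I) (f : I -> F') :
  (forall j, P j -> stepG e (f j)) -> stepG e (\sum_(j <- r | P j) f j).
Proof. by move=> h; elim/big_rec: _ => [|j x /h]; [exact: stepG0|exact: stepG_add]. Qed.

(** Powers of [rr] from [Q] on are reduced by [rr ^ Q = (u + b ^ Q + b) - rr]. This preserves
    orders: the bracket has order at least [-Q mu], the order given to [rr ^ Q], and [rr] a larger
    one. *)
Lemma stepG_filt : filt em' stepG.
Proof.
split; [exact: stepG_add| | | | |exact: stepG0].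
- move=> e a x [c [d [-> h]]]; exists (fun l => em a * c l), d; split.
    by rewrite mulr_sumr; apply: eq_bigr => l _; rewrite rmorphM mulrA.
  by move=> l lQ; have [g le] := h l lQ; split=> //; exact: (filtK GP).
- move=> e e' x le [c [d [-> h]]]; exists c, d; split=> // l lQ; have [g le'] := h l lQ.
  by split=> //; apply: le_trans le'.
- move=> e e' x z [c [d [-> h]]] [c' [d' [-> h']]].
  rewrite mulr_suml; apply: stepG_sum => l _; rewrite mulr_sumr; apply: stepG_sum => l' _.
  have [g1 e1] := h l (ltn_ord l); have [g2 e2] := h' l' (ltn_ord l').
  have -> : i (c l) * rr ^+ l * (i (c' l') * rr ^+ l') = i (c l * c' l') * rr ^+ (l + l').
    by rewrite exprD rmorphM; ring.
  have g12 := filtM GP g1 g2.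
  case: (ltnP (l + l') Q) => lQ.
    apply: (stepG_mono lQ g12); move: (d l) (d' l') e1 e2; clear -mu0; move=> a a'; nia.
  have tQ : ((l + l' - Q).+1 < Q)%N by have := ltn_ord l; have := ltn_ord l'; lia.
  have tE : l%:Z * mu + l'%:Z * mu = (l + l' - Q)%:Z * mu + Q%:Z * mu.
    by rewrite -!mulrDl -!PoszD subnK.
  have -> : rr ^+ (l + l') = rr ^+ (l + l' - Q) * (i (u + b ^+ Q + b) - rr).
    by rewrite -shift_eq addrK -exprD subnK.
  have -> : i (c l * c' l') * (rr ^+ (l + l' - Q) * (i (u + b ^+ Q + b) - rr)) =
     i (c l * c' l' * (u + b ^+ Q + b)) * rr ^+ (l + l' - Q) - i (c l * c' l') * rr ^+ (l + l' - Q).+1.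
    by rewrite rmorphM exprS; ring.
  apply: stepG_add.
    apply: (stepG_mono (ltnW tQ) (filtM GP g12 bmu)).
    by rewrite !mulrDr mulrN; move: (Q%:Z * _) (Q%:Z * _) (Q%:Z * _) e1 e2 tE; clear; lia.
  rewrite -mulNr -rmorphN; apply: (stepG_mono tQ (filtN GP g12)).
  have : 0 <= (Q%:Z - 1) * mu by rewrite mulr_ge0 // subr_ge0 lez_nat.
  rewrite mulrBl mul1r mulrDr -addn1 PoszD mulrDl mul1r.
  by move: (Q%:Z * _) (Q%:Z * _) (Q%:Z * _) e1 e2 tE; clear; lia.
have := @stepG_mono 0 0 1 0%N Q0 (filt1 GP); rewrite rmorph1 mul1r expr0; apply.
by rewrite mulr0 mul0r subr0.
Qed.

Lemma stepG_emb d a : G d a -> stepG (Q%:Z * d) (i a).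
Proof.
move=> g; have := @stepG_mono (Q%:Z * d) d a 0%N Q0 g; rewrite expr0 mulr1; apply.
by rewrite mul0r subr0.
Qed.

Lemma stepG_rr : stepG (- mu) rr.
Proof.
have := @stepG_mono (- mu) 0 1 1%N Q1 (filt1 GP); rewrite rmorph1 mul1r expr1; apply.
by rewrite mulr0 mul1r add0r.
Qed.

Lemma stepG_down e a : stepG e (i a) -> exists2 d, G d a & e <= Q%:Z * d.
Proof.
case=> c [d [E h]]; have [g le] := h _ Q0; exists (d 0%N); last by rewrite mul0r subr0 in le.
suff -> : a = c 0%N by [].
have := @coef_shift_uniq (fun j => if j == 0%N then a else 0) c _ 0%N Q0; apply.
rewrite -E (bigD1 (Ordinal Q0)) //= mulr1 big1 ?addr0 // => j j0.
by rewrite ifF ?rmorph0 ?mul0r //; apply: contraNF j0 => /eqP h'; apply/eqP/val_inj.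
Qed.

Lemma stepG_tau (t : {rmorphism F' -> F'}) be e z : (forall a, t (i a) = i a) -> t y = y + i (em be) ->
  stepG e z -> stepG e (t z).
Proof.
move=> ti ty [c [d [-> h]]]; rewrite rmorph_sum; apply: stepG_sum => l _.
rewrite rmorphM ti rmorphXn rmorphD ti ty -addrA [i (em be) + _]addrC addrA exprDn mulr_sumr.
apply: stepG_sum => j _; have [g le] := h l (ltn_ord l).
have jl : (j <= l)%N by rewrite -ltnS.
have -> : i (c l) * (rr ^+ (l - j) * i (em be) ^+ j *+ 'C(l, j)) =
   i (em (be ^+ j *+ 'C(l, j)) * c l) * rr ^+ (l - j).
  by rewrite rmorphM 2!rmorphMn 2!rmorphXn mulrnAr 2!mulrnAl; congr (_ *+ _); ring.
apply: (stepG_mono (d := d l)); [exact: leq_ltn_trans (leq_subr _ _) (ltn_ord l)|exact: (filtK GP)|].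
by move: (d l) (nat_of_ord l) (nat_of_ord j) jl le; clear -mu0; intros; nia.
Qed.

End Shift.
End Step.

(** * Counting dimensions *)

Section Dimension.
Variables (K F : fieldType) (em : {rmorphism K -> F}).

Definition ksub (P : F -> Prop) := P 0 /\ forall a x y, P x -> P y -> P (em a * x + y).

Definition kfree (I : finType) (b : I -> F) :=
  forall a : I -> K, \sum_t em (a t) * b t = 0 -> forall t, a t = 0.

(** A lower bound by an integer, possibly negative, so that bounds can be subtracted freely. *)
Definition dimge (P : F -> Prop) (z : int) :=
  exists n (b : 'I_n -> F), [/\ z <= n%:Z, kfree b & forall t, P (b t)].

(** The functionals need to be linear on [P] only. Passing to their common kernel lowers the
    dimension by at most [#|J|], also inside a subspace ([dim_cut]). *)
Definition cutby (J : finType) (P P' : F -> Prop) := exists phi : J -> F -> K,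
  (forall j a x y, P x -> P y -> phi j (em a * x + y) = a * phi j x + phi j y) /\
  forall x, P x -> (forall j, phi j x = 0) -> P' x.

Lemma ksub_sum P (I : finType) (A : pred I) (a : I -> K) (b : I -> F) : ksub P ->
  (forall t, P (b t)) -> P (\sum_(t | A t) em (a t) * b t).
Proof. by case=> P0 PS Pb; elim/big_rec: _ => // t x _; exact: PS. Qed.

Lemma ksubD P x y : ksub P -> P x -> P y -> P (x + y).
Proof. by case=> P0 PS Px Py; rewrite -[x]mul1r -(rmorph1 em); exact: PS. Qed.

Lemma ksubZ P a x : ksub P -> P x -> P (em a * x).
Proof. by case=> P0 PS Px; rewrite -[em a * x]addr0; exact: PS. Qed.

Lemma ksubI P P' : ksub P -> ksub P' -> ksub (fun x => P x /\ P' x).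
Proof. by move=> [h1 h2] [h3 h4]; split=> // a x y [? ?] [? ?]; split; [exact: h2|exact: h4]. Qed.

Lemma dimge_fin P (I : finType) (b : I -> F) z : z <= #|I|%:Z -> kfree b -> (forall t, P (b t)) -> dimge P z.
Proof.
move=> zI fb Pb; exists #|I|, (fun t => b (enum_val t)); split=> // a h t.
rewrite -[t]enum_valK; apply: (fb (fun x => a (enum_rank x))).
rewrite (reindex _ (onW_bij _ (@enum_val_bij I))) -[RHS]h /=; apply: eq_bigr => x _.
by rewrite enum_valK.
Qed.

Lemma dimge_sub (P P' : F -> Prop) z z' : (forall x, P x -> P' x) -> z' <= z -> dimge P z -> dimge P' z'.
Proof.
move=> PP zz [n [b [h1 h2 h3]]]; exists n, b; split=> // [|t]; first exact: le_trans h1.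
exact: PP.
Qed.

Lemma dim_cut (J : finType) (P P' Q : F -> Prop) z : ksub P -> ksub Q -> cutby J P P' ->
  dimge (fun x => P x /\ Q x) z -> dimge (fun x => P' x /\ Q x) (z - #|J|%:Z).
Proof.
move=> sP sQ [phi [lin ker]] [n [b [zn fb Pb]]].
have linS j (I : finType) (a : I -> K) (c : I -> F) : (forall t, P (c t)) ->
    phi j (\sum_t em (a t) * c t) = \sum_t a t * phi j (c t).
  move=> Pc; have p0 : phi j 0 = 0.
    by have := lin j 1 0 0 sP.1 sP.1; rewrite mulr0 addr0 mul1r => /eqP; rewrite -subr_eq subrr eq_sym => /eqP.
  suff [] : P (\sum_t em (a t) * c t) /\ phi j (\sum_t em (a t) * c t) = \sum_t a t * phi j (c t) by [].
  elim/big_rec2: _ => [|t x y _ [Px E]]; first by split; [exact: sP.1|].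
  by split; [apply: sP.2|rewrite lin // E].
pose A : 'M[K]_(n, #|J|) := \matrix_(t, j) phi (enum_val j) (b t).
pose B := row_base (kermx A).
have BA : B *m A = 0.
  by apply/sub_kermxP; rewrite eq_row_base.
have fB : row_free B by exact: row_base_free.
exists (\rank (kermx A)), (fun s => \sum_t em (B s t) * b t); split.
- have := mxrank_ker A; have := rank_leq_col A; move: (\rank A) (\rank (kermx A)) zn => x y; lia.
- move=> a h s; pose ar := \row_s a s.
  have : ar *m B = 0.
    apply/rowP => t; rewrite !mxE; apply: (fb (fun t => \sum_j ar 0 j * B j t)) => //.
    rewrite -[RHS]h; under eq_bigr => t' _ do rewrite rmorph_sum mulr_suml.
    rewrite exchange_big; apply: eq_bigr => s' _ /=; rewrite mulr_sumr; apply: eq_bigr => t' _.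
    by rewrite mxE rmorphM mulrA.
  have /row_freeP [C BC] := fB; move/(congr1 (mulmx^~ C)) => /=; rewrite -mulmxA BC mulmx1 mul0mx => E.
  by have := congr1 (fun M : 'rV_ _ => M 0 s) E; rewrite !mxE.
move=> s; have PS : P (\sum_t em (B s t) * b t) by apply: ksub_sum => // t; case: (Pb t).
split; last by apply: ksub_sum => // t; case: (Pb t).
apply: ker => // j; rewrite linS => [|t]; last by case: (Pb t).
have := congr1 (fun M : 'M_(_, _) => M s (enum_rank j)) BA; rewrite !mxE => h0; rewrite -[RHS]h0.
by apply: eq_bigr => t _; rewrite [A _ _]mxE enum_rankK.
Qed.

Lemma dim_cut_iter (J : finType) (L : int -> F -> Prop) (Q : F -> Prop) d z (a : nat) :
  (forall d, ksub (L d)) -> ksub Q -> (forall d, cutby J (L d) (L (d - 1))) ->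
  dimge (fun x => L d x /\ Q x) z -> dimge (fun x => L (d - a%:Z) x /\ Q x) (z - (a * #|J|)%:Z).
Proof.
move=> sL sQ cL; elim: a => [|a IH] h; first by rewrite mul0n !subr0.
have := dim_cut (sL _) sQ (cL (d - a%:Z)) (IH h).
have -> : d - a%:Z - 1 = d - a.+1%:Z by lia.
by have -> : z - (a * #|J|)%:Z - #|J|%:Z = z - (a.+1 * #|J|)%:Z by rewrite mulSn; move: (a * #|J|)%N (#|J|); glia.
Qed.

End Dimension.

(** One functional: multiply by an element of order [d] and take the residue. *)
Lemma hom_cut (K F : fieldType) (em : {rmorphism K -> F}) (L : laurent K) (H : {rmorphism F -> L}) d :
  (forall a, H (em a) = lcst L a) ->
  cutby em unit (fun x => vge (@lval _ L) (- d) (H x)) (fun x => vge (@lval _ L) (- (d - 1)) (H x)).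
Proof.
move=> HE; have vP := lvalP L.
have [td [td0 tdv]] : exists t : L, t != 0 /\ lval t = d.
  have [d0|d0] := leP 0 d.
    by exists (lvar L ^+ `|d|%N); rewrite expf_neq0 ?lvar_neq0 // (valnX vP) lval_var natz gez0_abs.
  by exists (lvar L ^- `|d|%N); rewrite invr_eq0 expf_neq0 ?lvar_neq0 // (valnV vP) (valnX vP) lval_var natz ltz0_abs // opprK.
have tv e z : vge (@lval _ L) e (z * td) = vge (@lval _ L) (e - d) z.
  rewrite /vge mulf_eq0 (negPf td0) orbF; case: eqP => //= /eqP z0.
  by rewrite (valnM vP) // tdv lerBlDr.
have /choice [phi phiP] : forall x, exists a, vge (@lval _ L) (- d) (H x) -> vge (@lval _ L) 1 (H x * td - lcst L a).
  move=> x; case: (boolP (vge (@lval _ L) (- d) (H x))) => hx; last by exists 0.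
  have : vge (@lval _ L) 0 (H x * td) by rewrite tv sub0r.
  by move/lres_ex => [a ha]; exists a.
have u1 z a b : vge (@lval _ L) 1 (z - lcst L a) -> vge (@lval _ L) 1 (z - lcst L b) -> a = b.
  move=> ha hb; apply/eqP; rewrite -subr_eq0; apply: contraT => ab.
  have := vgeB vP hb ha; rewrite opprB addrC addrA subrK -rmorphB.
  by rewrite vgeE ?fmorph_eq0 // lval_cst.
have sub : ksub em (fun x => vge (@lval _ L) (- d) (H x)).
  have fP := hom_filt HE; split; first exact: (filt0 fP).
  by move=> a x y hx hy; apply: (filtD fP) => //; exact: (filtK fP).
exists (fun _ => phi); split=> [_ a x y hx hy|x hx /(_ tt) h0].
  apply: (u1 (H (em a * x + y) * td)); first by apply: phiP; apply: sub.2.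
  rewrite rmorphD rmorphM HE rmorphD rmorphM.
  have -> : (lcst L a * H x + H y) * td - (lcst L a * lcst L (phi x) + lcst L (phi y)) =
    lcst L a * (H x * td - lcst L (phi x)) + (H y * td - lcst L (phi y)) by ring.
  apply: (vgeD vP); last exact: phiP.
  by have := vgeM vP (lcst_vge L a) (phiP x hx); rewrite add0r.
have := phiP x hx; rewrite h0 rmorph0 subr0 tv; apply: vge_le; lia.
Qed.

Section StepDimension.
Variables (K F F' : fieldType) (em : {rmorphism K -> F}) (i : {rmorphism F -> F'}) (Q : nat) (y : F').
Hypothesis (uniq : forall c : nat -> F, \sum_(j < Q) i (c j) * y ^+ j = 0 -> forall j, (j < Q)%N -> c j = 0).
Local Notation em' := ([the {rmorphism K -> F'} of i \o em]).

Lemma dimge_step (P : nat -> F -> Prop) (z : nat -> int) :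
  (forall l, (l < Q)%N -> P l 0) ->
  (forall l, (l < Q)%N -> dimge em (P l) (z l)) ->
  dimge em' (fun x => exists c : nat -> F, x = \sum_(l < Q) i (c l) * y ^+ l /\ forall l, (l < Q)%N -> P l (c l))
    (\sum_(l < Q) z l).
Proof.
move=> P0 h.
have /choice [nb nbP] : forall l : 'I_Q, exists nb : {n : nat & 'I_n -> F},
   [/\ z l <= (tag nb)%:Z, kfree em (tagged nb) & forall t, P l (tagged nb t)].
  by move=> l; have [n [b h']] := h l (ltn_ord l); exists (Tagged (fun n => 'I_n -> F) b).
pose I := {l : 'I_Q & 'I_(tag (nb l))}.
apply: (@dimge_fin _ _ _ _ I (fun t => i (tagged (nb (tag t)) (tagged t)) * y ^+ tag t)).
- rewrite card_tagged sumnE big_map big_enum /= -natz natr_sum; apply: ler_sum => l _.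
  by rewrite card_ord natz; case: (nbP l).
- move=> a h0 [l t].
  pose ci (l : 'I_Q) := \sum_(t < tag (nb l)) em (a (Tagged (fun l => 'I_(tag (nb l))) t)) * tagged (nb l) t.
  pose c (j : nat) := if insub j is Some l then ci l else 0.
  have cE (l' : 'I_Q) : c l' = ci l' by rewrite /c valK.
  have : ci l = 0.
    rewrite -cE; apply: (uniq (c := c)) (ltn_ord l); rewrite -[RHS]h0.
    transitivity (\sum_(l < Q) \sum_(t < tag (nb l)) em' (a (Tagged (fun l => 'I_(tag (nb l))) t)) * (i (tagged (nb l) t) * y ^+ l)).
      apply: eq_bigr => l' _; rewrite cE rmorph_sum mulr_suml; apply: eq_bigr => t' _.
      by rewrite rmorphM mulrA.
    by rewrite sig_big_dep; apply: eq_bigr => -[].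
  by have [_ fr _] := nbP l; move/(fr (fun t => a (Tagged (fun l => 'I_(tag (nb l))) t))) => /(_ t).
case=> l t /=; exists (fun j => if j == l :> nat then tagged (nb l) t else 0); split.
  rewrite (bigD1 l) //= eqxx big1 ?addr0 // => j jl; rewrite ifF ?rmorph0 ?mul0r //.
  by apply: contraNF jl => /eqP h'; apply/eqP/val_inj.
move=> j jQ; case: eqP => [->|_]; last exact: P0.
by have [_ _] := nbP l; apply.
Qed.

End StepDimension.

(** * The Garcia-Stichtenoth tower *)

Section QuadraticField.
Variables (K : finFieldType) (p f l : nat).
Hypotheses (pp : prime p) (lE : l = (p ^ f)%N) (f0 : (0 < f)%N) (Kl : #|K| = (l ^ 2)%N).

Let l1 : (1 < l)%N. Proof. by rewrite lE -(exp1n f) ltn_exp2r // prime_gt1. Qed.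
Let l0 : (0 < l)%N. Proof. exact: ltnW. Qed.
Let pK : p \in [pchar K].
Proof. by apply: (card_finPcharP (n := f * 2)); rewrite // Kl lE -expnM. Qed.
Let lK : [pchar K].-nat l. Proof. by rewrite lE pchar_pnat. Qed.

Definition Om : {set K} := [set b | b ^+ l + b == 0].
Definition Fl : {set K} := [set b | b ^+ l == b].
Definition fib u : {set K} := [set b | b ^+ l + b == u].

Lemma frobl2 (a : K) : a ^+ l ^+ l = a.
Proof. by rewrite -exprM -[RHS]expf_card Kl. Qed.

Lemma card_roots_le (g : {poly K}) (A : {set K}) : g != 0 -> {in A, forall b, root g b} ->
  (#|A| < size g)%N.
Proof.
move=> g0 h; rewrite cardE; apply: max_poly_roots => //; last exact: enum_uniq.
by apply/allP => b; rewrite mem_enum; apply: h.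
Qed.

Lemma card_fib_le u : (#|fib u| <= l)%N.
Proof.
have sz : size ('X^l + ('X - u%:P) : {poly K}) = l.+1 by rewrite size_polyDl size_polyXn // size_XsubC.
rewrite -ltnS -sz; apply: card_roots_le; first by rewrite -size_poly_gt0 sz.
move=> b; rewrite inE rootE hornerD hornerXn hornerXsubC => /eqP <-.
by rewrite addrA subrr.
Qed.

Lemma card_Fl_le : (#|Fl| <= l)%N.
Proof.
have sz : size ('X^l - 'X : {poly K}) = l.+1 by rewrite size_polyDl size_polyXn // size_polyN size_polyX.
rewrite -ltnS -sz; apply: card_roots_le; first by rewrite -size_poly_gt0 sz.
by move=> b; rewrite inE rootE hornerD hornerN hornerXn hornerX => /eqP ->; rewrite subrr.
Qed.

(** The trace [a |-> a ^ l + a] maps [K] into [Fl] with fibres of at most [l] elements, and [Fl] has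
    at most [l] elements; since [#|K| = l ^ 2], all these bounds are attained. *)
Lemma trace_count : #|Fl| = l /\ forall u, u \in Fl -> #|fib u| = l.
Proof.
have tot : (\sum_(u in Fl) #|fib u| = l * l)%N.
  rewrite mulnn -Kl -[RHS]sum1_card [RHS](partition_big (fun a : K => a ^+ l + a) (mem Fl)) /=.
    by apply: eq_bigr => u _; rewrite -sum1_card; apply: eq_bigl => a; rewrite !inE.
  by move=> a _; rewrite inE exprDn_pchar // frobl2 addrC.
have le : (\sum_(u in Fl) #|fib u| <= \sum_(u in Fl) l)%N by apply: leq_sum => u _; exact: card_fib_le.
have cF : #|Fl| = l.
  apply/eqP; rewrite eqn_leq card_Fl_le -(leq_pmul2r l0) -tot -sum_nat_const; exact: le.
split=> // u uF; apply/eqP; rewrite eqn_leq card_fib_le leqNgt; apply/negP => lt.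
have : (\sum_(u in Fl) #|fib u| < \sum_(u in Fl) l)%N.
  rewrite (bigD1 u) //= [X in (_ < X)%N](bigD1 u) //= -addSn leq_add //.
  by apply: leq_sum => u' _; exact: card_fib_le.
by rewrite tot sum_nat_const cF ltnn.
Qed.

Lemma card_Om : #|Om| = l.
Proof.
have [_ h] := trace_count; rewrite -(h 0); last by rewrite inE expr0n gtn_eqF.
by apply: eq_card => a; rewrite !inE.
Qed.

Lemma trace_surj (u : K) : u ^+ l = u -> exists b : K, b ^+ l + b = u.
Proof.
move=> uF; have [_ h] := trace_count; have := h u; rewrite inE uF eqxx => /(_ isT) c.
have : (0 < #|fib u|)%N by rewrite c.
by case/card_gt0P => b; rewrite inE => /eqP; exists b.
Qed.

Lemma unity_Fl (a : K) : a != 0 -> (a ^+ l.-1 == 1) = (a \in Fl).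
Proof.
by move=> a0; rewrite inE -{2}(prednK l0) exprS -[X in _ * _ == X]mulr1 (inj_eq (mulfI a0)).
Qed.

Lemma card_D0 (A : {set K}) : 0 \in A -> #|A| = l -> #|A :\ 0| = l.-1.
Proof. by move=> A0 cA; have := cardsD1 0 A; rewrite A0 cA => ->. Qed.

Lemma gamma_exists : exists ga : K, l.-1.-primitive_root ga.
Proof.
have n0 : (0 < l.-1)%N by rewrite -ltnS prednK.
have : has l.-1.-primitive_root (enum (Fl :\ 0)).
  apply: has_prim_root => //; last by rewrite -cardE card_D0 ?(proj1 trace_count) // inE expr0n gtn_eqF.
  - by apply/allP => a; rewrite mem_enum in_setD1 => /andP[a0 aF]; rewrite unity_rootE unity_Fl.
  - exact: enum_uniq.
by case/hasP => ga _; exists ga.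
Qed.

Variable ga : K.
Hypothesis gaP : l.-1.-primitive_root ga.

Lemma ga_neq0 : ga != 0.
Proof.
apply/eqP => g0; have := prim_expr_order gaP; rewrite g0 expr0n.
have -> : (l.-1 == 0)%N = false by apply/negbTE; rewrite -lt0n -ltnS prednK.
by move/eqP; rewrite eq_sym oner_eq0.
Qed.

Lemma ga_frob : ga ^+ l = ga.
Proof. by rewrite -{1}(prednK l0) exprS (prim_expr_order gaP) mulr1. Qed.

Lemma Om_ga b : (ga * b \in Om) = (b \in Om).
Proof. by rewrite !inE exprMn ga_frob -mulrDr mulf_eq0 (negPf ga_neq0). Qed.

Lemma alpha_exists : exists a, a \in Om :\ 0.
Proof.
apply/set0Pn; rewrite -card_gt0 card_D0 ?card_Om //; first by rewrite -ltnS prednK.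
by rewrite inE expr0n gtn_eqF // addr0.
Qed.

Lemma pow_ratio (a b : K) : a != 0 -> b ^+ l.-1 = a ^+ l.-1 -> exists j : 'I_l.-1, b = ga ^+ j * a.
Proof.
move=> a0 E; have : (b / a) ^+ l.-1 = 1 by rewrite expr_div_n E mulfV // expf_neq0.
by move/(prim_rootP gaP) => [j h]; exists j; rewrite -h mulfVK.
Qed.

Variable al : K.
Hypothesis alP : al \in Om :\ 0.

Lemma al_neq0 : al != 0. Proof. by move: alP; rewrite in_setD1 => /andP[]. Qed.
Lemma al_frob : al ^+ l = - al.
Proof. by move: alP; rewrite in_setD1 inE => /andP[_]; rewrite addr_eq0 => /eqP. Qed.

Lemma Om_pow b : b \in Om -> b != 0 -> b ^+ l.-1 = -1.
Proof.
move=> bO b0; apply: (mulfI b0); rewrite -exprS prednK // mulrN1.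
by move: bO; rewrite inE addr_eq0 => /eqP.
Qed.

Lemma ga_inj (j j' : 'I_l.-1) (a : K) : a != 0 -> ga ^+ j * a = ga ^+ j' * a -> j = j'.
Proof.
move=> a0 /(mulIf a0) /eqP; rewrite (eq_prim_root_expr gaP) !modn_small // => /eqP h.
exact: val_inj.
Qed.

(** Nonzero elements of [Om] have [(l - 1)]-st power [-1], so they form a single orbit under
    multiplication by [ga]. *)
Lemma sum_Om (g : K -> int) : \sum_(b in Om) g b = g 0 + \sum_(c < l.-1) g (ga ^+ c * al).
Proof.
have O0 : 0 \in Om by rewrite inE expr0n gtn_eqF // addr0.
have n0 : (0 < l.-1)%N by rewrite -ltnS prednK.
rewrite (bigD1 0) //=; congr (_ + _).
rewrite (reindex_onto (fun c : 'I_l.-1 => ga ^+ c * al)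
  (fun b => odflt (Ordinal n0) [pick c : 'I_l.-1 | b == ga ^+ c * al])) /=; last first.
  move=> b /andP[bO b0]; case: pickP => [c /eqP //|]; have [|j jE] := @pow_ratio al b al_neq0.
    by rewrite (Om_pow bO b0) Om_pow ?al_neq0 //; move: alP; rewrite in_setD1 => /andP[].
  by move/(_ j); rewrite jE eqxx.
apply: eq_bigl => c; case: pickP => [c' /eqP /(ga_inj al_neq0) ->|/(_ c)]; last by rewrite eqxx.
rewrite eqxx mulf_neq0 ?expf_neq0 ?ga_neq0 ?al_neq0 // !andbT.
have : al \in Om by move: alP; rewrite in_setD1 => /andP[].
by elim: (c' : nat) => [|j IH] h; rewrite ?expr0 ?mul1r // exprS -mulrA Om_ga IH.
Qed.

Definition orbit_rep z := [pick b : K | (b \notin Om) && (b ^+ l.-1 == z)].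
(** Outside [Om], orbits of [ga] are the fibres of the power [l - 1]; the representative is the one
    that [pick] returns on the fibre. *)
Definition reps : {set K} := [set a | (a \notin Om) && (orbit_rep (a ^+ l.-1) == Some a)].

Lemma Om0 : 0 \in Om. Proof. by rewrite inE expr0n gtn_eqF // addr0. Qed.
Lemma nOm_neq0 a : a \notin Om -> a != 0. Proof. by apply: contraNneq => ->; exact: Om0. Qed.
Lemma Om_gaX j a : (ga ^+ j * a \in Om) = (a \in Om).
Proof. by elim: j => [|j IH]; rewrite ?expr0 ?mul1r // exprS -mulrA Om_ga. Qed.

Lemma sum_good (g : K -> int) : \sum_(a in ~: Om) g a = \sum_(a in reps) \sum_(j < l.-1) g (ga ^+ j * a).
Proof.
have n0 : (0 < l.-1)%N by rewrite -ltnS prednK.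
have gaX j a : (ga ^+ j * a) ^+ l.-1 = a ^+ l.-1.
  by rewrite exprMn -exprM mulnC exprM (prim_expr_order gaP) expr1n mul1r.
rewrite pair_big_dep /=.
pose h (a : K) : K * 'I_l.-1 := if orbit_rep (a ^+ l.-1) is Some b
  then (b, odflt (Ordinal n0) [pick j : 'I_l.-1 | a == ga ^+ j * b]) else (0, Ordinal n0).
rewrite [RHS](reindex_onto h (fun aj => ga ^+ aj.2 * aj.1)) /=; last first.
  case=> a j; rewrite /= andbT inE => /andP[aO /eqP pk]; rewrite /h gaX pk.
  by case: pickP => [j' /eqP /(ga_inj (nOm_neq0 aO)) -> //|/(_ j)]; rewrite eqxx.
have hP a : a \notin Om -> (h a).1 \in reps /\ ga ^+ (h a).2 * (h a).1 = a.
  move=> aO; rewrite /h; case E: (orbit_rep (a ^+ l.-1)) => [b|]; last first.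
    by move: E; rewrite /orbit_rep; case: pickP => // /(_ a); rewrite aO eqxx.
  have [bO bE] : b \notin Om /\ b ^+ l.-1 = a ^+ l.-1.
    by move: E; rewrite /orbit_rep; case: pickP => // b' /andP[? /eqP ?] [<-].
  rewrite /= inE bO bE E eqxx; split=> //.
  have [j jE] := pow_ratio (nOm_neq0 bO) (esym bE).
  by case: pickP => [j' /eqP //|/(_ j)]; rewrite jE eqxx.
apply: eq_big => [a|a]; last by rewrite inE => aO; have [_ ->] := hP a aO.
rewrite inE; case: (boolP (a \in Om)) => aO /=; last by have [-> ->] := hP a aO; rewrite eqxx.
apply/esym/negbTE; apply: contraTN aO => /andP[/andP[+ _] /eqP <-].
by rewrite inE Om_gaX => /andP[].
Qed.

Lemma card_reps : #|reps| = l.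
Proof.
have n0 : (0 < l.-1)%N by rewrite -ltnS prednK.
have := sum_good (fun=> 1); rewrite sumr_const; under eq_bigr => a _ do rewrite sumr_const card_ord.
rewrite sumr_const => /eqP; rewrite -mulrnA eqr_nat cardsCs setCK card_Om Kl.
have -> : (l ^ 2 - l = l.-1 * l)%N by rewrite -mulnn -{3}(mul1n l) -mulnBl subn1.
by rewrite eqn_pmul2l // => /eqP.
Qed.

End QuadraticField.

(** * Groups of places where the tower has poles *)

Definition uof (F : fieldType) (l : nat) (x : F) : F := x ^+ l / (x ^+ l.-1 + 1).

(** Local data at a group of places where [u] has a pole. The scale of [G] grows by [l] at each
    level, so that this pole keeps the order [S]. [h] is the degree over the level at which the
    group starts, and [Lm d] allows [d] times the original place, up to the excess [h - S] of
    [tsLG]. [bs] lists the shifts for the coming steps: while it is nonempty, its head cancels the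
    pole of [u] ([tsH]) and the step is unramified, and [tsA] prepares the following entry for the
    same use one level up. Once it is empty, the steps ramify. *)
Record tstate (K F : fieldType) (em : {rmorphism K -> F}) (l : nat) (u : F) (S : nat)
  (G Lm : int -> F -> Prop) (J : finType) (h : nat) (bs : seq F) : Prop := TState {
  tsG : filt em G;
  tsL : forall d, ksub em (Lm d);
  tsC : forall d, cutby em J (Lm d) (Lm (d - 1));
  tsW : forall d d' x, d <= d' -> Lm d x -> Lm d' x;
  tsLG : forall d x, Lm d x -> G (- (h%:Z * d + (h - S)%N%:Z)) x;
  tsGL : bs != [::] -> forall d x, G (- (h%:Z * d)) x -> Lm d x;
  ts1 : Lm 0 1;
  tsJ : #|J| = h;
  tsu : u != 0 /\ G (- S%:Z) u /\ G S%:Z u^-1;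
  tsS : if bs is [::] then (S <= h : Prop)%N else S = (h * l ^ size bs)%N;
  tsB : forall t, (t < size bs)%N -> G (- (h * l ^ (size bs - t.+1))%N%:Z) (nth 0 bs t);
  tsH : bs != [::] -> G 0 (u + (head 0 bs) ^+ l + head 0 bs);
  tsA : forall t, (t.+1 < size bs)%N -> G 0 ((nth 0 bs t.+1) ^+ l + nth 0 bs t.+1 - nth 0 bs t)
}.

Section TypeStep.
Variables (K F F' : fieldType) (em : {rmorphism K -> F}) (i : {rmorphism F -> F'}) (l : nat) (u : F) (y : F').
Hypotheses (Q1 : (1 < l)%N) (QF : [pchar F].-nat l) (yE : y ^+ l + y = i u)
  (span : forall z, exists c : nat -> F, z = \sum_(j < l) i (c j) * y ^+ j)
  (uniq : forall c : nat -> F, \sum_(j < l) i (c j) * y ^+ j = 0 -> forall j, (j < l)%N -> c j = 0).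
Local Notation em' := ([the {rmorphism K -> F'} of i \o em]).
Let l0 : (0 < l)%N. Proof. exact: ltnW. Qed.

Lemma uof_facts : u != 0 -> let u' := uof l y in
  [/\ y != 0, u' != 0, y^-1 = (y ^+ l.-1 + 1) * i u^-1, u' = y - y ^+ 2 * i u^-1 & u'^-1 = y^-1 ^+ l + y^-1].
Proof.
move=> u0; have iu0 : i u != 0 by rewrite fmorph_eq0.
have E : y * (y ^+ l.-1 + 1) = i u by rewrite mulrDr mulr1 -exprS prednK.
have y0 : y != 0 by apply: contraNneq iu0 => h; rewrite -E h mul0r.
have w0 : y ^+ l.-1 + 1 != 0 by apply: contraNneq iu0 => h; rewrite -E h mulr0.
have V : y^-1 = (y ^+ l.-1 + 1) * i u^-1.
  by rewrite fmorphV -E invfM mulrCA mulfV ?mulr1.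
split=> //; first by rewrite /uof mulf_neq0 ?expf_neq0 ?invr_eq0.
  rewrite /uof; apply: (mulIf w0); rewrite mulfVK // mulrBl -mulrA [i u^-1 * _]mulrC -V.
  by rewrite E -yE expr2 mulfK // addrK.
rewrite /uof invf_div -{2}(prednK l0) mulrDl mul1r exprVn -{1}(prednK l0) exprS invfM.
by rewrite [y^-1 * _]mulrC mulrA mulfV ?expf_neq0 // mul1r addrC -exprVn exprVn -invfM -exprSr prednK.
Qed.

Lemma coef_exists b : exists cf : F' -> nat -> F, [/\
  forall z, z = \sum_(j < l) i (cf z j) * (y + i b) ^+ j,
  forall a z z' j, (j < l)%N -> cf (em' a * z + z') j = em a * cf z j + cf z' j &
  forall (c : nat -> F) j, (j < l)%N -> cf (\sum_(j < l) i (c j) * (y + i b) ^+ j) j = c j].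
Proof.
have /choice [cf cfE] := span_shift span b; exists cf; split=> // [a z z' j jl|c j jl].
  apply: (coef_shift_uniq uniq (b := b) (c := cf (em' a * z + z')) (d := fun j => em a * cf z j + cf z' j) _ jl).
  rewrite -cfE; under eq_bigr => t _ do rewrite rmorphD rmorphM mulrDl -mulrA.
  by rewrite big_split -mulr_sumr -!cfE.
by apply: (coef_shift_uniq uniq (b := b) (c := cf _) _ jl); rewrite -cfE.
Qed.

Definition stepL b (Lm : int -> F -> Prop) d z := exists c : nat -> F,
  z = \sum_(j < l) i (c j) * (y + i b) ^+ j /\ forall j, (j < l)%N -> Lm d (c j).

Variables (S : nat) (G Lm : int -> F -> Prop) (J : finType) (h : nat) (bs : seq F).
Hypothesis T : tstate em l u S G Lm J h bs.

Local Notation b := (head 0 bs).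
Local Notation mu := (if bs is [::] then S%:Z else 0).

Lemma tmu0 : 0 <= mu. Proof. by case: bs. Qed.
Lemma tbmu : G (- mu) (u + b ^+ l + b).
Proof.
have [_ _ _ _ _ _ _ _ [_ [hu _]] _ _ hH _] := T; move: hH; case: (bs) => [|b' bs'] /= hH.
  by rewrite expr0n gtn_eqF // !addr0.
by rewrite oppr0; apply: hH.
Qed.

(** One step drops the head of [bs], multiplies [h] by [l] and keeps [S]: [uof l y = y - y ^ 2 / u]
    differs from [y] by an integral function. The same identity turns the first instance of [tsA]
    into the new [tsH]. *)
Lemma tstate_step :
  tstate em' l (uof l y) S (stepG i l y b mu G) (stepL b Lm) ('I_l * J)%type (l * h) (map i (behead bs)).
Proof.
have [tG tL tC tW tLG tGL t1 tJ [u0 [hu hu']] tS tB tH tA] := T.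
have mu0 := tmu0; have bmu := tbmu.
have fG' := stepG_filt Q1 QF yE mu0 tG bmu.
have emb d a : G d a -> stepG i l y b mu G (l%:Z * d) (i a) by move=> ga; exact: (stepG_emb i y Q1 QF b mu0 tG ga).
have rrG : stepG i l y b mu G (- mu) (y + i b) by exact: (stepG_rr i y Q1 QF b mu0 tG).
have [y0 u'0 yV u'E u'V] := uof_facts u0.
have [cf [cfE cfL cfU]] := coef_exists b.
have lz : 2 <= l%:Z by rewrite lez_nat.
have yG : stepG i l y b mu G (- S%:Z) y.
  move: rrG emb fG' tB tS; case: (bs) => [|b' bs'] /= rrG emb fG' tB tS.
    by rewrite rmorph0 addr0 in rrG.
  have h1 : stepG i l y b' 0 G (- S%:Z) (y + i b') by apply: (filtW fG' _ rrG); lia.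
  have h2 : stepG i l y b' 0 G (- S%:Z) (i b').
    have := emb _ _ (tB 0%N isT); apply: (filtW fG'); rewrite /= subSS subn0 tS expnS.
    by move: (l ^ size bs')%N => x; nia.
  by have := filtB fG' h1 h2; rewrite addrK.
have uG := emb _ _ hu'.
have yVG : stepG i l y b mu G S%:Z y^-1.
  rewrite yV; have h1 : stepG i l y b mu G (- (l.-1 * S)%N%:Z) (y ^+ l.-1 + 1).
    apply: (filtD fG').
      by have := filtX fG' l.-1 yG; apply: (filtW fG'); rewrite mulNrn -mulr_natr natz PoszM mulrC.
    by apply: (filtW fG' _ (filt1 fG')); rewrite oppr_le0.
  have := filtM fG' h1 uG; apply: (filtW fG'); rewrite -{2}(prednK l0); nia.
have y2G : stepG i l y b mu G 0 (y ^+ 2 * i u^-1).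
  have := filtM fG' (filtX fG' 2 yG) uG; apply: (filtW fG'); rewrite mulNrn -mulr_natr natz; nia.
have u'G : stepG i l y b mu G (- S%:Z) (uof l y).
  by rewrite u'E; apply: (filtB fG') => //; apply: (filtW fG' _ y2G); lia.
have u'VG : stepG i l y b mu G S%:Z (uof l y)^-1.
  rewrite u'V; apply: (filtD fG') => //; have := filtX fG' l yVG; apply: (filtW fG').
  by rewrite -mulr_natr natz -PoszM lez_nat leq_pmulr.
split=> //.
- move=> d; have [P0 PS] := tL d; split.
    by exists (fun=> 0); split=> [|//]; rewrite big1 // => j _; rewrite rmorph0 mul0r.
  move=> a x z [c [-> hc]] [c' [-> hc']]; exists (fun j => em a * c j + c' j); split.
    rewrite mulr_sumr -big_split; apply: eq_bigr => j _ /=; by rewrite rmorphD rmorphM mulrDl mulrA.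
  by move=> j jl; apply: PS; [exact: hc|exact: hc'].
- move=> d; have [phi [lin ker]] := tC d.
  exists (fun (jt : 'I_l * J) z => phi jt.2 (cf z jt.1)); split=> [[j t] a x z hx hz|x [c [-> hc]] h0] /=.
    rewrite cfL // lin //.
      by have [c [-> hc]] := hx; rewrite cfU //; exact: hc.
    by have [c [-> hc]] := hz; rewrite cfU //; exact: hc.
  exists c; split=> // j jl; apply: ker; first exact: hc.
  by move=> t; have := h0 (Ordinal jl, t); rewrite /= cfU.
- by move=> d d' x le [c [-> hc]]; exists c; split=> // j jl; apply: tW le _; exact: hc.
- move=> d x [c [-> hc]]; exists c, (fun=> - (h%:Z * d + (h - S)%N%:Z)); split=> // j jl.
  split; first by apply: tLG; exact: hc.
  move: tS; case: (bs) => [|b' bs'] /= tS.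
    have -> : (l * h - S)%N%:Z = l%:Z * (h - S)%N%:Z + (l%:Z - 1) * S%:Z.
      have : (S <= l * h)%N by apply: leq_trans tS _; rewrite leq_pmull.
      by move: tS l0; clear; nia.
    rewrite PoszM -mulrA; move: ((h - S)%N%:Z) (h%:Z * d) => x1 x2.
    have : j%:Z * S%:Z <= (l%:Z - 1) * S%:Z by rewrite ler_wpM2r // lerBrDr -PoszD lez_nat addn1.
    by rewrite mulrN mulrDr; move: (j%:Z * S%:Z) ((l%:Z - 1) * S%:Z) (l%:Z * x1) (l%:Z * x2); glia.
  have hS : (h - S = 0)%N by apply/eqP; rewrite subn_eq0 tS leq_pmulr // expn_gt0 l0.
  have hS' : (l * h - S = 0)%N.
    by apply/eqP; rewrite subn_eq0 tS expnS mulnCA mulnA leq_pmulr // expn_gt0 l0.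
  by rewrite hS hS' PoszM mulr0 subr0 !addr0; lia.
- rewrite -size_eq0 size_map size_behead; move: tGL; case: (bs) => [|b' [|b'' bs']] //= tGL _ d x [c [d' [-> hc]]].
  exists c; split=> // j jl; have [g le] := hc j jl; apply: tGL => //; apply: (filtW tG _ g).
  by move: le; rewrite mulr0 subr0 PoszM; move: (d' j) l0; clear; nia.
- exists (fun j => if j == 0%N then 1 else 0); split.
    rewrite (bigD1 (Ordinal l0)) //= rmorph1 mulr1 big1 ?addr0 // => j j0.
    by rewrite ifF ?rmorph0 ?mul0r //; apply: contraNF j0 => /eqP h'; apply/eqP/val_inj.
  by move=> j _; case: eqP => _ //; exact: (tL 0).1.
- by rewrite card_prod card_ord tJ.
- by move: tS; case: (bs) => [|b' [|b'' bs']] /= tS; rewrite ?size_map; [exact: leq_trans tS (leq_pmull _ l0)|by rewrite tS expn1 mulnC|rewrite tS !expnS; lia].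
- move=> t; rewrite size_map size_behead => tb.
  have tb' : (t.+1 < size bs)%N by rewrite -ltn_predRL.
  rewrite (nth_map 0) ?size_behead // nth_behead; have := emb _ _ (tB _ tb'); apply: (filtW fG').
  have -> : ((size bs).-1 - t.+1 = size bs - t.+2)%N by move: (size bs); glia.
  by rewrite mulrN -PoszM mulnA.
- move: fG' emb u'E y2G rrG tA; case: (bs) => [|b' [|b'' bs']] //= fG' emb u'E y2G rrG tA _.
  have -> : uof l y + i b'' ^+ l + i b'' = (y + i b') - y ^+ 2 * i u^-1 + i (b'' ^+ l + b'' - b').
    by rewrite u'E !(rmorphB, rmorphD, rmorphXn); ring.
  apply: (filtD fG'); first by apply: (filtB fG') => //; rewrite oppr0 in rrG.
  by have := emb _ _ (tA 0%N isT); rewrite mulr0.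
move=> t; rewrite size_map size_behead => tb.
have tb' : (t.+2 < size bs)%N by rewrite -ltn_predRL.
rewrite !(nth_map 0) ?size_behead // ?nth_behead; last exact: ltnW.
rewrite -rmorphXn -rmorphD -rmorphB; have := emb _ _ (tA _ tb'); by rewrite mulr0.
Qed.

(** The pole order of the shift in units of [h], and 0 if no shift is made. *)
Definition tB_ : nat := if bs is [::] then 0%N else (l ^ (size bs).-1)%N.

Lemma tstate_twist t d x : Lm d x -> Lm (d + (t * tB_)%N%:Z) (b ^+ t * x).
Proof.
have [tG tL tC tW tLG tGL t1 tJ _ tS tB tH tA] := T.
move: tGL tS tB; rewrite /tB_; case: (bs) => [|b' bs'] tGL tS tB hx.
  rewrite muln0 addr0 /=; case: t => [|t]; first by rewrite expr0 mul1r.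
  by rewrite exprS !mul0r; exact: (tL d).1.
apply: tGL => //=; have := filtM tG (filtX tG t (tB 0%N isT)) (tLG _ _ hx).
apply: (filtW tG) => /=.
have hS : (h - S = 0)%N by apply/eqP; rewrite subn_eq0 tS leq_pmulr // expn_gt0 l0.
rewrite hS addr0 subSS subn0 mulNrn -mulr_natr natz.
by move: (l ^ size bs')%N => z; rewrite mulrDr !PoszM; lia.
Qed.

End TypeStep.

Lemma lval_surj (kk : fieldType) (L : laurent kk) (d : int) : exists t : L, t != 0 /\ lval t = d.
Proof.
have vP := lvalP L; have [d0|d0] := leP 0 d.
  by exists (lvar L ^+ `|d|%N); rewrite expf_neq0 ?lvar_neq0 // (valnX vP) lval_var natz gez0_abs.
exists (lvar L ^- `|d|%N); rewrite invr_eq0 expf_neq0 ?lvar_neq0 // (valnV vP) (valnX vP) lval_var.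
by rewrite natz ltz0_abs // opprK.
Qed.

Lemma vge_mulw (kk : fieldType) (L : laurent kk) (w z : L) e : w != 0 ->
  vge (@lval _ L) e (z * w) = vge (@lval _ L) (e - lval w) z.
Proof.
move=> w0; rewrite /vge mulf_eq0 (negPf w0) orbF; case: eqP => //= /eqP z0.
by rewrite (valnM (lvalP L)) // lerBlDr.
Qed.

(** * Norms and conjugate places *)

Section Galois.
Variables (K : finFieldType) (F F' : fieldType) (em : {rmorphism K -> F}) (i : {rmorphism F -> F'}) (l : nat) (u : F) (y : F').
Hypotheses (Q1 : (1 < l)%N) (QF : [pchar F].-nat l) (yE : y ^+ l + y = i u)
  (span : forall z, exists c : nat -> F, z = \sum_(j < l) i (c j) * y ^+ j)
  (uniq : forall c : nat -> F, \sum_(j < l) i (c j) * y ^+ j = 0 -> forall j, (j < l)%N -> c j = 0)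
  (cOm : #|Om K l| = l).
Variable tau : K -> {rmorphism F' -> F'}.
Hypotheses (taui : forall b a, b \in Om K l -> tau b (i a) = i a)
  (tauy : forall b, b \in Om K l -> tau b y = y + i (em b)).
Local Notation em' := ([the {rmorphism K -> F'} of i \o em]).
Let l0 : (0 < l)%N. Proof. exact: ltnW. Qed.

Lemma step_ext (B : fieldType) (h1 h2 : {rmorphism F' -> B}) :
  (forall a, h1 (i a) = h2 (i a)) -> h1 y = h2 y -> h1 =1 h2.
Proof.
move=> hi hy z; have [c ->] := span z; rewrite !rmorph_sum; apply: eq_bigr => j _.
by rewrite !rmorphM !rmorphXn hi hy.
Qed.

Lemma Om_add b b' : b \in Om K l -> b' \in Om K l -> b + b' \in Om K l.
Proof.
have lK : [pchar K].-nat l by rewrite -(eq_pnat _ (fmorph_pchar em)).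
rewrite !inE => /eqP h /eqP h'; rewrite exprDn_pchar // addrACA h h' addr0 //.
Qed.

Lemma Om_opp b : b \in Om K l -> - b \in Om K l.
Proof.
move=> bO; have lK : [pchar K].-nat l by rewrite -(eq_pnat _ (fmorph_pchar em)).
move: bO; rewrite !inE => /eqP h; have : (b + - b) ^+ l + (b + - b) = 0 by rewrite subrr expr0n gtn_eqF // addr0.
by rewrite exprDn_pchar // addrACA h add0r => ->.
Qed.

Lemma tau_tau b b' z : b \in Om K l -> b' \in Om K l -> tau b (tau b' z) = tau (b + b') z.
Proof.
move=> bO bO'; have sO := Om_add bO bO'.
apply: (step_ext (h1 := [the {rmorphism F' -> F'} of tau b \o tau b'])) => [a|] /=.
  by rewrite !taui.
by rewrite !tauy // rmorphD tauy // taui // !rmorphD addrA.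
Qed.

Definition nrm z := \prod_(b in Om K l) tau b z.

(** The norm is invariant under all [tau b]. Written as a polynomial in [y] of degree below [l], it
    takes the same value at the [l] conjugates of [y], so that polynomial is constant. *)
Lemma nrm_base z : exists g, nrm z = i g.
Proof.
have inv b : b \in Om K l -> tau b (nrm z) = nrm z.
  move=> bO; rewrite /nrm rmorph_prod /=.
  rewrite [RHS](reindex_onto (fun b' => b + b') (fun b' => b' - b)) /=; last by move=> b' _; rewrite addrC subrK.
  apply: eq_big => [b'|b' bO']; last by rewrite tau_tau.
  rewrite [b + b' - b]addrC addKr eqxx andbT; apply/idP/idP => [bO'|h]; first exact: Om_add.
  by rewrite -(addKr b b'); apply: Om_add => //; exact: Om_opp.
have [c cE] := span (nrm z); exists (c 0%N).
pose P : {poly F'} := \poly_(j < l) i (c j) - (nrm z)%:P.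
have P0 : P = 0.
  apply/eqP; apply: contraT => P0; pose rs := [seq y + i (em b) | b <- enum (Om K l)].
  have : (size rs < size P)%N.
    apply: max_poly_roots => //.
      apply/allP => x /mapP [b]; rewrite mem_enum => bO ->.
      rewrite rootE hornerD hornerN hornerC horner_poly -(inv b bO) cE rmorph_sum subr_eq0.
      by apply/eqP; apply: eq_bigr => j _; rewrite rmorphM rmorphXn taui // tauy.
    rewrite map_inj_uniq ?enum_uniq // => b b' /addrI /fmorph_inj; exact: fmorph_inj.
  rewrite size_map -cardE cOm ltnNge; case/negP.
  apply: leq_trans (size_polyD _ _) _; rewrite size_polyN geq_max size_poly.
  by apply: leq_trans (size_polyC_leq1 _) _.
have := congr1 (fun f : {poly F'} => f`_0) P0.
by rewrite coefB coef_poly l0 coefC eqxx coef0 => /eqP; rewrite subr_eq0 => /eqP.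
Qed.

(** All [l] conjugates have order at least [e], so their product has order at least [l e], which is
    order [e] in the scale of the lower field. *)
Lemma nrm_G b mu G e z g : 0 <= mu -> filt em G -> G (- mu) (u + b ^+ l + b) ->
  stepG i l y b mu G e z -> nrm z = i g -> G e g.
Proof.
move=> mu0 GP bmu hz ng; have fG' := stepG_filt Q1 QF yE mu0 GP bmu.
have tz b' : b' \in Om K l -> stepG i l y b mu G e (tau b' z).
  by move=> bO; apply: (stepG_tau Q1 QF mu0 GP (be := b')); rewrite ?tauy // => a; exact: taui.
have : stepG i l y b mu G (e *+ l) (nrm z).
  rewrite /nrm -big_enum /= -{2}cOm cardE.
  have : forall b', b' \in enum (Om K l) -> stepG i l y b mu G e (tau b' z) by move=> b'; rewrite mem_enum; exact: tz.
  elim: (enum _) => [|b' r IH] h; first by rewrite big_nil mulr0n; exact: (filt1 fG').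
  rewrite big_cons /= mulrS; apply: (filtM fG'); first by apply: h; rewrite inE eqxx.
  by apply: IH => b'' hb; apply: h; rewrite inE hb orbT.
rewrite ng => /(stepG_down Q1 uniq) [d Gd le]; apply: (filtW GP _ Gd).
by move: le; rewrite -mulr_natl natz ler_pM2l.
Qed.

(** A single place above the given one has [y] of residue 0. There [E0 = y ^ (l - 1) + 1] is a unit,
    while it vanishes at the other conjugates, where [y] has a nonzero residue in [Om]. So
    [z E0 ^ M] has order at least [e] at all conjugates of [O1], its coefficients do by
    interpolation, and this can be read off at [O2]. *)
Lemma O_unique (L : laurent K) (O1 O2 : {rmorphism F' -> L}) :
  (forall a, O1 (em' a) = lcst L a) -> (forall a, O2 (em' a) = lcst L a) ->
  (forall a, lval (O1 (i a)) = lval (O2 (i a))) ->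
  vge (@lval _ L) 1 (O1 y) -> vge (@lval _ L) 1 (O2 y) ->
  forall e z, vge (@lval _ L) e (O1 z) -> vge (@lval _ L) e (O2 z).
Proof.
move=> O1e O2e agr y1 y2 e z hz; have vP := lvalP L.
have y10 : vge (@lval _ L) 0 (O1 y) by apply: vge_le y1.
have y20 : vge (@lval _ L) 0 (O2 y) by apply: vge_le y2.
have ll : (0 < l.-1)%N by rewrite -ltnS prednK.
pose E0 := y ^+ l.-1 + 1.
have tauO1 b : b \in Om K l -> O1 (tau b y) = O1 y + lcst L b.
  by move=> bO; rewrite tauy // rmorphD -O1e.
have unit1 (x : L) : vge (@lval _ L) 1 x -> x ^+ l.-1 + 1 != 0 /\ lval (x ^+ l.-1 + 1) = 0.
  move=> hx; have := @valnD_lt _ _ vP 1 (x ^+ l.-1) (oner_neq0 _); rewrite (valn1 vP) add0r addrC; apply.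
  have := vgeX vP l.-1 hx; apply: vge_le; rewrite -mulr_natr natz mul1r lez_nat //.
have tE b : b \in Om K l -> b != 0 -> vge (@lval _ L) 1 (O1 (tau b E0)).
  move=> bO b0; rewrite /E0 rmorphD rmorphXn rmorph1 rmorphD rmorphXn rmorph1 tauO1 //.
  have -> : (O1 y + lcst L b) ^+ l.-1 + 1 = ((O1 y + lcst L b) ^+ l.-1 - lcst L b ^+ l.-1).
    rewrite -rmorphXn; have -> : b ^+ l.-1 = -1.
      apply: (mulfI b0); rewrite -exprS prednK // mulrN1.
      by move: bO; rewrite inE addr_eq0 => /eqP.
    by rewrite rmorphN rmorph1 opprK.
  rewrite subrXX addrK; have := vgeM vP y1 (_ : vge (@lval _ L) 0 (\sum_(j < l.-1) (O1 y + lcst L b) ^+ (l.-1.-1 - j) * lcst L b ^+ j)).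
  rewrite addr0; apply; apply: (vge_sum vP) => j _.
  by apply: (vge0M vP); apply: (vge0X vP); [apply: (vgeD vP) => //|]; exact: lcst_vge.
have [M MP] : exists M : nat, forall b, b \in Om K l -> e - M%:Z <= lval (O1 (tau b z)).
  exists (\sum_(b in Om K l) `|e - lval (O1 (tau b z))|)%N => b bO.
  rewrite (bigD1 b) //=; move: (\sum_(j in _ | _) _)%N (lval _) => s t; lia.
have [c cE] := span (z * E0 ^+ M).
have all1 b : b \in Om K l -> vge (@lval _ L) e (O1 (tau b (z * E0 ^+ M))).
  move=> bO; have [b0|b0] := eqVneq b 0.
    have -> : tau b (z * E0 ^+ M) = z * E0 ^+ M.
      apply: (step_ext (h2 := [the {rmorphism F' -> F'} of @idfun F'])) => [a|] /=; first exact: taui.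
      by rewrite tauy // b0 !rmorph0 addr0.
    rewrite rmorphM rmorphXn; have := vgeM vP hz (_ : vge (@lval _ L) 0 (O1 E0 ^+ M)).
    rewrite addr0; apply; apply: (vge0X vP); rewrite /E0 rmorphD rmorphXn rmorph1.
    by have [n0 v0] := unit1 _ y1; rewrite vgeE // v0.
  rewrite !rmorphM !rmorphXn; have := vgeM vP (_ : vge (@lval _ L) (e - M%:Z) (O1 (tau b z))) (vgeX vP M (tE b bO b0)).
  by rewrite -mulr_natr natz mul1r subrK; apply; rewrite /vge MP ?orbT.
have [w [w0 wv]] := lval_surj L e.
have ci j : (j < l)%N -> vge (@lval _ L) e (O2 (i (c j))).
  move=> jl; rewrite /vge fmorph_eq0 -agr -(fmorph_eq0 O1) -/(vge _ e (O1 (i (c j)))).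
  pose P := \poly_(j < l) (O1 (i (c j)) * w^-1).
  have : vge (@lval _ L) 0 P`_j.
    apply: (@vge_interp _ _ [seq O1 y + lcst L b | b <- enum (Om K l)]) => //.
    - by rewrite size_map -cardE cOm size_poly.
    - rewrite pairwise_map; have := enum_uniq (mem (Om K l)).
      rewrite uniq_pairwise; apply: sub_pairwise => b b' /= bb'.
      have -> : O1 y + lcst L b - (O1 y + lcst L b') = lcst L (b - b').
        by rewrite opprD addrACA subrr add0r rmorphB.
      by rewrite fmorph_eq0 subr_eq0 bb' lval_cst // subr_eq0.
    - by apply/allP => x /mapP [b _ ->]; apply: (vgeD vP) => //; exact: lcst_vge.
    move=> x /mapP [b]; rewrite mem_enum => bO ->.
    have -> : P.[O1 y + lcst L b] = O1 (tau b (z * E0 ^+ M)) * w^-1.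
      rewrite cE horner_poly !rmorph_sum mulr_suml; apply: eq_bigr => j' _.
      by rewrite !rmorphM !rmorphXn taui // tauO1 // mulrAC.
    by rewrite vge_mulw ?invr_eq0 // (valnV vP) wv opprK add0r; exact: all1.
  by rewrite coef_poly jl vge_mulw ?invr_eq0 // (valnV vP) wv opprK add0r.
have : vge (@lval _ L) e (O2 (z * E0 ^+ M)).
  rewrite cE rmorph_sum; apply: (vge_sum vP) => j _; rewrite rmorphM rmorphXn.
  have := vgeM vP (ci j (ltn_ord j)) (vge0X vP j y20); by rewrite addr0.
have [n0 v0] := unit1 _ y2.
have EO : O2 (E0 ^+ M) = (O2 y ^+ l.-1 + 1) ^+ M by rewrite rmorphXn rmorphD rmorphXn rmorph1.
by rewrite rmorphM EO vge_mulw ?expf_neq0 // (valnX vP) v0 mul0rn subr0.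
Qed.

End Galois.

Lemma tstate_hom (K F : fieldType) (em : {rmorphism K -> F}) (l : nat) (u : F) (L : laurent K)
    (H : {rmorphism F -> L}) (bs : seq F) : (0 < l)%N ->
  (forall a, H (em a) = lcst L a) -> u != 0 -> lval (H u) = - (l ^ size bs)%N%:Z ->
  (forall t, (t < size bs)%N -> vge (@lval _ L) (- (l ^ (size bs - t.+1))%N%:Z) (H (nth 0 bs t))) ->
  (bs != [::] -> vge (@lval _ L) 0 (H (u + (head 0 bs) ^+ l + head 0 bs))) ->
  (forall t, (t.+1 < size bs)%N ->
     vge (@lval _ L) 0 (H ((nth 0 bs t.+1) ^+ l + nth 0 bs t.+1 - nth 0 bs t))) ->
  tstate em l u (l ^ size bs) (fun e x => vge (@lval _ L) e (H x))
    (fun d x => vge (@lval _ L) (- d) (H x)) unit 1 bs.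
Proof.
move=> l0 He u0 vu hB hH hA; have fP := hom_filt He.
have S0 : (1 - l ^ size bs = 0)%N by apply/eqP; rewrite subn_eq0 expn_gt0 l0.
split=> //.
- move=> d; split; first exact: (filt0 fP).
  by move=> a x y hx hy; apply: (filtD fP) => //; exact: (filtK fP).
- by move=> d; exact: hom_cut.
- by move=> d d' x le; apply: vge_le; rewrite lerN2.
- by move=> d x; rewrite S0 mul1r addr0.
- by move=> _ d x; rewrite mul1r.
- by rewrite oppr0; exact: (filt1 fP).
- by rewrite card_unit.
- by rewrite !vgeE ?fmorph_eq0 ?invr_eq0 // fmorphV (valnV (lvalP L)) vu opprK.
- by case: (bs) => [|b bs'] //=; rewrite mul1n.
by move=> t tb; rewrite mul1n; exact: hB.
Qed.

Lemma cut_pull (K F F' : fieldType) (em : {rmorphism K -> F}) (em' : {rmorphism K -> F'})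
    (g : F' -> F) (J : finType) (P P' : F -> Prop) :
  (forall a z z', g (em' a * z + z') = em a * g z + g z') ->
  cutby em J P P' -> cutby em' J (fun z => P (g z)) (fun z => P' (g z)).
Proof.
move=> gl [phi [lin ker]]; exists (fun j z => phi j (g z)); split=> [j a x z hx hz|x hx h0].
  by rewrite gl lin.
exact: ker.
Qed.

Lemma ksub_pull (K F F' : fieldType) (em : {rmorphism K -> F}) (em' : {rmorphism K -> F'})
    (g : F' -> F) (P : F -> Prop) :
  (forall a z z', g (em' a * z + z') = em a * g z + g z') -> ksub em P -> ksub em' (fun z => P (g z)).
Proof.
move=> gl [P0 PS]; split; last by move=> a x y hx hy; rewrite gl; exact: PS.
have := gl 1 0 0; rewrite mulr0 addr0 rmorph1 mul1r => /eqP; rewrite -subr_eq subrr eq_sym => /eqP ->.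
exact: P0.
Qed.

Lemma multi_cut (K F : fieldType) (em : {rmorphism K -> F}) (X : finType) (J : X -> finType)
    (P : X -> int -> F -> Prop) (d : X -> int) (a : X -> nat) (Q : F -> Prop) z :
  (forall x e, ksub em (P x e)) -> (forall x e, cutby em (J x) (P x e) (P x (e - 1))) -> ksub em Q ->
  dimge em (fun f => (forall x, P x (d x + (a x)%:Z) f) /\ Q f) z ->
  dimge em (fun f => (forall x, P x (d x) f) /\ Q f) (z - \sum_x (a x * #|J x|)%N%:Z).
Proof.
move=> sP cP sQ h.
pose st (s : seq X) x := if x \in s then d x else d x + (a x)%:Z.
suff H : forall s : seq X, uniq s -> dimge em (fun f => (forall x, P x (st s x) f) /\ Q f)
    (z - \sum_(x <- s) (a x * #|J x|)%N%:Z).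
  have := H (enum X) (enum_uniq _); rewrite big_enum /=; apply: dimge_sub => // f [hf Qf]; split=> // x.
  by have := hf x; rewrite /st mem_enum.
elim=> [|x s IH] /=; first by rewrite big_nil subr0.
case/andP=> xs us; have := IH us.
pose Q' f := (forall x', x' != x -> P x' (st s x') f) /\ Q f.
have sQ' : ksub em Q'.
  split; first by split; [move=> x' _; exact: (sP _ _).1|exact: sQ.1].
  by move=> b f g [h1 h2] [h3 h4]; split; [move=> x' hx; apply: (sP _ _).2; [exact: h1|exact: h3]|apply: sQ.2].
move/(@dimge_sub _ _ _ _ (fun f => P x (d x + (a x)%:Z) f /\ Q' f) _ _ _ (lexx _)) => h1.
have {}h1 : dimge em (fun f => P x (d x + (a x)%:Z) f /\ Q' f) (z - \sum_(x <- s) (a x * #|J x|)%N%:Z).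
  apply: h1 => f [hf Qf]; split; last by split=> // x' _; exact: hf.
  by have := hf x; rewrite /st (negPf xs).
have := dim_cut_iter (a x) (sP x) sQ' (cP x) h1; rewrite addrK big_cons opprD addrA addrAC.
apply: dimge_sub => // f [hx [hf Qf]]; split=> // x'; rewrite /st inE.
by have [->|ne] := eqVneq x' x; [|exact: hf].
Qed.

Section Twist.
Variables (K F F' : fieldType) (em : {rmorphism K -> F}) (i : {rmorphism F -> F'}) (l : nat) (u : F) (y : F').
Hypotheses (Q1 : (1 < l)%N) (QF : [pchar F].-nat l)
  (uniq : forall c : nat -> F, \sum_(j < l) i (c j) * y ^+ j = 0 -> forall j, (j < l)%N -> c j = 0).
Variables (S : nat) (G Lm : int -> F -> Prop) (J : finType) (h : nat) (bs : seq F).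
Hypothesis T : tstate em l u S G Lm J h bs.
Local Notation b := (head 0 bs).
Local Notation B := (tB_ l bs).

(** The shift [b] depends on the group of places, while one space has to serve all groups; it is
    therefore written in powers of [y]. Expanding [y ^ j = ((y + b) - b) ^ j] brings in [b ^ q],
    with a pole of [q B], and lowers the index by [q]: the allowance [(l - 1 - j) B] is reproduced
    exactly. *)
Lemma twist_coef (d : int) (c : nat -> F) :
  (forall j, (j < l)%N -> Lm (d + ((l.-1 - j) * B)%N%:Z) (c j)) ->
  exists c' : nat -> F, \sum_(j < l) i (c j) * y ^+ j = \sum_(j < l) i (c' j) * (y + i b) ^+ j /\
    forall j, (j < l)%N -> Lm (d + ((l.-1 - j) * B)%N%:Z) (c' j).
Proof.
move=> hc; pose D z := exists c' : nat -> F, z = \sum_(j < l) i (c' j) * (y + i b) ^+ j /\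
    forall j, (j < l)%N -> Lm (d + ((l.-1 - j) * B)%N%:Z) (c' j).
have sL := tsL T.
have DD x z : D x -> D z -> D (x + z).
  case=> c1 [-> h1] [c2 [-> h2]]; exists (fun j => c1 j + c2 j); split.
    by rewrite -big_split; apply: eq_bigr => j _; rewrite rmorphD mulrDl.
  by move=> j jl; apply: ksubD => //; [exact: h1|exact: h2].
have D0 : D 0.
  by exists (fun=> 0); split=> [|j _]; [rewrite big1 // => j _; rewrite rmorph0 mul0r|exact: (sL _).1].
have DM a q : (q < l)%N -> Lm (d + ((l.-1 - q) * B)%N%:Z) a -> D (i a * (y + i b) ^+ q).
  move=> ql ha; exists (fun j => if j == q then a else 0); split.
    rewrite (bigD1 (Ordinal ql)) //= eqxx big1 ?addr0 // => j jq.
    by rewrite ifF ?rmorph0 ?mul0r //; apply: contraNF jq => /eqP h'; apply/eqP/val_inj.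
  by move=> j jl; case: eqP => [->|_] //; exact: (sL _).1.
suff : D (\sum_(j < l) i (c j) * y ^+ j) by [].
have Ds (I : Type) (r : seq I) (P : pred I) (g : I -> F') : (forall x, P x -> D (g x)) -> D (\sum_(x <- r | P x) g x).
  by move=> hg; elim/big_rec: _ => [|x z /hg]; [exact: D0|exact: DD].
apply: (Ds) => j _.
have -> : i (c j) * y ^+ j = i (c j) * ((y + i b) - i b) ^+ j by rewrite addrK.
rewrite exprDn mulr_sumr; apply: Ds => q _.
have qj : (q <= j)%N by rewrite -ltnS.
have -> : i (c j) * ((y + i b) ^+ (j - q) * (- i b) ^+ q *+ 'C(j, q)) =
   i (em ((-1) ^+ q *+ 'C(j, q)) * (b ^+ q * c j)) * (y + i b) ^+ (j - q).
  rewrite !rmorphM !rmorphMn !rmorphXn !rmorphN !rmorph1 -[- i b]mulN1r exprMn mulrnAr !mulrnAl.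
  by congr (_ *+ _); ring.
have jl := ltn_ord j.
apply: DM; first exact: leq_ltn_trans (leq_subr _ _) jl.
apply: ksubZ => //; have := tstate_twist Q1 QF T q (hc j jl).
by rewrite -addrA -PoszD -mulnDl; have -> : (l.-1 - j + q = l.-1 - (j - q))%N by move: (nat_of_ord j) (nat_of_ord q) qj jl; glia.
Qed.

End Twist.

Lemma iter_hom (F : fieldType) (s : {rmorphism F -> F}) j :
  exists S : {rmorphism F -> F}, forall z, S z = iter j s z.
Proof.
elim: j => [|j [S SE]]; first by exists [the {rmorphism F -> F} of @idfun F].
by exists [the {rmorphism F -> F} of s \o S] => z /=; rewrite SE.
Qed.

Lemma vge_lval (kk : fieldType) (L : laurent kk) (x : L) e : x != 0 -> vge (@lval _ L) e x -> e <= lval x.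
Proof. by move=> x0; rewrite vgeE. Qed.

Lemma val_pev_neg (K F : fieldType) (em : {rmorphism K -> F}) (P : F -> int) (x : F) (g : {poly K}) :
  valn P -> (forall a, a != 0 -> P (em a) = 0) -> P x < 0 -> g != 0 ->
  P (pev em g x) = P x * (size g).-1%:Z.
Proof.
move=> PP Pe Px g0; have sg : (0 < size g)%N by rewrite size_poly_gt0.
have x0 : x != 0 by apply: contraTneq Px => ->; rewrite (valn0 PP).
have lt : ((size g).-1 < size g)%N by rewrite prednK.
have lc : g`_(size g).-1 != 0 by rewrite -lead_coefE lead_coef_eq0.
have vt i : g`_i != 0 -> P (em g`_i * x ^+ i) = P x * i%:Z.
  move=> gi; rewrite (valnM PP) ?expf_neq0 ?fmorph_eq0 // Pe // add0r (valnX PP).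
  by rewrite -mulr_natr natz.
rewrite pev_sum; pose G (i : 'I_(size g)) := em g`_i * x ^+ i.
have G0 : G (Ordinal lt) != 0 by rewrite /G mulf_neq0 ?expf_neq0 ?fmorph_eq0.
have PG : P (G (Ordinal lt)) = P x * (size g).-1%:Z := vt _ lc.
have Gm i : i != Ordinal lt -> vge P (P (G (Ordinal lt)) + 1) (G i).
  move=> ii; have {}ii : (i < (size g).-1)%N.
    rewrite ltn_neqAle; apply/andP; split; last by rewrite -ltnS prednK.
    by apply: contraNneq ii => h; apply/eqP/val_inj.
  rewrite PG /G; have [->|gi] := eqVneq g`_i 0; first by rewrite rmorph0 mul0r vge0.
  rewrite vgeE ?mulf_neq0 ?expf_neq0 ?fmorph_eq0 // vt //.
  by move: (P x) (nat_of_ord i) (_.-1) Px ii; gnia.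
by have [_ ->] := valn_sum_min PP G0 Gm.
Qed.

Lemma hom_ksub (K F : fieldType) (em : {rmorphism K -> F}) (L : laurent K) (H : {rmorphism F -> L}) e :
  (forall a, H (em a) = lcst L a) -> ksub em (fun z => vge (@lval _ L) e (H z)).
Proof.
move=> He; have fP := hom_filt He; split; first exact: (filt0 fP).
by move=> a x y hx hy; apply: (filtD fP) => //; exact: (filtK fP).
Qed.

Section PointValue.
Variables (K F : fieldType) (em : {rmorphism K -> F}) (x : F) (L : laurent K) (b : K) (O : {rmorphism F -> L}).
Hypotheses (Oe : forall a, O (em a) = lcst L a) (Ox : lval (O x - lcst L b) = 1).

Let t := O x - lcst L b.
Let t0 : t != 0. Proof. by apply/eqP => h; move: Ox; rewrite -/t h (valn0 (lvalP L)). Qed.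

Lemma pt_pev p : O (pev em p x) = pev (lcst L) p (O x).
Proof. exact: rmorph_pev. Qed.

Lemma pt_int p : vge (@lval _ L) 0 (pev (lcst L) p (O x)).
Proof.
have vP := lvalP L; rewrite pev_sum; apply: (vge_sum vP) => j _; rewrite (vge0M vP) ?lcst_vge //.
apply: (vge0X vP); rewrite -(subrK (lcst L b) (O x)); apply: (vgeD vP); last exact: lcst_vge.
by rewrite -/t vgeE // Ox.
Qed.

Lemma pt_val (p q : {poly K}) e : p = q * ('X - b%:P) ^+ e -> q.[b] != 0 -> lval (O (pev em p x)) = e%:Z.
Proof.
move=> -> qb; have vP := lvalP L; rewrite pt_pev pevM.
have -> : pev (lcst L) (('X - b%:P) ^+ e) (O x) = t ^+ e.
  by rewrite /pev rmorphXn /= map_polyXsubC horner_exp hornerXsubC.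
have : root (q - q.[b]%:P) b by rewrite rootE hornerD hornerN hornerC subrr.
case/factor_theorem => g gE.
have qE : pev (lcst L) q (O x) = lcst L q.[b] + pev (lcst L) g (O x) * t.
  have : pev (lcst L) (q - q.[b]%:P) (O x) = pev (lcst L) g (O x) * t.
    by rewrite gE pevM; congr (_ * _); rewrite /pev map_polyXsubC hornerXsubC.
  by rewrite /pev rmorphB /= map_polyC hornerD hornerN hornerC => <-; rewrite addrC subrK.
have c0 : lcst L q.[b] != 0 by rewrite fmorph_eq0.
have := @valnD_lt _ _ vP (lcst L q.[b]) (pev (lcst L) g (O x) * t) c0.
rewrite lval_cst // add0r => -[|n0 v0].
  by have := vgeM vP (pt_int g) (_ : vge (@lval _ L) 1 t); rewrite add0r; apply; rewrite vgeE // Ox.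
by rewrite qE (valnM vP) ?expf_neq0 // v0 (valnX vP) Ox add0r natz.
Qed.

End PointValue.

Lemma pt_same (K F : fieldType) (em : {rmorphism K -> F}) (x : F) (L : laurent K) (b : K)
   (O1 O2 : {rmorphism F -> L}) :
  (forall z, exists n d : {poly K}, [/\ d != 0, coprimep n d & z = pev em n x / pev em d x]) ->
  (forall a, O1 (em a) = lcst L a) -> (forall a, O2 (em a) = lcst L a) ->
  lval (O1 x - lcst L b) = 1 -> lval (O2 x - lcst L b) = 1 -> forall z, lval (O1 z) = lval (O2 z).
Proof.
move=> fr O1e O2e O1x O2x z; have vP := lvalP L; have [n [d [d0 _ ->]]] := fr z.
have P (p : {poly K}) : p != 0 -> lval (O1 (pev em p x)) = lval (O2 (pev em p x)).
  move=> p0; have [e [q]] := multiplicity_XsubC p b; rewrite p0 /= => rq pE.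
  by rewrite (pt_val O1e O1x pE rq) (pt_val O2e O2x pE rq).
have [->|n0] := eqVneq n 0; first by rewrite /pev rmorph0 horner0 mul0r !rmorph0.
have [a0|a0] := eqVneq (pev em n x / pev em d x) 0; first by rewrite a0 !rmorph0.
move: a0; rewrite mulf_eq0 invr_eq0 negb_or => /andP[a0 b0].
rewrite !fmorph_div !(valnM vP) ?invr_eq0 ?fmorph_eq0 // !(valnV vP) !P //.
Qed.

Lemma roots_sum (K : finFieldType) (F : fieldType) (em : {rmorphism K -> F}) (x : F) (L : laurent K)
   (N : K -> {rmorphism F -> L}) (p : {poly K}) :
  (forall b a, N b (em a) = lcst L a) -> (forall b, lval (N b x - lcst L b) = 1) -> p != 0 ->
  \sum_b lval (N b (pev em p x)) <= (size p).-1%:Z.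
Proof.
move=> Ne Nx; have [n] := ubnP (size p); elim: n p => // n IH p; rewrite ltnS => sp p0.
case: (pickP (root p)) => [a ra|nr].
  have [q pE] := factor_theorem _ _ ra.
  have q0 : q != 0 by apply: contraNneq p0 => h; rewrite pE h mul0r.
  have sq : size p = (size q).+1 by rewrite pE size_Mmonic ?monicXsubC // size_XsubC addn2.
  have sq0 : (0 < size q)%N by rewrite size_poly_gt0.
  have := IH q; rewrite -ltnS -sq => /(_ sp q0).
  have -> : \sum_b lval (N b (pev em p x)) = \sum_b lval (N b (pev em q x)) + 1.
    have E b : lval (N b (pev em p x)) = lval (N b (pev em q x)) + (b == a)%:Z.
      have [e [g]] := multiplicity_XsubC q b; rewrite q0 /= => rg qE.
      rewrite (pt_val (Ne b) (Nx b) qE rg); have [ba|ba] := eqVneq b a.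
        rewrite (@pt_val _ _ _ _ _ b (N b) (Ne b) (Nx b) p g e.+1) //; first by rewrite -addn1 PoszD.
        by rewrite pE qE ba exprSr mulrA.
      rewrite (@pt_val _ _ _ _ _ b (N b) (Ne b) (Nx b) p (g * ('X - a%:P)) e) ?addr0 //.
        by rewrite pE qE mulrAC.
      by rewrite hornerM hornerXsubC mulf_neq0 // subr_eq0.
    under eq_bigr => b _ do rewrite E.
    rewrite big_split /=; congr (_ + _).
    by rewrite (bigD1 a) //= eqxx big1 ?addr0 // => b /negPf ->.
  by rewrite sq /=; move: (size q) sq0 (\sum_b _); glia.
rewrite big1 => [//|b _].
by rewrite (@pt_val _ _ _ _ _ b (N b) (Ne b) (Nx b) p p 0) ?expr0 ?mulr1 // -rootE nr.
Qed.

(** * Levels of the tower *)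

Section GSTower.
Variables (K : finFieldType) (p f l : nat) (ga al : K) (L : laurent K).
Hypotheses (pp : prime p) (lE : l = (p ^ f)%N) (f0 : (0 < f)%N) (Kl : #|K| = (l ^ 2)%N)
  (gaP : l.-1.-primitive_root ga) (alP : al \in Om K l :\ 0).
Local Notation n := l.-1.

(** Group 0 is the pole of [x_0]. Group [j + 1] starts at level [j], at the place where the earlier
    [x_i] vanish and [x_j] has residue [al]; there [uof x_j] has a pole of order [l ^ j]. [tyh] is
    the degree of level [k] over the start of the group. *)
Definition tyS (t : nat) : nat := if t is j.+1 then (l ^ j)%N else 1%N.
Definition tyh (k t : nat) : nat := if t is j.+1 then (l ^ (k - j))%N else (l ^ k)%N.

(** [gH] are the completely split points, one for each orbit of [gs], and [gO] is the common zero of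
    all [x_j]. The groups [gG t] carry the poles; their translates are reached by iterating [gs] on
    the function. [gprod] is the product formula as an inequality. [gdim] is a lower bound of
    Riemann type, with [l ^ k] as constant term, for the spaces [gL], which admit the additional
    poles recorded in [tsLG]. *)
Record gsl (k : nat) := GSL {
  gF :> fieldType; ge : {rmorphism K -> gF}; gx : nat -> gF; gv : gF -> int;
  gs : {rmorphism gF -> gF}; gR : gF -> Prop;
  gG : nat -> int -> gF -> Prop; gL : nat -> int -> gF -> Prop; gJ : nat -> finType; gb : nat -> seq gF;
  gO : {rmorphism gF -> L}; gI : finType; gH : gI -> {rmorphism gF -> L};
  gvP : valn gv; gvx : gv (gx k) = -1;
  gxr : forall j, (j < k)%N -> gx j.+1 ^+ l + gx j.+1 = uof l (gx j);
  gse : forall a, gs (ge a) = ge a;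
  gsx : forall j, (j <= k)%N -> gs (gx j) = ge ga * gx j;
  gsn : forall z, iter n gs z = z;
  gRP : filt ge (fun=> gR); gRu : gR (uof l (gx k)); gRuV : gR (uof l (gx k))^-1;
  gRs : forall z, gR z -> gR (gs z);
  gT : forall t, (t <= k.+1)%N ->
    tstate ge l (uof l (gx k)) (tyS t) (gG t) (gL t) (gJ t) (tyh k t) (gb t);
  gOe : forall a, gO (ge a) = lcst L a;
  gOx : forall j, (j <= k)%N -> gx j != 0 /\ lval (gO (gx j)) = (l ^ j)%N%:Z;
  gOs : forall z, lval (gO (gs z)) = lval (gO z);
  gHe : forall t a, gH t (ge a) = lcst L a;
  gHR : forall t z, gR z -> vge (@lval _ L) 0 (gH t z);
  gHx : forall t, exists2 a, a \notin Om K l & vge (@lval _ L) 1 (gH t (gx k) - lcst L a);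
  gIc : #|gI| = (l ^ k.+1)%N;
  gb0 : gb 0 = [::];
  gLs : forall d z, gL 0 d z -> gL 0 d (gs z);
  gGs : forall e z, gG 0 e z -> gG 0 e (gs z);
  gprod : forall z e0 e eO, z != 0 -> gR z -> gG 0 e0 z ->
    (forall j c, (j <= k)%N -> (c < n)%N -> gG j.+1 (e j c) (iter c gs z)) -> vge (@lval _ L) eO (gO z) ->
    \sum_t \sum_(j < n) lval (gH t (iter j gs z)) + e0 + \sum_(j < k.+1) \sum_(c < n) e j c + eO <= 0;
  gdim : forall d0 d dO, dimge ge (fun z => [/\ gR z, gL 0 d0 z,
      forall j c, (j <= k)%N -> (c < n)%N -> gL j.+1 (d j c) (iter c gs z) & vge (@lval _ L) (- dO) (gO z)])
    ((l ^ k)%N%:Z * d0 + \sum_(j < k.+1) \sum_(c < n) (l ^ (k - j))%N%:Z * d j c + dO + (l ^ k)%N%:Z)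
}.

Let l1 : (1 < l)%N. Proof. by rewrite lE -(exp1n f) ltn_exp2r // prime_gt1. Qed.
Let l0 : (0 < l)%N. Proof. exact: ltnW. Qed.
Let n0 : (0 < n)%N. Proof. by rewrite -ltnS prednK. Qed.
Let pK : p \in [pchar K].
Proof. by apply: (card_finPcharP (n := f * 2)); rewrite // Kl lE -expnM. Qed.
Let lchar (F : fieldType) (em : {rmorphism K -> F}) : [pchar F].-nat l.
Proof. by rewrite lE pchar_pnat // (fmorph_pchar em). Qed.

Lemma uof2 (F : fieldType) (x : F) : x != 0 -> uof l x = x ^+ l.+1 / (x ^+ l + x).
Proof.
move=> x0; have -> : x ^+ l + x = x * (x ^+ l.-1 + 1) by rewrite mulrDr mulr1 -exprS prednK.
by rewrite exprS -mulf_div mulfV // mul1r.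
Qed.

Lemma lval_as (x : L) d : x != 0 -> lval x = d -> 0 < d ->
  x ^+ l + x != 0 /\ lval (x ^+ l + x) = d.
Proof.
move=> x0 xv d0; have vP := lvalP L; rewrite addrC -xv; apply: (valnD_lt vP) => //.
rewrite vgeE ?expf_neq0 // (valnX vP) xv -mulr_natr natz.
by move: l1 d0; clear; nia.
Qed.

(** Level 0 is [K(x)] with the ring [K[x, 1 / (x ^ l + x)]]. The product formula compares the degree
    of a numerator with its zeros in [K]; the dimension bound starts from the functions
    [x ^ i / D ^ M] and imposes conditions at [Om]. *)
Lemma gsl0 : inhabited (gsl 0).
Proof.
have vP := lvalP L.
have [F [em [x [tr fr hom [v [vvP vp]]]]]] := ratfun_exists K.
have lF := lchar em.
have vx : v x = -1 by have := vp 'X; rewrite /pev map_polyX hornerX polyX_eq0 size_polyX; exact.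
have ve a : a != 0 -> v (em a) = 0.
  by move=> a0; have := vp a%:P; rewrite /pev map_polyC hornerC polyC_eq0 size_polyC a0; exact.
have x0 : x != 0 by apply/eqP => h; move: vx; rewrite h (valn0 vvP).
have ga0 := ga_neq0 pp lE f0 gaP.
have trg : transcendental em (em ga * x).
  by apply: (val_transcendental vvP ve); rewrite (valnM vvP) ?fmorph_eq0 // ve // vx.
have [s [se sx]] := hom _ em _ trg.
have isx j : iter j s x = em (ga ^+ j) * x.
  elim: j => [|j IH]; first by rewrite expr0 rmorph1 mul1r.
  by rewrite iterS IH rmorphM se sx mulrA -rmorphM exprSr.
have ise j a : iter j s (em a) = em a by elim: j => //= j ->; rewrite se.
have trN b : transcendental (lcst L) (lcst L b + lvar L).
  by move=> g g0; have := lpoint_neq0 L b g0.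
have /choice [N NP] := fun b => hom _ (lcst L) _ (trN b).
have Ne b a : N b (em a) = lcst L a by case: (NP b).
have Nx b : lval (N b x - lcst L b) = 1 by have [_ ->] := NP b; rewrite addrC addKr lval_var.
have trI : transcendental (lcst L) (lvar L)^-1.
  by apply: (val_transcendental vP (@lval_cst _ L)); rewrite (valnV vP) lval_var.
have [Hi [Hie Hix]] := hom _ (lcst L) _ trI.
pose D := x ^+ l + x.
have DE : D = pev em ('X^l + 'X) x by rewrite /pev rmorphD /= map_polyXn map_polyX hornerD hornerXn hornerX.
have D0 : D != 0.
  by rewrite DE tr // -size_poly_gt0 size_polyDl size_polyXn // size_polyX.
have uE : uof l x = x ^+ l.+1 / D by rewrite uof2.
have u0 : uof l x != 0 by rewrite uE mulf_neq0 ?expf_neq0 ?invr_eq0.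
have alO : al \in Om K l by move: alP; rewrite in_setD1 => /andP[].
have al0 : al != 0 := al_neq0 alP.
have lcl b : lcst L b ^+ l = lcst L (b ^+ l) by rewrite rmorphXn.
have ND b : N b D = (lvar L ^+ l + lvar L) + lcst L (b ^+ l + b).
  have [_ nx] := NP b; rewrite /D rmorphD rmorphXn nx exprDn_pchar ?lcl ?(eq_pnat _ (fmorph_pchar (lcst L))) //.
    by rewrite rmorphD; ring.
  by rewrite lE pchar_pnat.
have NDO b : b \in Om K l -> lval (N b D) = 1.
  rewrite inE => /eqP h; rewrite ND h rmorph0 addr0.
  by have [] := lval_as (lvar_neq0 L) (lval_var L) isT.
have NDn b : b \notin Om K l -> lval (N b D) = 0.
  rewrite inE => h; have c0 : lcst L (b ^+ l + b) != 0 by rewrite fmorph_eq0.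
  have := @valnD_lt _ _ vP (lcst L (b ^+ l + b)) (lvar L ^+ l + lvar L) c0.
  rewrite lval_cst // add0r ND [X in _ -> lval X = _]addrC => -[] //.
  by have [a0 a1] := lval_as (lvar_neq0 L) (lval_var L) isT; rewrite vgeE // a1.
pose R z := exists (g : {poly K}) (e : nat), z = pev em g x / D ^+ e.
have RP : filt em (fun=> R).
  split=> //.
  - move=> _ z z' [g [e ->]] [g' [e' ->]]; exists (g * ('X^l + 'X) ^+ e' + g' * ('X^l + 'X) ^+ e), (e + e')%N.
    rewrite /pev rmorphD hornerD !rmorphM !rmorphXn /= !hornerM !horner_exp -/(pev em ('X^l + 'X) x) -DE exprD.
    rewrite -addf_div ?expf_neq0 //; congr (_ / _); rewrite -/(pev em g x) -/(pev em g' x) //.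
  - move=> _ a z [g [e ->]]; exists (a *: g), e.
    by rewrite -mul_polyC pevM mulrA; congr (_ * _ / _); rewrite /pev map_polyC hornerC.
  - move=> _ _ z z' [g [e ->]] [g' [e' ->]]; exists (g * g'), (e + e')%N.
    by rewrite pevM exprD mulf_div.
  - by exists 1, 0%N; rewrite /pev rmorph1 hornerC divr1.
  by move=> _; exists 0, 0%N; rewrite /pev rmorph0 horner0 mul0r.
have RD : R D^-1 by exists 1, 1%N; rewrite /pev rmorph1 hornerC expr1 div1r.
have Rx : R x by exists 'X, 0%N; rewrite /pev map_polyX hornerX divr1.
have Rm z z' : R z -> R z' -> R (z * z') by exact: (filtM RP (e := 0) (e' := 0)).
have Ra z z' : R z -> R z' -> R (z + z') by exact: (filtD RP (e := 0)).
have RX z m : R z -> R (z ^+ m) by move=> h; elim: m => [|m IH]; rewrite ?exprS; [exact: (filt1 RP)|exact: Rm].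
have RxV : R x^-1.
  have -> : x^-1 = (x ^+ l.-1 + 1) * D^-1.
    by rewrite /D -{2}(prednK l0) exprS -[X in _ / (_ + X)]mulr1 -mulrDr invfM mulrCA mulfV ?mulr1 //; apply: contraNneq D0 => h; rewrite /D -(prednK l0) exprS -[X in _ + X]mulr1 -mulrDr h mulr0.
  by apply: Rm => //; apply: Ra; [exact: RX|exact: (filt1 RP)].
have sD : s D = em ga * D by rewrite /D rmorphD rmorphXn sx exprMn -rmorphXn (ga_frob pp lE f0 gaP) mulrDr.
pose rp (i : 'I_#|reps K l|) : K := enum_val i.
have rpO i : rp i \notin Om K l by have := enum_valP i; rewrite inE => /andP[].
have Gs j b (z' : F) : lval (N b (iter j s z')) = lval (N (ga ^+ j * b) z').
  have [S SE] := iter_hom s j; rewrite -SE.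
  apply: (pt_same (O1 := [the {rmorphism F -> L} of N b \o S]) (b := ga ^+ j * b) fr) => //= [a|].
    by rewrite SE ise Ne.
  rewrite SE isx rmorphM Ne rmorphM -mulrBr (valnM vP) ?fmorph_eq0 ?expf_neq0 // ?lval_cst ?expf_neq0 ?Nx //.
  by apply/eqP => h; have := Nx b; rewrite h (valn0 vP).
have Hix1 : lval (Hi x) < 0 by rewrite Hix (valnV vP) lval_var.
have pl (q : {poly K}) : q != 0 -> lval (Hi (pev em q x)) = - (size q).-1%:Z.
  move=> q0; rewrite (val_pev_neg (valn_comp Hi vP) _ Hix1 q0) => [|a a0]; last by rewrite Hie lval_cst.
  by rewrite Hix (valnV vP) lval_var mulN1r.
have HiD : lval (Hi D) = - l%:Z.
  by rewrite DE pl ?size_polyDl ?size_polyXn ?size_polyX // -size_poly_gt0 size_polyDl size_polyXn // size_polyX.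
have iter0 j z : (iter j s z == 0) = (z == 0).
  by have [S SE] := iter_hom s j; rewrite -SE fmorph_eq0.
have Nint b : vge (@lval _ L) 0 (N b x).
  by have := pt_int (Nx b) 'X; rewrite /pev map_polyX hornerX.
have His e z : vge (@lval _ L) e (Hi z) -> vge (@lval _ L) e (Hi (s z)).
  have [->|z0] := eqVneq z 0; first by rewrite !rmorph0.
  rewrite !vgeE ?fmorph_eq0 //; suff -> : lval (Hi (s z)) = lval (Hi z) by [].
  pose h := [the {rmorphism F -> L} of Hi \o s].
  have hx : lval (h x) = -1.
    by rewrite /= sx rmorphM Hie Hix (valnM vP) ?invr_eq0 ?lvar_neq0 ?fmorph_eq0 // lval_cst // (valnV vP) lval_var.
  have ph (q : {poly K}) : q != 0 -> lval (h (pev em q x)) = - (size q).-1%:Z.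
    move=> q0; rewrite (val_pev_neg (valn_comp h vP) _ _ q0) ?hx ?mulN1r // => a a0.
    by rewrite /= se Hie lval_cst.
  have [g [d [d0 _ zE]]] := fr z; move: z0; rewrite zE mulf_eq0 invr_eq0 negb_or => /andP[g1 d1].
  have g0 : g != 0 by apply: contraNneq g1 => ->; rewrite /pev rmorph0 horner0.
  rewrite !fmorph_div !(valnM vP) ?invr_eq0 ?fmorph_eq0 // !(valnV vP) !pl //.
  by have := ph _ g0; have := ph _ d0; rewrite /= => -> ->.
constructor; apply: (@GSL 0 F em (fun=> x) v s R
   (fun t e z => if t is 0 then vge (@lval _ L) e (Hi z) else vge (@lval _ L) e (N al z))
   (fun t d z => if t is 0 then vge (@lval _ L) (- d) (Hi z) else vge (@lval _ L) (- d) (N al z))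
   (fun=> unit : finType) (fun=> [::]) (N 0) ('I_#|reps K l| : finType) (fun i => N (rp i))) => //.
- move=> z; have [S SE] := iter_hom s n; rewrite -SE; have [g [d [d0 _ ->]]] := fr z.
  have SP (q : {poly K}) : S (pev em q x) = pev em q x.
    rewrite (rmorph_pev (h0 := em)) => [|a]; last by rewrite SE ise.
    by rewrite SE isx (prim_expr_order gaP) rmorph1 mul1r.
  by rewrite fmorph_div !SP.
- by rewrite uE; apply: Rm => //; exact: RX.
- rewrite uE invf_div mulrC -exprVn; apply: Rm; first exact: RX.
  by rewrite DE; exists ('X^l + 'X), 0%N; rewrite divr1.
- move=> z [g [e ->]]; rewrite fmorph_div rmorphXn sD (rmorph_pev (h0 := em)) // sx pev_sum.
  have -> : (em ga * D) ^+ e = em (ga ^+ e) * D ^+ e by rewrite exprMn rmorphXn.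
  rewrite invfM mulrA -exprVn -fmorphV; apply: Rm; last exact: RX.
  rewrite mulrC; apply: (filtK RP (e := 0)); apply: (filt_sum RP (e := 0)) => j _.
  by apply: (filtK RP (e := 0)); apply: RX; apply: (filtK RP (e := 0)).
- case=> [|[|t]] // _.
  + apply: (@tstate_hom _ _ em l (uof l x) L Hi [::]) => //.
    rewrite uE fmorph_div rmorphXn Hix /D rmorphD rmorphXn Hix.
    have w0 : (lvar L)^-1 != 0 by rewrite invr_eq0 lvar_neq0.
    have wv : lval (lvar L)^-1 = -1 by rewrite (valnV vP) lval_var.
    have [|||||d0 dv] := @as_neg L (@lval _ L) l 1 (lvar L)^-1 vP; rewrite ?wv ?oner_neq0 ?(valn1 vP) //.
    rewrite mul1r in d0 dv; rewrite (valnM vP) ?expf_neq0 ?invr_eq0 ?lvar_neq0 // (valnV vP (_ + _)) dv wv (valnX vP) wv.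
    by rewrite expn0 -mulr_natr natz -addn1 PoszD; move: (l%:Z); clear; lia.
  apply: (@tstate_hom _ _ em l (uof l x) L (N al) [::]) => //.
  rewrite uE fmorph_div rmorphXn (valnM vP) ?expf_neq0 ?invr_eq0 ?fmorph_eq0 // (valnV vP) (NDO _ alO) (valnX vP).
  have := @pt_val _ _ em x L al (N al) (Ne al) (Nx al) 'X 'X 0; rewrite expr0 mulr1 hornerX => /(_ erefl al0).
  by rewrite /pev map_polyX hornerX => ->; rewrite mul0rn.
- by case=> // _; have := Nx 0; rewrite rmorph0 subr0.
- move=> z; apply: (pt_same (O1 := [the {rmorphism F -> L} of N 0 \o s]) (b := 0) fr) => //= [a|].
    by rewrite se Ne.
  have := Nx 0; rewrite rmorph0 !subr0 => h; rewrite sx rmorphM Ne (valnM vP) ?fmorph_eq0 ?h ?lval_cst //.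
- move=> i z [g [e ->]] /=; rewrite fmorph_div rmorphXn; have aO := rpO i.
  apply: (vge0M vP); first by rewrite (pt_pev _ (Ne _)) (pt_int (Nx _)).
  by rewrite vgeE ?invr_eq0 ?expf_neq0 ?fmorph_eq0 // (valnV vP) (valnX vP) NDn // mul0rn.
- move=> i; exists (rp i) => //.
  by rewrite /= vgeE ?Nx //; apply/eqP => h; have := Nx (rp i); rewrite h (valn0 vP).
- by rewrite card_ord expn1 (card_reps pp lE f0 Kl gaP).
- by move=> d z; exact: His.
- move=> z e0 e eO z0 [g [m zE]] h0 h1 hO.
  have g0 : g != 0 by apply: contraNneq z0 => h; rewrite zE h /pev rmorph0 horner0 mul0r.
  have gx0 := tr _ g0.
  pose G b := lval (N b z).
  have lo0 : e0 <= m%:Z * l%:Z - (size g).-1%:Z.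
    have := vge_lval _ h0; rewrite fmorph_eq0 => /(_ z0); rewrite zE fmorph_div rmorphXn.
    rewrite (valnM vP) ?invr_eq0 ?expf_neq0 ?fmorph_eq0 // (valnV vP) (valnX vP).
    by rewrite HiD pl // -mulr_natr natz; move: (l) (m) (size g); glia.
  have lo1 c : (c < n)%N -> e 0%N c <= G (ga ^+ c * al).
    move=> cn; have := vge_lval _ (h1 0%N c isT cn); by rewrite Gs fmorph_eq0 iter0; exact.
  have loO : eO <= G 0 by have := vge_lval _ hO; rewrite fmorph_eq0; apply.
  rewrite big_ord1.
  have sumH : \sum_(i < #|reps K l|) \sum_(j < n) lval (N (rp i) (iter j s z)) = \sum_(a in ~: Om K l) G a.
    rewrite (sum_good pp lE f0 gaP G) [RHS]big_enum_val; apply: eq_bigr => i _.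
    by apply: eq_bigr => j _; rewrite Gs.
  rewrite sumH; have sO := sum_Om pp lE f0 gaP alP G.
  have tot : \sum_(a in ~: Om K l) G a + \sum_(a in Om K l) G a <= (size g).-1%:Z - m%:Z * l%:Z.
    have -> : \sum_(a in ~: Om K l) G a + \sum_(a in Om K l) G a = \sum_a G a.
      rewrite [RHS](bigID (mem (Om K l))) /= addrC; congr (_ + _).
      by apply: eq_bigl => a; rewrite inE.
    have Gb b : G b = lval (N b (pev em g x)) - m%:Z * (b \in Om K l)%:Z.
      rewrite /G zE fmorph_div rmorphXn (valnM vP) ?invr_eq0 ?expf_neq0 ?fmorph_eq0 // (valnV vP) (valnX vP).
      case: (boolP (b \in Om K l)) => bO; first by rewrite NDO // mulr1 natz.
      by rewrite NDn // mul0rn mulr0.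
    under eq_bigr => b _ do rewrite Gb.
    rewrite sumrB lerB //; first exact: roots_sum.
    rewrite -mulr_sumr; have -> : \sum_b (b \in Om K l)%:Z = l%:Z; last by [].
    rewrite -{2}(card_Om pp lE f0 Kl) -sum1_card [in RHS]big_mkcond -natz natr_sum.
    by apply: eq_bigr => b _; case: (b \in _).
  have : \sum_(c < n) e 0%N c <= \sum_(c < n) G (ga ^+ c * al) by apply: ler_sum => c _; exact: lo1.
  by move: lo0 loO tot; rewrite sO; move: (\sum_(c < n) e 0%N c) (\sum_(c < n) _) (\sum_(a in _) _) (G 0) (m%:Z * l%:Z) (size g).-1%:Z (e0) (eO); glia.
move=> d0 d dO.
(* [M] dominates all prescribed bounds: poles of order [M] are allowed at all of [Om] and then cut
   down to [d] and [dO], one condition per unit. *)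
pose M := (`|d0| + `|dO| + \sum_(c < n) `|d 0%N c|)%N.
have M1 : (`|d0| <= M)%N by rewrite /M -addnA leq_addr.
have M2 : (`|dO| <= M)%N by rewrite /M -addnA addnCA leq_addr.
have M3 (c : 'I_n) : (`|d 0%N c| <= M)%N by rewrite /M (bigD1 c) //= addnCA leq_addr.
have absle (a : int) b : (`|a| <= b)%N -> a <= b%:Z /\ 0 <= b%:Z + a by clear; case: a => a /=; lia.
have M0 : 0 <= (M * l)%N%:Z + d0.
  by have [] := absle d0 (M * l)%N (leq_trans M1 (leq_pmulr _ l0)).
have Mc (c : 'I_n) : d 0%N c <= M%:Z by have [] := absle _ _ (M3 c).
have MO : dO <= M%:Z by have [] := absle _ _ M2.
pose m' := `|((M * l)%N%:Z + d0)%R|%N.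
have m'E : m'%:Z = (M * l)%N%:Z + d0 by rewrite /m' gez0_abs.
pose w (i : 'I_m'.+1) := x ^+ i / D ^+ M.
have wfree : kfree em w.
  move=> a h; have : pev em (\poly_(i < m'.+1) a (inord i)) x = 0.
    have : (\sum_i em (a i) * w i) * D ^+ M = 0 by rewrite h mul0r.
    rewrite mulr_suml => h'; rewrite -[RHS]h' /pev (horner_coef_wide _ (_ : _ <= m'.+1)%N) ?size_map_poly ?size_poly //.
    apply: eq_bigr => i _; rewrite coef_map coef_poly ltn_ord inord_val /w -mulrA mulfVK ?expf_neq0 //.
  have [E _ i|ne] := eqVneq (\poly_(i < m'.+1) a (inord i)) 0; last by move/eqP; rewrite (negPf (tr _ ne)).
  by have := congr1 (fun q : {poly K} => q`_i) E; rewrite coef_poly ltn_ord coef0 inord_val.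
have wN b i : vge (@lval _ L) (- M%:Z) (N b (w i)).
  rewrite /w fmorph_div !rmorphXn; have := vgeM vP (vge0X vP i (Nint b)) (_ : vge (@lval _ L) (- M%:Z) (N b D ^- M)).
  rewrite add0r; apply; rewrite vgeE ?invr_eq0 ?expf_neq0 ?fmorph_eq0 // (valnV vP) (valnX vP).
  by case: (boolP (b \in Om K l)) => bO; [rewrite NDO // natz lexx|rewrite NDn // mul0rn oppr0 oppr_le0].
pose Q z := R z /\ vge (@lval _ L) (- d0) (Hi z).
have sR : ksub em R by split=> [|a z z' hz hz']; [exact: (filt0 RP 0)|apply: Ra => //; exact: (filtK RP (e := 0))].
have sQ : ksub em Q by apply: ksubI => //; exact: hom_ksub.
have hN c : exists S : {rmorphism F -> L}, (forall z, S z = N al (iter c s z)) /\ forall a, S (em a) = lcst L a.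
  have [S SE] := iter_hom s c; exists [the {rmorphism F -> L} of N al \o S]; split=> [z|a] /=; rewrite SE //.
  by rewrite ise Ne.
pose P (c : 'I_n) (e : int) z := vge (@lval _ L) (- e) (N al (iter c s z)) : Prop.
have sP c e : ksub em (P c e).
  have [S [SE Se]] := hN c; have := hom_ksub (- e) Se; congr ksub; apply/funext => z; by rewrite /P SE.
have cP c e : cutby em unit (P c e) (P c (e - 1)).
  by have [S [SE Se]] := hN c; have := hom_cut e Se; congr cutby; apply/funext => z; rewrite /P SE.
have sO e : ksub em (fun z => vge (@lval _ L) (- e) (N 0 z) : Prop) by exact: hom_ksub.
have start : dimge em (fun z => (forall c : 'I_n, P c (d 0%N c + `|(M%:Z - d 0%N c)%R|%N%:Z) z) /\
    (vge (@lval _ L) (- M%:Z) (N 0 z) /\ Q z)) (m'%:Z + 1).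
  exists m'.+1, w; split=> // [|i]; first by rewrite -addn1 PoszD.
  split=> [c|].
    rewrite /P; have -> : d 0%N c + `|(M%:Z - d 0%N c)%R|%N%:Z = M%:Z by have := Mc c; move: (d 0%N c) (M); glia.
    have := wN (ga ^+ c * al) i; rewrite /vge !fmorph_eq0 iter0; case: (eqVneq (w i) 0) => //= w0; by rewrite Gs.
  split; first exact: wN.
  split; first by rewrite /w -exprVn; apply: Rm; exact: RX.
  rewrite /w fmorph_div !rmorphXn vgeE ?mulf_neq0 ?invr_eq0 ?expf_neq0 ?fmorph_eq0 //.
  rewrite (valnM vP) ?invr_eq0 ?expf_neq0 ?fmorph_eq0 // (valnV vP) !(valnX vP) HiD Hix (valnV vP) lval_var.
  by have := ltn_ord i; rewrite -(mulr_natr _ i) -(mulr_natr _ M) !natz; move: m'E; rewrite PoszM; move: {i}(nat_of_ord i) => i; move: (M) (m') (l) (d0); gnia.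
have := multi_cut (J := fun=> unit) sP cP (ksubI (sO _) sQ) start.
have sQ' : ksub em (fun z => (forall c : 'I_n, P c (d 0%N c) z) /\ Q z).
  split; first by split; [move=> c; exact: (sP _ _).1|exact: sQ.1].
  by move=> a z z' [h1 h2] [h3 h4]; split; [move=> c; apply: (sP _ _).2|apply: sQ.2].
move/(dimge_sub (P' := fun z => vge (@lval _ L) (- M%:Z) (N 0 z) /\ ((forall c : 'I_n, P c (d 0%N c) z) /\ Q z))) => H.
have {}H := H _ (fun z h => conj h.2.1 (conj h.1 h.2.2)) (lexx _).
have := dim_cut_iter (L := fun e z => vge (@lval _ L) (- e) (N 0 z) : Prop) `|(M%:Z - dO)%R| sO sQ' (fun e => hom_cut e (Ne 0)) H.
apply: dimge_sub => [z [h1 [h2 [h3 h4]]]|].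
  split=> // [j c|]; first by rewrite leqn0 => /eqP -> cn; exact: (h2 (Ordinal cn)).
  by move: h1; have -> : M%:Z - `|(M%:Z - dO)%R|%N%:Z = dO by move: (dO) (M) MO; glia.
rewrite big_ord1 subn0 expn0 !mul1r card_unit muln1 m'E.
under eq_bigr => c _ do rewrite mul1r.
have -> : \sum_(c < n) (`|(M%:Z - d 0%N c)%R|%N * 1)%N%:Z = n%:Z * M%:Z - \sum_(c < n) d 0%N c.
  transitivity (\sum_(c < n) (M%:Z - d 0%N c)).
    by apply: eq_bigr => c _; rewrite muln1 gez0_abs // subr_ge0.
  by rewrite sumrB sumr_const card_ord -mulr_natl natz.
have -> : (M * l)%N%:Z = n%:Z * M%:Z + M%:Z by rewrite -{1}(prednK l0) mulnS PoszD PoszM mulrC addrC.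
rewrite (gez0_abs (_ : 0 <= M%:Z - dO)) ?subr_ge0 //.
by move: (n%:Z * M%:Z) (\sum_(c < n) _) (d0) (dO) (M%:Z); glia.
Qed.

End GSTower.

Arguments gv {K l ga L k} g _.
Arguments gR {K l ga L k} g _.
Arguments gG {K l ga L k} g _ _ _.
Arguments gL {K l ga L k} g _ _ _.

Lemma filt_const (K F : fieldType) (em : {rmorphism K -> F}) (G : int -> F -> Prop) :
  filt em G -> filt em (fun=> G 0).
Proof.
move=> GP; split=> // [_ x y|_ a x|_ _ x y hx hy||_]; [exact: (filtD GP)|exact: (filtK GP)| |exact: (filt1 GP)|exact: (filt0 GP)].
by have := filtM GP hx hy; rewrite addr0.
Qed.

Section Residues.
Variables (K : fieldType) (L : laurent K).
Local Notation rs x a := (vge (@lval _ L) 1 (x - lcst L a)).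
Let vP := lvalP L.

Lemma rs_int (x : L) a : rs x a -> vge (@lval _ L) 0 x.
Proof.
move=> h; rewrite -(subrK (lcst L a) x); apply: (vgeD vP); last exact: lcst_vge.
by apply: vge_le h.
Qed.

Lemma rsD (x y : L) a b : rs x a -> rs y b -> rs (x + y) (a + b).
Proof. by move=> h h'; rewrite rmorphD opprD addrACA (vgeD vP). Qed.

Lemma rsM (x y : L) a b : rs x a -> rs y b -> rs (x * y) (a * b).
Proof.
move=> h h'; have -> : x * y - lcst L (a * b) = (x - lcst L a) * y + lcst L a * (y - lcst L b).
  by rewrite rmorphM; ring.
apply: (vgeD vP); first by have := vgeM vP h (rs_int h'); rewrite addr0.
by have := vgeM vP (lcst_vge L a) h'; rewrite add0r.
Qed.

Lemma rsX (x : L) a n : rs x a -> rs (x ^+ n) (a ^+ n).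
Proof.
move=> h; elim: n => [|n IH]; last by rewrite !exprS rsM.
by rewrite !expr0 rmorph1 subrr vge0.
Qed.

Lemma rs_val (x : L) a : a != 0 -> rs x a -> x != 0 /\ lval x = 0.
Proof.
move=> a0 h; have c0 : lcst L a != 0 by rewrite fmorph_eq0.
have := @valnD_lt _ _ vP (lcst L a) (x - lcst L a) c0; rewrite lval_cst // add0r [_ + (x - _)]addrC subrK; exact.
Qed.

Lemma rsV (x : L) a : a != 0 -> rs x a -> rs x^-1 a^-1.
Proof.
move=> a0 h; have [x0 xv] := rs_val a0 h; have c0 : lcst L a != 0 by rewrite fmorph_eq0.
have -> : x^-1 - lcst L a^-1 = - ((x - lcst L a) * (x^-1 * (lcst L a)^-1)).
  by rewrite fmorphV mulrBl mulrA mulfV // mul1r mulrCA mulfV // mulr1 opprB.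
rewrite (vgeN vP); have := vgeM vP h (_ : vge (@lval _ L) 0 (x^-1 * (lcst L a)^-1)); rewrite addr0; apply.
by rewrite vgeE ?mulf_neq0 ?invr_eq0 // (valnM vP) ?invr_eq0 // !(valnV vP) xv lval_cst.
Qed.

Lemma rs_of (x : L) : vge (@lval _ L) 0 x -> exists a, rs x a.
Proof. exact: lres_ex. Qed.

End Residues.

(** * Going up one level *)

Section GSStep.
Variables (K : finFieldType) (p f l : nat) (ga al : K) (L : laurent K).
Hypotheses (pp : prime p) (lE : l = (p ^ f)%N) (f0 : (0 < f)%N) (Kl : #|K| = (l ^ 2)%N)
  (gaP : l.-1.-primitive_root ga) (alP : al \in Om K l :\ 0).
Local Notation n := l.-1.

Let l1 : (1 < l)%N. Proof. by rewrite lE -(exp1n f) ltn_exp2r // prime_gt1. Qed.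
Let l0 : (0 < l)%N. Proof. exact: ltnW. Qed.
Let pK : p \in [pchar K].
Proof. by apply: (card_finPcharP (n := f * 2)); rewrite // Kl lE -expnM. Qed.
Let lchar (F : fieldType) (em : {rmorphism K -> F}) : [pchar F].-nat l.
Proof. by rewrite lE pchar_pnat // (fmorph_pchar em). Qed.
Let lK : [pchar K].-nat l. Proof. by rewrite lE pchar_pnat. Qed.

Lemma as_lift (u : L) c : vge (@lval _ L) 1 (u - lcst L (c ^+ l + c)) ->
  exists y, y ^+ l + y = u /\ vge (@lval _ L) 1 (y - lcst L c).
Proof.
move=> h; have [||y [yE yv]] := @lhensel _ L p l 1 u 1 c pK lK l1 (oner_neq0 _) _ _; rewrite ?rmorph1 ?mul1r //.
by exists y; rewrite mul1r in yE.
Qed.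

(** At [a] outside [Om] the residue of [uof x] lies in [Fl], because [a ^ (l ^ 2) = a]; hence it is
    a trace, and the solutions [c] lie again outside [Om]. Adding [Om] gives all [l] of them in [K],
    so the evaluation points split completely at every level. *)
Lemma good_residue (a : K) : a \notin Om K l -> exists c, c ^+ l + c = a ^+ l.+1 / (a ^+ l + a) /\ c ^+ l + c != 0.
Proof.
move=> aO; have a0 : a != 0 := nOm_neq0 pp lE f0 aO.
have d0 : a ^+ l + a != 0 by move: aO; rewrite inE.
have all : (a ^+ l) ^+ l = a by rewrite -exprM mulnn -Kl expf_card.
have [|c cE] := trace_surj pp lE f0 Kl (u := a ^+ l.+1 / (a ^+ l + a)).
  rewrite expr_div_n exprDn_pchar // all [a + _]addrC; congr (_ / _).
  by rewrite exprS exprMn all mulrC.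
by exists c; rewrite cE; split=> //; rewrite mulf_neq0 ?invr_eq0 ?expf_neq0.
Qed.

Lemma gslS k : inhabited (gsl l ga L k) -> inhabited (gsl l ga L k.+1).
Proof.
case=> G; have vP := lvalP L; have gvP' := gvP G.
pose x := gx G k; pose u := uof l x.
have [x0 xl] : x != 0 /\ lval (gO G x) = (l ^ k)%N%:Z := gOx G (leqnn k).
have vu : gv G u = -1.
  rewrite /u (uof2 pp lE f0) //; have [|||||d0 dv] := @as_neg _ (gv G) l 1 x gvP'; rewrite ?oner_neq0 ?(valn1 gvP') ?gvx //.
  rewrite mul1r in d0 dv; rewrite (valnM gvP') ?expf_neq0 ?invr_eq0 // (valnV gvP') dv (valnX gvP') gvx.
  by rewrite -mulr_natr natz -addn1 PoszD; move: (l%:Z); clear; lia.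
have u0 : u != 0 by apply/eqP => h; move: vu; rewrite h (valn0 gvP').
have QF := lchar (ge G).
have [F' [i [y [yE span uniq univ0 [v' [v'P v'i v'S]]]]]] : exists (F' : fieldType) (i : {rmorphism G -> F'}) (y : F'),
  [/\ y ^+ l + i 1 * y = i u,
      forall z, exists c : nat -> G, z = \sum_(j < l) i (c j) * y ^+ j,
      forall c : nat -> G, \sum_(j < l) i (c j) * y ^+ j = 0 -> forall j, (j < l)%N -> c j = 0,
      forall (B : fieldType) (h : {rmorphism G -> B}) (b : B), b ^+ l + h 1 * b = h u ->
        exists h' : {rmorphism F' -> B}, (forall a, h' (i a) = h a) /\ h' y = b &
      exists v' : F' -> int, [/\ valn v', forall a, v' (i a) = l%:Z * gv G a &
        forall c : nat -> G, \sum_(j < l) i (c j) * y ^+ j != 0 ->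
        exists j, [/\ (j < l)%N, c j != 0,
          v' (\sum_(j < l) i (c j) * y ^+ j) = l%:Z * gv G (c j) - (j * 1)%:Z &
          forall q, (q < l)%N -> c q != 0 ->
            v' (\sum_(j < l) i (c j) * y ^+ j) <= l%:Z * gv G (c q) - (q * 1)%:Z]]].
  by apply: as_step => //; rewrite ?(valn1 gvP') // coprime1n.
rewrite rmorph1 mul1r in yE.
have univ (B : fieldType) (h : {rmorphism G -> B}) b : b ^+ l + b = h u ->
    exists h' : {rmorphism F' -> B}, (forall a, h' (i a) = h a) /\ h' y = b.
  by move=> hb; apply: univ0; rewrite rmorph1 mul1r.
pose em' := [the {rmorphism K -> F'} of i \o ge G].
have [y0 u'0 yV u'E u'V] := uof_facts l1 yE u0.
have ga0 := ga_neq0 pp lE f0 gaP; have gal := ga_frob pp lE f0 gaP.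
have v'y : v' y = -1.
  have sy : \sum_(j < l) i ((j == 1%N :> nat)%:R) * y ^+ j = y.
    rewrite (bigD1 (Ordinal l1)) //= rmorph1 mul1r expr1 big1 ?addr0 // => j jn.
    have -> : (j == 1%N :> nat) = false by apply: contraNF jn => /eqP h; apply/eqP/val_inj.
    by rewrite rmorph0 mul0r.
  have := v'S (fun j => (j == 1%N)%:R); rewrite sy => /(_ y0) [j [jl]].
  have [-> _|_] := eqVneq j 1%N; last by rewrite eqxx.
  by rewrite (valn1 gvP') mulr0 add0r.
have su : gs G u = ge G ga * u.
  rewrite /u /uof fmorph_div rmorphD rmorph1 !rmorphXn gsx // !exprMn -!rmorphXn gal (prim_expr_order gaP).
  by rewrite rmorph1 mul1r mulrA.
have [s' [s'i s'y]] : exists s' : {rmorphism F' -> F'}, (forall a, s' (i a) = i (gs G a)) /\ s' y = i (ge G ga) * y.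
  apply: (univ _ [the {rmorphism G -> F'} of i \o gs G]) => /=.
  by rewrite su exprMn -!rmorphXn gal -mulrDr yE rmorphM.
have s'e a : s' (em' a) = em' a by rewrite /= s'i gse.
have is'i c a : iter c s' (i a) = i (iter c (gs G) a) by elim: c => //= c ->; rewrite s'i.
have isge c a : iter c (gs G) (ge G a) = ge G a by elim: c => //= c ->; rewrite gse.
have is'y c : iter c s' y = i (ge G (ga ^+ c)) * y.
  elim: c => [|c IH]; first by rewrite expr0 !rmorph1 mul1r.
  by rewrite iterS IH rmorphM s'i gse s'y mulrA -!rmorphM exprSr.
have s'n z : iter n s' z = z.
  have [S SE] := iter_hom s' n; rewrite -SE.
  have := step_ext span (h1 := S) (h2 := [the {rmorphism F' -> F'} of @idfun F']); apply=> [a|] /=.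
    by rewrite SE is'i gsn.
  by rewrite SE is'y (prim_expr_order gaP) !rmorph1 mul1r.
have /choice [tau tauP] : forall b, exists t : {rmorphism F' -> F'}, b \in Om K l ->
    (forall a, t (i a) = i a) /\ t y = y + i (ge G b).
  move=> b; case: (boolP (b \in Om K l)) => bO; last by exists [the {rmorphism F' -> F'} of @idfun F'].
  have [|t [t1 t2]] := univ _ i (y + i (ge G b)); last by exists t.
  have E : i (ge G b) ^+ l + i (ge G b) = 0.
    by rewrite -!rmorphXn -!rmorphD; move: bO; rewrite inE => /eqP ->; rewrite !rmorph0.
  by rewrite exprDn_pchar ?(eq_pnat _ (fmorph_pchar i)) // addrACA yE E addr0.
have taui b a : b \in Om K l -> tau b (i a) = i a by move=> /tauP[-> _].
have tauy b : b \in Om K l -> tau b y = y + i (ge G b) by move=> /tauP[_ ->].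
have cOm := card_Om pp lE f0 Kl.
have ll : (0 < l ^ k.+1)%N by rewrite expn_gt0 l0.
have lk0 : 0 < (l ^ k)%N%:Z by rewrite ltz_nat expn_gt0 l0.
have Ou : lval (gO G u) = (l ^ k.+1)%N%:Z.
  rewrite /u (uof2 pp lE f0) // fmorph_div rmorphD !(rmorphXn (gO G)).
  have Ox0 : gO G x != 0 by rewrite fmorph_eq0.
  have [d0 dv] := lval_as pp lE f0 Ox0 xl lk0.
  rewrite (valnM vP) ?expf_neq0 ?invr_eq0 ?fmorph_eq0 // (valnV vP) dv (valnX vP) xl.
  by rewrite expnS PoszM; move: ((l ^ k)%N%:Z) => z; rewrite -mulr_natr natz -addn1 PoszD; clear; lia.
(* The branch above [gO] on which [y] has residue 0 is the new common zero; the branches with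
   nonzero residues in [Om] form the new group of poles. *)
have [eta [etaE etav]] : exists eta : L, eta ^+ l + eta = gO G u /\ vge (@lval _ L) 1 eta.
  have [|eta [h1 h2]] := @as_lift (gO G u) 0; last by exists eta; rewrite rmorph0 subr0 in h2.
  by rewrite expr0n gtn_eqF // addr0 rmorph0 subr0 vgeE ?fmorph_eq0 // Ou lez_nat.
have eta0 : eta != 0.
  apply/eqP => h; move: etaE; rewrite h expr0n gtn_eqF // addr0 => /esym/eqP.
  by rewrite fmorph_eq0 (negPf u0).
have etal : lval eta = (l ^ k.+1)%N%:Z.
  have [|_] := lval_as pp lE f0 eta0 erefl; last by rewrite etaE Ou.
  by move: etav; rewrite vgeE //; clear; lia.
have [O' [O'i O'y]] := univ _ (gO G) eta etaE.
have O'e a : O' (em' a) = lcst L a by rewrite /= O'i gOe.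
have al0 : al != 0 := al_neq0 alP.
have alO : al \in Om K l by move: alP; rewrite in_setD1 => /andP[].
have O'ty b : b \in Om K l -> O' (tau b y) = eta + lcst L b.
  by move=> bO; rewrite tauy // rmorphD O'y O'i gOe.
(* [O'] composed with [s'] still has [y] of residue 0, so it gives the same orders by [O_unique]. *)
have O's z : lval (O' (s' z)) = lval (O' z).
  have [->|z0] := eqVneq z 0; first by rewrite !rmorph0.
  pose O2 := [the {rmorphism F' -> L} of O' \o s'].
  have O2e a : O2 (em' a) = lcst L a by rewrite /= s'i gse O'i gOe.
  have ag a : lval (O2 (i a)) = lval (O' (i a)) by rewrite /= s'i !O'i gOs.
  have O2y : vge (@lval _ L) 1 (O2 y).
    rewrite /= s'y rmorphM O'i gOe O'y; have := vgeM vP (lcst_vge L ga) etav; by rewrite add0r.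
  have Oy : vge (@lval _ L) 1 (O' y) by rewrite O'y.
  apply/eqP; rewrite eq_le; apply/andP; split.
    have := O_unique l1 QF span cOm taui tauy O2e O'e ag O2y Oy (e := lval (O2 z)) (z := z).
    by rewrite !vgeE ?fmorph_eq0 //; apply; rewrite lexx.
  have := O_unique l1 QF span cOm taui tauy O'e O2e (fun a => esym (ag a)) Oy O2y (e := lval (O' z)) (z := z).
  by rewrite !vgeE ?fmorph_eq0 //; apply; rewrite lexx.
have is'O c z : lval (O' (iter c s' z)) = lval (O' z) by elim: c => //= c IH; rewrite O's.
have taus b c z : b \in Om K l -> tau b (iter c s' z) = iter c s' (tau (ga ^+ c * b) z).
  move=> bO; have [S SE] := iter_hom s' c; rewrite -!SE.
  have bO' : ga ^+ c * b \in Om K l by rewrite (Om_gaX pp lE f0 gaP).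
  apply: (step_ext span (h1 := [the {rmorphism F' -> F'} of tau b \o S])
    (h2 := [the {rmorphism F' -> F'} of S \o tau (ga ^+ c * b)])) => [a|] /=.
    by rewrite taui // !SE is'i taui.
  rewrite SE is'y tauy // rmorphM taui // tauy // rmorphD !SE is'y is'i mulrDr -!rmorphM; congr (_ + i _).
  by rewrite isge.
have /choice [Hh HhP] : forall t : gI G, exists h : {rmorphism F' -> L}, (forall a, h (i a) = gH t a) /\
     exists2 c, c ^+ l + c != 0 & vge (@lval _ L) 1 (h y - lcst L c).
  move=> t; have [a aO ha] := gHx t; have [c [cE c0]] := good_residue aO.
  have [|eta' [e1 e2]] := @as_lift (gH t u) c.
    rewrite cE /u (uof2 pp lE f0) // fmorph_div rmorphD !rmorphXn; apply: rsM; first exact: rsX.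
    by apply: rsV; [move: aO; rewrite inE|apply: rsD => //; exact: rsX].
  have [h [hi hy]] := univ _ (gH t) eta' e1; exists h; split=> //; exists c => //; by rewrite hy.
pose H' (t : gI G * 'I_#|Om K l|) := [the {rmorphism F' -> L} of Hh t.1 \o tau (enum_val t.2)].
pose R' := stepG i l y 0 0 (fun=> gR G) 0.
have ru0 : gR G (u + 0 ^+ l + 0) by rewrite expr0n gtn_eqF // !addr0; exact: gRu.
have fR : filt em' (fun=> R') := filt_const (stepG_filt l1 QF yE (lexx 0) (gRP G) ru0).
have Ri a : gR G a -> R' (i a).
  by move=> ha; have := stepG_emb i y l1 QF 0 (lexx 0) (gRP G) (d := 0) ha; rewrite mulr0.
have Ry : R' y by have := stepG_rr i y l1 QF 0 (lexx 0) (gRP G); rewrite rmorph0 addr0 oppr0.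
have RM z z' : R' z -> R' z' -> R' (z * z') by exact: (filtM fR (e := 0) (e' := 0)).
have RD z z' : R' z -> R' z' -> R' (z + z') by exact: (filtD fR (e := 0)).
have RX z m : R' z -> R' (z ^+ m) by move=> h; elim: m => [|m IH]; rewrite ?exprS; [exact: (filt1 fR)|exact: RM].
have RE z : R' z -> exists c : nat -> G, z = \sum_(j < l) i (c j) * y ^+ j /\ forall j, (j < l)%N -> gR G (c j).
  by case=> c [d [-> h]]; exists c; rewrite rmorph0 addr0; split=> // j jl; have [] := h j jl.
have ga'c c : gR G (ge G c) by exact: (filtC (gRP G)).
pose isO t := (t <= k.+1)%N.
pose mu t : int := if gb G t is [::] then (tyS l t)%:Z else 0.
pose G' t := if isO t then stepG i l y (head 0 (gb G t)) (mu t) (gG G t) else (fun e z => vge (@lval _ L) e (O' (tau al z)) : Prop).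
pose L' t := if isO t then stepL i l y (head 0 (gb G t)) (gL G t) else (fun d z => vge (@lval _ L) (- d) (O' (tau al z)) : Prop).
pose J' t : finType := if isO t then ('I_l * gJ G t)%type : finType else (unit : finType).
(* The shifts of the new group are [al ^ 2 / x_(k - t)]. As [al ^ l = - al], the shift
   [w = al ^ 2 / x_j] satisfies [w ^ l + w = al ^ 2 / uof x_j]. For [j = k] this cancels the pole of
   [uof y = y - y ^ 2 / u] where [y] has residue [al], and by the tower equation it links each shift
   to the next. *)
have [nb [sz nbh nbE]] : exists nb : seq F', [/\ size nb = k.+1, head 0 nb = i (ge G (al ^+ 2) / x) &
    forall t, (t < k.+1)%N -> nth 0 nb t = i (ge G (al ^+ 2) / gx G (k - t))].
  exists (mkseq (fun t => i (ge G (al ^+ 2) / gx G (k - t))) k.+1); rewrite size_mkseq; split=> //.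
    by rewrite /= subn0.
  by move=> t tk; rewrite nth_mkseq.
pose b' t := if isO t then map i (behead (gb G t)) else nb.
pose x' j := if (j <= k)%N then i (gx G j) else y.
have uofi a : uof l (i a) = i (uof l a) by rewrite /uof fmorph_div rmorphD rmorph1 !rmorphXn.
have x'k : x' k.+1 = y by rewrite /x' ltnn.
constructor; apply: (@GSL K l ga L k.+1 F' em' x' v' s' R' G' L' J' b' O' _ H') => //.
- by rewrite x'k.
- move=> j; rewrite ltnS /x' => jk; rewrite jk ltn_neqAle jk andbT; rewrite uofi; case: eqVneq => [->|jn] /=; first by rewrite yE.
  by rewrite -rmorphXn -rmorphD gxr ?ltn_neqAle ?jn.
- move=> j _; rewrite /x'; case: ifP => jk; last exact: s'y.
  by rewrite s'i gsx // rmorphM.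
- rewrite x'k u'E; apply: (filtB fR (e := 0)) => //; apply: RM; first exact: RX.
  by apply: Ri; exact: gRuV.
- have RyV : R' y^-1.
    rewrite yV; apply: RM; last by apply: Ri; exact: gRuV.
    by apply: RD; [exact: RX|exact: (filt1 fR)].
  by rewrite x'k u'V; apply: RD => //; exact: RX.
- move=> z /RE [c [-> hc]]; rewrite rmorph_sum; apply: (filt_sum fR (e := 0)) => j _.
  rewrite rmorphM s'i rmorphXn s'y; apply: (RM); first by apply: Ri; apply: gRs; exact: hc.
  by apply: RX; apply: (RM) => //; exact: Ri.
- move=> t; rewrite leq_eqVlt x'k => /orP[/eqP ->|tk]; last first.
    have tk' : (t <= k.+1)%N by [].
    rewrite /G' /L' /J' /b' /isO tk'; have := tstate_step l1 QF yE span uniq (gT G tk').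
    have -> // : (l * tyh l k t = tyh l k.+1 t)%N.
    case: (t) tk' => [|j]; rewrite /tyh ?expnS // ltnS => jk; by rewrite subSn // expnS.
  have nO : isO k.+2 = false by rewrite /isO ltnn.
  rewrite /G' /L' /J' /b' nO /tyh subnn expn0 /tyS.
  have Hi a : O' (tau al (i a)) = gO G a by rewrite taui // O'i.
  have Hy : O' (tau al y) = eta + lcst L al by rewrite O'ty.
  have rsy : vge (@lval _ L) 1 (eta + lcst L al - lcst L al) by rewrite addrK.
  have [Hy0 Hyv] := rs_val al0 rsy.
  have Y0 j : (j <= k)%N -> gO G (gx G j) != 0 /\ lval (gO G (gx G j)) = (l ^ j)%N%:Z.
    by move=> jk; have [h1 h2] := gOx G jk; rewrite fmorph_eq0.
  have lj j : 0 < (l ^ j)%N%:Z by rewrite ltz_nat expn_gt0 l0.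
  have bE j : (j <= k)%N -> (ge G (al ^+ 2) / gx G j) ^+ l + ge G (al ^+ 2) / gx G j = ge G (al ^+ 2) / uof l (gx G j).
    move=> jk; have [h1 _] := gOx G jk; rewrite expr_div_n -(rmorphXn (ge G)) -exprM mulnC exprM (al_frob alP) sqrrN.
    rewrite (uof2 pp lE f0) // invf_div -mulrDr; congr (_ * _); rewrite mulrDl addrC exprS invfM; congr (_ + _).
      by rewrite mulrCA mulfV ?expf_neq0 // mulr1.
    by rewrite mulrA mulfV // mul1r.
  rewrite -{1}sz; apply: (@tstate_hom _ _ em' l (uof l y) L [the {rmorphism F' -> L} of O' \o tau al] nb l0) => //=.
  + by move=> a; rewrite Hi gOe.
  + rewrite (uof2 pp lE f0) // yE fmorph_div fmorph_div Hi !(rmorphXn (tau al)) !(rmorphXn O') Hy sz.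
    by rewrite (valnM vP) ?invr_eq0 ?expf_neq0 ?fmorph_eq0 // (valnV vP) Ou (valnX vP) Hyv mul0rn add0r.
  + move=> t1; rewrite sz => tk; rewrite nbE // Hi fmorph_div gOe.
    have [h1 h2] := Y0 (k - t1)%N (leq_subr _ _).
    have c0 : lcst L (al ^+ 2) != 0 by rewrite fmorph_eq0 expf_neq0.
    rewrite vgeE ?mulf_neq0 ?invr_eq0 // (valnM vP) ?invr_eq0 //.
    by rewrite lval_cst ?expf_neq0 // (valnV vP) h2 add0r subSS lexx.
  + move=> _; rewrite nbh.
    rewrite -addrA -(rmorphXn i) -(rmorphD i) (bE k) // u'E.
    have E w1 w2 w3 w4 : O' (tau al (w1 - w2 ^+ 2 * w3 + w4)) =
        O' (tau al w1) - O' (tau al w2) ^+ 2 * O' (tau al w3) + O' (tau al w4).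
      by rewrite rmorphD rmorphB rmorphM rmorphXn rmorphD rmorphB rmorphM rmorphXn.
    rewrite E !Hi Hy fmorph_div gOe (rmorphXn (lcst L)) fmorphV -/x -/u.
    have U0 : gO G u != 0 by rewrite fmorph_eq0.
    have -> : eta + lcst L al - (eta + lcst L al) ^+ 2 * (gO G u)^-1 + lcst L al ^+ 2 / gO G u =
       (eta + lcst L al) - (eta / gO G u) * (eta + lcst L al + lcst L al) by field.
    have i1 := rs_int rsy.
    apply: (vgeB vP) => //; apply: (vge0M vP); last by apply: (vgeD vP) => //; exact: lcst_vge.
    by rewrite vgeE ?mulf_neq0 ?invr_eq0 // (valnM vP) ?invr_eq0 // (valnV vP) etal Ou subrr.
  move=> t1; rewrite sz ltnS => tk; rewrite !nbE ?ltnS //; last exact: ltnW.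
  have jE : (k - t1 = (k - t1.+1).+1)%N by move: tk; clear; lia.
  have jk : (k - t1.+1 < k)%N by rewrite -jE leq_subr.
  rewrite -(rmorphXn i) -(rmorphD i) bE ?(ltnW jk) // -(gxr G jk) jE -(rmorphB i) Hi.
  have [h1 h2] := Y0 _ jk; have [d0 dv] := lval_as pp lE f0 h1 h2 (lj _).
  rewrite rmorphB !fmorph_div gOe rmorphD (rmorphXn (gO G)); set Z := gO G _ in h1 h2 d0 dv *.
  have gen (a D z : L) : D != 0 -> z != 0 -> a / D - a / z = - (a * ((D - z) / (D * z))).
    by move=> D0 z0; field; rewrite D0 z0.
  rewrite gen // addrK.
  rewrite (vgeN vP); apply: (vge0M vP); first exact: lcst_vge.
  rewrite vgeE ?mulf_neq0 ?invr_eq0 ?mulf_neq0 ?expf_neq0 // (valnM vP) ?invr_eq0 ?mulf_neq0 ?expf_neq0 //.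
  rewrite (valnV vP) (valnM vP) // dv (valnX vP) h2 -mulr_natr natz.
  by have := lj (k - t1.+1)%N.+1; move: ((l ^ _)%N%:Z) l1; clear; nia.
- move=> j; rewrite leq_eqVlt /x' => /orP[/eqP ->|]; first by rewrite ltnn O'y.
  rewrite ltnS => jk; rewrite jk fmorph_eq0 O'i; exact: gOx.
- by move=> t a; rewrite /= taui ?enum_valP // (HhP t.1).1 gHe.
- move=> [t j] z /RE [c [-> hc]] /=; have bO := enum_valP j; rewrite !rmorph_sum; apply: (vge_sum vP) => q _.
  have [h1 [c' _ h2]] := HhP t.
  rewrite !rmorphM taui // h1 !rmorphXn tauy // rmorphD h1 gHe; apply: (vge0M vP); first by apply: gHR; exact: hc.
  by apply: (vge0X vP); apply: (vgeD vP); [exact: rs_int h2|exact: lcst_vge].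
- move=> [t j]; have bO := enum_valP j; have [h1 [c' c0 h2]] := HhP t; exists (c' + enum_val j).
    move: bO; rewrite !inE => /eqP h; rewrite exprDn_pchar // addrACA h addr0 //.
  by rewrite x'k /= tauy // rmorphD h1 gHe rmorphD opprD addrACA subrr addr0.
- by rewrite card_prod gIc card_ord cOm -expnSr.
- by rewrite /b' /isO leq0n gb0.
- move=> d z; rewrite /L' /isO leq0n gb0 => -[c [-> hc]]; exists (fun j => ge G (ga ^+ j) * gs G (c j)); split.
    rewrite rmorph_sum; apply: eq_bigr => j _; rewrite /= rmorph0 addr0 rmorphM s'i rmorphXn s'y exprMn mulrCA mulrA.
    by rewrite (rmorphM i) !rmorphXn.
  by move=> j jl; apply: (ksubZ _ (tsL (gT G (leq0n k.+1)) d)); apply: gLs; exact: hc.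
- move=> e z; rewrite /G' /isO leq0n gb0 => -[c [dd [-> hc]]]; exists (fun j => ge G (ga ^+ j) * gs G (c j)), dd; split.
    rewrite rmorph_sum; apply: eq_bigr => j _; rewrite /= rmorph0 addr0 rmorphM s'i rmorphXn s'y exprMn mulrCA mulrA.
    by rewrite (rmorphM i) !rmorphXn.
  move=> j jl; have [h1 h2] := hc j jl; split=> //.
  by apply: (filtK (tsG (gT G (leq0n k.+1)))); apply: gGs.
(* The product formula of the lower level is applied to the norm of [z], whose order at [gO] is the
   sum of the orders of [z] at [O'] and at the [n] conjugates that form the new group. *)
- move=> z e0 e eO z0 Rz h0 h1 hO.
  have [g gE] := nrm_base l1 QF span cOm taui tauy z.
  have g0 : g != 0.
    apply/eqP => h; move: gE; rewrite h rmorph0 => /eqP; rewrite /nrm prodf_seq_eq0 => /hasP[b _ /andP[_]].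
    by rewrite fmorph_eq0 (negPf z0).
  have gc c : nrm l tau (iter c s' z) = i (iter c (gs G) g).
    rewrite -is'i -gE; have [S SE] := iter_hom s' c; rewrite -[RHS]SE /nrm rmorph_prod.
    rewrite [RHS](reindex_inj (mulfI (expf_neq0 c ga0))) /=; apply: eq_big => b; first by rewrite (Om_gaX pp lE f0 gaP).
    by move=> bO; rewrite !SE taus.
  have Rg : gR G g := nrm_G l1 QF yE uniq cOm taui tauy (G := fun=> gR G) (lexx 0) (gRP G) ru0 Rz gE.
  have down t e1 c : (t <= k.+1)%N -> G' t e1 (iter c s' z) -> gG G t e1 (iter c (gs G) g).
    move=> tk; rewrite /G' /isO tk => h; have T := gT G tk.
    exact: (nrm_G l1 QF yE uniq cOm taui tauy (tmu0 _ _) (tsG T) (tbmu l1 T) h (gc c)).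
  have hO2 : vge (@lval _ L) (lval (gO G g)) (gO G g) by rewrite vgeE ?fmorph_eq0.
  have := gprod g0 Rg (down 0%N e0 0%N isT h0) (fun j c jk cn => down j.+1 _ c jk (h1 j c (leqW jk) cn)) hO2.
  have lprod (H : {rmorphism F' -> L}) w : w != 0 -> lval (H (nrm l tau w)) = \sum_(b in Om K l) lval (H (tau b w)).
    move=> w0; rewrite /nrm rmorph_prod.
    suff [] : (\prod_(b in Om K l) H (tau b w) != 0) /\ lval (\prod_(b in Om K l) H (tau b w)) = \sum_(b in Om K l) lval (H (tau b w)) by [].
    elim/big_rec2: _ => [|b a1 a2 _ [n1 n2]]; first by rewrite oner_neq0 (valn1 vP).
    by rewrite mulf_neq0 ?fmorph_eq0 // (valnM vP) ?fmorph_eq0 // n2.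
  have it0 c : iter c s' z != 0 by have [S SE] := iter_hom s' c; rewrite -SE fmorph_eq0.
  have sumO : lval (gO G g) = lval (O' z) + \sum_(c < n) lval (O' (tau (ga ^+ c * al) z)).
    rewrite -O'i -gE lprod // (sum_Om pp lE f0 gaP alP (fun b => lval (O' (tau b z)))); congr (lval _ + _).
    apply: (step_ext span (h1 := [the {rmorphism F' -> L} of O' \o tau 0]) (h2 := O')) => [a|] /=.
      by rewrite taui ?(Om0 _ pp lE f0).
    by rewrite tauy ?(Om0 _ pp lE f0) // !rmorph0 addr0.
  have lc (c : 'I_n) : e k.+1 c <= lval (O' (tau (ga ^+ c * al) z)).
    have := h1 k.+1 c (leqnn _) (ltn_ord c); rewrite /G' /isO ltnn taus //.
    by move/vge_lval; rewrite is'O; apply; have [S SE] := iter_hom s' c; rewrite -SE !fmorph_eq0.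
  have lO : eO <= lval (O' z) by have := vge_lval _ hO; rewrite fmorph_eq0; exact.
  have sumH : \sum_t \sum_(j < n) lval (H' t (iter j s' z)) = \sum_t \sum_(j < n) lval (gH t (iter j (gs G) g)).
    rewrite -(pair_big xpredT xpredT (fun t b => \sum_(j < n) lval (H' (t, b) (iter j s' z)))) /=.
    apply: eq_bigr => t _; rewrite exchange_big; apply: eq_bigr => j _ /=.
    by rewrite -(HhP t).1 -gc lprod // [RHS]big_enum_val.
  rewrite sumH sumO [X in _ -> _ + X + _ <= 0]big_ord_recr /= => h2.
  have : \sum_(c < n) e k.+1 c <= \sum_(c < n) lval (O' (tau (ga ^+ c * al) z)) by apply: ler_sum => c _; exact: lc.
  move: h2 lO; move: (\sum_t _) (\sum_(j < k.+1) _) (\sum_(c < n) _) (\sum_(c < n) _) (lval _) (e0) (eO); glia.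
(* The start is [sum_q c_q y ^ q], the bounds on [c_q] being enlarged by [(l - 1 - q) B] at the old
   groups and set to [M] at [gO]. By [twist_coef] the expansions in all shifted generators satisfy
   the enlarged bounds, and the excess is then cut away; each enlargement gains as many dimensions
   as its removal costs. *)
move=> d0 d dO.
pose X1 : finType := (unit + 'I_k.+1 * 'I_n)%type.
pose ty (a : X1) : nat := if a is inr jc then jc.1.+1 else 0%N.
pose tw (a : X1) : nat := if a is inr jc then jc.2 else 0%N.
pose dd (a : X1) : int := if a is inr jc then d jc.1 jc.2 else d0.
have tyk a : (ty a <= k.+1)%N by case: a => [[]|[j c]] //=; exact: ltn_ord.
have T a := gT G (tyk a).
pose B a := tB_ l (gb G (ty a)).
pose M := (`|dO| + \sum_(c < n) `|d k.+1 c|)%N.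
have absle (a : int) b : (`|a| <= b)%N -> a <= b%:Z by clear; case: a => a /=; lia.
have MO : dO <= M%:Z by apply: absle; rewrite /M leq_addr.
have Mc (c : 'I_n) : d k.+1 c <= M%:Z by apply: absle; rewrite /M (bigD1 c) //= addnCA leq_addr.
pose V q c := [/\ gR G c, gL G 0 (d0 + ((l.-1 - q) * tB_ l (gb G 0))%N%:Z) c,
  forall j c', (j <= k)%N -> (c' < n)%N -> gL G j.+1 (d j c' + ((l.-1 - q) * tB_ l (gb G j.+1))%N%:Z) (iter c' (gs G) c)
  & vge (@lval _ L) (- M%:Z) (gO G c)].
pose zq q := (l ^ k)%N%:Z * (d0 + ((l.-1 - q) * tB_ l (gb G 0))%N%:Z) +
  \sum_(j < k.+1) \sum_(c' < n) (l ^ (k - j))%N%:Z * (d j c' + ((l.-1 - q) * tB_ l (gb G j.+1))%N%:Z) + M%:Z + (l ^ k)%N%:Z.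
have start : dimge em' (fun z => exists c : nat -> G, z = \sum_(q < l) i (c q) * y ^+ q /\ forall q, (q < l)%N -> V q (c q))
    (\sum_(q < l) zq q).
  apply: (dimge_step uniq (P := V) (z := zq)) => q ql; last exact: gdim.
  split=> [||j c' jk cn|]; [exact: (filt0 (gRP G) 0)|exact: (tsL (gT G (leq0n k.+1)) _).1| |by rewrite rmorph0 vge0].
  have [S SE] := iter_hom (gs G) c'; rewrite -SE rmorph0; exact: (tsL (gT G (t := j.+1) jk) _).1.
have /choice [cf cfP] := fun a => coef_exists (ge G) span uniq (head 0 (gb G (ty a))).
pose XX : finType := (X1 * 'I_l + ('I_n + unit))%type.
pose PP (w : XX) (e : int) (z : F') : Prop := match w with
  | inl aq => gL G (ty aq.1) e (cf aq.1 (iter (tw aq.1) s' z) aq.2)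
  | inr (inl c) => vge (@lval _ L) (- e) (O' (tau al (iter c s' z)))
  | inr (inr _) => vge (@lval _ L) (- e) (O' z) end.
pose dX (w : XX) : int := match w with inl aq => dd aq.1 | inr (inl c) => d k.+1 c | inr (inr _) => dO end.
pose aX (w : XX) : nat := match w with inl aq => ((l.-1 - aq.2) * B aq.1)%N
  | inr (inl c) => `|(M%:Z - d k.+1 c)%R|%N | inr (inr _) => `|(M%:Z - dO)%R|%N end.
pose JX (w : XX) : finType := match w with inl aq => gJ G (ty aq.1) | inr _ => (unit : finType) end.
have hS c : exists S : {rmorphism F' -> F'}, (forall z, S z = iter c s' z) /\ forall a, S (em' a) = em' a.
  have [S SE] := iter_hom s' c; exists S; split=> // a; by rewrite SE /= is'i isge.
have linC a (q : 'I_l) b z z' : cf a (iter (tw a) s' (em' b * z + z')) q =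
    ge G b * cf a (iter (tw a) s' z) q + cf a (iter (tw a) s' z') q.
  by have [S [SE Se]] := hS (tw a); rewrite -!SE rmorphD rmorphM Se; have [_ h _] := cfP a; rewrite h ?ltn_ord.
have hO c : exists S : {rmorphism F' -> L}, (forall z, S z = O' (tau al (iter c s' z))) /\ forall a, S (em' a) = lcst L a.
  have [S [SE Se]] := hS c; exists [the {rmorphism F' -> L} of (O' \o tau al) \o S]; split=> [z|a] /=; rewrite ?SE //.
  by have := Se a; rewrite /= SE => ->; rewrite taui // O'i gOe.
have sP w e : ksub em' (PP w e).
  case: w => [[a q]|[c|[]]] /=.
  - exact: (ksub_pull (linC a q) (tsL (T a) e)).
  - have [S [SE Se]] := hO c; have := hom_ksub (- e) Se; congr ksub; apply/funext => z; by rewrite SE.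
  exact: hom_ksub.
have cP w e : cutby em' (JX w) (PP w e) (PP w (e - 1)).
  case: w => [[a q]|[c|[]]] /=.
  - exact: (cut_pull (linC a q) (tsC (T a) e)).
  - by have [S [SE Se]] := hO c; have := hom_cut e Se; congr cutby; apply/funext => z; rewrite SE.
  exact: hom_cut.
have sR : ksub em' R' by split=> [|a z z' hz hz']; [exact: (filt0 fR 0)|apply: RD => //; exact: (filtK fR (e := 0))].
have st : dimge em' (fun z => (forall w, PP w (dX w + (aX w)%:Z) z) /\ R' z) (\sum_(q < l) zq q).
  apply: dimge_sub start => // z [c [zE hc]]; split; last first.
    rewrite zE; apply: (filt_sum fR (e := 0)) => q _; have [h _ _ _] := hc q (ltn_ord q).
    by apply: RM; [exact: Ri|exact: RX].
  have Mabs (a : int) : a <= M%:Z -> - (a + `|(M%:Z - a)%R|%N%:Z) = - M%:Z.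
    by move=> h; rewrite gez0_abs ?subr_ge0 // addrC subrK.
  have int b q : b \in Om K l -> vge (@lval _ L) 0 (O' (tau b y) ^+ q).
    by move=> bO; apply: (vge0X vP); rewrite O'ty //; apply: (vgeD vP); [apply: vge_le etav|exact: lcst_vge].
  have cM q : (q < l)%N -> vge (@lval _ L) (- M%:Z) (gO G (c q)) by move=> ql; have [] := hc q ql.
  case=> [[a q]|[c'|[]]] /=.
  - pose c2 q := iter (tw a) (gs G) (c q) * ge G (ga ^+ tw a) ^+ q.
    have itE : iter (tw a) s' z = \sum_(q < l) i (c2 q) * y ^+ q.
      have [S SE] := iter_hom s' (tw a); rewrite -SE zE rmorph_sum; apply: eq_bigr => q' _.
      by rewrite rmorphM rmorphXn !SE is'i is'y exprMn mulrA /c2 (rmorphM i) (rmorphXn i).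
    have [|c3 [c3E c3P]] := twist_coef i y l1 QF (T a) (d := dd a) (c := c2).
      move=> q' ql; rewrite /c2 mulrC -rmorphXn; apply: (ksubZ _ (tsL (T a) _)).
      by have [_ h1 h2 _] := hc q' ql; case: (a) => [[]|[j c']] /=; [exact: h1|apply: h2 => //; exact: (ltn_ord j)].
    by rewrite itE c3E; have [_ _ ->] := cfP a; rewrite //; exact: c3P.
  - have [S [SE Se]] := hO c'; rewrite Mabs // -SE zE rmorph_sum; apply: (vge_sum vP) => q _.
    have [S' [S'E _]] := hS c'.
    rewrite SE -S'E (rmorphM S') (rmorphXn S') !S'E is'i is'y (rmorphM (tau al)) (rmorphM O') taui // O'i.
    have h1 : vge (@lval _ L) (- M%:Z) (gO G (iter c' (gs G) (c q))).
      have := cM q (ltn_ord q); have [S2 S2E] := iter_hom (gs G) c'.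
      rewrite /vge -S2E !fmorph_eq0; case: eqP => //= _; rewrite S2E.
      by have -> // : lval (gO G (iter c' (gs G) (c q))) = lval (gO G (c q)) by elim: {1}(nat_of_ord c') => //= m' <-; rewrite gOs.
    have := vgeM vP h1 (_ : vge (@lval _ L) 0 (O' (tau al ((i (ge G (ga ^+ c')) * y) ^+ q)))); rewrite addr0; apply.
    rewrite exprMn rmorphM rmorphM !(rmorphXn (tau al)) !(rmorphXn O') taui // O'i gOe.
    by apply: (vge0M vP); [apply: (vge0X vP); exact: lcst_vge|exact: int].
  rewrite Mabs // zE rmorph_sum; apply: (vge_sum vP) => q _.
  rewrite rmorphM O'i rmorphXn O'y; have := vgeM vP (cM q (ltn_ord q)) (_ : vge (@lval _ L) 0 (eta ^+ q)).
  by rewrite addr0; apply; apply: (vge0X vP); apply: vge_le etav.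
have := multi_cut sP cP sR st; apply: dimge_sub => [z [hP Rz]|].
  split=> // [|j c jk cn|].
  - rewrite /L' /isO leq0n; exists (cf (inl tt) z); split=> [|j jl]; first by have [h _ _] := cfP (inl tt); exact: h.
    exact: (hP (inl (inl tt, Ordinal jl))).
  - rewrite /L' /isO ltnS; case: leqP => jk'; last first.
      have -> : j = k.+1 by apply/eqP; rewrite eqn_leq jk jk'.
      exact: (hP (inr (inl (Ordinal cn)))).
    pose a : X1 := inr (Ordinal (jk' : (j < k.+1)%N), Ordinal cn).
    exists (cf a (iter c s' z)); split=> [|q ql]; first by have [h _ _] := cfP a; exact: h.
    exact: (hP (inl (a, Ordinal ql))).
  exact: (hP (inr (inr tt))).
pose hh a : int := (tyh l k (ty a))%:Z.
have zE q : zq q = \sum_a hh a * (dd a + ((l.-1 - q) * B a)%N%:Z) + (M%:Z + (l ^ k)%N%:Z).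
  rewrite /zq big_sumType (big_pred1 tt) => [|[]] //=; rewrite -addrA; congr (_ + _ + _).
  by rewrite -(pair_big xpredT xpredT (fun j c => hh (inr (j, c)) * (dd (inr (j, c)) + ((l.-1 - q) * B (inr (j, c)))%N%:Z))).
have wE : \sum_w (aX w * #|JX w|)%N%:Z = \sum_(q < l) \sum_a hh a * ((l.-1 - q) * B a)%N%:Z +
    (\sum_(c < n) (M%:Z - d k.+1 c) + (M%:Z - dO)).
  rewrite big_sumType /=; congr (_ + _).
    rewrite exchange_big -(pair_big xpredT xpredT (fun a (q : 'I_l) => ((l.-1 - q) * B a * #|gJ G (ty a)|)%N%:Z)) /=.
    by apply: eq_bigr => a _; apply: eq_bigr => q _; rewrite (tsJ (T a)) PoszM mulrC.
  rewrite big_sumType /= (big_pred1 tt) => [|[]] //=; rewrite card_unit muln1; congr (_ + _).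
    by apply: eq_bigr => c _; rewrite muln1 gez0_abs // subr_ge0.
  by rewrite gez0_abs // subr_ge0.
rewrite (eq_bigr _ (fun (q : 'I_l) _ => zE q)).
rewrite wE big_split /= sumr_const card_ord.
have -> : \sum_(q < l) \sum_a hh a * (dd a + ((l.-1 - q) * B a)%N%:Z) =
   (\sum_a hh a * dd a) *+ l + \sum_(q < l) \sum_a hh a * ((l.-1 - q) * B a)%N%:Z.
  rewrite -[X in _ *+ X]card_ord -sumr_const -big_split; apply: eq_bigr => q _; rewrite -big_split.
  by apply: eq_bigr => a _; rewrite mulrDr.
have hd : (\sum_a hh a * dd a) *+ l = (l ^ k.+1)%N%:Z * d0 + \sum_(j < k.+1) \sum_(c < n) (l ^ (k.+1 - j))%N%:Z * d j c.
  rewrite big_sumType (big_pred1 tt) => [|[]] //=; rewrite mulrnDl; congr (_ + _).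
    by rewrite /hh /= expnS PoszM -mulr_natl natz mulrA.
  rewrite -(pair_big xpredT xpredT (fun j c => hh (inr (j, c)) * dd (inr (j, c)))) /= -sumrMnl; apply: eq_bigr => j _.
  rewrite -sumrMnl; apply: eq_bigr => c _; have jk : (j <= k)%N := ltn_ord j.
  by rewrite /hh /= subSn // expnS PoszM -[LHS]mulr_natl natz mulrA.
rewrite hd big_ord_recr /= subnn expn0 sumrB sumr_const card_ord.
have -> : \sum_(c < n) 1 * d k.+1 c = \sum_(c < n) d k.+1 c by apply: eq_bigr => c _; rewrite mul1r.
have -> : (l ^ k.+1)%N%:Z = (l ^ k)%N%:Z *+ l by rewrite expnS PoszM -mulr_natl natz.
rewrite mulrnDl; have -> : M%:Z *+ l = M%:Z *+ n + M%:Z by rewrite -mulrSr prednK.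
move: (\sum_(j < k.+1) _) (\sum_(c < n) d k.+1 c) (\sum_(q < l) _) => S1 S2 S3.
by move: ((l ^ k)%N%:Z *+ l * d0) => A; move: ((l ^ k)%N%:Z *+ l) (M%:Z *+ n) (M%:Z) (dO); glia.
Qed.

Lemma gsl_exists k : inhabited (gsl l ga L k).
Proof. by elim: k => [|k IH]; [exact: (gsl0 L pp lE f0 Kl gaP alP)|exact: gslS]. Qed.

End GSStep.

(* [Dg w] are the elements of degree at most [w * T]: integral at the evaluation places, with poles bounded by [w]
   times those of [V]. *)
Lemma tower_interface (K : finFieldType) (p f l : nat) (ga : K) (L : laurent K) (k delta : nat) :
  prime p -> l = (p ^ f)%N -> (0 < f)%N -> #|K| = (l ^ 2)%N -> l.-1.-primitive_root ga ->
  exists (F : fieldType) (em : {rmorphism K -> F}) (s : {rmorphism F -> F}) (I : finType)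
    (H : I -> {rmorphism F -> L}) (V : F -> Prop) (Dg : nat -> F -> Prop),
  [/\ (forall a, s (em a) = em a) /\ (forall z, iter l.-1 s z = z),
      (forall t a, H t (em a) = lcst L a) /\ #|I| = (l ^ k.+1)%N,
      [/\ ksub em V, V 1, forall z, V z -> V (s z) & dimge em V (l ^ k * delta.+1)%N%:Z],
      [/\ forall w x y, Dg w x -> Dg w y -> Dg w (x + y),
          forall w w' x y, Dg w x -> Dg w' y -> Dg (w + w')%N (x * y), Dg 0 1 /\ (forall w, Dg w 0),
          forall w x, Dg w x -> Dg w (- x) & forall z, V z -> Dg 1 z] &
      [/\ forall w z, Dg w z -> Dg w (s z),
          forall w z t, Dg w z -> vge (@lval _ L) 0 (H t z) &
          forall w z, z != 0 -> Dg w z ->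
            \sum_t \sum_(j < l.-1) lval (H t (iter j s z)) <= (w * (l ^ k * (delta.+1 + l)))%N%:Z]].
Proof.
move=> pp lE f0 Kl gaP; have vP := lvalP L.
have l1 : (1 < l)%N by rewrite lE -(exp1n f) ltn_exp2r // prime_gt1.
have l0 : (0 < l)%N := ltnW l1.
have n0 : (0 < l.-1)%N by rewrite -ltnS prednK.
have [al alP] := alpha_exists pp lE f0 Kl.
have [G] := gsl_exists L pp lE f0 Kl gaP alP k.
pose Dg w z := [/\ gR G z, gG G 0 (- (w * (l ^ k * delta.+1))%N%:Z) z,
  forall j c, (j <= k)%N -> gG G j.+1 (- (w * l ^ (k - j))%N%:Z) (iter c (gs G) z) & vge (@lval _ L) 0 (gO G z)].
pose V z := [/\ gR G z, gL G 0 delta%:Z z, forall j c, (j <= k)%N -> gL G j.+1 0 (iter c (gs G) z) & vge (@lval _ L) 0 (gO G z)].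
have fG j : (j <= k.+1)%N -> filt (ge G) (gG G j) by move=> jk; exact: tsG (gT G jk).
have itm c : exists S : {rmorphism G -> G}, forall z, S z = iter c (gs G) z by exact: iter_hom.
have ise c a : iter c (gs G) (ge G a) = ge G a by elim: c => //= c ->; rewrite gse.
have O0 e w : gO G w = 0 -> vge (@lval _ L) e (gO G w) by move=> ->; exact: vge0.
have imod c z : iter c (gs G) z = iter (c %% l.-1) (gs G) z.
  rewrite {1}(divn_eq c l.-1) addnC iterD; congr (iter _ _ _); elim: (c %/ l.-1)%N => //= q IH.
  by rewrite mulSn iterD IH gsn.
exists G, (ge G), (gs G), (gI G), (@gH _ _ _ _ _ G), V, Dg; split.
- by split=> [a|z]; [exact: gse|exact: gsn].
- by split=> [t a|]; [exact: gHe|exact: gIc].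
- have t0 := gT G (leq0n k.+1); have tj j (jk : (j <= k)%N) := gT G (t := j.+1) jk.
  split.
  + split=> [|a x y [x1 x2 x3 x4] [y1 y2 y3 y4]]; split.
    * exact: (filt0 (gRP G) 0).
    * exact: (tsL t0 _).1.
    * by move=> j c jk; have [S SE] := itm c; rewrite -SE rmorph0; exact: (tsL (tj j jk) _).1.
    * by rewrite rmorph0 vge0.
    * by apply: (filtD (gRP G) (e := 0)) => //; exact: (filtK (gRP G) (e := 0)).
    * exact: (tsL t0 _).2.
    * move=> j c jk; have [S SE] := itm c; rewrite -SE rmorphD rmorphM !SE ise.
      by apply: (tsL (tj j jk) _).2; [exact: x3|exact: y3].
    rewrite rmorphD rmorphM gOe; apply: (vgeD vP) => //; apply: (vge0M vP) => //; exact: lcst_vge.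
  + split.
    * exact: (filt1 (gRP G)).
    * by apply: (tsW t0 _ (ts1 t0)).
    * by move=> j c jk; have [S SE] := itm c; rewrite -SE rmorph1; exact: (ts1 (tj j jk)).
    by rewrite rmorph1 vgeE ?oner_neq0 // (valn1 vP).
  + move=> z [z1 z2 z3 z4]; split; [exact: gRs|exact: gLs| |].
      by move=> j c jk; rewrite -iterSr; exact: z3.
    by move: z4; rewrite /vge !fmorph_eq0 gOs.
  have := gdim G delta%:Z (fun _ _ => 0) 0; apply: dimge_sub => [z [z1 z2 z3 z4]|].
    by split=> // j c jk; rewrite imod; apply: z3 => //; rewrite ltn_mod.
  rewrite big1 => [|j _]; last by rewrite big1 // => c _; rewrite mulr0.
  by rewrite !addr0 -PoszM -PoszD mulnS addnC.
- have abs x : gR G x -> gR G (- x) by move=> h; rewrite -mulN1r -(rmorph1 (ge G)) -rmorphN; exact: (filtK (gRP G) (e := 0)).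
  split.
  + move=> w x y [x1 x2 x3 x4] [y1 y2 y3 y4]; split.
    * exact: (filtD (gRP G) (e := 0)).
    * exact: (filtD (fG 0%N isT)).
    * by move=> j c jk; have [S SE] := itm c; rewrite -SE rmorphD !SE; apply: (filtD (fG j.+1 jk)); [exact: x3|exact: y3].
    by rewrite rmorphD (vgeD vP).
  + move=> w w' x y [x1 x2 x3 x4] [y1 y2 y3 y4]; split.
    * exact: (filtM (gRP G) (e := 0) (e' := 0)).
    * by have := filtM (fG 0%N isT) x2 y2; rewrite -opprD -PoszD -mulnDl.
    * move=> j c jk; have [S SE] := itm c; rewrite -SE rmorphM !SE.
      by have := filtM (fG j.+1 jk) (x3 j c jk) (y3 j c jk); rewrite -opprD -PoszD -mulnDl.
    by rewrite rmorphM (vge0M vP).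
  + split=> [|w]; split.
    * exact: (filt1 (gRP G)).
    * by rewrite mul0n oppr0; exact: (filt1 (fG 0%N isT)).
    * by move=> j c jk; have [S SE] := itm c; rewrite -SE rmorph1 mul0n oppr0; exact: (filt1 (fG j.+1 jk)).
    * by rewrite rmorph1 vgeE ?oner_neq0 // (valn1 vP).
    * exact: (filt0 (gRP G) 0).
    * exact: (filt0 (fG 0%N isT)).
    * by move=> j c jk; have [S SE] := itm c; rewrite -SE rmorph0; exact: (filt0 (fG j.+1 jk)).
    by rewrite rmorph0 vge0.
  + move=> w x [x1 x2 x3 x4]; split=> //; [exact: abs|exact: (filtN (fG 0%N isT))| |by rewrite rmorphN (vgeN vP)].
    by move=> j c jk; have [S SE] := itm c; rewrite -SE rmorphN SE; apply: (filtN (fG j.+1 jk)); exact: x3.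
  move=> z [z1 z2 z3 z4]; split=> //.
    have := tsLG (gT G (leq0n k.+1)) z2; apply: (filtW (fG 0%N isT)).
    by rewrite lerN2 mul1n /tyh mulnS PoszD addrC -PoszM lerD2r lez_nat leq_subr.
  move=> j c jk; have := tsLG (gT G (t := j.+1) jk) (z3 j c jk); apply: (filtW (fG j.+1 jk)).
  by rewrite lerN2 mul1n mulr0 add0r lez_nat /tyh leq_subr.
split.
- move=> w z [z1 z2 z3 z4]; split; [exact: gRs|exact: gGs| |].
    by move=> j c jk; rewrite -iterSr; exact: z3.
  by move: z4; rewrite /vge !fmorph_eq0 gOs.
- by move=> w z t [z1 _ _ _]; exact: gHR.
move=> w z z0 [z1 z2 z3 z4]; have := gprod z0 z1 z2 (e := fun j c => - (w * l ^ (k - j))%N%:Z) (fun j c jk _ => z3 j c jk) z4.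
have -> : \sum_(j < k.+1) \sum_(c < l.-1) - (w * l ^ (k - j))%N%:Z = - (w * \sum_(j < k.+1) l.-1 * l ^ (k - j))%N%:Z.
  rewrite big_distrr -natz natr_sum -sumrN; apply: eq_bigr => j _; rewrite sumr_const card_ord mulNrn natz; congr (- _).
  by rewrite -mulr_natl natz -PoszM mulnCA.
(* The groups other than 0 contribute [(l - 1) (l ^ k + ... + 1) = l ^ (k + 1) - 1] to the degree,
   the origin of the summand [l] in [delta.+1 + l]. *)
have : (\sum_(j < k.+1) l.-1 * l ^ (k - j) <= l ^ k * l)%N.
  rewrite -expnSr -big_distrr (reindex_inj rev_ord_inj) /=.
  under eq_bigr => j _ do rewrite subSS subKn ?(ltn_ord j : (j <= k)%N) //.
  by rewrite -predn_exp leq_pred.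
rewrite addr0 mulnDr mulnA.
move: (\sum_t _) (\sum_(j < k.+1) _)%N => A B; rewrite !mulnDr !PoszD !PoszM; nia.
Qed.

(** * Moore determinants and the list size *)

Section Moore.
Variables (F : fieldType) (s : {rmorphism F -> F}).

Definition ent (r : nat) (z : F) : F := if r is r'.+1 then iter r' s z else 1.

(* The determinant with rows [1, b, s b, ..., s^(u-1) b]: it vanishes iff the [b c] are affinely dependent over the
   fixed field of [s]. *)
Definition moore (u : nat) (b : nat -> F) : 'M[F]_u.+1 := \matrix_(r, c) ent r (b c).
Definition W (u : nat) (b : nat -> F) : F := \det (moore u b).

Lemma entS r z : s (ent r.+1 z) = ent r.+2 z. Proof. by []. Qed.

Lemma W_ext u b b' : (forall c, (c <= u)%N -> b c = b' c) -> W u b = W u b'.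
Proof.
by move=> E; congr (\det _); apply/matrixP => r c; rewrite !mxE E // -ltnS.
Qed.

Lemma det_ker (n : nat) (N : 'M[F]_n) (x : 'I_n -> F) : \det N != 0 ->
  (forall r, \sum_c x c * N r c = 0) -> forall c, x c = 0.
Proof.
move=> d0 h c; have [E|E] := eqVneq (\row_c x c) 0.
  by have := congr1 (fun M : 'rV_n => M 0 c) E; rewrite !mxE.
case/eqP: d0; rewrite -det_tr; apply/eqP/det0P; exists (\row_c x c) => //.
by apply/rowP => r; rewrite !mxE -[RHS](h r); apply: eq_bigr => c' _; rewrite !mxE.
Qed.

Definition ext u (B : nat -> F) f c := if c == u.+1 then f else B c.

(** An affine combination with coefficients fixed by [s]: the row [r = 0] says that they add up to
    1. *)
Definition flat u (B : nat -> F) f := exists e : nat -> F,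
  (forall c, s (e c) = e c) /\ forall r, ent r f = \sum_(c < u.+1) e c * ent r (B c).

(** A kernel vector of the larger matrix gives coefficients [e]. Comparing the image under [s] of
    the relation in row [r] with the relation in row [r + 1] shows that [e - s e] is annihilated by
    the image under [s] of the nonsingular [moore u B]; hence [e] is fixed, and the relation
    propagates to all rows. *)
Lemma flatP u B f : W u B != 0 -> W u.+1 (ext u B f) = 0 -> flat u B f.
Proof.
move=> WB; rewrite /W -det_tr => /eqP/det0P[v v0 vE].
have extB (c : 'I_u.+1) : ext u B f c = B c by rewrite /ext ltn_eqF.
have extf : ext u B f u.+1 = f by rewrite /ext eqxx.
pose w (c : 'I_u.+1) := v 0 (widen_ord (leqnSn _) c); pose vm := v 0 ord_max.
have R r : (r <= u.+1)%N -> \sum_(c < u.+1) w c * ent r (B c) + vm * ent r f = 0.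
  move=> ru; have := congr1 (fun M : 'rV_u.+2 => M 0 (inord r)) vE; rewrite !mxE big_ord_recr /= => h.
  rewrite -[RHS]h; congr (_ + _); last by rewrite !mxE inordK //= extf.
  by apply: eq_bigr => c _; rewrite !mxE inordK //= extB.
have vm0 : vm != 0.
  apply: contraNneq v0 => vm0; have w0 : forall c, w c = 0.
    apply: (det_ker (N := moore u B)) => // r; rewrite -[RHS](R r); last by rewrite ltnW.
    by rewrite vm0 mul0r addr0; apply: eq_bigr => c _; rewrite mxE.
  apply/eqP/rowP => c; rewrite mxE; case: (unliftP ord_max c) => [c'|] ->; last exact: vm0.
  by rewrite -[RHS](w0 c') /w; congr (v 0 _); apply/val_inj; rewrite /= /bump leqNgt ltn_ord.
pose e (c : nat) := - w (inord c) / vm.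
have Rl r : (r <= u.+1)%N -> \sum_(c < u.+1) e c * ent r (B c) = ent r f.
  move=> ru; apply: (mulfI vm0); rewrite -[RHS]addr0 -[X in _ = _ + X](R r ru) [RHS]addrC -addrA -[LHS]add0r.
  rewrite mulr_sumr; have -> : \sum_(c < u.+1) vm * (e c * ent r (B c)) = - \sum_(c < u.+1) w c * ent r (B c).
    by rewrite -sumrN; apply: eq_bigr => c _; rewrite /e inord_val mulrA mulrCA mulfV // mulr1 mulNr.
  by move: (R r ru); move: (\sum_(c < u.+1) _) (vm * _) => a b; move/eqP; rewrite addr_eq0 => /eqP ->; rewrite opprK add0r addrA addNr add0r.
have efix (c : 'I_u.+1) : e c - s (e c) = 0.
  apply: (det_ker (N := map_mx s (moore u B)) (x := fun c : 'I_u.+1 => e c - s (e c))); first by rewrite det_map_mx fmorph_eq0.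
  move=> r; under eq_bigr => c' _ do rewrite !mxE mulrBl -[s (e c') * _]rmorphM.
  rewrite sumrB -rmorph_sum Rl; last by rewrite ltnW.
  case: r => -[|r] ru /=; last by have /= -> := Rl r.+2 ru; rewrite subrr.
  by under eq_bigr => c' _ do rewrite rmorph1; have /= -> := Rl 0%N isT; rewrite rmorph1 subrr.
exists (fun c => if (c <= u)%N then e c else 0); split=> [c|r].
  case: ifP => cu; last by rewrite rmorph0.
  by have := efix (Ordinal (cu : (c < u.+1)%N)); move/eqP; rewrite subr_eq0 => /eqP <-.
have E (c : 'I_u.+1) : (if (c <= u)%N then e c else 0) = e c by rewrite -ltnS ltn_ord.
under eq_bigr => c _ do rewrite E.
have es (c : 'I_u.+1) : s (e c) = e c by have := efix c; move/eqP; rewrite subr_eq0 => /eqP <-.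
case: r => [|r]; first by rewrite -Rl.
elim: r => [|r IH]; first by rewrite -Rl.
rewrite -entS IH rmorph_sum; apply: eq_bigr => c _; by rewrite rmorphM es.
Qed.

Lemma moore_flat u u' B (b : nat -> F) : (forall c, (c <= u')%N -> flat u B (b c)) ->
  exists E : 'M[F]_(u.+1, u'.+1), map_mx s E = E /\ moore u' b = (\matrix_(r < u'.+1, c < u.+1) ent r (B c)) *m E.
Proof.
move=> h; have /choice [e eP] : forall c : 'I_u'.+1, exists e : nat -> F,
   (forall c, s (e c) = e c) /\ forall r, ent r (b c) = \sum_(c < u.+1) e c * ent r (B c) by move=> c; apply: h; rewrite -ltnS.
exists (\matrix_(r, c) e c r); split; first by apply/matrixP => r c; rewrite !mxE (eP c).1.
by apply/matrixP => r c; rewrite !mxE (eP c).2; apply: eq_bigr => c' _; rewrite !mxE mulrC.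
Qed.

(** Both matrices are the matrix of [B] times a matrix fixed by [s], so the determinants differ by a
    factor in the fixed field. The cross-multiplied form needs no case distinction for vanishing
    determinants. *)
Lemma W_ratio u B b b' : (forall c, (c <= u)%N -> flat u B (b c)) -> (forall c, (c <= u)%N -> flat u B (b' c)) ->
  s (W u b) * W u b' = W u b * s (W u b').
Proof.
move=> /moore_flat [E [sE bE]] /moore_flat [E' [sE' bE']].
have dE (M : 'M[F]_u.+1) : map_mx s M = M -> s (\det M) = \det M by move=> h; rewrite -det_map_mx h.
by rewrite /W bE bE' !det_mulmx !rmorphM (dE E) // (dE E') // mulrACA [RHS]mulrACA; congr (_ * _); exact: mulrC.
Qed.

Lemma W_flat0 u B b : (forall c, (c <= u.+1)%N -> flat u B (b c)) -> W u.+1 b = 0.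
Proof.
move=> /moore_flat [E [_ bE]]; apply/eqP; apply: contraT; rewrite -unitfE => d0.
have := mxrank_unit (d0 : moore u.+1 b \in unitmx); rewrite bE => h.
have := leq_trans (mxrankM_maxl (\matrix_(r < u.+2, c < u.+1) ent r (B c)) E) (rank_leq_col _).
by rewrite h ltnn.
Qed.

Lemma W0 b : W 0 b = 1. Proof. by rewrite /W det_mx11 mxE. Qed.
Lemma W1 b : W 1 b = b 1%N - b 0%N.
Proof. rewrite /W (expand_det_row _ ord0) big_ord_recl big_ord1 /cofactor !det_mx11 !mxE /= !mul1r.
by rewrite -[(0 + bump 0 0)%N]/1%N -[bump (bump 0 0) 0]/0%N -[bump 0 0]/1%N expr1 mulN1r. Qed.

Variable Dg : nat -> F -> Prop.
Hypotheses (DgD : forall w x y, Dg w x -> Dg w y -> Dg w (x + y))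
  (DgM : forall w w' x y, Dg w x -> Dg w' y -> Dg (w + w')%N (x * y)) (Dg1 : Dg 0 1) (Dg0 : forall w, Dg w 0)
  (DgN : forall w x, Dg w x -> Dg w (- x)) (Dgs : forall w z, Dg w z -> Dg w (s z)).

Lemma Dg_iter w j z : Dg w z -> Dg w (iter j s z).
Proof. by move=> h; elim: j => //= j IH; apply: Dgs. Qed.

(** Row 0 consists of ones, so the [u + 1] rows contribute degree [u] only. *)
Lemma Dg_W u b : (forall c, (c <= u)%N -> Dg 1 (b c)) -> Dg u (W u b).
Proof.
move=> h; rewrite /W /determinant; elim/big_rec: _ => // sg x _ hx; apply: DgD => //.
have prodD u' (g : 'I_u' -> F) : (forall i, Dg 1 (g i)) -> Dg u' (\prod_(i < u') g i).
  elim: u' g => [|u' IH] g hg; first by rewrite big_ord0.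
  rewrite big_ord_recr; have := DgM (IH (fun i => g (widen_ord (leqnSn u') i)) (fun i => hg _)) (hg ord_max).
  by rewrite addn1.
have P : Dg u (\prod_(i < u.+1) moore u b i (sg i)).
  rewrite big_ord_recl mxE /= mul1r.
  have : forall i : 'I_u, Dg 1 (moore u b (lift ord0 i) (sg (lift ord0 i))).
    by move=> i; rewrite mxE /=; apply: Dg_iter; apply: h; rewrite -ltnS.
  exact: prodD.
by case: (odd_perm sg); rewrite ?expr0 ?expr1 ?mul1r ?mulN1r //; exact: DgN.
Qed.

End Moore.

Section DetVal.
Variables (K : fieldType) (L : laurent K).
Let vP := lvalP L.

Lemma vge_prod (I : finType) (e : I -> nat) (g : I -> L) : (forall i, vge (@lval _ L) (e i)%:Z (g i)) ->
  vge (@lval _ L) (\sum_i e i)%N%:Z (\prod_i g i).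
Proof.
move=> h; elim/big_rec2: _ => [|i a b _ IH]; first by rewrite vgeE ?oner_neq0 // (valn1 vP).
by rewrite PoszD; apply: (vgeM vP).
Qed.

(** Subtracting one column [c0] of [S] from the others makes these divisible by the uniformiser
    without changing the determinant. Taking the least index for [c0] makes the column operation [U]
    triangular. *)
Lemma vge_det u (A : 'M[L]_u.+1) (S : {set 'I_u.+1}) :
  (forall r c, vge (@lval _ L) 0 (A r c)) ->
  (forall r c c', c \in S -> c' \in S -> vge (@lval _ L) 1 (A r c - A r c')) ->
  vge (@lval _ L) (#|S|.-1)%:Z (\det A).
Proof.
move=> A0 AS.
have leib (B : 'M[L]_u.+1) (S' : {set 'I_u.+1}) : (forall r c, vge (@lval _ L) (c \in S')%:Z (B r c)) ->
    vge (@lval _ L) #|S'|%:Z (\det B).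
  move=> hB; rewrite /determinant; apply: (vge_sum vP) => sg _.
  have := vge_prod (e := fun i => (sg i \in S') : nat) (g := fun i => B i (sg i)) (fun i => hB i (sg i)).
  have -> : (\sum_i (sg i \in S') = #|S'|)%N.
    by rewrite -sum1_card [RHS]big_mkcond [RHS](reindex_inj (@perm_inj _ sg)) /=; apply: eq_bigr => i _; case: (_ \in _).
  by case: (odd_perm sg); rewrite ?expr0 ?expr1 ?mul1r ?mulN1r // (vgeN vP).
have [->|[c1 c1S]] := set_0Vmem S.
  by rewrite cards0 /=; have := leib A set0; rewrite cards0; apply=> r c; rewrite inE.
pose c0 := [arg min_(c < c1 in S) (c : nat)].
have [c0S c0m] : c0 \in S /\ forall c, c \in S -> (c0 <= c)%N by rewrite /c0; case: arg_minnP.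
pose U : 'M[L]_u.+1 := \matrix_(r, c) ((r == c)%:R - ((r == c0) && (c \in S :\ c0))%:R).
have dU : \det U = 1.
  rewrite -det_tr det_trig; last first.
    apply/is_trig_mxP => r c rc; rewrite !mxE; have [E|_] := eqVneq c r; first by rewrite E ltnn in rc.
    case: eqP => [cE|_]; last by rewrite subrr.
    rewrite in_setD1 /=; case: (boolP (r \in S)) => [/c0m|_]; last by rewrite andbF subrr.
    by rewrite -cE leqNgt rc.
  by rewrite big1 // => r _; rewrite !mxE eqxx in_setD1; case: eqP; rewrite /= subr0.
have -> : \det A = \det (A *m U) by rewrite det_mulmx dU mulr1.
have AU r c : (A *m U) r c = A r c - (if c \in S :\ c0 then A r c0 else 0).
  rewrite mxE; under eq_bigr => j _ do rewrite mxE mulrBr.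
  rewrite sumrB (bigD1 c) //= eqxx mulr1 big1 ?addr0; last by move=> j /negPf ->; rewrite mulr0.
  congr (_ - _); rewrite (bigD1 c0) //= eqxx big1 ?addr0 /=; last by move=> j /negPf ->; rewrite mulr0.
  by case: (c \in _); rewrite ?mulr1 ?mulr0.
have := cardsD1 c0 S; rewrite c0S => ->; apply: leib => r c; rewrite AU.
case: (boolP (c \in S :\ c0)) => [|_]; last by rewrite subr0.
by rewrite in_setD1 => /andP[_ cS]; exact: AS.
Qed.

End DetVal.

Lemma sum_windows (D : nat -> int) B m m' n : (forall p, 0 <= D p) -> (m' <= m)%N -> (B * m <= n)%N ->
  \sum_(w < B) \sum_(j < m') D (m * w + j)%N <= \sum_(p < n) D p.
Proof.
move=> D0 mm Bn.
have -> : \sum_(p < n) D p = \sum_(0 <= p < n) D p by rewrite big_mkord.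
rewrite (big_cat_nat (n := B * m)) //=; apply: le_trans (_ : \sum_(0 <= p < B * m) D p <= _); last first.
  by rewrite lerDl; apply: sumr_ge0.
elim: (B) => [|B' IH]; first by rewrite big_ord0 big_geq.
rewrite big_ord_recr /= (big_cat_nat (n := B' * m)) //=; last by rewrite leq_mul2r leqnSn orbT.
apply: lerD => //; rewrite -{1}(add0n (B' * m)%N) big_addn mulSn addnK big_mkord.
rewrite -(big_mkord xpredT (fun j => D (m * B' + j)%N)) -(big_mkord xpredT (fun j => D (j + B' * m)%N)).
rewrite [X in _ <= X](big_cat_nat (n := m')) //=.
rewrite (eq_bigr (fun j => D (j + B' * m)%N)) => [|j _]; last by rewrite mulnC addnC.
by rewrite lerDl; apply: sumr_ge0.
Qed.

Lemma min_level (m' u : nat) (D : nat -> int) : (forall p, 0 <= D p) -> exists d : nat,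
  [/\ (d <= u)%N, forall j, (j < m')%N -> d%:Z <= D j & d = u \/ exists2 j, (j < m')%N & D j = d%:Z].
Proof.
move=> D0; pose P v := (v == u) || [exists j : 'I_m', `|D j|%N == v].
have ex : exists v, P v by exists u; rewrite /P eqxx.
case: (ex_minnP ex) => d Pd dm; exists d; split.
- by apply: dm; rewrite /P eqxx.
- move=> j jm; have : (d <= `|D j|)%N.
    by apply: dm; rewrite /P; apply/orP; right; apply/existsP; exists (Ordinal jm).
  by have := D0 j; move: (D j); clear; lia.
move: Pd; rewrite /P => /orP[/eqP|/existsP[j /eqP jE]]; [by left|right].
by exists j => //; have := D0 j; move: (D j) jE; clear; lia.
Qed.

(** * Moments of the number of agreements over random tuples *)

Section Tuples.
Variables (C : finType) (u : nat).
Local Notation tup := {ffun 'I_u.+1 -> C}.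

Lemma card_tuples (A : 'I_u.+1 -> {set C}) : #|[set b : tup | [forall r, b r \in A r]]| = (\prod_r #|A r|)%N.
Proof.
transitivity #|family (fun r => mem (A r))|; last by rewrite card_family foldrE big_map big_enum.
by apply: eq_card => b; rewrite !inE; apply: eq_forallb => r.
Qed.

Lemma card_one (S : {set C}) t : #|[set b : tup | b t \in S]| = (#|S| * #|C| ^ u)%N.
Proof.
have := card_tuples (fun r => if r == t then S else setT); rewrite (bigD1 t) //= eqxx => E.
have -> : (#|S| * #|C| ^ u = #|S| * \prod_(r | r != t) #|if r == t then S else setT|)%N.
  congr (_ * _)%N; rewrite (eq_bigr (fun=> #|C|)) => [|r /negPf ->]; last by rewrite cardsT.
  by rewrite prod_nat_const; congr (_ ^ _)%N; rewrite cardC1 card_ord.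
rewrite -E; apply: eq_card => b; rewrite !inE; apply/idP/forallP => [h r|/(_ t)]; last by rewrite eqxx.
by case: eqP => [->|]; rewrite ?inE.
Qed.

Lemma card_two (S : {set C}) t t' : t != t' ->
  (#|[set b : tup | (b t \in S) && (b t' \in S)]| * #|C| = #|S| ^ 2 * #|C| ^ u)%N.
Proof.
move=> tt; have := card_tuples (fun r => if (r == t) || (r == t') then S else setT).
rewrite (bigD1 t) //= eqxx (bigD1 t') ?(eq_sym t') //= eqxx orbT => E.
have -> : [set b : tup | (b t \in S) && (b t' \in S)] = [set b : tup | [forall r, b r \in if (r == t) || (r == t') then S else setT]].
  apply/setP => b; rewrite !inE; apply/andP/forallP => [[h h'] r|h]; last by have := h t; have := h t'; rewrite !eqxx orbT.
  by case: eqP => [->|_] //=; case: eqP => [->|_] //=; rewrite inE.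
rewrite E (eq_bigr (fun=> #|C|)) => [|r /andP[/negPf -> /negPf ->]]; last by rewrite cardsT.
rewrite prod_nat_const.
have kE : (2 + #|[pred r | (r != t) && (r != t')]| = u.+1)%N.
  have := cardsC [set t; t']; rewrite cards2 tt card_ord => h; rewrite -[RHS]h; congr (_ + _)%N.
  by apply: eq_card => r; rewrite !inE negb_or.
have -> : (#|C| ^ u = #|C| ^ #|[pred r | (r != t) && (r != t')]|.+1)%N by congr (_ ^ _)%N; case: kE.
by rewrite (expnS #|C|) -mulnn -!mulnA; congr (_ * (_ * _))%N; rewrite mulnC.
Qed.

Definition cnt (S : {set C}) (b : tup) : nat := \sum_t (b t \in S).

Lemma cnt_le S b : (cnt S b <= u.+1)%N.
Proof.
have : (cnt S b <= \sum_(t < u.+1) 1)%N by apply: leq_sum => t _; case: (_ \in _).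
by rewrite sum_nat_const card_ord muln1.
Qed.

Lemma sum_cnt S : (\sum_b cnt S b = u.+1 * (#|S| * #|C| ^ u))%N.
Proof.
rewrite exchange_big /= (eq_bigr (fun=> (#|S| * #|C| ^ u)%N)) ?sum_nat_const ?card_ord // => t _.
by rewrite -(card_one _ t) -sum1dep_card [RHS]big_mkcond; apply: eq_bigr => b _; case: (_ \in _).
Qed.

Lemma sum_cnt2 S : ((\sum_b cnt S b * cnt S b) * #|C| = (\sum_b cnt S b) * #|C| + u.+1 * u * (#|S| ^ 2 * #|C| ^ u))%N.
Proof.
have E b : (cnt S b * cnt S b = cnt S b + \sum_t \sum_(t' | t' != t) ((b t \in S) && (b t' \in S)))%N.
  rewrite {1}/cnt big_distrl -big_split; apply: eq_bigr => t _ /=; rewrite /cnt big_distrr (bigD1 t) //=.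
  by congr (_ + _)%N; [case: (_ \in _)|apply: eq_bigr => t' _; rewrite mulnb].
under eq_bigr => b _ do rewrite E.
rewrite big_split /= mulnDl; congr (_ + _)%N; rewrite exchange_big big_distrl /=.
rewrite (eq_bigr (fun=> (u * (#|S| ^ 2 * #|C| ^ u))%N)) => [|t _]; first by rewrite sum_nat_const card_ord mulnA.
rewrite exchange_big big_distrl /= (eq_bigr (fun=> (#|S| ^ 2 * #|C| ^ u)%N)) => [|t' tt].
  by rewrite sum_nat_const cardC1 card_ord.
rewrite eq_sym in tt; rewrite -(card_two _ tt) -sum1dep_card; congr (_ * _)%N; rewrite [RHS]big_mkcond.
by apply: eq_bigr => b _; case: (_ && _).
Qed.

(** Pointwise, [cnt ^ 2 <= (u + 1) (cnt - (d + 1)) + (d + 1) cnt] with truncated subtraction,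
    because [cnt <= u + 1]. Summing over all tuples brings in the first two moments of [cnt]. *)
Lemma cnt_excess (S : {set C}) (d : nat) :
  (u * #|S| ^ 2 * #|C| ^ u <= #|C| * (\sum_(b : tup) (cnt S b - d.+1)) + d * #|S| * #|C| ^ u.+1)%N.
Proof.
have pt b : (cnt S b * cnt S b <= u.+1 * (cnt S b - d.+1) + (cnt S b * d + cnt S b))%N.
  by have := cnt_le S b; move: (cnt S b); clear; nia.
have : (\sum_b cnt S b * cnt S b <= \sum_b (u.+1 * (cnt S b - d.+1) + (cnt S b * d + cnt S b)))%N by apply: leq_sum.
rewrite !big_split /= -big_distrr -big_distrl /= -(leq_pmul2r (ltn0Sn u)).
have := sum_cnt2 S; rewrite sum_cnt (expnS #|C| u) -!mulnn; move: (\sum_b _)%N (\sum_b _)%N (#|C| ^ u)%N (#|S|) (#|C|).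
clear; move=> A E Q x M h1 h2.
by rewrite -(leq_pmul2l (ltn0Sn u)); nia.
Qed.

End Tuples.

(** Makes the second moment estimate linear in the density [x] of agreeing list elements at a block,
    [d] being the normalised order of zero there. The loss [1 / (4 c)] is the maximum of
    [x (1 - c x)]. *)
Lemma block_bound (R : realFieldType) (c x d : R) : 0 < c -> 0 <= x -> 0 <= d ->
  x - (4 * c)^-1 <= d + c * Num.max 0 (x * (x - d)).
Proof.
move=> c0 x0 d0; have k0 : 0 < (4 * c)^-1 by rewrite invr_gt0 mulr_gt0.
have kE : 4 * c * (4 * c)^-1 = 1 by rewrite mulfV // gt_eqF // mulr_gt0.
move: ((4 * c)^-1) k0 kE => k k0 kE.
have [xd|xd] := leP x d.
  have : 0 <= c * Num.max 0 (x * (x - d)) by rewrite mulr_ge0 ?(ltW c0) // le_max lexx.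
  by lra.
have : c * (x * (x - d)) <= c * Num.max 0 (x * (x - d)) by rewrite ler_pM2l // le_max lexx orbT.
suff : x - k <= d + c * (x * (x - d)) by lra.
have [cx|cx] := leP 1 (c * x).
  have : 0 <= (x - d) * (c * x - 1) by rewrite mulr_ge0 ?subr_ge0 // ltW.
  by lra.
have h1 : d * (1 - c * x) >= 0 by rewrite mulr_ge0 // subr_ge0 ltW.
have h2 : x * (1 - c * x) <= k.
  rewrite -(ler_pM2l c0) -(ler_pM2l (ltr0n R 4 : 0 < 4%:R)).
  have : 0 <= (2 * (c * x) - 1) ^+ 2 by exact: sqr_ge0.
  by rewrite expr2; lra.
by lra.
Qed.

Section Numeric.
Variable R : realFieldType.

Lemma excess_arith (x dl Q M u E : R) :
  u * (x * M * (x * M)) * Q <= M * E + dl * u * (x * M) * (M * Q) -> M * (M * Q * u * (x * (x - dl))) <= M * E.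
Proof. lra. Qed.

Lemma block_arith (B m u M Q c dl mx E X : R) : c * (B * m) * (M * Q * u * mx) <= c * (B * m) * E ->
  X <= B * m * u * (M * Q) * (dl + c * mx) -> X <= M * Q * (B * (m * (dl * u))) + c * (B * m) * E.
Proof. lra. Qed.

Lemma total_arith (B m u M Q Sx N k T M' nb a : R) :
  B * m * u * (M * Q) * (Sx - N * k) <= M * Q * (B * (u * T)) + u * (M' * Q) * ((B * m + B * nb) * (N * u)) ->
  B * u * Q * m * (a * M) <= B * u * Q * m * (Sx * M) ->
  B * u * Q * (m * M * (a - N * k)) <= B * u * Q * (M * T + u * M' * (m + nb) * N).
Proof. lra. Qed.

Lemma count_arith (m C z T A A2 Ne : R) : m * C * z <= C * T + A -> A <= A2 -> C * (T + Ne) <= C * (m * z) -> C * Ne <= A2.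
Proof. lra. Qed.

End Numeric.

Lemma sum_pairs (I J : finType) (f : I * J -> nat) : (\sum_p f p = \sum_i \sum_j f (i, j))%N.
Proof. by rewrite pair_bigA; apply: eq_bigr => -[]. Qed.

(** * Bounding the list *)

Section ListBound.
Variables (K : finFieldType) (L : laurent K) (F : fieldType) (s : {rmorphism F -> F}) (I : finType)
  (H : I -> {rmorphism F -> L}) (Dg : nat -> F -> Prop) (T n m Bw : nat) (y : I * 'I_Bw -> nat -> K).
Hypotheses (DgD : forall w x y, Dg w x -> Dg w y -> Dg w (x + y))
  (DgM : forall w w' x y, Dg w x -> Dg w' y -> Dg (w + w')%N (x * y)) (Dg1 : Dg 0 1) (Dg0 : forall w, Dg w 0)
  (DgN : forall w x, Dg w x -> Dg w (- x)) (Dgs : forall w z, Dg w z -> Dg w (s z))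
  (DgH : forall w z t, Dg w z -> vge (@lval _ L) 0 (H t z))
  (DgT : forall w z, z != 0 -> Dg w z -> \sum_t \sum_(j < n) lval (H t (iter j s z)) <= (w * T)%N%:Z).
Hypotheses (Bm : (Bw * m <= n)%N) (Bw0 : (0 < Bw)%N) (m0 : (0 < m)%N).
Local Notation W := (W s).
Let vP := lvalP L.

Definition ag (f : F) (b : I * 'I_Bw) : bool :=
  [forall j : 'I_m, vge (@lval _ L) 1 (H b.1 (iter (m * b.2 + j) s f) - lcst L (y b j))].

Lemma iter_neq0 j z : z != 0 -> iter j s z != 0.
Proof. by have [S SE] := iter_hom s j; rewrite -SE fmorph_eq0. Qed.

(** From a start [j <= m - u] the rows [b, ..., s ^ (u - 1) b] stay inside the window, where all
    agreeing columns reduce to the received symbols; [vge_det] gives a zero of order one less than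
    their number. *)
Lemma start_val u (b : nat -> F) (p : I * 'I_Bw) j : (0 < u)%N -> (j + u <= m)%N ->
  (forall c, (c <= u)%N -> Dg 1 (b c)) -> W u b != 0 ->
  (\sum_(c < u.+1) ag (b c) p)%N%:Z - 1 <= lval (H p.1 (iter (m * p.2 + j) s (W u b))).
Proof.
move=> u0 ju hb W0; set q := (m * p.2 + j)%N.
have [S SE] := iter_hom s q; pose h := [the {rmorphism F -> L} of H p.1 \o S].
pose X := [set c : 'I_u.+1 | ag (b c) p].
have <- : #|X| = (\sum_(c < u.+1) ag (b c) p)%N.
  by rewrite -sum1dep_card big_mkcond; apply: eq_bigr => c _; case: (ag _ _).
have hW : H p.1 (iter q s (W u b)) = \det (map_mx h (moore s u b)) by rewrite -SE det_map_mx.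
have hE r z : h (ent s r.+1 z) = H p.1 (iter (q + r) s z) by rewrite /= SE -iterD.
have v : vge (@lval _ L) (#|X|.-1)%:Z (H p.1 (iter q s (W u b))).
  rewrite hW; apply: vge_det => [r c|r c c']; rewrite ?inE !mxE.
    case: r => -[|r] ru; first by rewrite /= !rmorph1 vgeE ?oner_neq0 // (valn1 vP).
    by rewrite hE; apply: (DgH (w := 1)); apply: Dg_iter => //; apply: hb; rewrite -ltnS.
  move=> /forallP hc /forallP hc'; case: r => -[|r] ru; first by rewrite subrr vge0.
  have jr : (j + r < m)%N by apply: leq_trans ju; rewrite ltn_add2l.
  rewrite !hE /q -addnA; have := vgeB vP (hc (Ordinal jr)) (hc' (Ordinal jr)).
  by rewrite opprB addrA subrK.
move: v; rewrite vgeE; last by rewrite fmorph_eq0 iter_neq0.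
by move: (#|X|) (lval _); clear; lia.
Qed.

(** A window has [m + 1 - u] starts. Summing [start_val] over starts and over the disjoint windows
    of all orbits stays below the number [u T] of zeros of the determinant. *)
Lemma single_bound u (b : nat -> F) : (0 < u <= m)%N -> (forall c, (c <= u)%N -> Dg 1 (b c)) -> W u b != 0 ->
  ((m.+1 - u) * \sum_p (\sum_(c < u.+1) ag (b c) p - 1) <= u * T)%N.
Proof.
move=> /andP[u0 um] hb W0; have dW : Dg u (W u b) by apply: Dg_W => //; exact: DgN.
have := DgT W0 dW; rewrite -lez_nat; apply: le_trans.
rewrite big_distrr sum_pairs /=.
rewrite -natz natr_sum; apply: ler_sum => i _.
have D0 q : 0 <= lval (H i (iter q s (W u b))).
  have := DgH i (Dg_iter Dgs q dW); rewrite vgeE // fmorph_eq0 iter_neq0 //.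
have mm : (m.+1 - u <= m)%N by move: u0; clear; lia.
apply: le_trans (sum_windows D0 mm Bm).
rewrite natr_sum; apply: ler_sum => w _; rewrite natz.
have -> : ((m.+1 - u) * (\sum_(c < u.+1) ag (b c) (i, w) - 1))%N%:Z =
    \sum_(j < m.+1 - u) ((\sum_(c < u.+1) ag (b c) (i, w) - 1)%N%:Z).
  by rewrite sumr_const card_ord -mulr_natl natz PoszM.
apply: ler_sum => j _; have jm : (j + u <= m)%N by have := ltn_ord j; move: um; clear; lia.
have := start_val (i, w) u0 jm hb W0; have := D0 (m * w + j)%N.
by move: (\sum_(c < u.+1) _)%N (lval _); clear; lia.
Qed.

(** Affine dimension at most [u] over the fixed field of [s]: any [u + 2] images are dependent. *)
Definition rk (C : finType) (phi : C -> F) u := forall b : nat -> C, W u.+1 (phi \o b) = 0.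

Section Step.
Variables (C : finType) (phi : C -> F) (u M' : nat).
Hypotheses (um : (0 < u <= m)%N) (phiD : forall c, Dg 1 (phi c)) (rkC : rk phi u).
Hypothesis IH : forall t (X : {set C}), (t < u)%N ->
  (forall b : nat -> C, (forall c, b c \in X) -> W t.+1 (phi \o b) = 0) -> (#|X| <= M')%N.
Local Notation tup := {ffun 'I_u.+1 -> C}.
Let tb (b : tup) : nat -> C := fun c => b (inord c).
Let Wt (b : tup) := W u (phi \o tb b).

Lemma flatC (B b : nat -> C) t : W t (phi \o B) != 0 ->
  (forall c, W t.+1 (ext t (phi \o B) (phi (b c))) = 0) -> forall c, flat s t (phi \o B) (phi (b c)).
Proof. by move=> h1 h2 c; apply: flatP. Qed.

(** In a degenerate tuple let [t + 1] be the first entry that depends on its predecessors. Once the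
    other entries are fixed, it lies in a flat of dimension [t < u], which contains at most [M']
    list elements by [IH]. *)
Lemma bad_count : (#|[set b : tup | Wt b == 0%R]| <= u * (M' * #|C| ^ u))%N.
Proof.
pose Bad (t : 'I_u) := [set b : tup | (W t (phi \o tb b) != 0%R) && (W t.+1 (phi \o tb b) == 0%R)].
have sub : [set b : tup | Wt b == 0%R] \subset \bigcup_t Bad t.
  apply/subsetP => b; rewrite inE => Wb; have ex : exists v, W v (phi \o tb b) == 0 by exists u.
  case: (ex_minnP ex) => -[|v] v0 vm; first by rewrite W0 oner_eq0 in v0.
  have vu : (v < u)%N := vm u Wb.
  apply/bigcupP; exists (Ordinal vu) => //; rewrite inE /= v0 andbT; apply/negP => /vm; by rewrite ltnn.
apply: leq_trans (subset_leq_card sub) _.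
have : (\sum_(t < u) #|Bad t| <= u * (M' * #|C| ^ u))%N.
  rewrite -[X in (_ <= X * _)%N]card_ord -sum_nat_const; apply: leq_sum => t _.
  have [E|[c1 _]] := set_0Vmem [set: C].
    have := max_card (mem (Bad t)); rewrite card_ffun card_ord -(cardsT C) E cards0 expnS mul0n leqn0 => /eqP -> //.
  have tu : (t.+1 < u.+1)%N by rewrite ltnS.
  pose t1 : 'I_u.+1 := Ordinal tu.
  (* [g] erases the entry [t + 1]; a fibre of [g] is counted through this entry. *)
  pose g (b : tup) : tup := [ffun c => if c == t1 then c1 else b c].
  rewrite -sum1_card (partition_big g (fun b : tup => b t1 \in [set c1])) => [|b _]; last by rewrite ffunE eqxx inE.
  apply: leq_trans (_ : \sum_(b : tup | b t1 \in [set c1]) M' <= _)%N; last first.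
    by rewrite sum_nat_const -[#|_|]cardsE (card_one [set c1] t1) cards1 mul1n mulnC.
  apply: leq_sum => b0 _; rewrite sum1_card.
  case: (pickP [pred b in Bad t | g b == b0]) => [b1 /andP[b1B /eqP b1g]|no]; last first.
    by rewrite eq_card0 // => b; have := no b.
  pose X := [set x | W t.+1 (ext t (phi \o tb b1) (phi x)) == 0].
  have Wb1 : W t (phi \o tb b1) != 0 by move: b1B; rewrite inE => /andP[].
  have tbE b c : (c <= t)%N -> g b = b0 -> tb b c = tb b1 c.
    move=> ct gb; have := congr1 (fun h : tup => h (inord c)) (etrans gb (esym b1g)); rewrite !ffunE.
    by case: eqP => // /(congr1 val); rewrite /= inordK ?ltnS => [E|]; [rewrite E ltnn in ct|apply: leq_trans ct (ltnW _)].
  apply: leq_trans (_ : #|X| <= _)%N; last first.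
    apply: (IH (t := t)) => // b bX; apply: (W_flat0 (B := phi \o tb b1) (u := t)) => c _.
    by apply: flatC => // c'; have := bX c'; rewrite inE => /eqP.
  rewrite -(card_in_imset (f := fun b : tup => b t1)).
    apply: subset_leq_card; apply/subsetP => x /imsetP[b /andP[bB /eqP gb] ->]; rewrite inE.
    move: bB; rewrite inE => /andP[_ /eqP <-]; apply/eqP; apply: W_ext => c ct; rewrite /ext /=.
    case: eqP => [->|/eqP cn]; first by congr (phi (b _)); apply/val_inj; rewrite /= inordK.
    by rewrite (tbE b) // -ltnS ltn_neqAle cn.
  move=> b b' /andP[_ /eqP gb] /andP[_ /eqP gb'] E; apply/ffunP => c.
  have := congr1 (fun h : tup => h c) (etrans gb (esym gb')); rewrite !ffunE; case: eqP => [-> //|_ //].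
apply: leq_trans; elim/big_rec2: _ => [|t X v _ h]; first by rewrite cards0.
by apply: leq_trans (leq_card_setU _ _) _; rewrite leq_add2l.
Qed.

(** Determinants of nondegenerate tuples differ by factors in the fixed field, so along an orbit
    their orders differ by a constant. The levels [d] belong to the tuple [bs i] of least order on
    each orbit. The excess [e i] of another tuple counts at all [n] points of the orbit, while it
    has to cover the excess agreements in only [Bw] windows. *)
Lemma excess_bound : (exists b : tup, Wt b != 0) -> exists d : I * 'I_Bw -> nat,
  (forall p, (d p <= u)%N) /\ forall b : tup, Wt b != 0 ->
  (Bw * ((m.+1 - u) * \sum_p d p) + n * \sum_p (cnt [set c | ag (phi c) p] b - (d p).+1) <= Bw * (u * T))%N.
Proof.
move=> [b0 Wb0]; have [u0 um'] := andP um.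
have D1 b c : Dg 1 ((phi \o tb b) c) by exact: phiD.
have dW b : Dg u (Wt b) by apply: Dg_W => //; exact: DgN.
pose v i (b : tup) q := lval (H i (iter q s (Wt b))).
have v0 i b q : Wt b != 0 -> 0 <= v i b q.
  by move=> Wb; have := DgH i (Dg_iter Dgs q (dW b)); rewrite vgeE // fmorph_eq0 iter_neq0.
have ratio b b' : s (Wt b) * Wt b' = Wt b * s (Wt b').
  apply: (W_ratio (B := phi \o tb b0)) => c _; apply: flatP => //.
    by rewrite -[RHS](rkC (fun j => if j == u.+1 then tb b c else tb b0 j)); apply: W_ext => j _; rewrite /ext /=; case: eqP.
  by rewrite -[RHS](rkC (fun j => if j == u.+1 then tb b' c else tb b0 j)); apply: W_ext => j _; rewrite /ext /=; case: eqP.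
have shift i b b' q : Wt b != 0 -> Wt b' != 0 -> v i b q - v i b' q = v i b 0%N - v i b' 0%N.
  move=> Wb Wb'; elim: q => // q <-; have [S SE] := iter_hom s q.
  have := congr1 (fun z => lval (H i (S z))) (ratio b b'); rewrite !rmorphM !(valnM vP) ?fmorph_eq0 // !SE -!iterSr -/(v i b q.+1) -/(v i b' q.+1).
  by rewrite -/(v i b q) -/(v i b' q); move: (v i b q.+1) (v i b' q.+1) (v i b q) (v i b' q); clear; lia.
pose bs i := [arg min_(b < b0 | Wt b != 0) (`|v i b 0%N|%N)].
have bsP i : Wt (bs i) != 0 /\ forall b, Wt b != 0 -> v i (bs i) 0%N <= v i b 0%N.
  rewrite /bs; case: arg_minnP => // b Wb bm; split=> // b' Wb'; have := bm b' Wb'.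
  by have := v0 i b 0%N Wb; have := v0 i b' 0%N Wb'; move: (v i b _) (v i b' _); clear; lia.
(* The least order over the starts of the window, capped at [u]: a tuple has at most [u + 1]
   agreements, so at level [u] there is no excess left. *)
have /choice [d dP] : forall p : I * 'I_Bw, exists d : nat, [/\ (d <= u)%N,
     forall j, (j < m.+1 - u)%N -> d%:Z <= v p.1 (bs p.1) (m * p.2 + j)%N &
     d = u \/ exists2 j, (j < m.+1 - u)%N & v p.1 (bs p.1) (m * p.2 + j)%N = d%:Z].
  by move=> p; apply: (@min_level (m.+1 - u) u (fun j => v p.1 (bs p.1) (m * p.2 + j)%N)) => j; apply: v0; case: (bsP p.1).
exists d; split=> [p|b Wb]; first by case: (dP p).
pose e i := `|(v i b 0%N - v i (bs i) 0%N)%R|%N.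
have eE i : (e i)%:Z = v i b 0%N - v i (bs i) 0%N.
  by rewrite /e gez0_abs // subr_ge0; have [_ h] := bsP i; apply: h.
have ex p : (cnt [set c | ag (phi c) p] b - (d p).+1 <= e p.1)%N.
  have [du _ [dE|[j jm jE]]] := dP p; first by rewrite dE (_ : _ - _ = 0)%N //; apply/eqP; rewrite subn_eq0 cnt_le.
  have ju : (j + u <= m)%N by move: jm um'; clear; lia.
  have := start_val p u0 ju (fun c _ => D1 b c) Wb.
  have -> : (\sum_(c < u.+1) ag ((phi \o tb b) c) p = cnt [set c | ag (phi c) p] b)%N.
    by apply: eq_bigr => c _; rewrite inE /= /tb inord_val.
  rewrite -/(v p.1 b (m * p.2 + j)%N); have [Ws _] := bsP p.1; have := shift p.1 b (bs p.1) (m * p.2 + j)%N Wb Ws.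
  rewrite jE -eE; move: (v p.1 b _) (cnt _ _) (d p) (e p.1); clear; lia.
have tot : ((m.+1 - u) * \sum_p d p + n * \sum_i e i <= u * T)%N.
  have := DgT Wb (dW b); rewrite -lez_nat; apply: le_trans.
  rewrite !big_distrr sum_pairs /= -big_split /=.
  rewrite -natz natr_sum; apply: ler_sum => i _.
  have -> : \sum_(j < n) lval (H i (iter j s (Wt b))) = \sum_(j < n) v i (bs i) j + n%:Z * (e i)%:Z.
    rewrite -[n%:Z * _]/(n%:Z * (e i)%:Z) -natz mulr_natl -[X in _ *+ X]card_ord -sumr_const -big_split; apply: eq_bigr => j _.
    have [Ws _] := bsP i; have := shift i b (bs i) j Wb Ws; rewrite -eE /= -/(v i b j).
    by move: (v i b j) (v i (bs i) j) (e i); clear; lia.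
  rewrite natz PoszD PoszM lerD2r.
  have mm : (m.+1 - u <= m)%N by move: u0; clear; lia.
  have D0 q : 0 <= v i (bs i) q by apply: v0; case: (bsP i).
  apply: le_trans (sum_windows D0 mm Bm).
  rewrite -natz natr_sum; apply: ler_sum => w _; rewrite natz.
  have -> : ((m.+1 - u) * d (i, w))%N%:Z = \sum_(j < m.+1 - u) (d (i, w))%:Z.
    by rewrite sumr_const card_ord -mulr_natl natz PoszM.
  by apply: ler_sum => j _; have [_ h _] := dP (i, w); apply: h.
have : (\sum_p (cnt [set c | ag (phi c) p] b - (d p).+1) <= Bw * \sum_i e i)%N.
  apply: leq_trans (_ : \sum_(p : I * 'I_Bw) e p.1 <= _)%N; first by apply: leq_sum => p _; exact: ex.
  rewrite sum_pairs big_distrr; apply: leq_sum => i _.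
  by rewrite /= sum_nat_const card_ord.
move: (\sum_p (_ - _))%N (\sum_p d p)%N (\sum_i e i)%N tot; move: (m.+1 - u)%N (u * T)%N; clear; nia.
Qed.

(** [excess_bound] is summed over all tuples, the degenerate ones, few by [bad_count], being charged
    a trivial bound. [cnt_excess] and [block_bound] with [c = n / (Bw m')] then pass from excesses
    to the densities [x p], at a loss of [1 / (4 c)] per block. *)
Lemma step_bound (R0 : realFieldType) (a : nat) : (0 < n)%N ->
  (forall c, (a <= #|[set p | ag (phi c) p]|)%N) -> (exists b : tup, Wt b != 0) ->
  (m.+1 - u)%:R * #|C|%:R * (a%:R - #|[set: I * 'I_Bw]|%:R * (Bw%:R * (m.+1 - u)%:R / (4 * n%:R))) <=
    #|C|%:R * T%:R + u%:R * M'%:R * ((m.+1 - u)%:R + n%:R / Bw%:R) * #|[set: I * 'I_Bw]|%:R :> R0.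
Proof.
move=> n0 ha ex; have [u0 um'] := andP um; have [d [du dP]] := excess_bound ex.
have [b1 _] := ex; have M0 : (0 < #|C|)%N by apply/card_gt0P; exists (b1 ord0).
pose E p := (\sum_(b : tup) (cnt [set c | ag (phi c) p] b - (d p).+1))%N.
pose N := #|[set: I * 'I_Bw]|; set m' := (m.+1 - u)%N in dP *.
have m'0 : (0 < m')%N by rewrite subn_gt0 ltnS.
have sumN (f : I * 'I_Bw -> nat) k : (forall p, (f p <= k)%N) -> (\sum_p f p <= N * k)%N.
  by move=> h; rewrite /N cardsT -sum_nat_const; apply: leq_sum.
have tot : (#|C| ^ u.+1 * (Bw * (m' * \sum_p d p)) + n * \sum_p E p <=
    #|C| ^ u.+1 * (Bw * (u * T)) + (u * (M' * #|C| ^ u)) * ((Bw * m' + n) * (N * u)))%N.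
  have -> : (\sum_p E p = \sum_(b : tup) \sum_p (cnt [set c | ag (phi c) p] b - (d p).+1))%N by rewrite exchange_big.
  have cT : (#|C| ^ u.+1 = #|{: tup}|)%N by rewrite card_ffun card_ord.
  rewrite {1}cT -[X in (X + _ <= _)%N]sum_nat_const [X in (_ + X <= _)%N]big_distrr -big_split /=.
  apply: leq_trans (_ : \sum_(b : tup) (Bw * (u * T) + (Wt b == 0%R) * ((Bw * m' + n) * (N * u))) <= _)%N; last first.
    rewrite big_split /= sum_nat_const -cT leq_add2l -big_distrl leq_mul2r; apply/orP; right.
    apply: leq_trans bad_count; rewrite -sum1dep_card [X in (_ <= X)%N]big_mkcond; apply: leq_sum => b _.
    by case: (Wt b == 0).
  apply: leq_sum => b _; have [Wb|Wb] := eqVneq (Wt b) 0; last by rewrite mul0n addn0; exact: dP.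
  rewrite mul1n; apply: leq_trans (leq_addl _ _); rewrite mulnDl leq_add //.
    by rewrite -mulnA leq_mul2l; apply/orP; right; rewrite leq_mul2l; apply/orP; right; exact: sumN.
  rewrite leq_mul2l; apply/orP; right; apply: sumN => p.
  by have := cnt_le [set c | ag (phi c) p] b; move: (cnt _ _) (d p); clear; lia.
have pos k : (0 < k)%N -> 0 < k%:R :> R0 by rewrite ltr0n.
have Mp := pos _ M0; have up := pos _ u0; have np := pos _ n0; have Bp := pos _ Bw0; have mp := pos _ m'0.
pose x p : R0 := #|[set c | ag (phi c) p]|%:R / #|C|%:R.
pose Q : R0 := #|C|%:R ^+ u; have Qp : 0 < Q by rewrite exprn_gt0.
pose c : R0 := n%:R / (Bw%:R * m'%:R).
have cp : 0 < c by rewrite divr_gt0 // mulr_gt0.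
have blk p : Bw%:R * m'%:R * u%:R * (#|C|%:R * Q) * (x p - (4 * c)^-1) <=
    #|C|%:R * Q * (Bw%:R * (m'%:R * (d p)%:R)) + n%:R * (E p)%:R.
  have := cnt_excess u [set c | ag (phi c) p] (d p); rewrite -/(E p) (expnS #|C| u) -(mulnn #|_|) -(ler_nat R0) natrD !natrM natrX -/Q.
  have xE : #|[set c | ag (phi c) p]|%:R = x p * #|C|%:R :> R0 by rewrite /x mulfVK // gt_eqF.
  rewrite xE; have x0 : 0 <= x p by rewrite divr_ge0.
  pose dl : R0 := (d p)%:R / u%:R; have dE : (d p)%:R = dl * u%:R :> R0 by rewrite /dl mulfVK // gt_eqF.
  have dl0 : 0 <= dl by rewrite divr_ge0.
  have := block_bound cp x0 dl0; rewrite dE => bb h.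
  have nE : n%:R = c * (Bw%:R * m'%:R) :> R0 by rewrite /c mulfVK // mulf_neq0 // gt_eqF.
  have E0 : 0 <= (E p)%:R :> R0 by [].
  have Em : #|C|%:R * Q * u%:R * Num.max 0 (x p * (x p - dl)) <= (E p)%:R.
    case: (leP 0 (x p * (x p - dl))) => _; last by rewrite mulr0.
    by rewrite -(ler_pM2l Mp); exact: excess_arith h.
  have h1 := ler_wpM2l (ltW (mulr_gt0 cp (mulr_gt0 Bp mp))) Em; 
  have h2 := ler_wpM2l (ltW (mulr_gt0 (mulr_gt0 (mulr_gt0 Bp mp) up) (mulr_gt0 Mp Qp))) bb.
  by rewrite nE; apply: block_arith h2.
have sx : a%:R * #|C|%:R <= (\sum_p x p) * #|C|%:R.
  rewrite mulr_suml; have -> : \sum_p x p * #|C|%:R = (\sum_p #|[set c | ag (phi c) p]|)%N%:R :> R0.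
    by rewrite natr_sum; apply: eq_bigr => p _; rewrite /x mulfVK // gt_eqF.
  rewrite -natrM ler_nat; have -> : (\sum_p #|[set c | ag (phi c) p]| = \sum_c #|[set p | ag (phi c) p]|)%N.
    transitivity (\sum_p \sum_c ag (phi c) p)%N; last rewrite exchange_big; apply: eq_bigr => t _.
      by rewrite -sum1dep_card big_mkcond; apply: eq_bigr => c' _; case: (ag _ _).
    by rewrite -sum1dep_card [RHS]big_mkcond; apply: eq_bigr => c' _; case: (ag _ _).
  by rewrite mulnC -sum_nat_const; apply: leq_sum => c' _.
have key : Bw%:R * m'%:R * u%:R * (#|C|%:R * Q) * (\sum_p x p - N%:R * (Bw%:R * m'%:R / (4 * n%:R))) <=
  #|C|%:R * Q * (Bw%:R * (u%:R * T%:R)) + (u%:R * (M'%:R * Q)) * ((Bw%:R * m'%:R + n%:R) * (N%:R * u%:R)).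
  have : \sum_p (Bw%:R * m'%:R * u%:R * (#|C|%:R * Q) * (x p - (4 * c)^-1)) <=
    \sum_p (#|C|%:R * Q * (Bw%:R * (m'%:R * (d p)%:R)) + n%:R * (E p)%:R) by apply: ler_sum => p _; exact: blk.
  have e1 A k : \sum_p (A * (x p - k)) = A * (\sum_p x p - k *+ #|{: I * 'I_Bw}|) by rewrite -mulr_sumr sumrB sumr_const.
  have e2 A A' A'' : \sum_p (A * (A' * (A'' * (d p)%:R)) + n%:R * (E p)%:R) =
    A * (A' * (A'' * \sum_p (d p)%:R)) + n%:R * \sum_p (E p)%:R :> R0 by rewrite big_split /= -!mulr_sumr.
  rewrite e1 e2.
  have -> : (4 * c)^-1 *+ #|{: I * 'I_Bw}| = N%:R * (Bw%:R * m'%:R / (4 * n%:R)) :> R0.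
    have -> : (4 * c)^-1 = Bw%:R * m'%:R / (4 * n%:R) by rewrite /c invfM invf_div mulrCA -invfM.
    by rewrite /N cardsT [RHS]mulr_natl.
  move/le_trans; apply.
  by move: tot; rewrite -(ler_nat R0) !(natrM, natrD, natrX, natr_sum) exprS -/Q.
have BuQ : 0 < Bw%:R * u%:R * Q by rewrite !mulr_gt0.
rewrite -(ler_pM2l BuQ); have Bi : Bw%:R * (n%:R / Bw%:R) = n%:R :> R0 by rewrite mulrCA mulfV ?mulr1 // gt_eqF.
have h3 := ler_wpM2l (ltW (mulr_gt0 BuQ mp)) sx.
by apply: total_arith h3; rewrite Bi.
Qed.

End Step.

(** A nonzero determinant [W s0] would contradict [single_bound]. Below this, induction on the
    dimension: by [hu], [step_bound] leaves a margin proportional to [eta] for each list element,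
    against a right side proportional to the bound [Mb u] of the previous dimension. *)
Lemma list_bound (R0 : realFieldType) (s0 a : nat) (eta : R0) (Mb : nat -> nat) :
  (0 < n)%N -> 0 < eta -> (0 < s0 <= m)%N -> (0 < #|[set: I * 'I_Bw]|)%N -> (0 < Mb 0)%N ->
  (forall u, (Mb u <= Mb u.+1)%N /\ u.+1%:R * (Mb u)%:R * (m%:R + n%:R) <= eta * (Mb u.+1)%:R) ->
  (forall u, (0 < u < s0)%N -> T%:R + #|[set: I * 'I_Bw]|%:R * eta <=
     (m.+1 - u)%:R * (a%:R - #|[set: I * 'I_Bw]|%:R * (Bw%:R * (m.+1 - u)%:R / (4 * n%:R)))) ->
  (s0 * T + (m.+1 - s0) * #|[set: I * 'I_Bw]| < (m.+1 - s0) * (s0.+1 * a))%N ->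
  forall (C : finType) (phi : C -> F), injective phi -> (forall c, Dg 1 (phi c)) ->
  (forall c, (a <= #|[set p | ag (phi c) p]|)%N) -> (#|C| <= Mb s0.-1)%N.
Proof.
move=> n0 eta0 /andP[s1 sm] N0 Mb0 MbS hu hs C phi inj phiD ha.
have step u : (u < s0)%N -> forall t, (t <= u)%N -> forall (C : finType) (phi : C -> F), injective phi ->
   (forall c, Dg 1 (phi c)) -> (forall c, (a <= #|[set p | ag (phi c) p]|)%N) -> rk phi t -> (#|C| <= Mb u)%N.
  elim: u => [|u IH] us t tu {}C {}phi {}inj {}phiD {}ha rkt.
    move: tu; rewrite leqn0 => /eqP tE; apply: leq_trans Mb0; apply/card_le1P => c _ c'; rewrite !inE.
    apply/esym/eqP/inj; have := rkt (fun j => if j == 0%N then c else c'); rewrite tE W1 /= => /eqP.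
    by rewrite subr_eq0 => /eqP.
  have [tu'|tu'] := leqP t u; first by apply: leq_trans (MbS u).1; exact: (IH (ltnW us) t tu' C phi inj phiD ha rkt).
  have {tu tu'}tE : t = u.+1 by apply/eqP; rewrite eqn_leq tu tu'.
  subst t.
  have uu : (0 < u.+1 <= m)%N by rewrite ltnS leq0n /=; apply: leq_trans sm; exact: ltnW.
  have [ex|nex] := pselect (exists b : {ffun 'I_u.+2 -> C}, W u.+1 (phi \o (fun c => b (inord c))) != 0); last first.
    apply: leq_trans (MbS u).1; apply: (IH (ltnW us) u (leqnn u) C phi inj phiD ha) => b.
    apply/eqP; apply: contraT => Wb; case: nex; exists [ffun c : 'I_u.+2 => b c].
    suff -> : W u.+1 (phi \o (fun c => [ffun c : 'I_u.+2 => b c] (inord c))) = W u.+1 (phi \o b) by [].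
    by apply: W_ext => c cu; rewrite /= ffunE inordK.
  have IH' t (X : {set C}) : (t < u.+1)%N ->
     (forall b : nat -> C, (forall c, b c \in X) -> W t.+1 (phi \o b) = 0) -> (#|X| <= Mb u)%N.
    move=> tu hX; rewrite -card_sig; apply: (IH (ltnW us) t tu {x : C | x \in X} (fun x => phi (val x))) => //.
      by move=> x x' /inj /val_inj.
    by move=> b; apply: (hX (fun c => val (b c))) => c; exact: valP.
  have := step_bound uu phiD rkt IH' R0 n0 ha ex.
  have := hu u.+1; rewrite us => /(_ isT); set N := #|_|%:R; set Y := (_ * (a%:R - _)) => h1 h2.
  have Np : 0 < N by rewrite ltr0n.
  have [_ h3] := MbS u.
  have h4 : #|C|%:R * (N * eta) <= u.+1%:R * (Mb u)%:R * (m%:R + n%:R) * N.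
    have : #|C|%:R * (T%:R + N * eta) <= #|C|%:R * Y by rewrite ler_wpM2l.
    have : u.+1%:R * (Mb u)%:R * ((m.+1 - u.+1)%:R + n%:R / Bw%:R) * N <= u.+1%:R * (Mb u)%:R * (m%:R + n%:R) * N.
      rewrite ler_wpM2r ?(ltW Np) // ler_wpM2l ?mulr_ge0 // lerD //; first by rewrite ler_nat subSS leq_subr.
      by rewrite ler_pdivrMr ?ltr0n // ler_peMr // ler1n.
    by move=> h5 h6; exact: count_arith h2 h5 h6.
  rewrite -(ler_nat R0) -(ler_pM2l eta0) -(ler_pM2r Np); apply: le_trans (_ : _ <= u.+1%:R * (Mb u)%:R * (m%:R + n%:R) * N) _.
    by have -> : eta * #|C|%:R * N = #|C|%:R * (N * eta) by ring.
  by rewrite ler_pM2r.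
apply: (step s0.-1 _ s0.-1 _ C phi) => //; first by rewrite prednK.
move=> b; rewrite prednK //; apply/eqP; apply: contraT => Wb.
have sm' : (0 < s0 <= m)%N by rewrite s1.
have := single_bound sm' (fun c _ => phiD (b c)) Wb; rewrite leqNgt => /negP []; move: hs.
have : (s0.+1 * a <= \sum_p (\sum_(c < s0.+1) ag (phi (b c)) p - 1) + #|[set: I * 'I_Bw]|)%N.
  apply: leq_trans (_ : \sum_p \sum_(c < s0.+1) ag (phi (b c)) p <= _)%N.
    rewrite exchange_big -[X in (X * _ <= _)%N]card_ord -sum_nat_const; apply: leq_sum => c _.
    apply: leq_trans (ha (b c)) _; rewrite -sum1dep_card big_mkcond; apply: leq_sum => p _; by case: (ag _ _).
  rewrite cardsT -sum1_card -big_split; apply: leq_sum => p _ /=; by move: (\sum_(c < s0.+1) _)%N; clear; lia.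
move: (\sum_p _)%N => S; move: (#|_|) (m.+1 - s0)%N (s0 * T)%N (s0.+1 * a)%N; clear; nia.
Qed.

End ListBound.

(** * Eigenvectors of the automorphism *)

Section Eigenbasis.
Variables (K F : fieldType) (em : {rmorphism K -> F}) (s : {rmorphism F -> F}) (n : nat) (ga : K) (V : F -> Prop).
Hypotheses (gaP : n.-primitive_root ga) (nK : n%:R != 0 :> K) (se : forall a, s (em a) = em a)
  (sn : forall z, iter n s z = z) (sV : ksub em V) (V1 : V 1) (Vs : forall z, V z -> V (s z)).

Definition kspan (t : nat) (y : nat -> F) z := exists a : nat -> K, z = \sum_(l < t) em (a l) * y l.

Lemma kspan_sum t y (I : finType) (f : I -> F) (c : I -> K) : (forall i, kspan t y (f i)) ->
  kspan t y (\sum_i em (c i) * f i).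
Proof.
move=> /choice [a aE]; exists (fun l => \sum_i c i * a i l).
under eq_bigr => i _ do rewrite aE mulr_sumr.
rewrite exchange_big; apply: eq_bigr => l _; rewrite rmorph_sum mulr_suml.
by apply: eq_bigr => i _; rewrite rmorphM mulrA.
Qed.

Lemma outside_span D t y : dimge em V D%:Z -> (t < D)%N -> exists2 v, V v & ~ kspan t y v.
Proof.
move=> [N [b [DN fb Vb]]] tD; apply: contrapT => no.
have /choice [a aE] : forall i, kspan t y (b i).
  by move=> i; apply: contrapT => h; apply: no; exists (b i).
pose A : 'M[K]_(N, t) := \matrix_(i, l) a i l.
have : kermx A != 0.
  rewrite -mxrank_eq0 mxrank_ker subn_eq0 -ltnNge; apply: leq_ltn_trans (rank_leq_col _) _.
  by apply: leq_trans tD _; rewrite -lez_nat.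
case/rowV0Pn=> x /sub_kermxP xA /eqP; case.
apply/rowP => i; rewrite mxE; apply: (fb (fun i => x 0 i)).
under eq_bigr => i' _ do rewrite aE mulr_sumr.
rewrite exchange_big big1 // => l _; have := congr1 (fun M : 'rV_t => M 0 l) xA; rewrite !mxE => h.
under eq_bigr => i' _ do rewrite mulrA -rmorphM.
rewrite -mulr_suml -rmorph_sum; have -> : \sum_i' x 0 i' * a i' l = 0; last by rewrite rmorph0 mul0r.
by rewrite -[RHS]h; apply: eq_bigr => i' _; rewrite mxE.
Qed.

Let n0 : (0 < n)%N. Proof. exact: prim_order_gt0 gaP. Qed.
(** The projection onto the eigenspace of [ga ^ c], a finite Fourier transform over the cyclic group
    generated by [s]. *)
Definition comp (c : nat) (v : F) := \sum_(j < n) em (n%:R^-1 * ga ^- (c * j)) * iter j s v.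

Lemma comp_V c v : V v -> V (comp c v).
Proof.
move=> Vv; have := @ksub_sum _ _ em V 'I_n xpredT (fun j => n%:R^-1 * ga ^- (c * j)) (fun j => iter j s v) sV; apply=> j.
by elim: {j}(nat_of_ord j) => //= j IH; exact: Vs.
Qed.

Let ga0 : ga != 0.
Proof.
apply/eqP => g0; have := prim_expr_order gaP; rewrite g0 expr0n gtn_eqF // => /eqP; by rewrite eq_sym oner_eq0.
Qed.

Lemma comp_eigen c v : s (comp c v) = em (ga ^+ c) * comp c v.
Proof.
rewrite rmorph_sum mulr_sumr /=; case: n n0 sn gaP => // n' _ sn' gaP'.
rewrite big_ord_recr [RHS]big_ord_recl /= addrC; congr (_ + _).
  rewrite rmorphM se -iterS sn' muln0 expr0 invr1 mulr1 mulrA -rmorphM; congr (em _ * _).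
  rewrite [RHS]mulrC; congr (_ * _); apply: (mulIf (expf_neq0 (c * n') ga0)); rewrite mulVf ?expf_neq0 // -exprD -mulnS.
  by rewrite mulnC exprM (prim_expr_order gaP') expr1n.
apply: eq_bigr => j _; rewrite rmorphM se mulrA -rmorphM /bump leq0n add1n add0n; congr (em _ * _).
rewrite mulrCA; congr (_ * _); apply: (mulIf (expf_neq0 (c * j.+1) ga0)); rewrite -mulrA mulVf ?expf_neq0 // mulr1.
by rewrite mulnS exprD mulrCA mulVf ?expf_neq0 // mulr1.
Qed.

Lemma comp_sum v : v = \sum_(c < n) comp c v.
Proof.
rewrite exchange_big (bigD1 (Ordinal n0)) //= [X in _ + X]big1 ?addr0 => [|j j0].
  under eq_bigr => c _ do rewrite muln0 expr0 invr1 mulr1.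
  by rewrite sumr_const card_ord -mulrnAl -rmorphMn -[_ *+ n]mulr_natl mulfV // rmorph1 mul1r.
rewrite -mulr_suml -rmorph_sum -mulr_sumr.
have -> : \sum_(c < n) ga ^- (c * j) = 0; last by rewrite mulr0 rmorph0 mul0r.
have w1 : ga ^- j != 1.
  rewrite invr_eq1 -(prim_order_dvd gaP); apply: contra j0 => /(dvdn_leq _) h; apply/eqP/val_inj => /=.
  by case: (posnP j) => // /h; rewrite leqNgt ltn_ord.
have := subrX1 (ga ^- j) n; rewrite exprVn -exprM mulnC exprM (prim_expr_order gaP) expr1n invr1 subrr => /esym/eqP.
rewrite mulf_eq0 subr_eq0 (negPf w1) /= => /eqP h; rewrite -[RHS]h; apply: eq_bigr => c _.
by rewrite exprVn -exprM mulnC.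
Qed.

(** Greedy choice: while fewer than [D] vectors are chosen, some element of [V] is outside their
    span, hence so is one of its eigencomponents. The start is 1, with exponent 0, because the
    realisation demands [y_0 = 1]. *)
Lemma eigenbasis D : dimge em V D%:Z -> (0 < D)%N -> exists (y : nat -> F) (ax : nat -> nat),
  [/\ y 0%N = 1 /\ ax 0%N = 0%N, forall l, (l < D)%N -> V (y l) /\ s (y l) = em (ga ^+ ax l) * y l
    & kfree em (fun l : 'I_D => y l)].
Proof.
move=> dV D0; suff H : forall t, (0 < t <= D)%N -> exists (y : nat -> F) (ax : nat -> nat),
  [/\ y 0%N = 1 /\ ax 0%N = 0%N, forall l, (l < t)%N -> V (y l) /\ s (y l) = em (ga ^+ ax l) * y l
    & kfree em (fun l : 'I_t => y l)] by apply: H; rewrite D0 leqnn.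
elim=> // -[_ _|t IH /andP[_ tD]].
  exists (fun=> 1), (fun=> 0%N); split=> // [l _|a]; first by rewrite rmorph1 expr0 rmorph1 mul1r.
  by rewrite big_ord1 mulr1 => /eqP h i; move: h; rewrite fmorph_eq0 (ord1 i) => /eqP.
have [|y [ax [[y0 ax0] yP fy]]] := IH; first by rewrite ltnS leq0n /= ltnW.
have [v Vv nv] := outside_span y dV tD.
have [c nc] : exists c : 'I_n, ~ kspan t.+1 y (comp c v).
  apply: contrapT => no; apply: nv; rewrite (comp_sum v).
  have := @kspan_sum t.+1 y 'I_n (fun c => comp c v) (fun=> 1) _.
  under eq_bigr => c _ do rewrite rmorph1 mul1r.
  by apply=> c; apply: contrapT => h; apply: no; exists c.
exists (fun l => if l == t.+1 then comp c v else y l), (fun l => if l == t.+1 then c : nat else ax l); split=> //.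
  move=> l; rewrite ltnS leq_eqVlt; case: eqP => [-> _|_ /= lt]; last exact: yP.
  by split; [exact: comp_V|exact: comp_eigen].
move=> a; rewrite big_ord_recr /= eqxx => h.
have E (l : 'I_t.+1) : (if l == t.+1 :> nat then comp c v else y l) = y l by rewrite ltn_eqF.
have {}h : \sum_(l < t.+1) em (a (widen_ord (leqnSn _) l)) * y l + em (a ord_max) * comp c v = 0.
  by rewrite -[RHS]h; congr (_ + _); apply: eq_bigr => l _; rewrite E.
have am : a ord_max = 0.
  apply/eqP; apply: contraT => am; case: nc.
  exists (fun l => - a (inord l) / a ord_max); have em0 : em (a ord_max) != 0 by rewrite fmorph_eq0.
  apply: (mulfI em0); move/eqP: h; rewrite addrC addr_eq0 => /eqP ->; rewrite mulr_sumr -sumrN; apply: eq_bigr => l _.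
  rewrite mulrA -rmorphM mulrCA mulfV // mulr1 rmorphN mulNr; congr (- (em (a _) * _)).
  by apply/val_inj; rewrite /= inordK // ltnS ltnW.
rewrite am rmorph0 mul0r addr0 in h; move=> l; case: (unliftP ord_max l) => [l'|] -> //.
rewrite -[RHS](fy _ h l'); congr a; apply/val_inj; by rewrite /= /bump leqNgt ltn_ord.
Qed.

End Eigenbasis.

(** * The main case *)

Lemma window_arith (R : realFieldType) (rm N eta m' al : R) : 0 <= (m' - 1) * eta * N ->
  (rm + m' * (eta * 2)) * N <= m' * al * N -> rm * N + N * eta <= m' * (al * N - N * eta).
Proof. lra. Qed.

Lemma top_arith (R : realFieldType) (N A z T s : R) : s * T < s * (z * A * N) -> s * T + A * N < A * ((1 + s * z) * N).
Proof. lra. Qed.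

(** Used with [A = m - s0 + 1], [m' = m + 1 - u], [al = 1 - tau]. Here [al] is the convex
    combination [z + (1 - z) / (s + 1)]. A dimension [u < s0] leaves at least one start more than
    [A] in each window, and this pays for the slack [m' / (m + 1)]. *)
Lemma alpha_slack (R : realFieldType) (A s m' z al i j : R) : 1 <= A -> 1 <= s -> A + 1 <= m' -> 0 <= z -> z <= 1 ->
  i * (A + s) = 1 -> j * (s + 1) = 1 -> (s + 1) * al = 1 + s * z -> z * A + m' * i <= m' * al.
Proof.
move=> A1 s1 Am z0 z1 iE jE alE.
have i0 : 0 < i by rewrite -(pmulr_lgt0 _ (_ : 0 < A + s)) ?iE //; lra.
have ij : i <= j by rewrite -(ler_pM2r (_ : 0 < s + 1)) ?jE -?iE ?ler_pM2l //; lra.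
have iA : i * (A + 1) <= 1 by rewrite -[X in _ <= X]iE ler_pM2l // lerD2l.
have alE' : al = z + (1 - z) * j.
  by apply: (mulfI (_ : s + 1 != 0)); [rewrite gt_eqF //; lra|rewrite alE mulrDr mulrCA [_ * j]mulrC jE; lra].
have h0 : 0 <= (1 - z) * (j - i) by rewrite mulr_ge0 ?subr_ge0.
have h1 : 0 <= z * (1 - i) by rewrite mulr_ge0 // subr_ge0; apply: le_trans iA; rewrite ler_peMr ?ltW //; lra.
have h2 : 0 <= (m' - (A + 1)) * (al - i) by rewrite mulr_ge0 ?subr_ge0 //; rewrite alE'; lra.
have h3 : 0 <= (A + 1) * ((1 - z) * (j - i)) by rewrite mulr_ge0 //; lra.
have h4 : 0 <= z * (1 - i * (A + 1)) by rewrite mulr_ge0 // subr_ge0.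
by move: h2; rewrite alE'; lra.
Qed.

Lemma thresholds (R0 : archiRealFieldType) (eta : R0) (q : nat) : 0 < eta -> exists Mb : nat -> nat, (0 < Mb 0%N)%N /\
  forall u, (Mb u <= Mb u.+1)%N /\ u.+1%:R * (Mb u)%:R * q%:R <= eta * (Mb u.+1)%:R.
Proof.
move=> eta0; have /choice [g gP] : forall ux : nat * nat, exists x' : nat, (ux.2 <= x')%N /\ ux.1.+1%:R * ux.2%:R * q%:R <= eta * x'%:R.
  move=> [u x] /=; have ge : 0 <= u.+1%:R * x%:R * q%:R / eta by apply: divr_ge0; [rewrite !mulr_ge0|exact: ltW].
  have [k /andP[h _]] := nat_ceil ge; exists (maxn x k.+1); split; first exact: leq_maxl.
  rewrite [eta * _]mulrC -ler_pdivrMr //; apply: le_trans h _; by rewrite ler_nat leq_maxr.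
pose Mb := fix Mb u := if u is u'.+1 then g (u', Mb u') else 1%N.
by exists Mb; split=> // u; have := gP (u, Mb u).
Qed.

Section CaseA.
Variables (K : finFieldType) (p f r m s0 : nat) (R0 : archiRealFieldType) (R rho tau : R0).
Local Notation l := (r ^ 2)%N.
Hypotheses (pp : prime p) (lE : l = (p ^ f)%N) (f0 : (0 < f)%N) (Kl : #|K| = (l ^ 2)%N) (r8 : (8 * m < r)%N)
  (sm : (0 < s0 <= m)%N) (R_gt0 : 0 < R) (rhoE : rho = R + 2 / (r%:R - 1)) (rho1 : rho < 1)
  (tauE : tau = s0%:R / (s0 + 1)%:R * (1 - m%:R / (m - s0 + 1)%:R * rho)).
Local Notation n := l.-1.
(** The least number of windows with [m Bw > r]: enough points per orbit for [T_bound], and few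
    compared with the orbit length [r ^ 2 - 1]. *)
Let Bw := ((r + m) %/ m)%N.

Let s_gt0 : (0 < s0)%N. Proof. by case/andP: sm. Qed.
Let s_le : (s0 <= m)%N. Proof. by case/andP: sm. Qed.
Let m0 : (0 < m)%N. Proof. exact: leq_trans s_le. Qed.
Let r1 : (8 < r)%N. Proof. by apply: leq_ltn_trans r8; rewrite leq_pmulr. Qed.
Let Bm1 : (r < m * Bw)%N.
Proof. by have := ltn_ceil (r + m) m0; rewrite -/Bw mulSn mulnC addnC ltn_add2l mulnC. Qed.
Let Bm2 : (m * Bw <= r + m)%N. Proof. by rewrite mulnC leq_divM. Qed.
Let Bw0 : (0 < Bw)%N. Proof. by move: Bm1; case: (Bw) => //; rewrite muln0. Qed.
Let Bmn : (Bw * m <= n)%N.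
Proof. by rewrite mulnC; apply: leq_trans Bm2 _; move: r8 r1; rewrite -mulnn; clear; nia. Qed.
Let n0 : (0 < n)%N. Proof. by apply: leq_trans Bmn; rewrite muln_gt0 Bw0. Qed.
Let rl : (1 < l)%N. Proof. by rewrite -mulnn; move: r1; clear; nia. Qed.

(* [T = l^k (delta + 1 + l)] against [rho * m * N] with [N = l^(k+1) Bw]: the loss [(1 + l) l^k] is at most
   [2 / (r - 1)] of [m N] because [m * Bw > r]. *)
Let T_bound k delta N : N = (l ^ k.+1 * Bw)%N -> delta.+1%:R <= R * (m * Bw * l)%:R + 1 ->
  (l ^ k * (delta.+1 + l))%N%:R < rho * m%:R * N%:R.
Proof.
move=> NE hd; have lk : 0 < (l ^ k)%:R :> R0 by rewrite ltr0n expn_gt0 (ltnW rl).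
have -> : rho * m%:R * N%:R = (l ^ k)%:R * (rho * (m * Bw * l)%:R) by rewrite NE expnS !natrM; ring.
rewrite natrM ltr_pM2l // natrD; apply: le_lt_trans (lerD hd (lexx _)) _.
rewrite rhoE mulrDl -addrA ltrD2l.
have rp : 0 < r%:R - 1 :> R0 by rewrite subr_gt0 ltr1n (ltn_trans _ r1).
have l1 : 1 < l%:R :> R0 by rewrite ltr1n.
have hB : r%:R <= (m * Bw)%:R :> R0 by rewrite ler_nat ltnW.
apply: lt_le_trans (_ : 2 * l%:R <= _); first by lra.
rewrite natrM mulrA ler_pM2r; last by lra.
by rewrite mulrAC ler_pdivlMr // ler_pM2l //; lra.
Qed.

Lemma caseA : good_family K m R rho tau.
Proof.
have [L] := laurent_exists K; have vP := lvalP L.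
have [ga gaP] := gamma_exists pp lE f0 Kl.
(* [eta] is spent twice, on the loss of averaging ([loss]) and on the margin of [list_bound];
   [2 eta = 1 / (m + 1)] is the slack granted by [alpha_slack]. *)
pose eta : R0 := (2 * m.+1%:R)^-1; have eta0 : 0 < eta by rewrite invr_gt0 mulr_gt0.
have [Mb [Mb0 MbS]] := thresholds (m + n) eta0.
(* The bound 1 is for [tau <= 0], where only full agreement counts. The level [k] is large enough
   for [l ^ (k + 1) Bw >= N0]. *)
exists (maxn 1 (Mb s0.-1)) => N0; pose k := N0.
(* The pole order at infinity is such that the dimension [l ^ k (delta + 1)] just reaches
   [R m N]. *)
have [delta /andP[d1 d2]] : exists delta : nat, R * (m * Bw * l)%:R <= delta.+1%:R <= R * (m * Bw * l)%:R + 1.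
  by apply: nat_ceil; rewrite mulr_ge0 // ltW.
have [F [em [s [I [H [V [Dg [[se sn] [He cI] [sV V1 Vs dV] [DgD DgM [Dg1 Dg0] DgN VD] [Dgs DgH DgT]]]]]]]]] :=
  tower_interface L k delta pp lE f0 Kl gaP.
set T := (l ^ k * (delta.+1 + l))%N in DgT; pose D := (l ^ k * delta.+1)%N.
have D0 : (0 < D)%N by rewrite muln_gt0 expn_gt0 (ltnW rl).
have pK : p \in [pchar K] by apply: (card_finPcharP (n := f * 2)); rewrite // Kl lE -expnM.
have nK : n%:R != 0 :> K.
  have : l%:R = 0 :> K by rewrite lE; apply/eqP; rewrite -(dvdn_pcharf pK) -(prednK f0) expnS dvdn_mulr.
  by rewrite -{1}(prednK (ltnW rl)) -natr1 => /eqP; rewrite addr_eq0 => /eqP ->; rewrite oppr_eq0 oner_eq0.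
have [y [ax [[y0 ax0] yP fy]]] := eigenbasis gaP nK se sn sV V1 Vs dV D0.
pose Bk : finType := (I * 'I_Bw)%type; pose N := #|Bk|; pose bl (i : 'I_N) : Bk := enum_val i.
have NE : N = (l ^ k.+1 * Bw)%N by rewrite /N card_prod cI card_ord.
have N_gt0 : (0 < N)%N by rewrite NE muln_gt0 Bw0 expn_gt0 (ltnW rl).
have Np : 0 < N%:R :> R0 by rewrite ltr0n.
have mp : 0 < m%:R :> R0 by rewrite ltr0n.
have TN : T%:R < rho * m%:R * N%:R := T_bound NE d2.
have yD l' : (l' < D)%N -> Dg 1%N (y l') by move=> h; apply: VD; case: (yP _ h).
have /choice [va vaP] : forall il : 'I_N * nat, exists a : K, (il.2 < D)%N ->
    vge (@lval _ L) 1 (H (bl il.1).1 (iter (m * (bl il.1).2) s (y il.2)) - lcst L a).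
  move=> [i l']; case: (ltnP l' D) => h; last by exists 0.
  have /rs_of [a ha] : vge (@lval _ L) 0 (H (bl i).1 (iter (m * (bl i).2) s (y l'))).
    by apply: (DgH 1%N); apply: Dg_iter => //; exact: yD.
  by exists a.
pose val (i : 'I_N) (l' : nat) : K := if l' == 0%N then 1 else va (i, l').
have valP i l' : (l' < D)%N -> vge (@lval _ L) 1 (H (bl i).1 (iter (m * (bl i).2) s (y l')) - lcst L (val i l')).
  move=> h; rewrite /val; case: eqP => [->|_]; last exact: (vaP (i, l')).
  have [S SE] := iter_hom s (m * (bl i).2)%N; by rewrite y0 -SE !rmorph1 subrr vge0.
pose k0 := D.-1; have k0E : k0.+1 = D by rewrite prednK.
(* As [y_l'] is an eigenvector, its value at position [j] of a window is its value at the start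
   times [ga ^ (ax l' * j)]: the diagonal form that [tame_realised] provides. *)
pose w (i : 'I_N) (j l' : nat) : K := ga ^+ (ax l' * j) * val i l'.
have Kp : #|K| = (p ^ (f * 2))%N by rewrite Kl lE -expnM.
have q4 : (4 <= #|K|)%N by rewrite Kl; apply: leq_trans (_ : 2 ^ 2 <= _)%N => //; rewrite leq_exp2r.
have rw : realised m k0 w.
  apply: (tame_realised (p := p) (e := f * 2) pp Kp _ q4 k0 gaP) => //.
  - by rewrite muln_gt0 f0.
  - by rewrite prednK ?(ltnW rl) // lE -(prednK f0) expnS dvdn_mulr.
  - by rewrite Kl -mulnn; move: rl; clear; nia.
  by rewrite m0 /=; apply: leq_trans Bmn; rewrite leq_pmull.
pose phi (c : 'rV[K]_k0.+1) : F := \sum_(l' < k0.+1) em (c 0 l') * y l'.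
have fy' : kfree em (fun l' : 'I_k0.+1 => y l') by rewrite k0E; exact: fy.
have phi0 c : phi c = 0 -> c = 0.
  move=> h; apply/rowP => l'; rewrite mxE; exact: (fy' (fun l' => c 0 l') h).
have phiB c c' : phi (c - c') = phi c - phi c'.
  by rewrite /phi -sumrB; apply: eq_bigr => l' _; rewrite !mxE rmorphB mulrBl.
have phi_inj : injective phi.
  by move=> c c' h; apply/eqP; rewrite -subr_eq0; apply/eqP/phi0; rewrite phiB h subrr.
have phiV c : V (phi c).
  have := @ksub_sum _ _ em V 'I_k0.+1 xpredT (fun l' => c 0 l') (fun l' => y l') sV; apply=> l'.
  by have := ltn_ord l'; rewrite [X in (_ < X)%N]k0E => /yP[].
have phiD c : Dg 1%N (phi c) := VD _ (phiV c).
have enc c i j : vge (@lval _ L) 1 (H (bl i).1 (iter (m * (bl i).2 + j) s (phi c)) - lcst L (\sum_l' c 0 l' * w i j l')).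
  have [S SE] := iter_hom s (m * (bl i).2 + j)%N; rewrite -SE /phi !rmorph_sum -sumrB; apply: (vge_sum vP) => l' _.
  have lD : (l' < D)%N by rewrite -k0E.
  have [_ ey] := yP l' lD.
  have ise q a : iter q s (em a) = em a by elim: q => //= q ->; rewrite se.
  have ieig q : iter q s (y l') = em (ga ^+ (ax l' * q)) * y l'.
    elim: q => [|q IH]; first by rewrite muln0 expr0 rmorph1 mul1r.
    by rewrite iterS IH rmorphM se ey mulrA -rmorphM -exprD mulnS addnC.
  rewrite (rmorphM S) !SE ise (rmorphM (H _)) He ieig mulnDr exprD (rmorphM em) /w.
  have -> : em (ga ^+ (ax l' * (m * (bl i).2))) * em (ga ^+ (ax l' * j)) * y l' =
     em (ga ^+ (ax l' * j)) * iter (m * (bl i).2) s (y l') by rewrite ieig; ring.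
  rewrite (rmorphM (H _)) He; apply: rsM; first by rewrite subrr vge0.
  by apply: rsM; [rewrite subrr vge0|exact: valP].
have agP c (Y : 'M[K]_(N, m)) i : row i (encw m w c) == row i Y ->
    ag s H m (fun (b : Bk) j => yrow Y (enum_rank b) j) (phi c) (bl i).
  move=> /eqP E; apply/forallP => j; have := enc c i j.
  rewrite /yrow enum_valK valK; have := congr1 (fun M : 'rV_m => M 0 j) E; by rewrite !mxE => ->.
have agree_ag c (Y : 'M[K]_(N, m)) : (agree (encw m w c) Y <=
    #|[set b | ag s H m (fun (b : Bk) j => yrow Y (enum_rank b) j) (phi c) b]|)%N.
  rewrite /agree -(card_imset _ (@enum_val_inj _ Bk)); apply: subset_leq_card; apply/subsetP => b /imsetP[i].
  by rewrite inE => h ->; rewrite inE; exact: agP.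
(* Distance is the case [u = 1], where the determinant of the messages 0 and [c] is [phi c]. *)
have zeros (c : 'rV[K]_k0.+1) : c != 0 -> (m * agree (encw m w c) 0 <= T)%N.
  move=> c0; have c0' : phi c != 0 by apply: contra_neq c0; exact: phi0.
  pose b j := if j == 0%N then 0 else phi c.
  have Wb : W s 1 b != 0 by rewrite W1 /b /= subr0.
  have Db j : (j <= 1)%N -> Dg 1%N (b j) by rewrite /b; case: eqP => _ _.
  have := single_bound (fun (b : Bk) j => yrow (0 : 'M[K]_(N, m)) (enum_rank b) j) DgD DgM Dg1 Dg0 DgN Dgs DgH DgT Bmn (u := 1) _ Db Wb.
  rewrite subSS subn0 mul1n => /(_ m0); apply: leq_trans; rewrite leq_mul2l; apply/orP; right.
  apply: leq_trans (agree_ag c 0) _; rewrite -sum1dep_card big_mkcond; apply: leq_sum => p' _.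
  rewrite big_ord_recl big_ord1 /b /=.
  have -> : ag s H m (fun (b : Bk) j => yrow (0 : 'M[K]_(N, m)) (enum_rank b) j) 0 p' = true.
    apply/forallP => j; have [S SE] := iter_hom s (m * p'.2 + j)%N; rewrite -SE !rmorph0 /yrow valK mxE rmorph0 subrr vge0 //.
  by case: (ag _ _ _ _ _ _).
have dist (c : 'rV[K]_k0.+1) : c != 0 -> (agree (encw m w c) 0)%:R < rho * N%:R.
  move=> /zeros h; rewrite -(ltr_pM2l mp) -natrM; apply: le_lt_trans (_ : _ <= T%:R) _; first by rewrite ler_nat.
  by apply: lt_le_trans TN _; rewrite [rho * _]mulrC -mulrA.
have einj (c : 'rV[K]_k0.+1) : encw m w c = 0 -> c = 0.
  move=> E; apply/eqP; apply: contraT => /dist; rewrite E.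
  have -> : agree (0 : 'M[K]_(N, m)) 0 = N.
    by rewrite /agree -[RHS]card_ord -cardsT; congr #|pred_of_set _|; apply/setP => i; rewrite !inE eqxx.
  by rewrite ltNge; case/negP; rewrite ger_pMl // ltW.
exists N, k0, w; split=> //.
  rewrite NE; apply: leq_trans (ltnW (ltn_expl k rl)) _; apply: leq_trans (_ : l ^ k.+1 <= _)%N; first by rewrite leq_exp2l.
  by rewrite leq_pmulr.
split=> //.
- rewrite k0E; have -> : R * (m * N)%:R = (l ^ k)%:R * (R * (m * Bw * l)%:R).
    by rewrite NE expnS !natrM; ring.
  by rewrite /D [X in _ <= X]natrM ler_wpM2l.
- by move=> c /dist /ltW.
move=> Y; set LS := [set c | _].
have [tau0|tau0] := leP tau 0.
  apply: leq_trans (leq_maxl _ _); apply/card_le1_eqP => c c'; rewrite !inE => hc hc'.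
  have full (c2 : 'rV[K]_k0.+1) : (1 - tau) * N%:R <= (agree (encw m w c2) Y)%:R -> encw m w c2 = Y.
    move=> h; apply: agree_full; rewrite -(ler_nat R0); apply: le_trans h.
    by rewrite ler_peMl // lerBrDr gerDl.
  apply/eqP; rewrite -subr_eq0; apply/eqP; apply: einj; by rewrite encwB (full _ hc) (full _ hc') subrr.
pose A := (m - s0 + 1)%N; have AE : A = (m.+1 - s0)%N by rewrite /A addn1 subSn.
have A0 : (0 < A)%N by rewrite /A addn1.
have Ap : 0 < A%:R :> R0 by rewrite ltr0n.
pose z : R0 := m%:R / A%:R * rho.
have zA : z * A%:R = rho * m%:R by rewrite /z mulrAC mulfVK ?gt_eqF // mulrC.
have rho0 : 0 < rho.
  rewrite rhoE addr_gt0 // divr_gt0 // subr_gt0 ltr1n; exact: ltn_trans r1.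
have z0 : 0 <= z by rewrite /z mulr_ge0 ?divr_ge0 // ltW.
have s1p : 0 < (s0 + 1)%:R :> R0 by rewrite ltr0n addn1.
have z1 : z <= 1.
  have sp : 0 < s0%:R / (s0 + 1)%:R :> R0 by apply: divr_gt0 => //; rewrite ltr0n.
  by move: tau0; rewrite tauE (pmulr_rgt0 _ sp) subr_gt0 => /ltW.
have alE : (s0%:R + 1) * (1 - tau) = 1 + s0%:R * z.
  have tz : (s0%:R + 1) * tau = s0%:R * (1 - z).
    by rewrite tauE natr1 -addn1 mulrA mulrCA mulfV ?mulr1 // gt_eqF.
  by rewrite mulrBr tz; ring.
have [a [ha1 ha2]] : exists a : nat, (1 - tau) * N%:R <= a%:R /\ forall b : nat, (1 - tau) * N%:R <= b%:R -> (a <= b)%N.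
  have ex : exists b : nat, (1 - tau) * N%:R <= b%:R.
    exists N; rewrite ger_pMl // gerBl; exact: ltW.
  by case: (ex_minnP ex) => a h1 h2; exists a.
apply: leq_trans (leq_maxr _ _).
have cN : #|[set: I * 'I_Bw]| = N by rewrite cardsT.
have etaE : eta * 2 = m.+1%:R^-1 by rewrite /eta invfM mulrAC mulVf ?mul1r // pnatr_eq0.
pose C : finType := {c : 'rV[K]_k0.+1 | c \in LS}.
have -> : #|LS| = #|C| by rewrite card_sig.
apply: (@list_bound K L F s I H Dg T n m Bw (fun (b : Bk) j => yrow Y (enum_rank b) j) DgD DgM Dg1 Dg0 DgN Dgs DgH DgT
   Bmn Bw0 R0 s0 a eta Mb n0 eta0 sm _ Mb0 _ _ _ C (fun c : C => phi (sval c))) => //.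
- by rewrite cN.
- by move=> u; rewrite -natrD; exact: MbS.
- move=> u /andP[u0 us]; rewrite cN; set m' := (m.+1 - u)%N.
  have m'A : (A < m')%N by rewrite AE /m'; move: us s_le; clear; lia.
  have m'm : (m' <= m)%N by rewrite /m'; move: u0; clear; lia.
  have m'p : 1 <= m'%:R :> R0 by rewrite ler1n; apply: leq_ltn_trans m'A.
  have slack := @alpha_slack R0 A%:R s0%:R m'%:R z (1 - tau) m.+1%:R^-1 (s0%:R + 1)^-1.
  have {}slack : rho * m%:R + m'%:R * (eta * 2) <= m'%:R * (1 - tau).
    rewrite -zA etaE; apply: slack => //; rewrite ?ler1n //.
    - by rewrite natr1 ler_nat.
    - by rewrite -natrD (_ : (A + s0 = m.+1)%N) ?mulVf ?pnatr_eq0 // AE subnK // leqW.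
    by rewrite mulVf // natr1 pnatr_eq0.
  (* [Bw m' <= r + m] against [4 (r ^ 2 - 1)]: with [8 m < r] the quotient drops below
     [1 / (2 (m + 1))]. *)
  have loss : Bw%:R * m'%:R / (4 * n%:R) <= eta.
    rewrite ler_pdivrMr ?mulr_gt0 ?ltr0n // /eta [X in _ <= X]mulrC ler_pdivlMr ?mulr_gt0 //.
    rewrite -!natrM ler_nat; have : (Bw * m' <= r + m)%N by apply: leq_trans Bm2; rewrite mulnC leq_mul2r m'm orbT.
    by move: (Bw * m')%N r8 m0 => v; rewrite -mulnn; clear; nia.
  apply: le_trans (_ : rho * m%:R * N%:R + N%:R * eta <= _); first by rewrite lerD2r ltW.
  apply: le_trans (_ : m'%:R * ((1 - tau) * N%:R - N%:R * eta) <= _); last first.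
    by rewrite ler_wpM2l // lerB // ler_wpM2l.
  have h1 : 0 <= (m'%:R - 1) * eta * N%:R by rewrite !mulr_ge0 ?subr_ge0 // ltW.
  have h2 := ler_wpM2r (ltW Np) slack.
  exact: window_arith h1 h2.
- rewrite cN -AE -(ltr_nat R0) natrD (natrM _ s0 T) (natrM _ A N) (natrM _ A) (natrM _ s0.+1 a) -natr1.
  apply: lt_le_trans (_ : A%:R * ((s0%:R + 1) * ((1 - tau) * N%:R)) <= _); last by rewrite ler_pM2l // ler_pM2l // natr1 ltr0n.
  rewrite [(s0%:R + 1) * _]mulrA alE.
  have : s0%:R * T%:R < s0%:R * (rho * m%:R * N%:R) by rewrite ltr_pM2l ?ltr0n.
  by rewrite -zA; exact: top_arith.
- by move=> c c' /phi_inj /val_inj.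
move=> [c cL] /=; apply: leq_trans (agree_ag c Y); apply: ha2; by move: cL; rewrite inE.
Qed.

End CaseA.

Lemma good_family_exists (K : finFieldType) (p e r m s : nat) (R0 : archiRealFieldType) (R : R0) :
  prime p -> (r ^ 2 = p ^ e)%N -> (0 < e)%N -> #|K| = ((r ^ 2) ^ 2)%N -> 0 < R -> R < 1 -> (1 <= s <= m)%N ->
  good_family K m R (R + 2 / (r%:R - 1))
    (s%:R / (s + 1)%:R * (1 - m%:R / (m - s + 1)%:R * (R + 2 / (r%:R - 1)))).
Proof.
move=> pp rE e0 Kl R0p R1 /andP[s1 sm]; have m0 : (0 < m)%N := leq_trans s1 sm.
have r2 : (2 <= r)%N.
  have : (1 < r ^ 2)%N by rewrite rE -(exp1n e) ltn_exp2r // prime_gt1.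
  by case: r {rE Kl} => [|[|r']].
have Kp : #|K| = (p ^ (e * 2))%N by rewrite Kl rE -expnM.
have e2 : (0 < e * 2)%N by rewrite muln_gt0 e0.
have Kr : #|K| = (r ^ 4)%N by rewrite Kl -expnM.
have rp : 0 < r%:R - 1 :> R0 by rewrite subr_gt0 ltr1n.
set rho := R + _; set kp := m%:R / _; set sg := s%:R / _; set tau := sg * _.
have rhoR : rho - R = 2 / (r%:R - 1) by rewrite /rho addrC addKr.
have kp1 : 1 <= kp.
  rewrite /kp ler_pdivlMr ?ltr0n ?addn1 // mul1r ler_nat; move: s1 sm; clear; lia.
have sp : 0 < (s + 1)%:R :> R0 by rewrite ltr0n addn1.
have sg0 : 0 < sg by rewrite /sg divr_gt0 // ltr0n.
have sg1 : sg < 1 by rewrite /sg ltr_pdivrMr // mul1r ltr_nat addn1.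
have rho0 : 0 < rho by rewrite /rho addr_gt0 // divr_gt0.
have [rho1|rho1] := leP 1 rho.
  apply: (caseB_trivial pp Kp e2 r2 Kr m0) => //.
  rewrite /tau pmulr_rle0 // subr_le0; apply: le_trans rho1 _; by rewrite ler_peMl // ltW.
(* Thus the decoding radius asks for no more than the distance, and one slack estimate serves
   both. *)
have tr : rho <= 1 - tau.
  rewrite /tau; have : 0 <= (1 - sg) * (1 - rho) by rewrite mulr_ge0 // subr_ge0 ltW.
  have : 0 <= sg * ((kp - 1) * rho) by apply: mulr_ge0; [exact: ltW|apply: mulr_ge0; [rewrite subr_ge0|exact: ltW]].
  by move: (sg) (kp) (rho); clear; move=> *; lra.
have ssm : (0 < s <= m)%N by rewrite s1.
have [r8|r8] := leqP r (8 * m); last exact: (caseA pp rE e0 Kl r8 ssm R0p erefl rho1 erefl).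
have h1 : 1 < 4 * m%:R * (rho - R).
  rewrite rhoR mulrA ltr_pdivlMr // mul1r.
  have : r%:R <= 8 * m%:R :> R0 by rewrite -natrM ler_nat.
  by move: (r%:R : R0) (m%:R : R0); clear; move=> *; lra.
have mp : 0 < 4 * m%:R :> R0 by rewrite mulr_gt0 // ltr0n.
apply: (caseB_random pp Kp e2 r2 Kr m0) => //.
  by apply: lt_le_trans h1 _; rewrite ler_pM2l // lerD2r.
by move: tr rho0; clear; move=> *; lra.
Qed.

Theorem theorem2p7 (ell r : nat)
  (hell_pp : exists p k : nat, prime p /\ (0 < k)%N /\ ell = (p ^ k)%N)
  (hell_sq : ell = (r ^ 2)%N)
  (K : finFieldType) (hK : #|K| = (ell ^ 2)%N)
  (R : Rdefinitions.R) (hR0 : 0 < R) (hR1 : R < 1)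
  (m s : nat) (hs1 : (1 <= s)%N) (hsm : (s <= m)%N) :
  let tau : Rdefinitions.R :=
    s%:R / (s + 1)%:R *
    (1 - m%:R / (m - s + 1)%:R * (R + 2 / (r%:R - 1))) in
  exists Cst : Rdefinitions.R, forall N0 : nat,
  exists (F : fieldType) (emb : {rmorphism K -> F}) (sigma sigmainv : F -> F)
         (N l nD : nat) (Pp : 'I_N -> F -> int)
         (Dp : 'I_nD -> F -> int) (Dn : 'I_nD -> int),
    [/\ folded_AG_data emb sigma sigmainv m l Pp Dp Dn,
        (N0 <= N)%N,
        (* rate at least R *)
        R <= (fcode_dim emb sigmainv m l Pp Dp Dn)%:R / (m * N)%:R,
        (* relative distance at least 1 - R - 2/(sqrt ell - 1) *)
        (forall c c', c \in fcode emb sigmainv m l Pp Dp Dn ->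
           c' \in fcode emb sigmainv m l Pp Dp Dn -> c != c' ->
           1 - R - 2 / (r%:R - 1) <= (hamming c c')%:R / N%:R) &
        (* list decoding from error fraction tau *)
        (forall y : 'M[K]_(N, m),
           exists S : seq F,
           [/\ uniq S,
               (size S)%:R <= Cst * N%:R ^+ ((r - 1) * s),
               (forall f, f \in S -> message emb l Dp Dn f),
               (0 \in S) /\
               (forall f g, f \in S -> g \in S -> f + g \in S) /\
               (forall (a : K) f, f \in S -> emb a * f \in S) &
               (forall f, message emb l Dp Dn f ->
                  (hamming (fenc emb sigmainv m Pp f) y)%:R <= tau * N%:R ->
                  f \in S)])].
Proof.
have [p [e [pp [e0 ellE]]]] := hell_pp.
have rE : (r ^ 2 = p ^ e)%N by rewrite -hell_sq.
have Kl : #|K| = ((r ^ 2) ^ 2)%N by rewrite hK hell_sq.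
have m0 : (0 < m)%N := leq_trans hs1 hsm.
have sm : (1 <= s <= m)%N by rewrite hs1.
move=> tau; have [L0 fam] := good_family_exists pp rE e0 Kl hR0 hR1 sm.
(* The size of the returned subspace is bounded along the family, and powers of [N >= 1] are at
   least 1. *)
exists (#|K| ^ L0.+1)%:R => N0; have [N [k0 [w [NN Np rea gc]]]] := fam N0.
have [F [emb [si [sinv [Pp [Dp [Dn [x [y [data msg enc]]]]]]]]]] := rea.
exists F, emb, si, sinv, N, 1%N, 1%N, Pp, Dp, Dn; split=> //.
- exact: (reduction_rate m0 Np gc msg enc).
- move=> c c' hc hc' ne; rewrite -addrA -opprD; exact: (reduction_dist Np gc msg enc hc hc' ne).
move=> Y; have [S [h1 h2 h3 h4 h5]] := reduction_list gc msg enc Y.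
exists S; split=> //; apply: le_trans (_ : (#|K| ^ L0.+1)%:R <= _); first by rewrite ler_nat.
by rewrite ler_peMr // exprn_ege1 // ler1n.
Qed.
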